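(* Let $p$ be an odd prime, let $S$ be a finite $p$-group of sectional rank $3$ and let $\mathcal{F}$ be a saturated fusion system on $S$ such that $O_p(\mathcal{F})=1$. Then either $S$ is isomorphic to a Sylow $p$-subgroup of $\mathrm{Sp}_4(p)$, or there exists an $\mathcal{F}$-essential subgroup of $S$ that is not normal in $S$ and there is at most one $\mathcal{F}$-essential subgroup of $S$ that is $\mathcal{F}$-characteristic in $S$.
   Context: The rank of a finite group is the minimal size of a generating set; a $p$-group $S$ has sectional rank $k$ if every subgroup of $S$ has rank at most $k$ and $k$ is minimal with this property. For $P\le S$, $\mathrm{Aut}_{\mathcal{F}}(P)=\mathrm{Hom}_{\mathcal{F}}(P,P)$, $\mathrm{Out}_{\mathcal{F}}(P)=\mathrm{Aut}_{\mathcal{F}}(P)/\mathrm{Inn}(P)$, and $P^{\mathcal{F}}$ is the set of images $P\alpha$ with $\alpha\in\mathrm{Hom}_{\mathcal{F}}(P,S)$. A subgroup $E\le S$ is $\mathcal{F}$-essential if: $C_S(P)\le P$ for every $P\in E^{\mathcal{F}}$; $|N_S(E)|\ge|N_S(P)|$ for every $P\in E^{\mathcal{F}}$; and $\mathrm{Out}_{\mathcal{F}}(E)$ contains a strongly $p$-embedded subgroup. For $Q\le P\le S$, $Q$ is $\mathcal{F}$-characteristic in $P$ if $Q$ is normalized by every element of $\mathrm{Aut}_{\mathcal{F}}(P)$. A subgroup $Q\le S$ is normal in $\mathcal{F}$ if every morphism $\varphi\in\mathrm{Hom}_{\mathcal{F}}(P,R)$ extends to some $\bar\varphi\in\mathrm{Hom}_{\mathcal{F}}(PQ,RQ)$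 with $Q\bar\varphi=Q$; $O_p(\mathcal{F})$ is the largest subgroup of $S$ normal in $\mathcal{F}$. *)

(* Defs.v *)
From HB Require Import structures.
From mathcomp Require Import all_boot all_order all_algebra all_fingroup all_solvable.
Set Implicit Arguments. Unset Strict Implicit. Unset Printing Implicit Defensive.
Import GRing.Theory.

Local Open Scope group_scope.

Section FusionDefs.
Variable gT : finGroupType.
Variable S : {group gT}.

(* A candidate fusion system on S: F P Q f  <=> f (a function gT -> gT, only
   its values on P matter) is a morphism in Hom_F(P,Q). *)
Definition fusion_rel := {set gT} -> {set gT} -> pred {ffun gT -> gT}.

Definition conj_map (s : gT) : {ffun gT -> gT} := [ffun x => x ^ s].
Definition comp_map (g f : {ffun gT -> gT}) : {ffun gT -> gT} := [ffun x => g (f x)].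

Record fusion_system (F : fusion_rel) : Prop := {
  fs_hom : forall P Q f, F P Q f ->
    [/\ group_set P, group_set Q, P \subset S & Q \subset S] /\
    [/\ {in P &, {morph f : x y / x * y}}, {in P &, injective f}
      & f @: P \subset Q];
  fs_conj : forall (P Q : {group gT}) s, P \subset S -> Q \subset S ->
    s \in S -> P :^ s \subset Q -> F P Q (conj_map s);
  fs_ext : forall P Q f (g : {ffun gT -> gT}), F P Q f -> {in P, f =1 g} -> F P Q g;
  fs_comp : forall P Q R f (g : {ffun gT -> gT}), F P Q f -> F Q R g -> F P R (comp_map g f);
  fs_codom : forall P Q (R : {group gT}) f, F P Q f ->
    f @: P \subset R -> R \subset S -> F P R f;
  fs_inv : forall P Q f, F P Q f ->
    exists g : {ffun gT -> gT}, F (f @: P) P g /\ {in P, forall x, g (f x) = x}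
}.

Variable F : fusion_rel.

Definition autF (P : {set gT}) : {set {perm gT}} :=
  [set a in Aut P | F P P (pval a)].
Definition autS (P : {set gT}) : {set {perm gT}} :=
  [set a in Aut P | [exists s in 'N_S(P), [forall x in P, a x == x ^ s]]].
Definition innA (P : {set gT}) : {set {perm gT}} :=
  [set a in Aut P | [exists s in P, [forall x in P, a x == x ^ s]]].

Definition fully_normalized (P : {set gT}) : Prop :=
  forall f, F P S f -> #|'N_S(f @: P)| <= #|'N_S(P)|.
Definition fully_centralized (P : {set gT}) : Prop :=
  forall f, F P S f -> #|'C_S(f @: P)| <= #|'C_S(P)|.

(* N_phi = { g in N_S(P) | phi^-1 c_g phi in Aut_S(P phi) } *)
Definition Nphi (P : {set gT}) (f : {ffun gT -> gT}) : {set gT} :=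
  [set g in 'N_S(P) |
     [exists h in 'N_S(f @: P), [forall x in P, f (x ^ g) == f x ^ h]]].

Definition saturated (p : nat) : Prop :=
  fusion_system F /\
  (forall P : {group gT}, P \subset S -> fully_normalized P ->
     fully_centralized P /\ p.-Sylow(autF P) (autS P)) /\
  (forall (P : {group gT}) f, F P S f -> fully_centralized (f @: P) ->
     exists fb : {ffun gT -> gT}, F (Nphi P f) S fb /\ {in P, fb =1 f}).

Definition strongly_p_embedded (aT : finGroupType) (p : nat) (G H : {set aT}) :=
  [/\ H \proper G, p %| #|H|
    & forall g, g \in G :\: H -> ~~ (p %| #|H :&: H :^ g|)].

Definition essential (p : nat) (E : {group gT}) : Prop :=
  [/\ E \subset S,
      forall f, F E S f -> 'C_S(f @: E) \subset f @: E,
      forall f, F E S f -> #|'N_S(f @: E)| <= #|'N_S(E)|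
    & exists H : {group coset_of (innA E)},
        strongly_p_embedded p (autF E / innA E) H].

Definition F_characteristic (Q P : {set gT}) : Prop :=
  forall a, a \in autF P -> [set a x | x in Q] = Q.

Definition normal_in_fusion (Q : {set gT}) : Prop :=
  Q \subset S /\
  forall P R f, F P R f ->
    exists fb : {ffun gT -> gT}, [/\ F (P * Q) (R * Q) fb, {in P, fb =1 f} & fb @: Q = Q].

Definition Op_trivial : Prop :=
  forall Q : {group gT}, normal_in_fusion Q -> Q :=: 1.

End FusionDefs.

Definition rank_le (gT : finGroupType) (G : {set gT}) (k : nat) : Prop :=
  exists A : {set gT}, <<A>> = G /\ #|A| <= k.

Definition sectional_rank (gT : finGroupType) (S : {set gT}) (k : nat) : Prop :=
  (forall H : {group gT}, H \subset S -> rank_le H k) /\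
  forall j, (forall H : {group gT}, H \subset S -> rank_le H j) -> k <= j.

(* Sp_4(p) inside GL_4(F_p), for the form J = [[0, I2], [-I2, 0]] *)
Definition sympJ (p : nat) : 'M['F_p]_4 :=
  \matrix_(i < 4, j < 4)
    (if (i : nat) + 2 == j then 1%R else if (j : nat) + 2 == i then (-1)%R else 0%R).

Definition Sp4 (p : nat) : {set {'GL_4['F_p]}} :=
  [set g : {'GL_4['F_p]} | ((GLval g) *m sympJ p *m (GLval g)^T == sympJ p)%R].

(* Main.v *)
(* Let E be an essential subgroup that is normal in S.  Then |S : E| = p and S / E acts on the section
   V = E / Phi(E), which has order at most p ^ 3.  If no hyperplane of V is centralised by S,
   then Aut_F(E) is irreducible on V, and a second normal essential subgroup forces Phi(E) = 1
   and |S| = p ^ 4; this group is recognised as a Sylow subgroup of Sp_4(p) by explicit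
   generators and relations.  Otherwise S / E acts by transvections on V, and distinct normal
   essential subgroups share the centraliser M of S in E / Phi(E), the subgroup Phi(E), and the
   Aut_F(E)-fixed part C / Phi(E) of V.  Two of them that are stable under Aut_F(S) make M
   central in S with |S : M| = p ^ 2, so that every essential subgroup contains M and is normal.
   If all essential subgroups are normal in S, then Alperin's argument shows that Phi(E) and
   C are normal in F, hence trivial, and |S| = p ^ 3 is generated by two elements together with
   all its subgroups, against sectional rank 3. *)

Require Import Defs.
From HB Require Import structures.
From mathcomp Require Import all_boot all_order all_algebra all_fingroup all_solvable all_character.
From mathcomp Require Import ring.
From Stdlib Require Import Classical.

Set Implicit Arguments. Unset Strict Implicit. Unset Printing Implicit Defensive.
Import GroupScope.

(** Two essential subgroups are compared through the involution t, because t lies in Aut_F(S) and so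
    acts on every t-stable section of S, not only on sections of the E it comes from. On V it is the
    element -1 of an SL_2(p) generated by two conjugate transvections; commuting with the action of
    S on V, it normalises Aut_S(E), and saturation extends it to S. As p is odd, t has a sign on
    each factor of order p; commutators multiply signs and p-th powers keep them, so a commutator or
    a power of the wrong sign is trivial. Two further devices recur. Modulo a suitable N the p-th
    power map is a homomorphism, so its kernel is a subgroup, and an invariant kernel containing C
    and the centre of the transvections is everything. The rank hypothesis is applied not only to E
    but to W, C and E1 :&: E2: an N containing the Frattini subgroup of X has index at most p ^ 3 in
    X. Strong p-embedding enters mainly through two consequences: a p-subgroup of Aut_F(E) meeting H
    outside Inn(E) lies in H, and a normal p-subgroup of Aut_F(E) lies in Inn(E). *)

Section AutBasics.
Variables (gT : finGroupType) (E : {group gT}) (a : {perm gT}).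
Hypothesis Aa : a \in Aut E.

(** * Automorphisms of a subgroup, given as permutations *)

Lemma AutM : {in E &, {morph a : x y / x * y}}.
Proof. by move=> x y Ex Ey; apply: (morphM (autm_morphism Aa)). Qed.

Lemma Aut_one : a 1 = 1.
Proof. exact: (morph1 (autm_morphism Aa)). Qed.

Lemma AutV : {in E, {morph a : x / x^-1}}.
Proof. by move=> x Ex; apply: (morphV (autm_morphism Aa)). Qed.

Lemma AutX n : {in E, {morph a : x / x ^+ n}}.
Proof. by move=> x Ex; apply: (morphX (autm_morphism Aa)). Qed.

Lemma AutJ : {in E &, {morph a : x y / x ^ y}}.
Proof. by move=> x y Ex Ey; apply: (morphJ (autm_morphism Aa)). Qed.

Lemma AutR : {in E &, {morph a : x y / [~ x, y]}}.
Proof. by move=> x y Ex Ey; apply: (morphR (autm_morphism Aa)). Qed.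

Lemma Aut_imset (X : {group gT}) : X \subset E -> a @: X = autm_morphism Aa @* X.
Proof. by move=> sXE; rewrite morphimEsub. Qed.

Lemma Aut_img_group (X : {group gT}) : X \subset E -> group_set (a @: X).
Proof. by move=> sXE; rewrite Aut_imset ?groupP. Qed.

Lemma Aut_sub (X : {set gT}) : X \subset E -> a @: X \subset E.
Proof.
move=> sXE; apply/subsetP=> _ /imsetP[x Xx ->].
by rewrite (Aut_closed Aa) ?(subsetP sXE).
Qed.

Lemma Aut_Phi (X : {group gT}) : X \subset E -> a @: 'Phi(X) = 'Phi(a @: X).
Proof.
move=> sXE; rewrite (Aut_imset (subset_trans (Phi_sub X) sXE)) (Aut_imset sXE).
by rewrite injm_Phi ?injm_autm.
Qed.

Lemma Aut_comm (X Y : {group gT}) :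
  X \subset E -> Y \subset E -> a @: [~: X, Y] = [~: a @: X, a @: Y].
Proof.
move=> sXE sYE; rewrite (@Aut_imset [group of [~: X, Y]]) /=; last first.
  by apply: subset_trans (commgSS sXE sYE) _; rewrite commg_subr normG.
by rewrite (Aut_imset sXE) (Aut_imset sYE) morphimR.
Qed.

End AutBasics.

(** * Subgroups stable under automorphisms *)

Section Stable.
Variables (gT : finGroupType).
Implicit Types (a : {perm gT}) (X : {set gT}).

(** One inclusion, stated pointwise: finiteness turns it into an equality of sets ([stab_imset]),
    and stability of a constructed subgroup can be checked on elements. *)
Definition stab a X := {in X, forall x, a x \in X}.
Definition invar (A : {set {perm gT}}) X := {in A, forall a, stab a X}.

Lemma stab_imset a X : stab a X <-> a @: X = X.
Proof.
split=> [sX | eX x Xx]; last by rewrite -eX imset_f.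
apply/eqP; rewrite eqEcard card_imset ?leqnn ?andbT; last exact: perm_inj.
by apply/subsetP=> _ /imsetP[x Xx ->]; apply: sX.
Qed.

Lemma stabK a X : stab a X -> forall x, a x \in X -> x \in X.
Proof.
by move/stab_imset=> eX x; rewrite -{1}eX => /imsetP[y Xy /perm_inj->].
Qed.

Lemma stabI a X Y : stab a X -> stab a Y -> stab a (X :&: Y).
Proof. by move=> sX sY x /setIP[Xx Yx]; rewrite inE sX ?sY. Qed.

Lemma Aut_stab (E : {group gT}) a : a \in Aut E -> stab a E.
Proof. by move=> Aa x Ex; rewrite (Aut_closed Aa). Qed.

Lemma stab_Phi (E X : {group gT}) a :
  a \in Aut E -> X \subset E -> stab a X -> stab a 'Phi(X).
Proof. by move=> Aa sXE /stab_imset eX; apply/stab_imset; rewrite (Aut_Phi Aa) ?eX. Qed.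

Lemma stab_comm (E X Y : {group gT}) a : a \in Aut E -> X \subset E -> Y \subset E ->
  stab a X -> stab a Y -> stab a [~: X, Y].
Proof.
move=> Aa sXE sYE /stab_imset eX /stab_imset eY; apply/stab_imset.
by rewrite (Aut_comm Aa) ?eX ?eY.
Qed.

Lemma stab_join (E X Y : {group gT}) a : a \in Aut E -> X \subset E -> Y \subset E ->
  stab a X -> stab a Y -> stab a (X <*> Y).
Proof.
move=> Aa sXE sYE /stab_imset eX /stab_imset eY; apply/stab_imset.
rewrite (@Aut_imset _ _ _ Aa [group of X <*> Y]) ?join_subG ?sXE //=.
by rewrite morphimY // -!(Aut_imset Aa) // eX eY.
Qed.

End Stable.

(** * The p-th power of a product, p odd *)

Section Powers.
Variables (p : nat).
Hypothesis (odd_p : odd p).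

Lemma bin_p2 : 'C(p, 2) = (p * (p.-1)./2)%N.
Proof.
rewrite bin2 -{1}(odd_double_half p.-1).
have -> : odd p.-1 = false by case: p odd_p => //= n /negbTE.
by rewrite add0n -doubleMr doubleK.
Qed.

(** In class 2 the p-th power of a product differs from the product of the powers by the commutator
    to the power 'C(p, 2), which p divides because p is odd. *)
Lemma expMp (gT : finGroupType) (x y : gT) : commute x [~ x, y] -> commute y [~ x, y] ->
  [~ x, y] ^+ p = 1 -> (y * x) ^+ p = y ^+ p * x ^+ p.
Proof.
move=> cx cy xp; rewrite expMg_Rmul // bin_p2 expgM xp expg1n mulg1 //.
Qed.

End Powers.

(** * Power maps, chief factors and rank in p-groups *)

Section PGroups.
Variables (gT : finGroupType) (p : nat).
Hypotheses (pr_p : prime p) (odd_p : odd p).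
Implicit Types (X Y N S E K M H : {group gT}).

(** Modulo N, the group X has class at most 2 and its commutators have order dividing p. For odd p
    this makes the p-th power map of X modulo N a homomorphism. *)
Definition pow_cond X N := [/\ X \subset 'N(N), [~: X, X, X] \subset N &
  {in X &, forall x y, [~ x, y] ^+ p \in N}].

Lemma pow_mod X N x y : pow_cond X N -> x \in X -> y \in X ->
  coset N ((x * y) ^+ p) = coset N (x ^+ p) * coset N (y ^+ p).
Proof.
case=> nNX cl ex Xx Xy; have nN := subsetP nNX.
have N1 := nN _ Xx; have N2 := nN _ Xy.
rewrite !morphX ?morphM ?groupM //.
have cc z : z \in X -> commute (coset N z) [~ coset N y, coset N x].
  move=> Xz; apply/commgP; rewrite -!morphR ?groupR ?nN //.
  apply/eqP; apply: coset_id; rewrite -invg_comm groupV; apply: (subsetP cl).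
  by rewrite !mem_commg.
apply: (expMp odd_p); try exact: cc.
have := coset_id (ex _ _ Xy Xx); rewrite morphX ?groupR ?morphR //.
Qed.

(** Having the kernel of the power map as a subgroup, one checks [x ^+ p \in N] on generators only,
    or on an orbit of an automorphism that stabilises N. *)
Lemma powker X N : pow_cond X N ->
  exists K : {group gT}, K =i [pred x | (x \in X) && (x ^+ p \in N)].
Proof.
move=> pc; have [nNX _ _] := pc; have nN := subsetP nNX.
have gK : group_set [set x in X | x ^+ p \in N].
  apply/group_setP; split=> [|x y]; first by rewrite inE group1 expg1n group1.
  rewrite !inE => /andP[Xx Nx] /andP[Xy Ny]; rewrite groupM //=.
  apply: coset_idr; first by rewrite groupX ?groupM ?nN.
  by rewrite (pow_mod pc) // !coset_id ?mulg1.
by exists (Group gK) => x; rewrite !inE.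
Qed.

Lemma order_mod_p X N : N <| X -> p.-group X -> 'Phi(X) \subset N -> {in X, forall x, x ^+ p \in N}.
Proof.
move=> nNX pX sPN x Xx; apply: (subsetP sPN); rewrite (Phi_joing pX).
rewrite mem_gen // inE; apply/orP; right.
by apply: (Mho_p_elt 1); rewrite ?(mem_p_elt pX).
Qed.

Lemma Phi_pow X x : p.-group X -> x \in X -> x ^+ p \in 'Phi(X).
Proof.
move=> pX; apply: (order_mod_p _ pX (subxx _)).
exact: Phi_normal.
Qed.

Lemma Phi_der X : p.-group X -> [~: X, X] \subset 'Phi(X).
Proof. by move=> pX; rewrite (Phi_joing pX) joing_subl. Qed.

Lemma Phi_sub_crit X N : p.-group X -> X \subset 'N(N) -> [~: X, X] \subset N ->
  {in X, forall x, x ^+ p \in N} -> 'Phi(X) \subset N.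
Proof.
move=> pX nNX cN pN; apply: (Phi_min pX nNX); apply/(abelemP pr_p); split.
  by rewrite /abelian quotient_cents2r.
move=> _ /morphimP[x Nx Xx ->]; rewrite -morphX //.
by apply: coset_id; apply: pN.
Qed.

Lemma idx_cases X N K : N \subset K -> K \subset X -> prime #|X : N| ->
  (K :=: N) \/ (K :=: X).
Proof.
move=> sNK sKX pr; have := Lagrange_index sKX sNK => e.
have : #|X : K| %| #|X : N| by rewrite -e dvdn_mulr.
case/((primeP pr).2)/orP=> /eqP h.
  by right; apply/eqP; rewrite eqEsubset sKX -indexg_eq1 h.
left; apply/eqP; rewrite eqEsubset sNK andbT -indexg_eq1.
by rewrite -(eqn_pmul2l (indexg_gt0 X K)) e h muln1.
Qed.

Lemma leq_p2 : (p ^ 2 <= p) = false.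
Proof. by rewrite -{2}(expn1 p) leq_exp2l ?(prime_gt1 pr_p). Qed.

Lemma expg_coprime (N : {group gT}) (x : gT) k :
  x ^+ p \in N -> x ^+ k \in N -> ~~ (p %| k) -> x \in N.
Proof.
move=> xp xk npk; have [u v e _] := egcdnP k (prime_gt0 pr_p).
have gpk : gcdn p k = 1%N by apply/eqP; rewrite -/(coprime p k) prime_coprime.
have : x ^+ (u * p) = x ^+ (v * k) * x by rewrite e gpk expgD expg1.
move=> e'; rewrite -(groupMl _ (_ : x ^+ (v * k) \in N)) -?e'.
  by rewrite mulnC expgM groupX.
by rewrite mulnC expgM groupX.
Qed.

(** The usual way of exploiting a prime index below: the elements with a desired property form a
    subgroup K that contains N, and one more element makes it all of X. *)
Lemma idx_full X N K x : N \subset K -> K \subset X -> prime #|X : N| ->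
  x \in K -> x \notin N -> K :=: X.
Proof.
move=> sNK sKX pr Kx nx; case: (idx_cases sNK sKX pr) => // eK.
by move: nx; rewrite -eK Kx.
Qed.

(** A normal subgroup of order p in the p-group S / N meets the centre nontrivially, hence lies in
    it. *)
Lemma pcentral S X N : p.-group S -> N <| S -> X <| S -> N \subset X ->
  #|X : N| = p -> [~: X, S] \subset N.
Proof.
move=> pS nNS nXS sNX iXN; have nNX := normal_norm nNS.
have sXS := normal_sub nXS; have nX := subset_trans sXS nNX.
rewrite -quotient_cents2 //.
have cXN : #|X / N| = p by rewrite card_quotient.
have nt : X / N != 1 by rewrite -cardG_gt1 cXN prime_gt1.
have nilS : nilpotent (S / N) by apply: pgroup_nil (quotient_pgroup N pS).
have := meet_center_nil nilS (quotient_normal N nXS) nt.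
move/(prime_meetG _); rewrite cXN => /(_ pr_p) h; apply: subset_trans h _.
exact: subsetIr.
Qed.

Lemma pquot_gt S X N : p.-group S -> N <| S -> X <| S -> N \proper X ->
  exists Y : {group gT}, [/\ N \subset Y, Y \proper X, Y <| S & #|X : Y| = p].
Proof.
move=> pS nNS nXS; rewrite properEneq => /andP[neNX sNX].
have sXS := normal_sub nXS; have pX := pgroupS sXS pS.
have nNX := subset_trans sXS (normal_norm nNS).
have pSN := quotient_pgroup N pS.
have nXN := quotient_normal N nXS.
have [n cX] : exists n, #|X / N| = (p ^ n)%N.
  by exists (logn p #|X / N|); apply: card_pgroup (pgroupS (quotientS N sXS) pSN).
have gt1 : X / N != 1.
  by apply: contra neNX => /eqP/trivgP; rewrite quotient_sub1 // eqEsubset sNX.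
case: n cX => [|n] cX; first by rewrite trivg_card1 cX in gt1.
have [|Q [sQ nQ cQ]] := @normal_pgroup p _ n _ _ pSN nXN.
  by rewrite cX pfactorK.
have [Y eY sNY nYS] := inv_quotientN nNS nQ.
have sYX : Y \subset X.
  rewrite -(quotientSGK _ sNX) -?eY //.
  exact: subset_trans (normal_sub nYS) (normal_norm nNS).
have iXY : #|X : Y| = p.
  have := Lagrange_index sYX sNY.
  rewrite -(card_quotient nNX) -(card_quotient (subset_trans sYX nNX)) -eY cQ cX.
  by rewrite expnS => /eqP; rewrite eqn_pmul2r ?expn_gt0 ?prime_gt0 // => /eqP.
exists Y; split=> //; rewrite properEneq sYX andbT.
apply: contraTneq (prime_gt1 pr_p) => eYX.
by rewrite -iXY eYX indexgg.
Qed.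

(** The rank bound in index form ([rank_le_index]): it bounds the index in H of every subgroup that
    contains the Frattini subgroup of H. *)
Definition rk3 (S : {set gT}) :=
  forall H : {group gT}, H \subset S -> #|H : 'Phi(H)| <= p ^ 3.

Lemma rank_le_index S k : p.-group S -> rank_le S k -> #|S : 'Phi(S)| <= p ^ k.
Proof.
move=> pS [A [gA cA]].
have ab := Phi_quotient_abelem pS.
have nP := normal_norm (Phi_normal S).
rewrite -card_quotient // (card_pgroup (abelem_pgroup ab)).
rewrite leq_exp2l ?prime_gt1 // -(rank_abelem ab) -grank_abelian; last exact: abelem_abelian ab.
by apply: leq_trans (quotient_grank nP) _; rewrite -gA; apply: leq_trans (grank_min _) cA.
Qed.

Lemma sqrt_pelt (x : gT) : p.-elt x -> (x ^+ (#[x].+1)./2) ^+ 2 = x.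
Proof.
move=> px; rewrite -expgM muln2.
have o : odd #[x] by case/p_natP: px => n ->; rewrite oddX odd_p orbT.
have := odd_double_half #[x].+1; rewrite /= o add0n => ->.
by rewrite expgS expg_order mulg1.
Qed.

End PGroups.

(** * Involutory automorphisms of p-groups, p odd *)

Section Involution.
Variables (gT : finGroupType) (p : nat) (S : {group gT}) (t : {perm gT}).
Hypotheses (pr_p : prime p) (odd_p : odd p) (pS : p.-group S).
Hypotheses (At : t \in Aut S) (tt : forall x, t (t x) = x).

Lemma invol_odd (x : gT) (N : {group gT}) : x \in S -> x ^+ 2 \in N -> x \in N.
Proof.
move=> Sx N2; rewrite -(sqrt_pelt odd_p (mem_p_elt pS Sx)) -expgM mulnC expgM.
by rewrite groupX.
Qed.

Lemma invol_fixed (N : {group gT}) x : N \subset S -> x \in S ->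
  x^-1 * t x \in N -> exists2 x', x' \in x *: N & t x' = x'.
Proof.
move=> sNS Sx; set n := _ * _ => Nn.
have Sn := subsetP sNS n Nn; have St := Aut_stab At Sx.
have tn : t n = n^-1 by rewrite /n (AutM At) ?groupV // (AutV At) // tt invMg invgK.
(* The square root of n inside [<[n]>], available since n has odd order. As t inverts n it inverts
   k, so t (x * k) = x * n * k^-1 = x * k. *)
pose k := n ^+ (#[n].+1)./2.
have kk : k ^+ 2 = n by rewrite /k (sqrt_pelt odd_p) // (mem_p_elt pS).
exists (x * k); first by rewrite mem_lcoset mulKg groupX.
rewrite (AutM At) ?groupX // (AutX At) // tn expVgn -/k.
have -> : t x = x * n by rewrite /n mulKVg.
by rewrite -kk expgS expg1 !mulgA mulgK.
Qed.

(** By [invol_fixed] every coset of the Frattini subgroup contains a fixed point, so the fixed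
    points generate X. *)
Lemma invol_Phi (X : {group gT}) : X \subset S ->
  {in X, forall x, x^-1 * t x \in 'Phi(X)} -> {in X, forall x, t x = x}.
Proof.
move=> sXS tX; have sX := subsetP sXS.
have gF : group_set [set x in X | t x == x].
  apply/group_setP; split=> [|x y]; first by rewrite inE group1 (Aut_one At) eqxx.
  rewrite !inE => /andP[Xx /eqP ex] /andP[Xy /eqP ey].
  by rewrite groupM // (AutM At) ?sX // ex ey eqxx.
suff eX : X \subset Group gF by move=> x /(subsetP eX); rewrite inE => /andP[_ /eqP].
have : 'Phi(X) <*> Group gF = X.
  apply/eqP; rewrite eqEsubset join_subG Phi_sub (_ : Group gF \subset X) /=; last by apply/subsetP=> x; rewrite inE => /andP[].
  apply/subsetP=> x Xx.
  have [x' xx' tx'] := invol_fixed (subset_trans (Phi_sub X) sXS) (sX x Xx) (tX x Xx).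
  have Px : x' \in x *: 'Phi(X) by [].
  rewrite mem_lcoset in Px.
  have Xx' : x' \in X by rewrite -(groupMl _ (groupVr Xx)) (subsetP (Phi_sub X)).
  have -> : x = x' * (x^-1 * x')^-1 by rewrite invMg invgK mulKVg.
  rewrite groupM ?groupV //; apply: mem_gen; rewrite inE; apply/orP; [right | by left].
  by rewrite inE Xx' tx' eqxx.
by move/Phi_nongen; rewrite genGid => ->.
Qed.

End Involution.

(** * Centralisers modulo a subgroup *)

Section CentMod.
Variable gT : finGroupType.
Implicit Types (X Y N E H : {group gT}).

(** The elements of X whose commutators with Y lie in N, when N is normalised ([cmodP]). The form as
    an intersection with a preimage of a centraliser lets the group structure be inferred. *)
Definition cmod (X Y N : {set gT}) := X :&: coset N @*^-1 'C(Y / N).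
Definition cmod1 (X : {set gT}) w (N : {set gT}) := X :&: coset N @*^-1 'C[coset N w].
Canonical cmod_group X (Y N : {set gT}) := Eval hnf in [group of cmod X Y N].
Canonical cmod1_group X w (N : {set gT}) := Eval hnf in [group of cmod1 X w N].

Lemma cmodP X Y N x : X \subset 'N(N) -> Y \subset 'N(N) ->
  reflect (x \in X /\ {in Y, forall y, [~ x, y] \in N}) (x \in cmod X Y N).
Proof.
move=> nX nY; apply: (iffP idP) => [/setIP[Xx /morphpreP[Nx /centP cx]] | [Xx cx]].
  split=> // y Yy; apply: coset_idr; first by rewrite groupR ?(subsetP nX x) ?(subsetP nY y).
  rewrite morphR ?(subsetP nX x) ?(subsetP nY y) //; apply/eqP/commgP; apply: cx.
  exact: mem_quotient.
have Nx := subsetP nX x Xx.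
rewrite inE Xx; apply/morphpreP; split=> //; apply/centP=> _ /morphimP[y Ny Yy ->].
by apply/commgP; rewrite -morphR //; apply/eqP/coset_id/cx.
Qed.

Lemma cmod1P X w N x : X \subset 'N(N) -> w \in 'N(N) ->
  reflect (x \in X /\ [~ x, w] \in N) (x \in cmod1 X w N).
Proof.
move=> nX Nw; apply: (iffP idP) => [/setIP[Xx /morphpreP[Nx /cent1P cx]] | [Xx cx]].
  split=> //; apply: coset_idr; first by rewrite groupR.
  by rewrite morphR //; apply/eqP/commgP.
have Nx := subsetP nX x Xx.
rewrite inE Xx; apply/morphpreP; split=> //; apply/cent1P.
by apply/commgP; rewrite -morphR //; apply/eqP/coset_id.
Qed.

Lemma cmod_sub X Y N : cmod X Y N \subset X. Proof. exact: subsetIl. Qed.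
Lemma cmod1_sub X w N : cmod1 X w N \subset X. Proof. exact: subsetIl. Qed.

Lemma sub_cmod (A : {group gT}) X Y N : A \subset X -> X \subset 'N(N) -> Y \subset 'N(N) ->
  (A \subset cmod X Y N) = ([~: A, Y] \subset N).
Proof.
move=> sAX nX nY; apply/idP/idP => [sA | cA]; last first.
  apply/subsetP=> x Ax; apply/(cmodP _ nX nY); split; first exact: (subsetP sAX).
  by move=> y Yy; apply: (subsetP cA); rewrite mem_commg.
rewrite gen_subG; apply/subsetP=> _ /imset2P[x y Ax Yy ->].
by have /(cmodP _ nX nY)[_ ->] := subsetP sA x Ax.
Qed.

Lemma cmod_comm X Y N : X \subset 'N(N) -> Y \subset 'N(N) -> [~: cmod X Y N, Y] \subset N.
Proof.
move=> nX nY; have := sub_cmod (A := [group of cmod X Y N]) (cmod_sub X Y N) nX nY.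
by rewrite subxx.
Qed.

Lemma stab_cmod E X Y N a : a \in Aut E -> X \subset E -> Y \subset E ->
  X \subset 'N(N) -> Y \subset 'N(N) -> N \subset E ->
  stab a X -> stab a Y -> stab a N -> stab a (cmod X Y N).
Proof.
move=> Aa sXE sYE nX nY sNE sX sY sN x /(cmodP _ nX nY)[Xx cx].
apply/(cmodP _ nX nY); split; first exact: sX.
move=> y Yy; have /stab_imset eY := sY; rewrite -eY in Yy.
case/imsetP: Yy => y' Yy' ->.
by rewrite -(AutR Aa) ?(subsetP sXE x) ?(subsetP sYE y') // sN ?cx.
Qed.

(** E / N is generated by the image of H, which is central, and one further element, so it is
    abelian. *)
Lemma der_ext H E N : H \subset E -> E \subset 'N(N) -> prime #|E : H| ->
  [~: H, E] \subset N -> [~: E, E] \subset N.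
Proof.
move=> sHE nE pr cH; rewrite -(sub_cmod (subxx E) nE nE).
have sHK : H \subset cmod E E N by rewrite sub_cmod.
have [w Ew nHw] : exists2 w, w \in E & w \notin H.
  apply/subsetPn; apply: contraL pr => sEH.
  by rewrite (eqP (_ : #|E : H| == 1%N)) ?indexg_eq1.
have Nw := subsetP nE w Ew.
have eT : cmod1 E w N = E.
  apply: (idx_full (N := H) (x := w)) => //.
  - apply/subsetP=> h Hh; apply/(cmod1P _ nE Nw); split; first exact: (subsetP sHE).
    by apply: (subsetP cH); rewrite mem_commg.
  - exact: cmod1_sub.
  - by apply/(cmod1P _ nE Nw); rewrite commgg group1.
have -> : cmod E E N = E; last exact: subxx.
apply: (idx_full (N := H) (x := w)) => //; first exact: cmod_sub.
apply/(cmodP _ nE nE); split=> // e; rewrite -{1}eT => /(cmod1P _ nE Nw)[_ h].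
by rewrite -invg_comm groupV.
Qed.

End CentMod.

(** By induction y ^+ n sends w to w times q to the power n + p * i * 'C(n, 2). For n = p odd this
    exponent is p modulo p ^ 2, so y ^+ p can fix w only if q ^+ p = 1. In other words, a
    transvection of order p modulo p does not lift to an automorphism of order p of a homocyclic
    group of exponent p ^ 2. *)
Lemma no_lift_pow (gT : finGroupType) (p : nat) (w q y : gT) i : odd p ->
  commute w q -> w ^ y = w * q -> q ^ y = q ^+ (1 + p * i) ->
  w ^ (y ^+ p) = w -> q ^+ (p ^ 2) = 1 -> q ^+ p = 1.
Proof.
move=> odd_p cwq wy qy wyp q2.
have e n : w ^ (y ^+ n) = w * q ^+ (n + p * i * 'C(n, 2)).
  elim: n => [|n IHn]; first by rewrite expg0 conjg1 bin0n muln0 mulg1.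
  rewrite expgSr conjgM IHn conjMg wy conjXg qy -expgM -mulgA -expgS.
  congr (_ * _); rewrite binS bin1.
  have -> : ((1 + p * i) * (n + p * i * 'C(n, 2))).+1 =
    (n.+1 + p * i * ('C(n, 2) + n) + p ^ 2 * (i * i * 'C(n, 2)))%N.
    by rewrite -!mulnn; ring.
  by rewrite expgD [q ^+ (p ^ 2 * _)]expgM q2 expg1n mulg1.
move: (e p); rewrite wyp bin_p2 // => /esym/eqP.
rewrite -[X in _ == X]mulg1 (inj_eq (mulgI _)) => /eqP.
have -> : (p + p * i * (p * p.-1./2))%N = (p + p ^ 2 * (i * p.-1./2))%N.
  by rewrite -!mulnn; ring.
by rewrite expgD expgM q2 expg1n mulg1.
Qed.

(** * Normal subgroups on which S acts by transvections *)

Section Transvection.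
Variables (gT : finGroupType) (p : nat) (S : {group gT}).
Hypotheses (pr_p : prime p) (odd_p : odd p) (pS : p.-group S) (rS : rk3 p S).
Implicit Types (X Y N E C W D K M : {group gT}) (t a : {perm gT}).

(** [axis] and [centre] are the full preimages in E of the fixed points and of the commutator of S
    on V = E / Phi(E). When the fixed points form a hyperplane, these are the axis and the centre of
    a group of transvections. *)
Definition axis (E : {set gT}) := cmod E S 'Phi(E).
Canonical axis_group E := Eval hnf in [group of axis E].
Definition centre (E : {set gT}) := [~: E, S] <*> 'Phi(E).
Canonical centre_group E := Eval hnf in [group of centre E].

(* V = E / Phi(E) is the direct product of W / Phi(E) and C / Phi(E), where S / E acts as a
   group of transvections of W / Phi(E) and trivially on C / Phi(E); a is a transvection
   from another Sylow subgroup and t acts as -1 on W / Phi(E) and as 1 on C / Phi(E). *)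
Record transv E C W t a : Prop := Transv {
  tr_nE : E <| S;
  tr_iE : #|S : E| = p;
  tr_iH : #|E : axis E| = p;
  tr_QC : 'Phi(E) \subset C;
  tr_CH : C \subset axis E;
  tr_iC : #|axis E : C| = p;
  tr_ZW : centre E \subset W;
  tr_WE : W \subset E;
  tr_iW : #|W : 'Phi(E)| = (p ^ 2)%N;
  tr_WC : W * C = E;
  tr_WIC : W :&: C = 'Phi(E);
  tr_tS : t \in Aut S;
  tr_tt : forall x, t (t x) = x;
  tr_tE : stab t E;
  tr_tW : {in W, forall w, w * t w \in 'Phi(E)};
  tr_tC : {in C, forall c, c^-1 * t c \in 'Phi(E)};
  tr_tSE : {in S, forall s, s^-1 * t s \in E};
  tr_aE : a \in Aut E;
  tr_aC : {in C, forall c, c^-1 * a c \in 'Phi(E)};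
  tr_aW : stab a W;
  tr_aZ : {in centre E, forall q, q \notin 'Phi(E) -> a q \notin axis E}
}.

Section Facts.
Variables (E C W : {group gT}) (t a : {perm gT}).
Hypothesis trE : transv E C W t a.

Let nES := tr_nE trE.
Let sES : E \subset S := normal_sub nES.
Let sQE : 'Phi(E) \subset E := Phi_sub E.

Lemma tr_nQ : 'Phi(E) <| S.
Proof. exact: char_normal_trans (Phi_char E) nES. Qed.
Let nQ := tr_nQ.
Let nQS : S \subset 'N('Phi(E)) := normal_norm nQ.
Let nQE : E \subset 'N('Phi(E)) := subset_trans sES nQS.
Lemma tr_pE : p.-group E. Proof. exact: pgroupS sES pS. Qed.
Let pE := tr_pE.

Lemma axisP x : reflect (x \in E /\ {in S, forall s, [~ x, s] \in 'Phi(E)}) (x \in axis E).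
Proof. exact: cmodP. Qed.

Lemma tr_HE : axis E \subset E. Proof. exact: cmod_sub. Qed.
Lemma tr_CE : C \subset E. Proof. exact: subset_trans (tr_CH trE) tr_HE. Qed.
Lemma tr_QH : 'Phi(E) \subset axis E. Proof. exact: subset_trans (tr_QC trE) (tr_CH trE). Qed.
Lemma tr_QZ : 'Phi(E) \subset centre E. Proof. exact: joing_subr. Qed.
Lemma tr_QW : 'Phi(E) \subset W. Proof. exact: subset_trans tr_QZ (tr_ZW trE). Qed.

Lemma tr_HS : [~: axis E, S] \subset 'Phi(E). Proof. exact: cmod_comm. Qed.

Lemma tr_between X : 'Phi(E) \subset X -> X \subset axis E -> X <| S.
Proof.
move=> sQX sXH; have sXE := subset_trans sXH tr_HE.
rewrite /normal (subset_trans sXE sES) -commg_subl.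
exact: subset_trans (subset_trans (commSg S sXH) tr_HS) sQX.
Qed.

Lemma tr_nH : axis E <| S. Proof. exact: tr_between tr_QH (subxx _). Qed.
Lemma tr_nC : C <| S. Proof. exact: tr_between (tr_QC trE) (tr_CH trE). Qed.

Lemma tr_above X : centre E \subset X -> X \subset E -> X <| S.
Proof.
move=> sZX sXE; rewrite /normal (subset_trans sXE sES) -commg_subl.
apply: subset_trans (commSg S sXE) _.
exact: subset_trans (joing_subl _ _) sZX.
Qed.
Lemma tr_nW : W <| S. Proof. exact: tr_above (tr_ZW trE) (tr_WE trE). Qed.

Lemma tr_ZH : centre E \subset axis E.
Proof.
rewrite join_subG tr_QH andbT; apply: (pcentral pr_p pS) => //; first exact: tr_nH.
  exact: tr_HE.
exact: tr_iH trE.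
Qed.
Lemma tr_nZ : centre E <| S. Proof. exact: tr_between tr_QZ tr_ZH. Qed.

Let prH : prime #|E : axis E|. Proof. by rewrite (tr_iH trE). Qed.

Lemma tr_WnH : ~~ (W \subset axis E).
Proof.
apply/negP=> sWH; have := prime_gt1 prH.
rewrite (eqP (_ : #|E : axis E| == 1%N)) // indexg_eq1 -(tr_WC trE).
by rewrite mul_subG // (tr_CH trE).
Qed.

Lemma tr_HW : axis E * W = E.
Proof.
apply/eqP; rewrite eqEsubset mul_subG ?tr_HE ?(tr_WE trE) //= -{1}(tr_WC trE).
by rewrite -(normC (_ : W \subset 'N(axis E))) ?mulgS ?(tr_CH trE) // (subset_trans (tr_WE trE)) // (subset_trans sES) ?(normal_norm tr_nH).
Qed.

Lemma tr_iWH : #|W : W :&: axis E| = p.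
Proof.
have e := mul_cardG (axis E) W; rewrite tr_HW in e.
have cW := Lagrange (subsetIr (axis E) W); have cE := Lagrange tr_HE.
rewrite -(tr_iH trE) setIC; apply/eqP.
rewrite -(eqn_pmul2l (_ : 0 < #|axis E| * #|axis E :&: W|)) ?muln_gt0 ?cardG_gt0 //.
by rewrite -mulnA cW e -cE; apply/eqP; ring.
Qed.

Lemma tr_Zneq : ~~ (centre E \subset 'Phi(E)).
Proof.
apply/negP=> sZ; have := prime_gt1 prH.
rewrite (eqP (_ : #|E : axis E| == 1%N)) // indexg_eq1.
rewrite (sub_cmod (subxx E) nQE nQS).
exact: subset_trans (joing_subl _ _) sZ.
Qed.

Lemma tr_ZWH : centre E = W :&: axis E.
Proof.
have sZI : centre E \subset W :&: axis E by rewrite subsetI (tr_ZW trE) tr_ZH.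
have iQ : #|W :&: axis E : 'Phi(E)| = p.
  have sQI : 'Phi(E) \subset W :&: axis E by rewrite subsetI tr_QW tr_QH.
  have := Lagrange_index (subsetIl W (axis E)) sQI.
  by rewrite tr_iWH (tr_iW trE) -mulnn => /eqP; rewrite eqn_pmul2l ?prime_gt0 // => /eqP.
case: (idx_cases (K := [group of centre E]) tr_QZ sZI) => //=; first by rewrite iQ.
by move=> eZ; have := tr_Zneq; rewrite eZ subxx.
Qed.

Lemma tr_iZ : #|centre E : 'Phi(E)| = p.
Proof.
have sQI : 'Phi(E) \subset W :&: axis E by rewrite subsetI tr_QW tr_QH.
have := Lagrange_index (subsetIl W (axis E)) sQI.
by rewrite tr_iWH (tr_iW trE) -mulnn tr_ZWH => /eqP; rewrite eqn_pmul2l ?prime_gt0 // => /eqP.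
Qed.

Lemma tr_iWZ : #|W : centre E| = p.
Proof. by rewrite tr_ZWH tr_iWH. Qed.

Lemma tr_ZC : centre E * C = axis E.
Proof.
rewrite tr_ZWH setIC group_modr ?(tr_CH trE) // (tr_WC trE).
by apply/setIidPl; apply: tr_HE.
Qed.

(** The elements of S that centralise w modulo Phi(E) form a subgroup containing E, and E has prime
    index in S. *)
Lemma tr_notin w y : w \in E -> w \notin axis E -> y \in S -> y \notin E ->
  [~ w, y] \notin 'Phi(E).
Proof.
move=> Ew nHw Sy nEy; apply: contra nHw => qQ.
have Nw := subsetP nQE w Ew.
have eS : cmod1 S w 'Phi(E) = S.
  apply: (idx_full (N := E) (x := y)) => //; rewrite ?(tr_iE trE) //.
  - apply/subsetP=> e Ee; apply/(cmod1P _ nQS Nw); split; first exact: (subsetP sES).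
    by apply: (subsetP (Phi_der pE)); rewrite mem_commg.
  - exact: cmod1_sub.
  - by apply/(cmod1P _ nQS Nw); rewrite -invg_comm groupV.
apply/axisP; split=> // s; rewrite -{1}eS => /(cmod1P _ nQS Nw)[_ h].
by rewrite -invg_comm groupV.
Qed.

Lemma tr_aQ : stab a 'Phi(E).
Proof. exact: stab_Phi (tr_aE trE) (subxx _) (Aut_stab (tr_aE trE)). Qed.
Lemma tr_aCC : stab a C.
Proof.
move=> c Cc; rewrite -[a c](mulKVg c) groupM // (subsetP (tr_QC trE)) //.
exact: (tr_aC trE).
Qed.

(** W / Phi(E) is a plane spanned by the line [centre E / Phi(E)] and its image under a, which
    leaves the axis. *)
Lemma tr_Wfull K q : K \subset W -> stab a K -> 'Phi(E) \subset K -> q \in centre E ->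
  q \notin 'Phi(E) -> q \in K -> K :=: W.
Proof.
move=> sKW aK sQK Zq nQq Kq.
have sZK : centre E \subset K.
  rewrite -(_ : centre E :&: K = centre E) ?subsetIr //.
  apply: (idx_full (N := 'Phi(E)) (x := q)) => //=.
  - by rewrite subsetI tr_QZ.
  - exact: subsetIl.
  - by rewrite tr_iZ.
  - by rewrite inE Zq.
apply: (idx_full sZK sKW _ (aK q Kq)); first by rewrite tr_iWZ.
have := tr_aZ trE Zq nQq; apply: contra.
exact: (subsetP tr_ZH).
Qed.

Lemma tr_ex : exists w y, [/\ w \in W, w \notin axis E, y \in S & y \notin E].
Proof.
have /subsetPn[w Ww nw] := tr_WnH.
have /subsetPn[y Sy ny] : ~~ (S \subset E).
  by rewrite -indexg_eq1 (tr_iE trE) neq_ltn prime_gt1 ?orbT.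
by exists w, y.
Qed.

Lemma tr_ypE y : y \in S -> y ^+ p \in E.
Proof.
move=> Sy; have nE := normal_norm nES.
apply: coset_idr; first by rewrite groupX ?(subsetP nE).
rewrite morphX ?(subsetP nE) // -(tr_iE trE) -card_quotient //.
by apply: expg_cardG; rewrite mem_quotient.
Qed.

(** Modulo D, the elements w, q and y satisfy the hypotheses of [no_lift_pow], hence q ^+ p lies in
    D. The p-th power map of W modulo D then has an a-stable kernel that contains Phi(E) and q, and
    [tr_Wfull] makes it all of W. *)
Lemma tr_no_lift D w y i : D <| S -> stab a D -> 'Phi(E) :&: D = D ->
  {in 'Phi(E), forall x, x ^+ p \in D} -> [~: W, W] \subset D ->
  w \in W -> w \notin axis E -> y \in S -> y \notin E ->
  [~ w, y ^+ p] \in D -> [~ w, y, y] \in [~ w, y] ^+ (p * i) *: D ->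
  {in W, forall v, v ^+ p \in D}.
Proof.
move=> nDS aD sDQ pQD cWD Ww nHw Sy nEy cyp hq.
have nD := subsetP (normal_norm nDS); have Sw := subsetP sES w (subsetP (tr_WE trE) w Ww).
set q := [~ w, y] in hq *.
have Zq : q \in centre E.
  by apply: (subsetP (joing_subl _ _)); rewrite mem_commg ?(subsetP (tr_WE trE)).
have Ew := subsetP (tr_WE trE) w Ww.
have nQq : q \notin 'Phi(E) by exact: tr_notin.
have Wq := subsetP (tr_ZW trE) q Zq.
have Sq : q \in S by rewrite groupR.
have sWS := subset_trans (tr_WE trE) sES.
have sDS := normal_sub nDS.
have pc : pow_cond p W D.
  split; first by apply: subset_trans sWS (normal_norm nDS).
    apply: subset_trans (commSg _ cWD) _; rewrite commg_subl.
    exact: subset_trans sWS (normal_norm nDS).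
  by move=> u v Wu Wv; rewrite groupX // (subsetP cWD) ?mem_commg.
have [K eK] := powker odd_p pc.
have qp : q ^+ p \in 'Phi(E).
  by rewrite (Phi_pow pE) // (subsetP (tr_WE trE)).
have qpD : q ^+ p \in D.
  apply: coset_idr; first by rewrite groupX ?nD.
  have Nw := nD w Sw; have Ny := nD y Sy; have Nq := nD q Sq.
  rewrite morphX //; apply: (@no_lift_pow _ _ (coset D w) _ (coset D y) i) => //.
  - apply/commgP; rewrite -morphR //; apply/eqP/coset_id.
    by apply: (subsetP cWD); rewrite mem_commg.
  - by rewrite -morphJ // -morphM // /q commgEl mulKVg.
  - rewrite -morphJ // -morphX // add1n expgS.
    have -> : q ^ y = q * [~ q, y] by rewrite commgEl mulKVg.
    have /lcosetP[d Dd ->] := hq; rewrite mulgA -expgS.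
    exact: coset_kerr.
  - rewrite -morphX // -morphJ ?groupX //.
    have -> : w ^ (y ^+ p) = w * [~ w, y ^+ p] by rewrite commgEl mulKVg.
    exact: coset_kerr.
  - by rewrite -morphX // -mulnn expgM; apply/coset_id/pQD.
have eKW : K :=: W.
  apply: (@tr_Wfull K q) => //.
  - by apply/subsetP=> v; rewrite eK => /andP[].
  - move=> v; rewrite !eK => /andP[Wv vp]; apply/andP; split; first exact: (tr_aW trE).
    by rewrite -(AutX (tr_aE trE)) ?aD // (subsetP (tr_WE trE)).
  - apply/subsetP=> v Qv; rewrite eK; apply/andP; split; first exact: (subsetP tr_QW).
    exact: pQD.
  - by rewrite eK inE /= Wq.
by move=> v; rewrite -eKW eK => /andP[].
Qed.

End Facts.
End Transvection.

(** * Recovering Phi(E) from the axis *)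

Section Key.
Variables (gT : finGroupType) (p : nat) (S : {group gT}).
Hypotheses (pr_p : prime p) (odd_p : odd p) (pS : p.-group S).
Implicit Types (X Y N E C W D K M : {group gT}) (t a : {perm gT}).
Let axis := axis S.
Let centre := centre S.

(** With the easy inclusion this expresses Phi(E) by the axis and S alone, so that essential
    subgroups with equal axes have equal Frattini subgroups. If it fails, a normal N of index p in
    Phi(E) contains the right-hand side. Then w ^+ p is outside N, while [q, y] is a power of q ^+ p
    modulo D, and [tr_no_lift] puts w ^+ p into D, inside N. *)
Lemma tr_key E C W t a : transv p S E C W t a ->
  'Phi(E) \subset [~: axis E, S] <*> 'Phi(axis E).
Proof.
move=> trE; set X := _ <*> _; apply/idPn=> nsQX.
have nES := tr_nE trE; have sES := normal_sub nES.
have nQ := tr_nQ trE; have pE := tr_pE pS trE.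
have sHE := tr_HE S E; have sCH := tr_CH trE; have sCE := tr_CE trE.
have pH : p.-group (axis E) := pgroupS sHE pE.
have nHS : axis E <| S := tr_nH trE.
have sXQ : X \subset 'Phi(E).
  by rewrite join_subG (tr_HS trE) (PhiS pE sHE).
have nXS : X <| S.
  rewrite normalY // ?(char_normal_trans (Phi_char _)) //.
  rewrite /normal commg_normr andbT.
  by rewrite (subset_trans (tr_HS trE)) // (normal_sub nQ).
have ltX : X \proper 'Phi(E) by rewrite properE sXQ.
have [N [sXN ltNQ nNS iQN]] := pquot_gt pr_p pS (N := [group of X]) nXS nQ ltX.
have sNQ := proper_sub ltNQ.
have [cHN PHN] : [~: axis E, S] \subset N /\ 'Phi(axis E) \subset N.
  by apply/andP; rewrite -join_subG.
have nNE : E \subset 'N(N) := subset_trans sES (normal_norm nNS).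
have cEN : [~: E, E] \subset N.
  apply: (der_ext (H := [group of axis E])) => //=; first by rewrite (tr_iH trE).
  exact: subset_trans (commgS _ sES) cHN.
(* N need not be a-stable. D is a subgroup of N that is a-stable by construction, so that a can be
   applied modulo D. *)
pose D := [group of [~: E, E] <*> 'Phi(C)].
have sDN : D \subset N by rewrite join_subG cEN (subset_trans (PhiS pH sCH)).
have cED : [~: E, E] \subset D by apply: joing_subl.
have nDS : D <| S.
  rewrite normalY // ?(char_normal_trans (Phi_char _)) ?(tr_nC trE) //.
  exact: char_normal_trans (der_char 1 E) nES.
have aE := tr_aE trE.
have aD : stab a D.
  apply: (stab_join aE); rewrite ?commg_subl ?normG //.
  - exact: subset_trans (Phi_sub C) sCE.
  - by apply: (stab_comm aE); rewrite ?subxx //; apply: Aut_stab.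
  - exact: stab_Phi aE sCE (tr_aCC trE).
have pQD : {in 'Phi(E), forall x, x ^+ p \in D}.
  move=> x Qx; apply: (subsetP (joing_subr _ _)).
  by rewrite Phi_pow ?(pgroupS sCE pE) // (subsetP (tr_QC trE)).
have sWE := tr_WE trE.
have [w [y [Ww nHw Sy nEy]]] := tr_ex pr_p trE.
have Ew := subsetP sWE w Ww.
set q := [~ w, y].
have Zq : q \in centre E by apply: (subsetP (joing_subl _ _)); rewrite mem_commg.
have nQq : q \notin 'Phi(E) by apply: (tr_notin pr_p pS trE).
have Hq : q \in axis E := subsetP (tr_ZH pr_p pS trE) q Zq.
have Eq := subsetP sHE q Hq.
have qpN : q ^+ p \in N by apply: (subsetP PHN); apply: Phi_pow.
(* U is D enlarged by the p-th powers of q and w. Since C, q and w generate E modulo Phi(E), the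
   p-th powers of all elements of E lie in U, whence Phi(E) lies in U. *)
pose T := [group of <[q ^+ p]> <*> D].
pose U := [group of <[w ^+ p]> <*> T].
have sDT : D \subset T by apply: joing_subr.
have sTU : T \subset U by apply: joing_subr.
have sDU := subset_trans sDT sTU.
have nrm (V : {group gT}) : D \subset V -> V \subset E -> E \subset 'N(V).
  move=> sDV sVE; rewrite -commg_subl; apply: subset_trans (commSg _ sVE) _.
  exact: subset_trans cED sDV.
have sTE : T \subset E.
  by rewrite join_subG cycle_subG groupX //= (subset_trans sDN) // (subset_trans sNQ) ?Phi_sub.
have sUE : U \subset E by rewrite join_subG cycle_subG groupX.
have pcU : pow_cond p E U.
  split; first exact: nrm.
    apply: subset_trans (commSg _ (subset_trans cED sDU)) _.
    by rewrite commg_subl nrm.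
  by move=> u v Eu Ev; rewrite groupX // (subsetP (subset_trans cED sDU)) ?mem_commg.
have [K eK] := powker odd_p pcU.
have sKE : K \subset E by apply/subsetP=> v; rewrite eK => /andP[].
have sCK : C \subset K.
  apply/subsetP=> c Cc; rewrite eK inE (subsetP sCE) //=.
  apply: (subsetP sDU); apply: (subsetP (joing_subr _ _)).
  by rewrite Phi_pow ?(pgroupS sCE pE).
have sZK : centre E \subset K.
  rewrite -(_ : centre E :&: K = centre E) ?subsetIr //.
  apply: (idx_full (N := 'Phi(E)) (x := q)) => //=.
  - by rewrite subsetI (tr_QZ S) (subset_trans (tr_QC trE)).
  - exact: subsetIl.
  - by rewrite (tr_iZ pr_p pS trE).
  - rewrite inE Zq eK inE Eq /=; apply: (subsetP sTU); apply: (subsetP (joing_subl _ _)).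
    exact: cycle_id.
have sWK : W \subset K.
  rewrite -(_ : W :&: K = W) ?subsetIr //.
  apply: (idx_full (N := [group of centre E]) (x := w)) => //=.
  - by rewrite subsetI (tr_ZW trE).
  - exact: subsetIl.
  - by rewrite (tr_iWZ pr_p pS trE).
  - rewrite inE Ww eK inE Ew /=; apply: (subsetP (joing_subl _ _)).
    exact: cycle_id.
  - by apply: contra nHw; apply: (subsetP (tr_ZH pr_p pS trE)).
have eKE : K :=: E.
  by apply/eqP; rewrite eqEsubset sKE -(tr_WC trE) mul_subG.
have sQU : 'Phi(E) \subset U.
  apply: (Phi_sub_crit pr_p pE); first exact: nrm.
    exact: subset_trans cED sDU.
  by move=> x; rewrite -{1}eKE eK => /andP[].
have sTN : T \subset N by rewrite join_subG cycle_subG qpN.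
have nwN : w ^+ p \notin N.
  apply: contra (proper_subn ltNQ) => wN.
  by apply: subset_trans sQU _; rewrite join_subG cycle_subG wN.
(* An element of N is a k-th power of w ^+ p times an element of T. As w ^+ p is outside N while its
   p-th power lies in D, p divides k. *)
have sNT : N \subset T.
  apply/subsetP=> n Nn; have Un := subsetP sQU n (subsetP sNQ n Nn).
  have nTw : <[w ^+ p]> \subset 'N(T) by rewrite cycle_subG (subsetP (nrm _ sDT sTE)) ?groupX.
  move: Un; rewrite /= norm_joinEl // => /mulsgP[_ u /cycleP[k ->] Tu en].
  have Nk : (w ^+ p) ^+ k \in N by rewrite -(groupMr _ (subsetP sTN u Tu)) -en.
  have wppD : (w ^+ p) ^+ p \in D by rewrite pQD // (Phi_pow pE).
  have pk : p %| k.
    by apply: contraR nwN => /expg_coprime->//; apply: (subsetP sDN).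
  rewrite en groupM // (subsetP sDT) //; case/dvdnP: pk => k' ->.
  by rewrite mulnC expgM groupX.
have : [~ q, y] \in T.
  by apply: (subsetP sNT); apply: (subsetP cHN); rewrite mem_commg.
have nDq : <[q ^+ p]> \subset 'N(D).
  by rewrite cycle_subG (subsetP (nrm D (subxx _) (subset_trans sDT sTE))) ?groupX.
rewrite /= norm_joinEl // => /mulsgP[_ d /cycleP[i ->] Dd ed].
have wD : {in W, forall v, v ^+ p \in D}.
  apply: (tr_no_lift pr_p odd_p pS trE (w := w) (y := y) (i := i)) => //.
  - by apply/setIidPr; apply: subset_trans sDN sNQ.
  - exact: subset_trans (commgSS sWE sWE) cED.
  - by apply: (subsetP cED); rewrite mem_commg // (tr_ypE trE).
  - by rewrite -/q ed expgM mem_lcoset mulKg.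
by have := nwN; rewrite (subsetP sDN) // wD.
Qed.

Lemma tr_Phi_axis E C W t a : transv p S E C W t a ->
  'Phi(E) = [~: axis E, S] <*> 'Phi(axis E).
Proof.
move=> trE; apply/eqP; rewrite eqEsubset (tr_key trE) join_subG (tr_HS trE).
by rewrite (PhiS (tr_pE pS trE)) ?tr_HE.
Qed.

End Key.

(** * Pairs of maximal subgroups; commutator identities *)

Section Aux.
Variables (gT : finGroupType) (p : nat).
Hypotheses (pr_p : prime p) (odd_p : odd p).
Implicit Types (X Y N A B H S : {group gT}) (t a : {perm gT}).

Lemma max_meet X A B : p.-group X -> A \subset X -> B \subset X ->
  #|X : A| = p -> #|X : B| = p -> A :!=: B ->
  [/\ A <| X, B <| X, A * B = X & #|A : A :&: B| = p].
Proof.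
move=> pX sAX sBX iA iB neAB.
have nn Y : Y \subset X -> #|X : Y| = p -> Y <| X.
  by move=> sYX iY; apply: p_maximal_normal pX _; apply: p_index_maximal; rewrite ?iY.
have nA := nn A sAX iA; have nB := nn B sBX iB.
have sAY : A \subset A <*> B := joing_subl A B.
have sYX : A <*> B \subset X by rewrite join_subG sAX.
have eAB : A * B = X.
  rewrite -norm_joinEr ?(subset_trans sBX) ?normal_norm //.
  case: (idx_cases (K := [group of A <*> B]) sAY sYX); rewrite ?iA //= => eA.
  have sBA : B \subset A by rewrite -eA joing_subr.
  case: (idx_cases sBA sAX) => [|eBA|eAX]; first by rewrite iB.
    by rewrite -eBA eqxx in neAB.
  by move: (prime_gt1 pr_p); rewrite -iA eAX indexgg.
split=> //; apply/eqP; rewrite -iB -(eqn_pmul2l (cardG_gt0 (A :&: B))) Lagrange ?subsetIl //.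
have e := mul_cardG A B; rewrite eAB in e.
by rewrite -(eqn_pmul2r (cardG_gt0 B)) e -(Lagrange sBX); apply/eqP; ring.
Qed.

Lemma index_cycle_join x N : x \in 'N(N) -> x ^+ p \in N -> #|<[x]> <*> N : N| <= p.
Proof.
move=> Nx xp; have nxN : <[x]> \subset 'N(N) by rewrite cycle_subG.
rewrite -card_quotient ?join_subG ?nxN ?normG // joingC quotientYidl //.
rewrite quotient_cycle // -orderE; apply: dvdn_leq (prime_gt0 pr_p) _.
by rewrite order_dvdn -morphX //; apply/eqP/coset_id.
Qed.

Lemma Aut_normal S X a : a \in Aut S -> X <| S -> a @: X <| S.
Proof.
move=> Aa nXS; rewrite (Aut_imset Aa (normal_sub nXS)) -[X in _ <| X](im_autm Aa).
exact: morphim_normal.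
Qed.

Lemma comm_mul X A B N : X :=: A * B -> X \subset 'N(N) ->
  [~: A, A] \subset N -> [~: A, B] \subset N -> [~: B, B] \subset N -> [~: X, X] \subset N.
Proof.
move=> eX nX cA cAB cB.
have sAX : A \subset X by rewrite eX mulG_subl.
have sBX : B \subset X by rewrite eX mulG_subr.
have [nA nB] := (subset_trans sAX nX, subset_trans sBX nX).
have cXA : [~: X, A] \subset N.
  rewrite -(sub_cmod (subxx X) nX nA) {1}eX mul_subG // (sub_cmod _ nX nA) //.
  by rewrite commGC.
have cXB : [~: X, B] \subset N.
  by rewrite -(sub_cmod (subxx X) nX nB) {1}eX mul_subG // (sub_cmod _ nX nB).
rewrite -(sub_cmod (subxx X) nX nX) {1}eX mul_subG // (sub_cmod _ nX nX) //.
  by rewrite commGC.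
by rewrite commGC.
Qed.

Lemma comm_mulr X A B N Y : X :=: A * B -> X \subset 'N(N) -> Y \subset 'N(N) ->
  [~: Y, A] \subset N -> [~: Y, B] \subset N -> [~: Y, X] \subset N.
Proof.
move=> eX nX nY cA cB; rewrite commGC.
have sAX : A \subset X by rewrite eX mulG_subl.
have sBX : B \subset X by rewrite eX mulG_subr.
rewrite -(sub_cmod (subxx X) nX nY) {1}eX mul_subG // (sub_cmod _ nX nY) //.
  by rewrite commGC.
by rewrite commGC.
Qed.

(** Computes the image of [w, x] when an automorphism inverts w and fixes x up to factors z and z'
    that commute with everything in sight. *)
Lemma comm_invl (w x z z' : gT) : commute z w -> commute z x -> commute z z' ->
  commute z' w -> commute z' x -> commute w [~ w, x] ->
  [~ w^-1 * z, x * z'] = [~ w, x]^-1.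
Proof.
move=> zw zx zz' z'w z'x cw.
have c1 : [~ z, x * z'] = 1 by apply/eqP/commgP; apply: commuteM.
have c2 : [~ w^-1, z'] = 1.
  by apply/eqP/commgP/commute_sym; apply: commuteV.
have fx (u v : gT) : commute u v -> v ^ u = v by move=> c; rewrite conjgE -c mulKg.
rewrite commMgJ c1 mulg1 commgMJ c2 mul1g commVg //.
by rewrite !conjVg !conjRg !(fx z' w, fx z' x) // !(fx z w, fx z x).
Qed.

End Aux.

(** * The Frattini subgroup of S and the rank bound on W *)

Section PairLemmas.
Variables (gT : finGroupType) (p : nat) (S : {group gT}).
Hypotheses (pr_p : prime p) (odd_p : odd p) (pS : p.-group S) (rS : rk3 p S).
Implicit Types (X Y N E C W D K M : {group gT}) (t a : {perm gT}).

Lemma Phi_le_max E : E <| S -> #|S : E| = p -> 'Phi(S) \subset E.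
Proof.
move=> nE iE; apply: Phi_sub_max; apply: p_index_maximal; rewrite ?iE //.
exact: normal_sub nE.
Qed.

Lemma centre_Phi E : E \subset S -> centre S E \subset 'Phi(S).
Proof.
move=> sES; rewrite join_subG (PhiS pS sES) andbT.
exact: subset_trans (commSg _ sES) (Phi_der pS).
Qed.

(** If M is not the axis, it contains w * c with w in W outside the axis and c in C. As M is
    t-stable and t inverts w and fixes c, both lie in M; so W lies in M and t is trivial on E / M.
    Being trivial on S / E too, t is trivial modulo Phi(S) = M, hence on S, against its inverting w
    modulo Phi(E). *)
Lemma tr_frat E C W t a M : transv p S E C W t a -> 'Phi(S) = M -> #|E : M| = p ->
  M :=: axis S E.
Proof.
move=> trE eM iM; have nES := tr_nE trE; have sES := normal_sub nES.
have sPE := Phi_le_max nES (tr_iE trE); have sME : M \subset E by rewrite -eM.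
have nMS : M <| S by rewrite -eM Phi_normal.
have nM := subsetP (normal_norm nMS).
have At := tr_tS trE; have tt := tr_tt trE.
have tM : stab t M by rewrite -eM; apply: stab_Phi At (subxx _) (Aut_stab At).
have sQM : 'Phi(E) \subset M by rewrite -eM (PhiS pS).
have sZM : centre S E \subset M by rewrite -eM centre_Phi.
have sCE := tr_CE trE; have sWE := tr_WE trE.
have sWS := subset_trans sWE sES; have sCS := subset_trans sCE sES.
have tSS := Aut_stab At.
have tW w : w \in W -> coset M (t w) = (coset M w)^-1.
  move=> Ww; have Sw := subsetP sWS w Ww.
  apply/eqP; rewrite eq_sym eq_invg_mul -morphM ?nM ?tSS //; apply/eqP/coset_id.
  by rewrite (subsetP sQM) // (tr_tW trE).
have tC c : c \in C -> coset M (t c) = coset M c.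
  move=> Cc; have Sc := subsetP sCS c Cc.
  apply/eqP; rewrite eq_sym eq_mulVg1 -morphV ?nM // -morphM ?groupV ?nM ?tSS //.
  by apply/eqP/coset_id; rewrite (subsetP sQM) // (tr_tC trE).
case: (boolP (M \subset axis S E)) => [sMH | /subsetPn[m Mm nHm]].
  have prM : prime #|E : M| by rewrite iM.
  case: (idx_cases sMH (tr_HE S E) prM) => [-> // | eH].
  by move: (prime_gt1 pr_p); rewrite -(tr_iH trE) eH indexgg.
have Em := subsetP sME m Mm.
have := Em; rewrite -(tr_WC trE) => /mulsgP[w c Ww Cc em].
have [Sw Sc] := (subsetP sWS w Ww, subsetP sCS c Cc).
have nHw : w \notin axis S E.
  by apply: contra nHm => Hw; rewrite em groupM // (subsetP (tr_CH trE)).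
have Mw : w \in M.
  apply: (invol_odd odd_p pS Sw); apply: coset_idr; first by rewrite groupX ?nM.
  have e1 : coset M w * coset M c = 1 by rewrite -morphM ?nM // -em; exact: coset_id.
  have e2 : (coset M w)^-1 * coset M c = 1.
    rewrite -tW // -(tC c) // -morphM ?nM ?tSS // -(AutM At) // -em.
    exact: coset_id (tM m Mm).
  have e3 : coset M c = coset M w by apply/eqP; rewrite eq_sym eq_mulVg1 e2.
  by rewrite morphX ?nM //= expgS expg1 -{2}e3.
have sWM : W \subset M.
  rewrite -(_ : W :&: M = W) ?subsetIr //.
  apply: (idx_full (N := [group of centre S E]) (x := w)) => //=.
  - by rewrite subsetI (tr_ZW trE).
  - exact: subsetIl.
  - by rewrite (tr_iWZ pr_p pS trE).
  - by rewrite inE Ww.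
  - by apply: contra nHw; apply: (subsetP (tr_ZH pr_p pS trE)).
have tE e : e \in E -> coset M (t e) = coset M e.
  rewrite -(tr_WC trE) => /mulsgP[v b Wv Cb ->].
  have [Sv Sb] := (subsetP sWS v Wv, subsetP sCS b Cb).
  rewrite (AutM At) // !morphM ?nM ?tSS //= (tC b Cb) (tW v Wv).
  by rewrite (coset_id (subsetP sWM v Wv)) invg1.
(* Here u = s^-1 * t s is inverted by t, and it is fixed modulo M because it lies in E; so its
   square lies in M. *)
have tS1 : {in S, forall s, s^-1 * t s \in 'Phi(S)}.
  move=> s Ss; rewrite eM; set u := _ * _.
  have Eu : u \in E := tr_tSE trE Ss.
  have Su := subsetP sES u Eu.
  have tu : t u = u^-1 by rewrite (AutM At) ?groupV ?tSS // (AutV At) // tt invMg invgK.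
  apply: (invol_odd odd_p pS Su); apply: coset_idr; first by rewrite groupX ?nM.
  have := tE u Eu; rewrite tu morphV ?nM // morphX ?nM //= expgS expg1 => {1}<-.
  by rewrite mulVg.
have t1 := invol_Phi odd_p pS At tt (subxx S) tS1.
have := tr_tW trE Ww; rewrite t1 // => wQ.
case/negP: nHw; apply: (subsetP (tr_QH trE)).
by apply: (invol_odd odd_p pS Sw); rewrite expgS expg1.
Qed.

Lemma tr_WE_cases E C W t a : transv p S E C W t a ->
  W :=: E \/ (#|E : W| = p /\ #|axis S E : centre S E| = p).
Proof.
move=> trE; have sES := normal_sub (tr_nE trE); have sWE := tr_WE trE.
have le := rS sES.
have e1 := Lagrange_index sWE (tr_QW trE); rewrite (tr_iW trE) in e1.
have lep : #|E : W| <= p.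
  by move: le; rewrite -e1 (expnS p 2) leq_pmul2r ?expn_gt0 ?prime_gt0.
have iW : #|E : W| %| p ^ logn p #|E|.
  by rewrite -(card_pgroup (tr_pE pS trE)) dvdn_indexg.
have [k _ ek] := dvdn_pfactor _ _ pr_p iW.
case: k ek => [|[|k]] ek.
- by left; apply/eqP; rewrite eqEsubset sWE -indexg_eq1 ek.
- right; rewrite ek; split=> //.
  have e2 := Lagrange_index (tr_HE S E) (tr_ZH pr_p pS trE).
  have e3 := Lagrange_index sWE (tr_ZW trE).
  apply/eqP; rewrite -(eqn_pmul2l (prime_gt0 pr_p)) -{1}(tr_iH trE) e2 -e3.
  by rewrite (tr_iWZ pr_p pS trE) ek expn1.
- have := leq_trans (leq_pexp2l (prime_gt0 pr_p) (isT : 1 < k.+2)) (eq_leq (esym ek)).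
  move/leq_trans/(_ lep); rewrite leqNgt -{1}[p]expn1 ltn_exp2l ?prime_gt1 //.
Qed.

(* By the rank condition the Frattini subgroup of W is N, so N is a-invariant. *)
Lemma tr_comm_WC E C W t a N : transv p S E C W t a -> N <| S -> N \subset 'Phi(E) ->
  #|'Phi(E) : N| = p -> {in W, forall w, w ^+ p \in N} ->
  [~: centre S E, E] \subset N -> [~: W, C] \subset N.
Proof.
move=> trE nNS sNQ iN pW cZ; have sES := normal_sub (tr_nE trE).
have sWE := tr_WE trE; have sWS := subset_trans sWE sES; have aE := tr_aE trE.
have nNW := subset_trans sWS (normal_norm nNS).
have nNC := subset_trans (subset_trans (tr_CE trE) sES) (normal_norm nNS).
have pW' := pgroupS sWS pS.
have cWW : [~: W, W] \subset N.
  apply: (der_ext (H := [group of centre S E])) => //=; first exact: tr_ZW trE.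
    by rewrite (tr_iWZ pr_p pS trE).
  exact: subset_trans (commgS _ sWE) cZ.
have sPN : 'Phi(W) \subset N := Phi_sub_crit pr_p pW' nNW cWW pW.
have ePN : N = 'Phi(W) :> {set gT}.
  have e1 := Lagrange_index (subset_trans sNQ (tr_QW trE)) sPN.
  have e2 := Lagrange_index (tr_QW trE) sNQ.
  have := rS sWS; rewrite -e1 -e2 (tr_iW trE) iN -expnSr => le.
  apply/eqP; rewrite eqEsubset sPN andbT -indexg_eq1 eqn_leq indexg_gt0 andbT.
  by rewrite -(leq_pmul2l (_ : 0 < p ^ 3)) ?expn_gt0 ?prime_gt0 // muln1.
have aN : stab a N by rewrite ePN; apply: stab_Phi aE sWE (tr_aW trE).
rewrite -(sub_cmod (subxx W) nNW nNC).
have sZX : centre S E \subset cmod W C N.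
  rewrite (sub_cmod _ nNW nNC) ?(tr_ZW trE) //=.
  exact: subset_trans (commgS _ (tr_CE trE)) cZ.
have /subsetPn[q Zq nQq] := tr_Zneq pr_p trE.
rewrite (tr_Wfull pr_p pS trE (K := [group of cmod W C N]) (q := q)) //=.
- exact: cmod_sub.
- apply: (stab_cmod aE) => //; [exact: tr_CE trE | | exact: tr_aW trE | exact: tr_aCC trE].
  exact: subset_trans sNQ (Phi_sub E).
- exact: subset_trans (tr_QZ S E) sZX.
- exact: (subsetP sZX).
Qed.

End PairLemmas.

(** * Two transvection subgroups meet in their common axis *)

Section Pair.
Variables (gT : finGroupType) (p : nat) (S : {group gT}).
Hypotheses (pr_p : prime p) (odd_p : odd p) (pS : p.-group S) (rS : rk3 p S).
Implicit Types (X Y N E C W D K M : {group gT}) (t a : {perm gT}).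

(* Otherwise N and t(N) meet in P with S centralising Phi(S) / P, and the rank condition on W
   produces a section W / D on which an element of S \ E acts as a transvection of order p,
   although W / D maps onto a homocyclic group of exponent p ^ 2. *)
Lemma tr_stabN E C W t a N : transv p S E C W t a -> 'Phi(S) = centre S E -> N <| S ->
  N \subset 'Phi(E) -> #|'Phi(E) : N| = p -> [~: 'Phi(S), S] \subset N ->
  {in 'Phi(S), forall f, f ^+ p \in N} -> stab t N.
Proof.
move=> trE eF nNS sNQ iN cFN pFN; apply/stab_imset/eqP/idPn=> neN.
have At := tr_tS trE; have tt := tr_tt trE; have aE := tr_aE trE.
have nES := tr_nE trE; have sES := normal_sub nES; have pE := tr_pE pS trE.
have sWE := tr_WE trE; have sWS := subset_trans sWE sES.
have nQ := tr_nQ trE; have sQS := normal_sub nQ; have sNS := normal_sub nNS.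
have tQ : stab t 'Phi(E) := stab_Phi At sES (tr_tE trE).
have tF : t @: 'Phi(S) = 'Phi(S).
  by apply/stab_imset; apply: (stab_Phi At (subxx _) (Aut_stab At)).
have tS : t @: S = S by apply/stab_imset/Aut_stab.
pose Nt := Group (Aut_img_group At sNS).
pose P := [group of N :&: Nt].
have nNtS : Nt <| S := Aut_normal At nNS.
have nPS : P <| S by apply: normalI.
have sNtQ : Nt \subset 'Phi(E) by have /stab_imset <- := tQ; apply: imsetS.
have iNt : #|'Phi(E) : Nt| = p.
  apply/eqP; rewrite -(eqn_pmul2l (cardG_gt0 Nt)) Lagrange //=.
  by rewrite card_imset ?(Lagrange sNQ) -?iN ?Lagrange //; apply: perm_inj.
have pQ : p.-group 'Phi(E) := pgroupS sQS pS.
have neN' : N :!=: Nt by rewrite eq_sym.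
have [_ _ _ iP] := max_meet pr_p pQ sNQ sNtQ iN iNt neN'.
have sPQ : P \subset 'Phi(E) := subset_trans (subsetIl _ _) sNQ.
have iPQ : #|'Phi(E) : P| = (p ^ 2)%N.
  by rewrite -(Lagrange_index sNQ (subsetIl N Nt)) iN iP mulnn.
have cFP : [~: 'Phi(S), S] \subset P.
  have e : t @: [~: 'Phi(S), S] = [~: 'Phi(S), S] by rewrite (Aut_comm At) ?Phi_sub // tF tS.
  by rewrite subsetI cFN -e imsetS.
have pFP : {in 'Phi(S), forall f, f ^+ p \in P}.
  move=> f Ff; rewrite inE pFN //= -(tt f) -(AutX At) ?(Aut_stab At) //; last first.
    exact: (subsetP (Phi_sub S)).
  by apply/imset_f/pFN; rewrite -tF imset_f.
have sQF : 'Phi(E) \subset 'Phi(S) := PhiS pS sES.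
have sFW : 'Phi(S) \subset W by rewrite eF (tr_ZW trE).
have [w [y [Ww nHw Sy nEy]]] := tr_ex pr_p trE.
have Ew := subsetP sWE w Ww.
have iWF : #|W : 'Phi(S)| = p by rewrite eF (tr_iWZ pr_p pS trE).
have nFw : w \notin 'Phi(S).
  by apply: contra nHw; rewrite eF; apply: (subsetP (tr_ZH pr_p pS trE)).
have nrmP : W \subset 'N(P) := subset_trans sWS (normal_norm nPS).
have cWP : [~: W, W] \subset P.
  apply: (der_ext (H := [group of 'Phi(S)])) => //=; first by rewrite iWF.
  exact: subset_trans (commgS _ sWS) cFP.
have pW := pgroupS sWS pS.
(* The construction of [tr_key] with W in place of E and P in place of N: D lies in P and is
   a-stable. *)
pose D := [group of [~: W, W] <*> 'Phi('Phi(E))].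
have PQP : 'Phi('Phi(E)) \subset P.
  apply: (Phi_sub_crit pr_p pQ).
  - exact: subset_trans sQS (normal_norm nPS).
  - exact: subset_trans (commgSS sQF sQS) cFP.
  - by move=> x Qx; apply: pFP; apply: (subsetP sQF).
have sDP : D \subset P by rewrite join_subG cWP.
have cWD : [~: W, W] \subset D by apply: joing_subl.
have sDW : D \subset W.
  by rewrite (subset_trans sDP) // (subset_trans sPQ) // (tr_QW trE).
have nrm (V : {group gT}) : D \subset V -> V \subset W -> W \subset 'N(V).
  move=> sDV sVW; rewrite -commg_subl; apply: subset_trans (commSg _ sVW) _.
  exact: subset_trans cWD sDV.
have nDS : D <| S.
  rewrite normalY // ?(char_normal_trans (Phi_char _)) ?(tr_nW trE) //.
  exact: char_normal_trans (der_char 1 W) (tr_nW trE).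
have aD : stab a D.
  apply: (stab_join aE).
  - by apply: subset_trans sWE; rewrite commg_subl normG.
  - exact: subset_trans (Phi_sub _) (Phi_sub E).
  - by apply: (stab_comm aE) => //; apply: (tr_aW trE).
  - exact: stab_Phi aE (Phi_sub E) (tr_aQ trE).
have pQD : {in 'Phi(E), forall x, x ^+ p \in D}.
  by move=> x Qx; apply: (subsetP (joing_subr _ _)); apply: Phi_pow.
set q := [~ w, y].
have Zq : q \in centre S E by apply: (subsetP (joing_subl _ _)); rewrite mem_commg.
have Fq : q \in 'Phi(S) by rewrite eF.
have nQq : q \notin 'Phi(E) by apply: (tr_notin pr_p pS trE).
have Wq := subsetP sFW q Fq.
have Qwp : w ^+ p \in 'Phi(E) := Phi_pow pE Ew.
have qpP : q ^+ p \in P := pFP q Fq.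
pose T := [group of <[q ^+ p]> <*> D].
pose U := [group of <[w ^+ p]> <*> T].
have sDT : D \subset T by apply: joing_subr.
have sTU : T \subset U by apply: joing_subr.
have sDU := subset_trans sDT sTU.
have sTP : T \subset P by rewrite join_subG cycle_subG qpP.
have sUQ : U \subset 'Phi(E).
  by rewrite join_subG cycle_subG Qwp (subset_trans sTP).
have sUW : U \subset W := subset_trans sUQ (tr_QW trE).
have pcU : pow_cond p W U.
  split; first exact: nrm.
    apply: subset_trans (commSg _ (subset_trans cWD sDU)) _.
    by rewrite commg_subl nrm.
  by move=> u v Wu Wv; rewrite groupX // (subsetP (subset_trans cWD sDU)) ?mem_commg.
have [K eK] := powker odd_p pcU.
have sKW : K \subset W by apply/subsetP=> v; rewrite eK => /andP[].
have sQK : 'Phi(E) \subset K.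
  apply/subsetP=> c Qc; rewrite eK inE (subsetP (tr_QW trE)) //=.
  by apply: (subsetP sDU); apply: pQD.
have sFK : 'Phi(S) \subset K.
  rewrite -(_ : 'Phi(S) :&: K = 'Phi(S)) ?subsetIr //.
  apply: (idx_full (N := 'Phi(E)) (x := q)) => //=.
  - by rewrite subsetI sQF.
  - exact: subsetIl.
  - by rewrite eF (tr_iZ pr_p pS trE).
  - rewrite inE Fq eK inE Wq /=; apply: (subsetP sTU); apply: (subsetP (joing_subl _ _)).
    exact: cycle_id.
have eKW : K :=: W.
  apply: (idx_full sFK sKW _ _ nFw); first by rewrite iWF.
  by rewrite eK inE Ww; apply: (subsetP (joing_subl _ _)); apply: cycle_id.
have sPWU : 'Phi(W) \subset U.
  apply: (Phi_sub_crit pr_p pW); first exact: nrm.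
    exact: subset_trans cWD sDU.
  by move=> x; rewrite -{1}eKW eK => /andP[].
(* The rank of W is used here: Phi(W) lies in U, so Phi(E) : U has index at most p, whereas Phi(E) :
   P has index p ^ 2. This keeps w ^+ p out of P and forces P into U. *)
have iU : #|'Phi(E) : U| <= p.
  have e1 := Lagrange_index (tr_QW trE) (subset_trans sPWU sUQ).
  have := rS sWS; rewrite -e1 (tr_iW trE) (expnSr p 2) leq_pmul2l ?expn_gt0 ?prime_gt0 //.
  by apply: leq_trans; rewrite dvdn_leq ?indexg_gt0 // indexgS.
have nwP : w ^+ p \notin P.
  apply/negP=> wP; have sUP : U \subset P by rewrite join_subG cycle_subG wP.
  have : #|'Phi(E) : P| <= p.
    by apply: leq_trans iU; rewrite dvdn_leq ?indexg_gt0 // indexgS.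
  by rewrite iPQ (leq_p2 pr_p).
have nwT (V : {group gT}) : D \subset V -> V \subset W -> <[w ^+ p]> \subset 'N(V).
  by move=> sDV sVW; rewrite cycle_subG (subsetP (nrm _ sDV sVW)) ?groupX.
have sPW : P \subset W := subset_trans sPQ (tr_QW trE).
have sPU : P \subset U.
  have sUUP : U \subset U <*> P by apply: joing_subl.
  have sUPQ : U <*> P \subset 'Phi(E) by rewrite join_subG sUQ.
  have dv : #|'Phi(E) : U| %| p ^ logn p #|'Phi(E)|.
    by rewrite -(card_pgroup pQ) dvdn_indexg.
  have [k _ ek] := dvdn_pfactor _ _ pr_p dv; case: k ek => [|k] ek.
    by apply: subset_trans sPQ _; rewrite -indexg_eq1 ek.
  have iU' : #|'Phi(E) : U| = p.
    by apply/eqP; rewrite eqn_leq iU ek -{1}[p]expn1 leq_exp2l ?(prime_gt1 pr_p).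
  have prU : prime #|'Phi(E) : U| by rewrite iU'.
  case: (idx_cases (K := [group of U <*> P]) sUUP sUPQ prU) => /= eU.
    by have := joing_subr U P; rewrite eU.
  have sQw : 'Phi(E) \subset <[w ^+ p]> <*> P.
    by rewrite -eU join_subG joing_subr /= join_subG joing_subl (subset_trans sTP) ?joing_subr.
  have wpp : (w ^+ p) ^+ p \in P by apply: pFP; apply: (subsetP sQF).
  have Nwp : w ^+ p \in 'N(P) by rewrite (subsetP nrmP) ?groupX.
  have := index_cycle_join pr_p Nwp wpp.
  have -> : <[w ^+ p]> <*> P = 'Phi(E).
    by apply/eqP; rewrite eqEsubset sQw join_subG cycle_subG Qwp sPQ.
  by rewrite iPQ (leq_p2 pr_p).
have sPT : P \subset T.
  apply/subsetP=> n Pn; have := subsetP sPU n Pn.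
  rewrite /= norm_joinEl ?nwT ?(subset_trans sTP) // => /mulsgP[_ u /cycleP[k ->] Tu en].
  have Pk : (w ^+ p) ^+ k \in P by rewrite -(groupMr _ (subsetP sTP u Tu)) -en.
  have pk : p %| k.
    apply: contraR nwP => /expg_coprime->//; apply: pFP.
    exact: (subsetP sQF).
  rewrite en groupM // (subsetP sDT) //; case/dvdnP: pk => k' ->.
  by rewrite mulnC expgM groupX // pQD.
have : [~ q, y] \in T.
  by apply: (subsetP sPT); apply: (subsetP cFP); rewrite mem_commg.
have nDq : <[q ^+ p]> \subset 'N(D).
  by rewrite cycle_subG (subsetP (nrm D (subxx _) sDW)) ?groupX.
rewrite /= norm_joinEl // => /mulsgP[_ d /cycleP[i ->] Dd ed].
have wD : {in W, forall v, v ^+ p \in D}.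
  apply: (tr_no_lift pr_p odd_p pS trE (w := w) (y := y) (i := i)) => //.
  - by apply/setIidPr; apply: subset_trans sDP sPQ.
  - apply: (subsetP cWD); rewrite mem_commg // (subsetP sFW) //.
    exact: Phi_pow.
  - by rewrite -/q ed expgM mem_lcoset mulKg.
by have := nwP; rewrite (subsetP sDP) // wD.
Qed.

Lemma tr_iCQ E C W t a : transv p S E C W t a -> #|axis S E : centre S E| = p ->
  #|C : 'Phi(E)| = p.
Proof.
move=> trE iHZ.
have e1 := Lagrange_index (tr_CH trE) (tr_QC trE).
have e2 := Lagrange_index (tr_ZH pr_p pS trE) (tr_QZ S E).
rewrite (tr_iC trE) in e1; rewrite iHZ (tr_iZ pr_p pS trE) -e1 in e2.
by apply/esym/eqP; rewrite -(eqn_pmul2l (prime_gt0 pr_p)) e2.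
Qed.

Lemma tr_der_sub E C W t a N : transv p S E C W t a -> #|axis S E : centre S E| = p ->
  N <| S -> [~: centre S E, E] \subset N -> [~: W, C] \subset N -> [~: E, E] \subset N.
Proof.
move=> trE iHZ nNS cZ cWC; have sES := normal_sub (tr_nE trE).
have nN := normal_norm nNS; have sCE := tr_CE trE; have sWE := tr_WE trE.
have nE := subset_trans sES nN.
apply: (comm_mul (A := W) (B := C)) => //; first by rewrite (tr_WC trE).
  apply: (der_ext (H := [group of centre S E])) => //=; first exact: tr_ZW trE.
  - exact: subset_trans sWE nE.
  - by rewrite (tr_iWZ pr_p pS trE).
  - exact: subset_trans (commgS _ sWE) cZ.
apply: (der_ext (H := [group of 'Phi(E)])) => //=; first exact: tr_QC trE.
- exact: subset_trans sCE nE.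
- by rewrite (tr_iCQ trE).
- exact: subset_trans (commgSS (tr_QZ S E) sCE) cZ.
Qed.

(** Suppose that M = E1 :&: E2 is not the axis of E1. By [tr_frat], Phi(S) is smaller than M, which
    excludes W = E for both subgroups. The rank of M then forces Phi(E1) and Phi(E2) to be distinct
    of index p ^ 2 in M, with intersection N of index p in each; their product F is Phi(S) and the
    centre for both. The involution t stabilises N, and its signs force the p-th powers of all
    elements of E1 or of E2 into N. By [tr_comm_WC] that subgroup is then abelian modulo N, so S
    centralises M modulo Phi(E1) or Phi(E2), which is impossible. *)
Lemma tr_pair_not_axis E1 C1 W1 t a E2 C2 W2 t2 a2 :
  transv p S E1 C1 W1 t a -> transv p S E2 C2 W2 t2 a2 -> E1 :!=: E2 ->
  E1 :&: E2 = axis S E1.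
Proof.
move=> tr1 tr2 ne12; pose M := [group of E1 :&: E2].
have [nE1 nE2] := (tr_nE tr1, tr_nE tr2).
have [sE1 sE2] := (normal_sub nE1, normal_sub nE2).
have [_ _ eE12 iM1] := max_meet pr_p pS sE1 sE2 (tr_iE tr1) (tr_iE tr2) ne12.
have iM2 : #|E2 : M| = p.
  rewrite /= setIC; rewrite eq_sym in ne12.
  by case: (max_meet pr_p pS sE2 sE1 (tr_iE tr2) (tr_iE tr1) ne12).
have nMS : M <| S by apply: normalI.
have sMS := normal_sub nMS.
have [sM1 sM2] : M \subset E1 /\ M \subset E2 by rewrite subsetIl subsetIr.
have sPM : 'Phi(S) \subset M.
  by rewrite subsetI !(Phi_le_max pr_p) ?(tr_iE tr1) ?(tr_iE tr2).
apply/eqP/idPn => neMH.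
have frM : 'Phi(S) <> M.
  by move=> eM; case/eqP: neMH; apply: (tr_frat pr_p odd_p pS tr1).
have maxcentre E : E \subset S -> #|E : centre S E| = p -> M \subset E -> #|E : M| = p ->
    'Phi(S) = M.
  move=> sES iZ sME iM; have prZ : prime #|E : centre S E| by rewrite iZ.
  have sZM := subset_trans (centre_Phi pS sES) sPM.
  case: (idx_cases (N := [group of centre S E]) sZM sME prZ) => eM.
    by apply/eqP; rewrite eqEsubset sPM [M : {set gT}]eM (centre_Phi pS).
  by move: (prime_gt1 pr_p); rewrite -iM [M : {set gT}]eM indexgg.
have ty3 E C W u b : transv p S E C W u b -> M \subset E -> #|E : M| = p ->
    #|E : W| = p /\ #|axis S E : centre S E| = p.
  move=> trE sME iM; case: (tr_WE_cases pr_p pS rS trE) => // eW; case: frM.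
  apply: (maxcentre E) => //; first exact: normal_sub (tr_nE trE).
  by rewrite -(tr_iWZ pr_p pS trE) eW.
have [iW1 iH1] := ty3 _ _ _ _ _ tr1 sM1 iM1.
have [iW2 iH2] := ty3 _ _ _ _ _ tr2 sM2 iM2.
have neqaxis (X : {group gT}) (E : {group gT}) : M \subset X -> X \subset E -> #|E : M| = p ->
    #|E : X| = p -> M :=: X.
  move=> sMX sXE iM iX; have prM : prime #|E : M| by rewrite iM.
  case: (idx_cases sMX sXE prM) => [-> // | eX].
  by move: (prime_gt1 pr_p); rewrite -iX eX indexgg.
have cM1 : ~~ ([~: M, S] \subset 'Phi(E1)).
  apply: contra neMH => cM; apply/eqP; apply: (neqaxis _ E1) => //=; last exact: tr_iH tr1.
    rewrite sub_cmod // ?(normal_norm (tr_nQ tr1)) //.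
    exact: subset_trans sE1 (normal_norm (tr_nQ tr1)).
  exact: cmod_sub.
set Q1 := 'Phi(E1) in cM1 *; set Q2 := 'Phi(E2).
have [nQ1 nQ2] : Q1 <| S /\ Q2 <| S by rewrite (tr_nQ tr1) (tr_nQ tr2).
have [pE1 pE2] := (pgroupS sE1 pS, pgroupS sE2 pS).
have [c11 c22] : [~: E1, E1] \subset Q1 /\ [~: E2, E2] \subset Q2.
  by rewrite !(Phi_der pE1, Phi_der pE2).
have nM X : X <| S -> M \subset 'N(X).
  by move=> nX; apply: subset_trans sMS (normal_norm nX).
have cMS X : X <| S -> [~: M, E1] \subset X -> [~: M, E2] \subset X -> [~: M, S] \subset X.
  by move=> nX; apply: comm_mulr (esym eE12) (normal_norm nX) (nM X nX).
have cM1Q : [~: M, E1] \subset Q1 := subset_trans (commSg _ sM1) c11.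
have cM2Q : [~: M, E2] \subset Q2 := subset_trans (commSg _ sM2) c22.
have sQ1F : Q1 \subset 'Phi(S) := PhiS pS sE1.
have sQ2F : Q2 \subset 'Phi(S) := PhiS pS sE2.
have [sQ1M sQ2M] := (subset_trans sQ1F sPM, subset_trans sQ2F sPM).
pose N := [group of Q1 :&: Q2].
have nNS : N <| S by apply: normalI.
have [sN1 sN2] : N \subset Q1 /\ N \subset Q2 by rewrite subsetIl subsetIr.
have iMQ E C W u b : transv p S E C W u b -> #|E : W| = p -> M \subset E -> #|E : M| = p ->
    'Phi(E) \subset M -> #|M : 'Phi(E)| = (p ^ 2)%N.
  move=> trE iW sME iM sQM.
  have e1 := Lagrange_index sME sQM; have e2 := Lagrange_index (tr_WE trE) (tr_QW trE).
  apply/eqP; rewrite -(eqn_pmul2l (prime_gt0 pr_p)) -{1}iM e1 -e2 iW (tr_iW trE).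
  by rewrite eqxx.
have iMQ1 := iMQ _ _ _ _ _ tr1 iW1 sM1 iM1 sQ1M.
have iMQ2 := iMQ _ _ _ _ _ tr2 iW2 sM2 iM2 sQ2M.
have sPMN : 'Phi(M) \subset N.
  by rewrite subsetI (PhiS pE1 sM1) (PhiS pE2 sM2).
have leN : #|M : N| <= p ^ 3.
  apply: leq_trans (rS sMS); rewrite dvdn_leq ?indexg_gt0 //.
  exact: indexgS.
have iN X : X :&: N = N -> X \subset M -> #|M : X| = (p ^ 2)%N -> N :!=: X -> #|X : N| = p.
  move=> /setIidPr sNX sXM iX neX.
  have e1 := Lagrange_index sXM sNX.
  have le1 : #|X : N| <= p.
    by move: leN; rewrite -e1 iX (expnSr p 2) leq_pmul2l ?expn_gt0 ?prime_gt0.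
  have dv : #|X : N| %| p ^ logn p #|X|.
    by rewrite -(card_pgroup (pgroupS (subset_trans sXM sMS) pS)) dvdn_indexg.
  have [k _ ek] := dvdn_pfactor _ _ pr_p dv; case: k ek => [|k] ek.
    by case/eqP: neX; apply/eqP; rewrite eqEsubset sNX -indexg_eq1 ek.
  apply/eqP; rewrite eqn_leq le1 ek -{1}[p]expn1 leq_exp2l ?(prime_gt1 pr_p) //.
have neQ : Q1 <> Q2.
  move=> eQ; case/negP: cM1; rewrite -eQ in cM2Q.
  exact: (cMS [group of Q1] nQ1 cM1Q cM2Q).
have eN1 : #|Q1 : N| = p.
  apply: (iN [group of Q1]) => //=; first by apply/setIidPr.
  apply/eqP => eNQ; apply: neQ; apply/eqP; rewrite eqEcard -{1}eNQ sN2 /=.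
  have := Lagrange sQ1M; rewrite iMQ1 -(Lagrange sQ2M) iMQ2 => /eqP.
  by rewrite eqn_pmul2r ?expn_gt0 ?prime_gt0 // => /eqP->.
have eN2 : #|Q2 : N| = p.
  apply: (iN [group of Q2]) => //=; first by apply/setIidPr.
  apply/eqP => eNQ; apply: neQ; apply/esym/eqP; rewrite eqEcard -{1}eNQ sN1 /=.
  have := Lagrange sQ1M; rewrite iMQ1 -(Lagrange sQ2M) iMQ2 => /eqP.
  by rewrite eqn_pmul2r ?expn_gt0 ?prime_gt0 // => /eqP->.
pose F := [group of Q1 <*> Q2].
have sF1 : Q1 \subset F by apply: joing_subl.
have sF2 : Q2 \subset F by apply: joing_subr.
have nFS : F <| S by apply: normalY.
have nSQ1 := normal_norm nQ1.
have eF : F = Q1 * Q2 :> {set gT}.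
  by rewrite /= norm_joinEr // (subset_trans (normal_sub nQ2)).
have iF1 : #|F : Q1| = p.
  apply/eqP; rewrite -(eqn_pmul2l (cardG_gt0 [group of Q1])) Lagrange // eF.
  by rewrite -LagrangeMl -indexgI setIC eN2.
have iF2 : #|F : Q2| = p.
  apply/eqP; rewrite -(eqn_pmul2r (cardG_gt0 [group of Q2])) mulnC Lagrange // eF.
  by rewrite -LagrangeMr -indexgI eN1.
have cMF : [~: M, S] \subset F.
  by apply: cMS; rewrite // ?(subset_trans cM1Q) ?(subset_trans cM2Q).
have ecF : centre S E1 = F.
  have prZ : prime #|centre S E1 : Q1| by rewrite (tr_iZ pr_p pS tr1).
  have sK : Q1 \subset [~: M, S] <*> Q1 by apply: joing_subr.
  have sKZ : [~: M, S] <*> Q1 \subset centre S E1.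
    by rewrite join_subG (tr_QZ S) andbT (subset_trans (commSg _ sM1)) ?joing_subl.
  case: (idx_cases (K := [group of [~: M, S] <*> Q1]) sK sKZ prZ) => /= eK.
    by case/negP: cM1; have := joing_subl [~: M, S] Q1; rewrite eK.
  have sZF : centre S E1 \subset F by rewrite -eK join_subG cMF.
  have prF : prime #|F : Q1| by rewrite iF1.
  case: (idx_cases (K := [group of centre S E1]) (tr_QZ S E1) sZF prF) => //= eZ.
  by have := tr_Zneq pr_p tr1; rewrite eZ subxx.
have ePF : 'Phi(S) = F.
  apply/eqP; rewrite eqEsubset join_subG sQ1F sQ2F /= andbT.
  have cSF : [~: S, S] \subset F.
    apply: (der_ext sE1 (normal_norm nFS)); first by rewrite (tr_iE tr1).
    by rewrite -ecF joing_subl.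
  apply: (Phi_sub_crit pr_p pS (normal_norm nFS) cSF).
  have pc : pow_cond p S F.
    split; first exact: normal_norm.
      by apply: subset_trans (commSg _ cSF) _; rewrite commg_subl normal_norm.
    by move=> u v Su Sv; rewrite groupX // (subsetP cSF) ?mem_commg.
  have [K eK] := powker odd_p pc.
  have sK1 : E1 \subset K.
    apply/subsetP=> x Ex; rewrite eK inE (subsetP sE1) //=.
    by apply: (subsetP sF1); apply: Phi_pow.
  have sK2 : E2 \subset K.
    apply/subsetP=> x Ex; rewrite eK inE (subsetP sE2) //=.
    by apply: (subsetP sF2); apply: Phi_pow.
  have sSK : S \subset K by rewrite -eE12 mul_subG.
  by move=> x /(subsetP sSK); rewrite eK => /andP[].
have ecF2 : centre S E2 = F.
  have prF : prime #|F : Q2| by rewrite iF2.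
  have sZF : centre S E2 \subset F by rewrite -ePF (centre_Phi pS).
  case: (idx_cases (K := [group of centre S E2]) (tr_QZ S E2) sZF prF) => //= eZ.
  by have := tr_Zneq pr_p tr2; rewrite eZ subxx.
have cFN : [~: F, S] \subset N.
  by rewrite subsetI !(pcentral pr_p pS).
have pFN : {in F, forall f, f ^+ p \in N}.
  move=> f Ff; apply: (subsetP sPMN); apply: (Phi_pow (pgroupS sMS pS)).
  by rewrite (subsetP sPM) // ePF.
have tN : stab t N.
  apply: (tr_stabN tr1) => //; first by rewrite ePF.
    by rewrite ePF.
  by move=> f; rewrite ePF; apply: pFN.
have At := tr_tS tr1; have tt := tr_tt tr1; have tSS := Aut_stab At.
have nN := subsetP (normal_norm nNS); have nF := subsetP (normal_norm nFS).
have sFS := normal_sub nFS.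
have cosF z s : z \in F -> s \in S -> commute (coset N z) (coset N s).
  move=> Fz Ss; have Sz := subsetP sFS z Fz.
  apply/commgP; rewrite -morphR ?nN //; apply/eqP/coset_id.
  by apply: (subsetP cFN); rewrite mem_commg.
have powF s f : s \in S -> f \in F -> coset N ((s * f) ^+ p) = coset N (s ^+ p).
  move=> Ss Ff; have Sf := subsetP sFS f Ff.
  rewrite morphX ?nN ?groupM // morphM ?nN // expgMn; last exact/commute_sym/cosF.
  by rewrite -!morphX ?nN //= (coset_id (pFN f Ff)) mulg1.
have mPN m : m \in M -> m ^+ p \in N.
  by move=> Mm; apply: (subsetP sPMN); apply: (Phi_pow (pgroupS sMS pS)).
have pcE E : E \subset S -> 'Phi(E) \subset F -> pow_cond p E N.
  move=> sES sQF; have dE := Phi_der (pgroupS sES pS); split.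
  - exact: subset_trans sES (normal_norm nNS).
  - exact: subset_trans (commgSS (subset_trans dE sQF) sES) cFN.
  - by move=> u v Eu Ev; apply: pFN; apply: (subsetP sQF); apply: (subsetP dE); rewrite mem_commg.
have [sW1 sC1] := (tr_WE tr1, tr_CE tr1).
have [sW1S sC1S] := (subset_trans sW1 sE1, subset_trans sC1 sE1).
have sFW1 : F \subset W1 by rewrite -ecF (tr_ZW tr1).
have cZ1 : [~: centre S E1, E1] \subset N.
  by rewrite ecF; apply: subset_trans (commgS _ sE1) cFN.
have cZ2 : [~: centre S E2, E2] \subset N.
  by rewrite ecF2; apply: subset_trans (commgS _ sE2) cFN.
have prE1 : prime #|E1 : M| by rewrite iM1.
have prE2 : prime #|E2 : M| by rewrite iM2.
have sFH : F \subset axis S E1 by rewrite -ecF (tr_ZH pr_p pS tr1).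
have nMH : ~~ (M \subset axis S E1).
  apply: contra neMH => sMH; apply/eqP.
  by apply: (neqaxis _ E1) => //=; [exact: cmod_sub | exact: tr_iH tr1].
(* If M is the axis of E2, the p-th powers of E2 are shown to lie in N; it is enough to find one
   such element of E2 outside M. *)
case: (boolP (M == axis S E2 :> {set gT})) => [_ | neMH2].
  have nder2 : ~~ ([~: E2, E2] \subset N).
    apply: contra cM1 => d2; apply: (cMS [group of Q1] nQ1 cM1Q).
    exact: subset_trans (subset_trans (commSg _ sM2) d2) sN1.
  have [K eK] := powker odd_p (pcE E2 sE2 sF2).
  have sKE : K \subset E2 by apply/subsetP=> x; rewrite eK => /andP[].
  have sMK : M \subset K.
    by apply/subsetP=> m Mm; rewrite eK inE (subsetP sM2) //=; apply: mPN.
  have cSF : [~: S, S] \subset F by rewrite -ePF (Phi_der pS).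
  have cosFc u v : u \in S -> v \in S -> commute (coset F u) (coset F v).
    move=> Su Sv; apply/commgP; rewrite -morphR ?nF //; apply/eqP/coset_id.
    by apply: (subsetP cSF); rewrite mem_commg.
  (* As S / F is abelian, d is a homomorphism. It kills C1, and on W1 it is inversion followed by
     squaring. *)
  pose d s := coset F (s^-1 * t s).
  have dM : {in S &, {morph d : x y / x * y}}.
    move=> x y Sx Sy; rewrite /d.
    have Sd : x^-1 * t x \in S by rewrite groupM ?groupV ?tSS.
    have -> : (x * y)^-1 * t (x * y) = (x^-1 * t x) ^ y * (y^-1 * t y).
      by rewrite (AutM At) // invMg conjgE !mulgA mulgK.
    rewrite morphM ?nF ?groupM ?groupJ ?groupV ?tSS //=; congr (_ * _).
    by rewrite morphJ ?nF //= conjgE -(cosFc _ _ Sy Sd) mulKg.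
  pose dm := Morphism dM.
  have dW w : w \in W1 -> d w = (coset F w)^-1 * (coset F w)^-1.
    move=> Ww; have Sw := subsetP sW1S w Ww.
    rewrite /d morphM ?nF ?groupV ?tSS // morphV ?nF //=; congr (_ * _).
    apply/eqP; rewrite eq_sym eq_invg_mul -morphM ?nF ?tSS //; apply/eqP/coset_id.
    by rewrite (subsetP sF1) // (tr_tW tr1).
  have dC c : c \in C1 -> d c = 1.
    by move=> Cc; apply: coset_id; rewrite (subsetP sF1) // (tr_tC tr1).
  have tCO c : c \in C1 -> c ^+ 2 \in F -> c \in F.
    by move=> Cc; apply: (invol_odd odd_p pS); apply: (subsetP sC1S).
  have /subsetPn[m Mm nHm] := nMH.
  have Em := subsetP sM1 m Mm; have Sm := subsetP sE1 m Em.
  have := Em; rewrite -(tr_WC tr1) => /mulsgP[w c Ww Cc em].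
  have [Sw Sc] := (subsetP sW1S w Ww, subsetP sC1S c Cc).
  set v := m^-1 * t m.
  have Sv : v \in S by rewrite groupM ?groupV ?tSS.
  have ev : coset F v = (coset F w)^-1 * (coset F w)^-1.
    by rewrite -/(d m) em dM // dW // dC // mulg1.
  have nFw : w \notin F.
    by apply: contra nHm => Fw; rewrite em groupM ?(subsetP sFH w) ?(subsetP (tr_CH tr1) c).
  have nFv : v \notin F.
    apply: contra nFw => Fv; apply: (invol_odd odd_p pS Sw); apply: coset_idr.
      by rewrite groupX ?nF.
    have := coset_id Fv; rewrite ev -invMg => /eqP; rewrite invg_eq1 => /eqP.
    by rewrite morphX ?nF.
  have memW s : s \in S -> forall u, u \in W1 -> coset F s = coset F u -> s \in W1.
    move=> Ss u Wu e; have Su := subsetP sW1S u Wu.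
    have : u^-1 * s \in F.
      apply: coset_idr; first by rewrite groupM ?groupV ?nF.
      by rewrite morphM ?groupV ?nF // morphV ?nF //= e mulVg.
    by move/(subsetP sFW1); rewrite groupMl ?groupV.
  have Wv : v \in W1.
    apply: (memW v Sv (w^-1 * w^-1)); first by rewrite groupM ?groupV.
    by rewrite ev morphM ?groupV ?nF //= morphV ?nF.
  have /subsetPn[y0 Ey0 nMy0] : ~~ (E2 \subset M).
    by rewrite -indexg_eq1 iM2 neq_ltn (prime_gt1 pr_p) orbT.
  have Sy0 := subsetP sE2 y0 Ey0.
  set u := y0^-1 * t y0.
  have Eu : u \in E1 := tr_tSE tr1 Sy0; have Su := subsetP sE1 u Eu.
  have tu : t u = u^-1 by rewrite (AutM At) ?groupV ?tSS // (AutV At) // tt invMg invgK.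
  have Wu : u \in W1.
    have := Eu; rewrite -(tr_WC tr1) => /mulsgP[w' c' Ww' Cc' eu].
    have [Sw' Sc'] := (subsetP sW1S w' Ww', subsetP sC1S c' Cc').
    suff Fc' : c' \in F by rewrite eu groupM // (subsetP sFW1).
    apply: tCO => //; apply: coset_idr; first by rewrite groupX ?nF.
    have e1 : d u = (coset F w')^-1 * (coset F w')^-1 by rewrite eu dM // dW // dC // mulg1.
    have e2 : d u = (coset F u)^-1 * (coset F u)^-1.
      by rewrite /d tu morphM ?groupV ?nF //= morphV ?nF.
    have cWC : commute (coset F c') (coset F w') by apply: cosFc.
    have eU : coset F u = coset F w' * coset F c' by rewrite eu morphM ?nF.
    move: e2; rewrite e1 eU invMg -!invMg => /invg_inj.
    rewrite -mulgA (mulgA (coset F c')) cWC -!mulgA => /mulgI e3.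
    rewrite morphX ?nF //=; apply: (mulgI (coset F w')); rewrite mulg1 expgS expg1.
    exact: esym e3.
  have eW : <[v]> <*> F = W1.
    have prW : prime #|W1 : F| by rewrite -ecF (tr_iWZ pr_p pS tr1).
    apply: (idx_full (N := F) (K := [group of <[v]> <*> F]) (x := v)) => //=.
    - exact: joing_subr.
    - by rewrite join_subG cycle_subG Wv.
    - by apply: (subsetP (joing_subl _ _)); apply: cycle_id.
  have := Wu; rewrite -eW norm_joinEl; last by rewrite cycle_subG nF.
  case/mulsgP=> _ f /cycleP[k ->] Ff eu.
  (* The image d m generates W1 / F and d y0 lies in W1 / F. Correcting y0 by a power of m gives an
     element of E2 outside M that t fixes modulo F. *)
  pose y := y0 * m ^- k.
  have Ey : y \in E2 by rewrite groupM ?groupV ?groupX ?(subsetP sM2 m).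
  have nMy : y \notin M by rewrite /y groupMr ?groupV ?groupX.
  have Sy := subsetP sE2 y Ey.
  have Fy : y^-1 * t y \in F.
    apply: coset_idr; first by rewrite groupM ?groupV ?nF ?tSS.
    have d1 : d y0 = coset F (v ^+ k * f) by rewrite /d -/u eu.
    have d2 : dm m = coset F v by [].
    rewrite -/(d y) dM ?groupV ?groupX // d1.
    have -> : d (m ^- k) = dm m ^- k by rewrite -morphX // -morphV ?groupX.
    rewrite d2 -morphX ?nF // morphM ?groupX ?nF ?(subsetP sFS f) //=.
    by rewrite (coset_id Ff) mulg1 mulgV.
  pose f' := y^-1 * t y; pose g := y ^+ p.
  have Sg : g \in S by rewrite groupX.
  have Qg : g \in Q2 by apply: Phi_pow.
  have Fg : g \in F := subsetP sF2 g Qg.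
  have tg : coset N (t g) = coset N g.
    rewrite /g (AutX At) //; have -> : t y = y * f' by rewrite mulKVg.
    exact: powF.
  have nQN := subsetP (normal_norm nQ1).
  (* t fixes y ^+ p modulo N, but it inverts F modulo Phi(E1). So y ^+ p lies in Phi(E1), and it
     lies in Phi(E2) as a p-th power of an element of E2. *)
  have Q1g : g \in Q1.
    apply: (invol_odd odd_p pS Sg); apply: coset_idr; first by rewrite groupX ?nQN.
    have e1 : coset Q1 (t g) = coset Q1 g.
      have : g^-1 * t g \in N.
        apply: coset_idr; first by rewrite groupM ?groupV ?nN ?tSS.
        by rewrite morphM ?groupV ?nN ?tSS // morphV ?nN //= tg mulVg.
      move/(subsetP sN1)/coset_id; rewrite morphM ?groupV ?nQN ?tSS // morphV ?nQN //=.
      by move/eqP; rewrite -eq_mulVg1 => /eqP.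
    have : g * t g \in Q1 by apply: (tr_tW tr1); apply: (subsetP sFW1).
    move/coset_id; rewrite morphM ?nQN ?tSS //= e1 => h.
    by rewrite morphX ?nQN //= expgS expg1.
  have gN : g \in N by rewrite inE Q1g.
  have eKE : K :=: E2.
    by apply: (idx_full sMK sKE prE2 _ nMy); rewrite eK inE Ey.
  case/negP: nder2; apply: (tr_der_sub tr2) => //; apply: (tr_comm_WC pr_p pS rS tr2) => //.
  by move=> x Wx; have := subsetP (tr_WE tr2) x Wx; rewrite -{1}eKE eK => /andP[].
(* If M is not the axis of E2 either, the roles change: a commutator [w, c], inverted by t,
   generates Phi(E1) / N, whereas t fixes modulo N the p-th powers of elements of C1. So those
   powers lie in N, and so do all p-th powers of elements of E1. *)
have cM2 : ~~ ([~: M, S] \subset Q2).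
  apply: contra neMH2 => cM; apply/eqP; apply: (neqaxis _ E2) => //=; last exact: tr_iH tr2.
    rewrite sub_cmod // ?(normal_norm (tr_nQ tr2)) //.
    exact: subset_trans sE2 (normal_norm (tr_nQ tr2)).
  exact: cmod_sub.
have nWC : ~~ ([~: W1, C1] \subset N).
  apply: contra cM2 => cWC; apply: (cMS [group of Q2] nQ2 _ cM2Q).
  have d1 : [~: E1, E1] \subset N by apply: (tr_der_sub tr1).
  exact: subset_trans (subset_trans (commSg _ sM1) d1) sN2.
have [w Ww [c Cc nwc]] : exists2 w, w \in W1 & exists2 c, c \in C1 & [~ w, c] \notin N.
  move: nWC; rewrite gen_subG => /subsetPn[_ /imset2P[w c Ww Cc ->] nwc].
  by exists w => //; exists c.
have [Sw Sc] := (subsetP sW1S w Ww, subsetP sC1S c Cc).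
set g := [~ w, c] in nwc.
have Qg : g \in Q1 by apply: (subsetP c11); rewrite mem_commg ?(subsetP sW1 w) ?(subsetP sC1 c).
have Sg : g \in S by rewrite groupR.
have tg : coset N (t g) = (coset N g)^-1.
  have Qz : w * t w \in Q1 by apply: (tr_tW tr1).
  have Qz' : c^-1 * t c \in Q1 by apply: (tr_tC tr1).
  have [Fz Fz'] := (subsetP sF1 _ Qz, subsetP sF1 _ Qz').
  have [Sz Sz'] := (subsetP sFS _ Fz, subsetP sFS _ Fz').
  rewrite /g (AutR At) // -[t w](mulKg w) -[t c](mulKVg c).
  move: Fz Fz' Sz Sz'; set z := w * _; set z' := c^-1 * _ => Fz Fz' Sz Sz'.
  transitivity [~ (coset N w)^-1 * coset N z, coset N c * coset N z'].
    rewrite morphR ?nN ?groupM ?groupV ?tSS // morphM ?groupV ?nN // morphV ?nN //=.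
    by rewrite [coset N (c * z')]morphM ?nN.
  rewrite comm_invl ?[coset N [~ w, c]]morphR ?nN //=; try by apply: cosF.
  rewrite -morphR ?nN //; apply/commute_sym/cosF => //.
  exact: (subsetP sF1).
have [K eK] := powker odd_p (pcE E1 sE1 sF1).
have sKE : K \subset E1 by apply/subsetP=> x; rewrite eK => /andP[].
have sMK : M \subset K.
  by apply/subsetP=> m Mm; rewrite eK inE (subsetP sM1) //=; apply: mPN.
have eQg : <[g]> <*> N = Q1.
  have prQ : prime #|Q1 : N| by rewrite eN1.
  apply: (idx_full (N := N) (X := [group of Q1]) (K := [group of <[g]> <*> N]) (x := g)) => //=.
  - exact: joing_subr.
  - by rewrite join_subG cycle_subG Qg.
  - by apply: (subsetP (joing_subl _ _)); apply: cycle_id.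
have sCK : C1 \subset K.
  apply/subsetP=> x Cx; rewrite eK inE (subsetP sC1) //=.
  have Sx := subsetP sC1S x Cx.
  have Qx : x ^+ p \in Q1 by apply: Phi_pow; rewrite ?(subsetP sC1).
  apply: (invol_odd odd_p pS); first by rewrite groupX.
  have e1 : coset N (t (x ^+ p)) = coset N (x ^+ p).
    rewrite (AutX At) // -[t x](mulKVg x); apply: powF => //.
    by apply: (subsetP sF1); apply: (tr_tC tr1).
  have := Qx; rewrite -eQg norm_joinEl; last by rewrite cycle_subG nN.
  case/mulsgP=> _ n /cycleP[k ->] Nn ex.
  have e2 : coset N (t (x ^+ p)) = (coset N (x ^+ p))^-1.
    rewrite ex (AutM At) ?groupX ?(subsetP sFS n) ?(subsetP sF1 n) ?(subsetP sN1 n) //.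
    rewrite (AutX At) // !morphM ?groupX ?nN ?tSS ?groupX ?(subsetP (normal_sub nNS) n) //=.
    by rewrite (coset_id Nn) (coset_id (tN n Nn)) !mulg1 !morphX ?nN ?tSS //= tg expVgn.
  apply: coset_idr; first by rewrite !groupX ?nN.
  rewrite [in LHS]morphX ?groupX ?nN //= expgS expg1 -{1}e1 e2.
  by rewrite mulVg.
have eKE : K :=: E1.
  have /subsetPn[x Cx nMx] : ~~ (C1 \subset M).
    apply: contra nMH => sCM; have sHM : axis S E1 \subset M.
      rewrite -(tr_ZC pr_p pS tr1) mul_subG //=.
      by rewrite ecF -ePF.
    have eHM := idx_cases sHM sM1; case: eHM => [|-> //|eME].
      by rewrite (tr_iH tr1).
    by move: (prime_gt1 pr_p); rewrite -iM1 -[X in #|X : _|]eME indexgg.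
  by apply: (idx_full sMK sKE prE1 _ nMx); apply: (subsetP sCK).
case/negP: nWC; apply: (tr_comm_WC pr_p pS rS tr1) => //.
by move=> x Wx; have := subsetP sW1 x Wx; rewrite -{1}eKE eK => /andP[].
Qed.

Lemma tr_pair E1 C1 W1 t1 a1 E2 C2 W2 t2 a2 :
  transv p S E1 C1 W1 t1 a1 -> transv p S E2 C2 W2 t2 a2 -> E1 :!=: E2 ->
  [/\ E1 :&: E2 = axis S E1, E1 :&: E2 = axis S E2 & 'Phi(E1) = 'Phi(E2)].
Proof.
move=> tr1 tr2 ne12.
have e1 := tr_pair_not_axis tr1 tr2 ne12.
have e2 : E1 :&: E2 = axis S E2.
  by rewrite setIC; apply: (tr_pair_not_axis tr2 tr1); rewrite eq_sym.
split=> //.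
have k1 := tr_Phi_axis pr_p odd_p pS tr1; have k2 := tr_Phi_axis pr_p odd_p pS tr2.
by rewrite k1 k2 -e1 -e2.
Qed.

End Pair.

(** * Irreducible action on a Frattini quotient of order p ^ 3 *)

Lemma index_ker (gT rT : finGroupType) (X K : {group gT}) (f : gT -> rT) :
  {in X &, {morph f : x y / x * y}} -> K =i [pred x | (x \in X) && (f x == 1)] ->
  #|X : K| = #|f @: X|.
Proof.
move=> fM eK; pose fm := Morphism fM.
have -> : f @: X = fm @* X by rewrite morphimEdom.
rewrite card_morphim setIid; congr #|_ : _|; apply/setP=> x.
by rewrite eK !inE.
Qed.

Section Irreducible.
Variables (gT : finGroupType) (p : nat) (E : {group gT}) (A : {set {perm gT}}).
Hypotheses (pr_p : prime p) (odd_p : odd p) (pE : p.-group E) (rE : rk3 p E).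
Hypothesis (sA : A \subset Aut E).
Implicit Types (X Y N V M K Q : {group gT}).

Definition irr_on X := #|X : 'Phi(X)| = (p ^ 3)%N /\
  forall Y, 'Phi(X) \subset Y -> Y \subset X -> invar A Y -> Y :=: 'Phi(X) \/ Y :=: X.

Lemma index_cmod1 X V N a : X \subset 'N(N) -> a \in X -> N \subset V -> V \subset 'N(N) ->
  {in X, forall x, [~ x, a] \in V} -> [~: V, X] \subset N ->
  #|X : cmod1 X a N| <= #|V : N|.
Proof.
move=> nX Xa sNV nV cV cVX; have nN := subsetP nX.
pose f x := coset N [~ x, a].
have fM : {in X &, {morph f : x y / x * y}}.
  move=> x y Xx Xy; rewrite /f commMgJ morphM ?nN ?groupJ ?groupR //; congr (_ * _).
  rewrite conjg_mulR; apply: coset_kerr.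
  by apply: (subsetP cVX); rewrite mem_commg ?cV.
rewrite (index_ker fM (K := [group of cmod1 X a N])); last first.
  move=> x; rewrite [RHS]inE /=.
  apply/idP/andP => [/(cmod1P _ nX (nN a Xa))[Xx h] | [Xx /eqP h]].
    by split=> //; apply/eqP/coset_id.
  apply/(cmod1P _ nX (nN a Xa)); split=> //.
  by apply: coset_idr h; rewrite groupR ?nN.
rewrite -card_quotient //; apply: subset_leq_card.
by apply/subsetP=> _ /imsetP[x Xx ->]; apply: mem_quotient; apply: cV.
Qed.

(** The power map embeds X / K into V / N. The second clause is surjectivity, obtained by
    counting. *)
Lemma index_pow X K N V : pow_cond p X N -> N \subset V -> V \subset 'N(N) ->
    K =i [pred x | (x \in X) && (x ^+ p \in N)] -> {in X, forall x, x ^+ p \in V} ->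
  #|X : K| <= #|V : N| /\
  (#|V : N| <= #|X : K| -> {in V, forall v, exists2 x, x \in X & coset N v = coset N (x ^+ p)}).
Proof.
move=> pc sNV nV eK pV; have [nX _ _] := pc; have nN := subsetP nX.
pose f x := coset N (x ^+ p).
have fM : {in X &, {morph f : x y / x * y}}.
  by move=> x y Xx Xy; rewrite /f (pow_mod odd_p pc).
have sf : f @: X \subset V / N.
  by apply/subsetP=> _ /imsetP[x Xx ->]; apply: mem_quotient; apply: pV.
rewrite (index_ker fM (K := K)); last first.
  move=> x; rewrite eK !inE; case Xx: (x \in X) => //=.
  apply/idP/eqP => [h | h]; first exact: coset_id.
  by apply: coset_idr h; rewrite groupX ?nN.
rewrite -card_quotient //; split; first exact: subset_leq_card.
move=> le v Vv; have : f @: X == V / N by rewrite eqEcard sf.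
move/eqP=> e; have : coset N v \in V / N by apply: mem_quotient.
by rewrite -e => /imsetP[x Xx ->]; exists x.
Qed.

Lemma p_index_le X N : X \subset E -> N \subset X -> #|X : N| <= p -> N :!=: X -> #|X : N| = p.
Proof.
move=> sXE sNX le ne; have dv : #|X : N| %| p ^ logn p #|X|.
  by rewrite -(card_pgroup (pgroupS sXE pE)) dvdn_indexg.
have [k _ ek] := dvdn_pfactor _ _ pr_p dv; case: k ek => [|k] ek.
  by case/eqP: ne; apply/eqP; rewrite eqEsubset sNX -indexg_eq1 ek.
apply/eqP; rewrite eqn_leq le ek -{1}[p]expn1 leq_exp2l ?(prime_gt1 pr_p) //.
Qed.

Lemma cycle_join_p X Q x : X \subset E -> Q \subset X -> X \subset 'N(Q) -> x \in X -> x \notin Q ->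
  x ^+ p \in Q -> #|<[x]> <*> Q : Q| = p.
Proof.
move=> sXE sQX nQ Xx nx xp; apply: p_index_le (subset_trans _ sXE) _ _ _.
- by rewrite join_subG cycle_subG Xx.
- exact: joing_subr.
- by apply: (index_cycle_join pr_p) => //; apply: (subsetP nQ).
- apply: contraNneq nx => e; rewrite [in _ \in _]e; apply: (subsetP (joing_subl _ _)).
  exact: cycle_id.
Qed.

(** Otherwise X / R has exponent p and centre Phi(X) / R. The commutator form modulo a hyperplane Y
    / R of Phi(X) / R is alternating in dimension 3, so it has a radical vector x. The centraliser D
    of x modulo R is abelian modulo R and has index p. Two distinct such subgroups would intersect
    in a subgroup central modulo R, hence inside Phi(X), which is too small; so D is A-stable,
    against irreducibility. *)
Lemma irr_exp X : X \subset E -> invar A X -> irr_on X -> 'Phi(X) :!=: 1 ->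
  let R := [group of [~: 'Phi(X), X] <*> 'Phi('Phi(X))] in
  exists2 x, x \in X & x ^+ p \notin R.
Proof.
move=> sXE iX [iXQ irr] ntQ R; apply/exists_inP/contraT.
rewrite negb_exists_in => /forall_inP pR'.
have {}pR' : {in X, forall x, x ^+ p \in R} by move=> x /pR'; rewrite negbK.
have pX := pgroupS sXE pE; have nQX := normal_norm (Phi_normal X).
set Q := 'Phi(X) in R pR' iXQ irr ntQ nQX *.
have sQX : Q \subset X := Phi_sub X; have pQ : p.-group Q := pgroupS sQX pX.
have sQE := subset_trans sQX sXE.
have autA a : a \in A -> a \in Aut E by apply: (subsetP sA).
have nRX : R <| X.
  rewrite normalY // ?(char_normal_trans (Phi_char _)) ?Phi_normal //.
  by rewrite /normal commg_normr andbT (subset_trans _ sQX) // commg_subl.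
have nX := normal_norm nRX.
have sRQ : R \subset Q by rewrite join_subG commg_subl nQX Phi_sub.
have cQX : [~: Q, X] \subset R by apply: joing_subl.
have ltR : R \proper Q.
  rewrite properE sRQ; apply/negP=> sQR.
  have eQ : Q = [~: Q, X].
    have := @Phi_nongen _ [group of Q] [~: Q, X]; rewrite /= genGid => -> //.
    apply/eqP; rewrite joingC eqEsubset sRQ; exact: sQR.
  have := nil_comm_properl (pgroup_nil pX) sQX ntQ.
  move/(_ X); rewrite subsetI subxx nQX => /(_ isT).
  by rewrite -eQ properxx.
have cXX : [~: X, X] \subset Q := Phi_der pX.
have iR : invar A R.
  move=> a Aa; have Ea := autA a Aa.
  have aQ : stab a Q := stab_Phi Ea sXE (iX a Aa).
  apply: (stab_join Ea).
  - by rewrite (subset_trans _ sQE) // commg_subl.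
  - exact: subset_trans (Phi_sub _) sQE.
  - exact: stab_comm Ea sQE sXE aQ (iX a Aa).
  - exact: (stab_Phi Ea sQE aQ).
have QppR : {in Q, forall q, q ^+ p \in R}.
  by move=> q Qq; apply: (subsetP (joing_subr _ _)); apply: Phi_pow.
(* The centre of X / R is A-stable, and if it were everything then Phi(X) would lie in R. *)
have eZ : cmod X X R = Q.
  have sQZ : Q \subset cmod X X R by rewrite (sub_cmod sQX nX nX).
  case: (irr [group of cmod X X R] sQZ (cmod_sub _ _ _)) => //=.
    move=> a Aa; apply: (stab_cmod (autA a Aa)) => //.
    - exact: subset_trans sRQ sQE.
    - exact: iX.
    - exact: iX.
    - exact: iR.
  move=> eZ; have := cmod_comm nX nX; rewrite eZ => cR.
  by move: ltR; rewrite properE (Phi_sub_crit pr_p pX nX cR pR') andbF.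
have XpQ x : x \in X -> x ^+ p \in Q by apply: Phi_pow.
have neXQ : Q :!=: X.
  by apply: contraTneq (prime_gt1 pr_p) => e; rewrite -(ltn_exp2r _ _ (isT : 0 < 3)) -iXQ e indexgg.
have cjQ x : x \in X -> x \notin Q -> #|<[x]> <*> Q : Q| = p.
  by move=> Xx nx; apply: (cycle_join_p sXE sQX nQX) => //; apply: XpQ.
have cjX x : x \in X -> <[x]> <*> Q \subset X by move=> Xx; rewrite join_subG cycle_subG Xx.
have nbig x M : x \in X -> x \notin Q -> Q \subset M -> p ^ 2 <= #|M : Q| ->
    exists2 b, b \in M & b \notin <[x]> <*> Q.
  move=> Xx nx sQM le; apply/subsetPn; apply: contraL le => sM; rewrite -ltnNge.
  have := indexSg (H := [group of Q]) sQM sM; rewrite /= cjQ // => /dvdn_leq le.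
  apply: leq_ltn_trans (le (prime_gt0 pr_p)) _.
  by rewrite -{1}[p]expn1 ltn_exp2l ?(prime_gt1 pr_p).
have nsub (N : {group gT}) : R \subset N -> N \subset Q -> X \subset 'N(N).
  move=> sRN sNQ; rewrite -commg_subl; apply: subset_trans (commSg _ sNQ) _.
  exact: subset_trans cQX sRN.
have ltQ : Q \proper X by rewrite properEneq neXQ.
have [M [sQM ltM nMX iXM]] := pquot_gt pr_p pX (N := [group of Q]) (Phi_normal X) (normal_refl X) ltQ.
have sMX := normal_sub nMX.
have iMQ : #|M : Q| = (p ^ 2)%N.
  apply/eqP; rewrite -(eqn_pmul2l (prime_gt0 pr_p)) -{1}iXM.
  by rewrite (Lagrange_index sMX sQM) iXQ.
(* |Q : R| <= p ^ 2, because the maximal subgroup M has rank at most 3 *)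
have iQR : #|Q : R| <= p ^ 2.
  have /subsetPn[a Ma nQa] : ~~ (M \subset Q).
    by rewrite -indexg_eq1 iMQ -(expn0 p) eqn_exp2l ?(prime_gt1 pr_p).
  have Xa := subsetP sMX a Ma.
  have [b Mb nb] := nbig a M Xa nQa sQM (eq_leq (esym iMQ)).
  have Xb := subsetP sMX b Mb.
  have gQ : [~ a, b] \in Q by apply: (subsetP cXX); rewrite mem_commg.
  pose U := [group of <[[~ a, b]]> <*> R].
  have sRU : R \subset U by apply: joing_subr.
  have sUQ : U \subset Q by rewrite join_subG cycle_subG gQ.
  have nU := nsub U sRU sUQ; have nUM := subset_trans sMX nU.
  have H : #|M : <[a]> <*> Q| = p.
    have saM : <[a]> <*> Q \subset M by rewrite join_subG cycle_subG Ma.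
    have e := Lagrange_index saM (joing_subr _ _); rewrite /= cjQ // iMQ -mulnn in e.
    by apply/eqP; rewrite -(eqn_pmul2r (prime_gt0 pr_p)) e.
  have saM : <[a]> <*> Q \subset M by rewrite join_subG cycle_subG Ma.
  have cMU : [~: M, M] \subset U.
    apply: (der_ext (H := [group of <[a]> <*> Q])) => //=; first by rewrite H.
    rewrite -(sub_cmod saM nUM nUM) join_subG cycle_subG; apply/andP; split; last first.
      rewrite (sub_cmod sQM nUM nUM); apply: subset_trans (commgS _ sMX) _.
      exact: subset_trans cQX sRU.
    have Na := subsetP nUM a Ma.
    have eM : cmod1 M a U = M.
      apply: (idx_full (N := [group of <[a]> <*> Q]) (x := b)) => //=.
      - rewrite join_subG cycle_subG; apply/andP; split.
          by apply/(cmod1P _ nUM Na); rewrite commgg group1.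
        apply/subsetP=> x Qx; apply/(cmod1P _ nUM Na); split; first exact: (subsetP sQM).
        by apply: (subsetP sRU); apply: (subsetP cQX); rewrite mem_commg.
      - exact: cmod1_sub.
      - by rewrite H.
      - apply/(cmod1P _ nUM Na); split=> //; rewrite -invg_comm groupV.
        by apply: (subsetP (joing_subl _ _)); apply: cycle_id.
    apply/(cmodP _ nUM nUM); split=> // m; rewrite -{1}eM => /(cmod1P _ nUM Na)[_ h].
    by rewrite -invg_comm groupV.
  have sPU : 'Phi(M) \subset U.
    apply: (Phi_sub_crit pr_p (pgroupS sMX pX)) => // m Mm.
    by apply: (subsetP sRU); apply: pR'; apply: (subsetP sMX).
  have le1 : #|Q : U| <= p.
    have le3 : #|M : U| <= p ^ 3.
      apply: leq_trans (rE (subset_trans sMX sXE)); rewrite dvdn_leq ?indexg_gt0 //.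
      exact: indexgS.
    by move: le3; rewrite -(Lagrange_index sQM sUQ) iMQ (expnSr p 2) leq_pmul2l ?expn_gt0 ?prime_gt0.
  have le2 : #|U : R| <= p.
    by apply: (index_cycle_join pr_p); [apply: (subsetP nX); apply: (subsetP sQX) | apply: QppR].
  by rewrite -(Lagrange_index sUQ sRU) -mulnn leq_mul.
have nRQX : R <| X := nRX.
have [Y [sRY ltY nYX iQY]] := pquot_gt pr_p pX nRX (Phi_normal X) ltR.
have sYQ := proper_sub ltY; have nY := normal_norm nYX.
have iYR : #|Y : R| <= p.
  by move: iQR; rewrite -(Lagrange_index sYQ sRY) iQY -mulnn leq_pmul2l ?prime_gt0.
have cQY : [~: Q, X] \subset Y := subset_trans cQX sRY.
have idxY a : a \in X -> #|X : cmod1 X a Y| <= p.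
  move=> Xa; rewrite -iQY; apply: index_cmod1 => //.
    exact: subset_trans sQX nY.
  by move=> x Xx; apply: (subsetP cXX); rewrite mem_commg.
have sQC a N : a \in X -> X \subset 'N(N) -> [~: Q, X] \subset N -> Q \subset cmod1 X a N.
  move=> Xa nN cN; apply/subsetP=> q Qq; apply/(cmod1P _ nN (subsetP nN a Xa)).
  by split; [apply: (subsetP sQX) | apply: (subsetP cN); rewrite mem_commg].
have big2 M1 : Q \subset M1 -> M1 \subset X -> #|X : M1| <= p -> p ^ 2 <= #|M1 : Q|.
  move=> sQM1 sM1X le; rewrite -(leq_pmul2l (prime_gt0 pr_p)) -expnS -iXQ.
  by rewrite -(Lagrange_index sM1X sQM1) leq_mul2r le orbT.
(* an alternating form in odd dimension has a radical *)
have [x Xx [nQx cxY]] : exists2 x, x \in X & x \notin Q /\ {in X, forall z, [~ z, x] \in Y}.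
  have /subsetPn[a Xa nQa] : ~~ (X \subset Q) by case/properP: ltQ => _ [u Xu nu]; apply/subsetPn; exists u.
  have Na := subsetP nY a Xa.
  have sCa := cmod1_sub X a Y.
  have [b] := nbig a [group of cmod1 X a Y] Xa nQa (sQC a Y Xa nY cQY)
    (big2 [group of cmod1 X a Y] (sQC a Y Xa nY cQY) sCa (idxY a Xa)).
  move/(cmod1P _ nY Na) => [Xb cba] nb; have Nb := subsetP nY b Xb.
  pose M1 := [group of <[b]> <*> (<[a]> <*> Q)].
  have sQa : Q \subset <[a]> <*> Q := joing_subr _ _.
  have sQM1 : Q \subset M1 by apply: subset_trans sQa (joing_subr _ _).
  have sM1X : M1 \subset X by rewrite join_subG cycle_subG Xb cjX.
  have iM1 : p ^ 2 <= #|M1 : Q|.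
    have sa1 : <[a]> <*> Q \subset M1 by apply: joing_subr.
    rewrite -(Lagrange_index sa1 sQa) cjQ // -mulnn leq_mul2r; apply/orP; right.
    have ne : <[a]> <*> Q != M1.
      by apply: contraNneq nb => ->; apply: (subsetP (joing_subl _ _)); apply: cycle_id.
    have dv : #|M1 : <[a]> <*> Q| %| p ^ logn p #|M1|.
      by rewrite -(card_pgroup (pgroupS sM1X pX)) dvdn_indexg.
    have [k _ ek] := dvdn_pfactor _ _ pr_p dv; case: k ek => [|k] ek.
      by case/eqP: ne; apply/eqP; rewrite eqEsubset sa1 -indexg_eq1 ek.
    by rewrite ek expnS leq_pmulr ?expn_gt0 ?prime_gt0.
  have nM1 := subset_trans sM1X nY.
  have abM1 : [~: M1, M1] \subset Y.
    have inZ g : g \in M1 -> [~ g, a] \in Y /\ [~ g, b] \in Y -> g \in cmod M1 M1 Y.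
      move=> Mg [ga gb]; have Ng := subsetP nM1 g Mg.
      have sM : M1 \subset cmod1 X g Y.
        have C1 h : h \in X -> [~ g, h] \in Y -> h \in cmod1 X g Y.
          by move=> Xh gh; apply/(cmod1P _ nY Ng); split=> //; rewrite -invg_comm groupV.
        rewrite !join_subG !cycle_subG !C1 //= sQC //.
        exact: (subsetP sM1X).
      apply/(cmodP _ nM1 nM1); split=> // h /(subsetP sM)/(cmod1P _ nY Ng)[_ c].
      by rewrite -invg_comm groupV.
    rewrite -(sub_cmod (subxx M1) nM1 nM1) {1}/M1 /= !join_subG !cycle_subG.
    apply/and3P; split.
    - apply: inZ; first by apply: (subsetP (joing_subl _ _)); apply: cycle_id.
      by rewrite commgg group1.
    - apply: inZ.
        by apply: (subsetP (joing_subr _ _)); apply: (subsetP (joing_subl _ _)); apply: cycle_id.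
      by rewrite commgg group1 -invg_comm groupV.
    - apply/subsetP=> q Qq; apply: inZ; first exact: (subsetP sQM1).
      by split; apply: (subsetP cQY); rewrite mem_commg.
  case: (boolP (X \subset M1)) => [sXM1 | /subsetPn[c Xc nc]].
    exists a => //; split=> // z Xz; apply: (subsetP abM1); rewrite mem_commg ?(subsetP sXM1) //.
  have Nc := subsetP nY c Xc.
  have iXM1 : #|X : M1| = p.
    apply: (p_index_le sXE sM1X); last first.
      by apply: contraNneq nc => ->.
    rewrite -(leq_pmul2r (_ : 0 < p ^ 2)) ?expn_gt0 ?prime_gt0 // -expnS -iXQ.
    by rewrite -(Lagrange_index sM1X sQM1) leq_mul2l iM1 orbT.
  have [x Mx [Cx nQx]] : exists2 x, x \in M1 & x \in cmod1 X c Y /\ x \notin Q.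
    have sQI : Q \subset M1 :&: cmod1 X c Y by rewrite subsetI sQM1 sQC.
    have : ~~ (M1 :&: cmod1 X c Y \subset Q).
      apply/negP=> sIQ; have eI : M1 :&: cmod1 X c Y = Q by apply/eqP; rewrite eqEsubset sIQ.
      have : #|M1 : Q| <= p.
        rewrite -eI indexgI; apply: leq_trans (idxY c Xc).
        exact: subset_leq_card (imsetS _ sM1X).
      by move/(leq_trans iM1); rewrite (leq_p2 pr_p).
    by case/subsetPn=> x /setIP[Mx Cx] nx; exists x.
  have Xx := subsetP sM1X x Mx; have Nx := subsetP nY x Xx.
  exists x => //; split=> //.
  suff eX : cmod1 X x Y = X by move=> z; rewrite -{1}eX => /(cmod1P _ nY Nx)[].
  apply: (idx_full (N := M1) (x := c)) => //; last 1 first.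
  - apply/(cmod1P _ nY Nx); split=> //; rewrite -invg_comm groupV.
    by have /(cmod1P _ nY Nc)[] := Cx.
  - apply/subsetP=> g Mg; apply/(cmod1P _ nY Nx); split; first exact: (subsetP sM1X).
    by apply: (subsetP abM1); rewrite mem_commg.
  - exact: cmod1_sub.
  - by rewrite iXM1.
have Nx := subsetP nX x Xx.
(* [X, x] lies in Y and Y / R has order at most p, so centralising x modulo R costs at most one
   factor p. *)
pose D := [group of cmod1 X x R].
have sDX : D \subset X := cmod1_sub _ _ _.
have sQD : Q \subset D by apply: sQC.
have iXD : #|X : D| = p.
  apply: (p_index_le sXE sDX).
    apply: leq_trans iYR; apply: index_cmod1 => //; first exact: subset_trans sYQ (subset_trans sQX nX).
    exact: subset_trans (commSg _ sYQ) cQX.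
  apply: contraNneq nQx => eD; rewrite -eZ; apply/(cmodP _ nX nX); split=> // z.
  rewrite -{1}eD => /(cmod1P _ nX Nx)[_ c].
  by rewrite -invg_comm groupV.
have iDQ : #|D : Q| = (p ^ 2)%N.
  apply/eqP; rewrite -(eqn_pmul2l (prime_gt0 pr_p)) -{1}iXD.
  by rewrite (Lagrange_index sDX sQD) iXQ.
have nD := subset_trans sDX nX.
have Dx : x \in D by apply/(cmod1P _ nX Nx); rewrite commgg group1.
have cDR : [~: D, D] \subset R.
  have sxD : <[x]> <*> Q \subset D by rewrite join_subG cycle_subG Dx.
  apply: (der_ext (H := [group of <[x]> <*> Q])) => //=.
    have e := Lagrange_index sxD (joing_subr _ _); rewrite /= cjQ // iDQ -mulnn in e.
    rewrite (_ : #|_ : _| = p) //; apply/eqP.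
    by rewrite -(eqn_pmul2r (prime_gt0 pr_p)) e.
  rewrite -(sub_cmod sxD nD nD) join_subG cycle_subG (sub_cmod sQD nD nD).
  rewrite (subset_trans (commgS _ sDX)) // andbT.
  apply/(cmodP _ nD nD); split=> // z /(cmod1P _ nX Nx)[_ c].
  by rewrite -invg_comm groupV.
have iD : invar A D.
  move=> a Aa; have Ea := autA a Aa; have sDE := subset_trans sDX sXE.
  apply/stab_imset/eqP/idPn=> neD; pose D' := Group (Aut_img_group Ea sDE).
  have eX := (stab_imset _ _).1 (iX a Aa).
  have sD'X : D' \subset X by rewrite -eX; apply: imsetS.
  have iXD' : #|X : D'| = p.
    apply/eqP; rewrite -(eqn_pmul2l (cardG_gt0 D')) Lagrange //=.
    by rewrite card_imset ?(Lagrange sDX) -?iXD ?Lagrange //; apply: perm_inj.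
  have neD' : D :!=: D' by rewrite eq_sym.
  have [_ _ eDD iI] := max_meet pr_p pX sDX sD'X iXD iXD' neD'.
  have cD'R : [~: D', D'] \subset R.
    by rewrite -(Aut_comm Ea sDE sDE) -((stab_imset _ _).1 (iR a Aa)); apply: imsetS.
  have sIX : D :&: D' \subset X by rewrite subIset ?sDX.
  have cI : [~: D :&: D', X] \subset R.
    apply: (comm_mulr (esym eDD) nX (subset_trans sIX nX)).
      exact: subset_trans (commSg _ (subsetIl _ _)) cDR.
    exact: subset_trans (commSg _ (subsetIr _ _)) cD'R.
  have sIQ : D :&: D' \subset Q by rewrite -eZ (sub_cmod sIX nX nX).
  have : #|D : Q| <= p.
    by rewrite -iI dvdn_leq ?indexg_gt0 // indexgS.
  by rewrite iDQ (leq_p2 pr_p).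
case: (irr D sQD sDX iD) => eD.
  by move: iDQ; rewrite eD indexgg => /eqP; rewrite -(expn0 p) eqn_exp2l ?(prime_gt1 pr_p).
by move: (prime_gt1 pr_p); rewrite -iXD eD indexgg.
Qed.

(** By [irr_exp] and irreducibility, the kernel of the p-th power map modulo R is Phi(X). So the map
    embeds X / Phi(X) into Phi(X) / R, and the rank bound on Phi(X) leaves only equality, with R =
    'Phi('Phi(X)). The map commutes with A, whence irreducibility passes from X to Phi(X). *)
Lemma irr_next X : X \subset E -> invar A X -> irr_on X -> 'Phi(X) :!=: 1 ->
  [/\ {in X &, forall x y, exists2 r, r \in 'Phi('Phi(X)) & (x * y) ^+ p = x ^+ p * y ^+ p * r},
      {in X, forall x, (x ^+ p \in 'Phi('Phi(X))) = (x \in 'Phi(X))},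
      irr_on 'Phi(X) & invar A 'Phi(X)].
Proof.
move=> sXE iX irrX ntQ; have [u Xu nRu] := irr_exp sXE iX irrX ntQ.
set R := [group of _] in nRu; have [iXQ irr] := irrX.
have pX := pgroupS sXE pE; have nQX := normal_norm (Phi_normal X).
have sQX : 'Phi(X) \subset X := Phi_sub X; have pQ := pgroupS sQX pX.
have sQE := subset_trans sQX sXE.
have autA a : a \in A -> a \in Aut E by apply: (subsetP sA).
have iQ : invar A 'Phi(X) by move=> a Aa; apply: stab_Phi (autA a Aa) sXE (iX a Aa).
have sRQ : R \subset 'Phi(X) by rewrite join_subG commg_subl nQX Phi_sub.
have cQX : [~: 'Phi(X), X] \subset R by apply: joing_subl.
have nsub N : R \subset N -> N \subset 'Phi(X) -> X \subset 'N(N).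
  move=> sRN sNQ; rewrite -commg_subl; apply: subset_trans (commSg _ sNQ) _.
  exact: subset_trans cQX sRN.
have QppR : {in 'Phi(X), forall q, q ^+ p \in R}.
  by move=> q Qq; apply: (subsetP (joing_subr _ _)); apply: Phi_pow.
have cXX : [~: X, X] \subset 'Phi(X) := Phi_der pX.
have pcN N : R \subset N -> N \subset 'Phi(X) -> pow_cond p X N.
  move=> sRN sNQ; split; first exact: nsub.
    exact: subset_trans (commSg _ cXX) (subset_trans cQX sRN).
  by move=> x y Xx Xy; rewrite (subsetP sRN) // QppR // (subsetP cXX) ?mem_commg.
have kerN N : R \subset N -> N \subset 'Phi(X) -> invar A N ->
    (forall x, x \in X -> (x ^+ p \in N) = (x \in 'Phi(X))) \/
    (forall x, x \in X -> x ^+ p \in N).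
  move=> sRN sNQ iN; have [K eK] := powker odd_p (pcN N sRN sNQ).
  have sQK : 'Phi(X) \subset K.
    apply/subsetP=> q Qq; rewrite eK inE (subsetP sQX) //=.
    by apply: (subsetP sRN); apply: QppR.
  have sKX : K \subset X by apply/subsetP=> x; rewrite eK => /andP[].
  have iK : invar A K.
    move=> a Aa x; rewrite !eK !inE => /andP[Xx Nx]; rewrite iX //=.
    by rewrite -(AutX (autA a Aa)) ?iN // (subsetP sXE).
  case: (irr K sQK sKX iK) => e; [left | right] => x Xx.
    by rewrite -e eK inE Xx.
  by move: (Xx); rewrite -{1}e eK => /andP[].
have iR : invar A R.
  move=> a Aa; have Ea := autA a Aa; apply: (stab_join Ea).
  - by rewrite (subset_trans _ sQE) // commg_subl.
  - exact: subset_trans (Phi_sub _) sQE.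
  - exact: stab_comm Ea sQE sXE (iQ a Aa) (iX a Aa).
  - exact: (stab_Phi Ea sQE (iQ a Aa)).
have kR : forall x, x \in X -> (x ^+ p \in R) = (x \in 'Phi(X)).
  by case: (kerN R (subxx _) sRQ iR) => // /(_ u Xu); rewrite (negPf nRu).
have pcR := pcN R (subxx _) sRQ.
have nRX := nsub R (subxx _) sRQ; have nRQ := subset_trans sQX nRX.
have XpQ : {in X, forall x, x ^+ p \in 'Phi(X)} by move=> x Xx; apply: Phi_pow.
have eK : [group of 'Phi(X)] =i [pred x | (x \in X) && (x ^+ p \in R)].
  move=> x; rewrite inE /=; case Xx: (x \in X); first by rewrite kR.
  by apply: contraFF Xx; apply: (subsetP sQX).
have [le onto] := index_pow pcR sRQ nRQ eK XpQ.
have leR : #|'Phi(X) : R| <= #|'Phi(X) : 'Phi('Phi(X))|.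
  by rewrite dvdn_leq ?indexg_gt0 // indexgS ?joing_subr.
have leQ := rE sQE.
have eQ3 : #|'Phi(X) : 'Phi('Phi(X))| = (p ^ 3)%N.
  by apply/eqP; rewrite eqn_leq leQ (leq_trans _ leR) // -iXQ.
have eR : R :=: 'Phi('Phi(X)).
  apply/eqP; rewrite eq_sym eqEcard joing_subr /=.
  rewrite -(leq_pmul2r (_ : 0 < p ^ 3)) ?expn_gt0 ?prime_gt0 // -{2}eQ3 Lagrange ?Phi_sub //.
  rewrite -(Lagrange sRQ) leq_pmul2l ?cardG_gt0 // -iXQ.
  exact: le.
have {}onto := onto (leq_trans leR (eq_leq (etrans eQ3 (esym iXQ)))).
split=> //.
- move=> x y Xx Xy; exists ((x ^+ p * y ^+ p)^-1 * (x * y) ^+ p); last by rewrite mulKVg.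
  have nR := subsetP nRX; rewrite -eR; apply: coset_idr.
    by rewrite groupM ?groupV ?groupM ?groupX ?nR ?groupM.
  have h := pow_mod odd_p pcR Xx Xy.
  rewrite morphM ?groupV ?groupM ?groupX ?nR ?groupM // morphV ?groupM ?groupX ?nR //=.
  by rewrite h morphM ?groupX ?nR // mulVg.
- by move=> x Xx; rewrite -eR kR.
split=> // Y; rewrite -eR => sRY sYQ iY.
case: (kerN Y sRY sYQ iY) => hY; [left | right]; apply/eqP.
  rewrite eqEsubset sRY andbT; apply/subsetP=> y Yy.
  have Qy := subsetP sYQ y Yy; have [x Xx exy] := onto y Qy.
  have nRy := subsetP nRQ _ Qy; have nRx := subsetP nRQ _ (XpQ x Xx).
  have Rxy : y^-1 * x ^+ p \in R.
    apply: coset_idr; first by rewrite groupM ?groupV.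
    by rewrite morphM ?groupV // morphV //= exy mulVg.
  have Yx : x ^+ p \in Y by rewrite -[x ^+ p](mulKVg y) groupM // (subsetP sRY).
  have : x ^+ p \in R by rewrite kR // -hY.
  by rewrite -[x ^+ p](mulKVg y) groupMr.
rewrite eqEsubset sYQ; apply/subsetP=> y Qy; have [x Xx exy] := onto y Qy.
have nRy := subsetP nRQ _ Qy; have nRx := subsetP nRQ _ (XpQ x Xx).
have Rxy : (x ^+ p)^-1 * y \in R.
  apply: coset_idr; first by rewrite groupM ?groupV.
  by rewrite morphM ?groupV // morphV //= exy mulVg.
by rewrite -[y](mulKVg (x ^+ p)) groupM ?hY // (subsetP sRY).
Qed.

(* All elements outside Phi(X) have the same order, and the last nontrivial power map is a
   homomorphism with kernel Phi(X). *)
Lemma irr_pow_hom X : X \subset E -> invar A X -> irr_on X ->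
  exists k, [/\ {in X &, {morph (fun x => x ^+ (p ^ k)) : x y / x * y}},
    {in X, forall x, (x ^+ (p ^ k) == 1) = (x \in 'Phi(X))} & 'Phi(X) :!=: 1 -> 0 < k].
Proof.
move: {2}_.+1 (ltnSn #|X|) => n; elim: n X => // n IHn X leX sXE iX irrX.
have [Q1 | ntQ] := eqVneq ('Phi(X) : {set gT}) 1.
  exists 0; split; rewrite ?Q1 ?eqxx //.
  by move=> x Xx; rewrite expn0 expg1; apply/eqP/set1gP.
have [pM pK irrQ iQ] := irr_next sXE iX irrX ntQ.
have sQX := Phi_sub X; have sQE := subset_trans sQX sXE; have pX := pgroupS sXE pE.
have ltQ : #|'Phi(X)| < n.
  rewrite -ltnS; apply: leq_trans leX; rewrite ltnS proper_card // Phi_proper //.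
  by apply: contraNneq ntQ => X1; rewrite -subG1 -X1 Phi_sub.
have [k [kM kK _]] := IHn [group of 'Phi(X)] ltQ sQE iQ irrQ.
have XpQ : {in X, forall x, x ^+ p \in 'Phi(X)} by move=> x Xx; apply: Phi_pow.
exists k.+1; split=> // [x y Xx Xy | x Xx]; last first.
  by rewrite expnS expgM kK ?XpQ // pK.
rewrite /= expnS !expgM; have [r Rr ->] := pM x y Xx Xy.
have Qr := subsetP (Phi_sub _) r Rr.
rewrite kM ?groupM ?XpQ // kM ?XpQ //; move: Rr; rewrite -kK // => /eqP->.
by rewrite mulg1.
Qed.

End Irreducible.

(** * Irreducible action and a second maximal subgroup: the Frattini subgroup vanishes *)

Section IrrPair.
Variables (gT : finGroupType) (p : nat) (S E1 E2 : {group gT}) (A1 : {set {perm gT}})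
  (A2 : {group {perm gT}}).
Hypotheses (pr_p : prime p) (odd_p : odd p) (pS : p.-group S) (rS : rk3 p S).
Hypotheses (nE1 : E1 <| S) (iE1 : #|S : E1| = p) (nE2 : E2 <| S) (iE2 : #|S : E2| = p).
Hypotheses (ne12 : E1 :!=: E2) (sA1 : A1 \subset Aut E1) (sA2 : A2 \subset Aut E2).
Hypotheses (irr1 : irr_on p A1 E1) (iH1 : #|axis S E1 : 'Phi(E1)| = p).
Hypothesis (ninv : ~ invar A2 (E1 :&: E2)).

(** If Phi(E1) is not 1, the last power map f of E1 has kernel Phi(E1) and image B, elementary
    abelian of order p ^ 3 and central in E1. The rank bound makes B maximal among elementary
    abelian subgroups of E1, so the subgroup J generated by the A2-images of f(M) stays in B and M
    centralises it. The centraliser of J in E2 is A2-stable and M is not, so E2 centralises J as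
    well. Hence f(M) is central in S, [M, S] lies in Phi(E1), and M lies in the axis, whose index
    over Phi(E1) is too small. *)
Lemma irr_pair_Phi1 : 'Phi(E1) = 1.
Proof.
apply/eqP/idPn => ntQ; pose M := [group of E1 :&: E2].
have [sE1 sE2] := (normal_sub nE1, normal_sub nE2).
have pE1 := pgroupS sE1 pS; have pE2 := pgroupS sE2 pS.
have rE1 : rk3 p E1 by move=> H sH; apply: rS; apply: subset_trans sE1.
have [_ _ eE12 iM1] := max_meet pr_p pS sE1 sE2 iE1 iE2 ne12.
have iM2 : #|E2 : M| = p.
  have ne21 : E2 :!=: E1 by rewrite eq_sym.
  by rewrite /= setIC; case: (max_meet pr_p pS sE2 sE1 iE2 iE1 ne21).
have [sM1 sM2] : M \subset E1 /\ M \subset E2 by rewrite subsetIl subsetIr.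
have iA1 : invar A1 E1 by move=> a /(subsetP sA1); apply: Aut_stab.
have autA a : a \in A2 -> a \in Aut E2 by apply: (subsetP sA2).
have [k [kM kK k0]] := irr_pow_hom pr_p odd_p pE1 rE1 sA1 (subxx E1) iA1 irr1.
(* The exponent p ^ k has a factor p because Phi(E1) is nontrivial. This makes f map E2 into
   Phi(E2), which is A2-stable and lies in M. *)
have {k0} := k0 ntQ; case: k kM kK => // k kM kK _.
pose f (x : gT) := x ^+ (p ^ k.+1); pose fm := Morphism kM.
have c11 := Phi_der pE1.
pose B := [group of fm @* E1].
have sfB x : x \in E1 -> f x \in B by move=> Ex; apply: mem_morphim.
have BP z : z \in B -> exists2 x, x \in E1 & z = f x.
  by case/morphimP=> x _ Ex ->; exists x.
have fQ x : x \in 'Phi(E1) -> f x = 1.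
  by move=> Qx; apply/eqP; rewrite kK // (subsetP (Phi_sub E1)).
have cB z g : z \in B -> g \in E1 -> commute z g.
  case/BP=> x Ex -> Eg; apply/commgP/conjg_fixP; rewrite /f conjXg.
  have -> : x ^ g = x * [~ x, g] by rewrite commgEl mulKVg.
  rewrite [LHS]kM ?groupR //= [X in _ * X]fQ ?mulg1 //.
  by apply: (subsetP c11); rewrite mem_commg.
have expB z : z \in B -> z ^+ p = 1.
  by case/BP=> x Ex ->; rewrite /f -expgM mulnC expgM; apply: fQ; apply: Phi_pow.
have cardB : #|B| = (p ^ 3)%N.
  have [<- _] := irr1; rewrite (index_ker kM (K := [group of 'Phi(E1)])) /B /= ?morphimEdom //.
  move=> x; rewrite [RHS]inE /=; case Ex: (x \in E1); first by rewrite kK.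
  by apply: contraFF Ex; apply: (subsetP (Phi_sub E1)).
pose G := [set z | [exists a in A2, [exists m in M, z == a (f m)]]].
have GP z : z \in G -> exists a m, [/\ a \in A2, m \in M & z = a (f m)].
  by rewrite inE => /exists_inP[a Aa /exists_inP[m Mm /eqP->]]; exists a, m.
pose J := [group of <<G>>].
have fE2 x : x \in E2 -> f x \in 'Phi(E2).
  by move=> Ex; rewrite /f expnS expgM groupX // Phi_pow.
have sPM : 'Phi(E2) \subset M.
  rewrite subsetI Phi_sub andbT; apply: subset_trans (PhiS pS sE2) _.
  exact: Phi_le_max nE1 iE1.
have stP a : a \in A2 -> stab a 'Phi(E2).
  by move=> /autA Ea; apply: stab_Phi Ea (subxx _) (Aut_stab Ea).
have sJP : J \subset 'Phi(E2).
  rewrite gen_subG; apply/subsetP=> _ /GP[a [m [Aa Mm ->]]].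
  by apply: stP => //; apply: fE2; apply: (subsetP sM2).
have sJM := subset_trans sJP sPM; have sJE1 := subset_trans sJM sM1.
have cG z h : z \in G -> h \in 'Phi(E2) -> commute z h.
  move=> /GP[a [m [Aa Mm ->]]] Ph; have Ea := autA a Aa.
  have := (stab_imset a 'Phi(E2)).1 (stP a Aa) => eP.
  move: Ph; rewrite -eP => /imsetP[h' Ph' ->].
  have Eh' := subsetP (Phi_sub E2) h' Ph'.
  have Efm : f m \in E2 by rewrite groupX // (subsetP sM2).
  rewrite /commute -!(AutM Ea) //; congr (a _); apply: cB.
    by apply: sfB; apply: (subsetP sM1).
  exact: subsetP sM1 _ (subsetP sPM _ Ph').
have abJ : abelian J.
  rewrite abelian_gen; apply/centsP=> z Gz h Gh; apply: cG => //.
  by apply: (subsetP sJP); apply: mem_gen.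
have cJB : J \subset 'C(B).
  by apply/centsP=> z Jz b Bb; apply/commute_sym/cB => //; apply: (subsetP sJE1).
have abB : abelian B.
  apply/centsP=> z Bz b /BP[x Ex ->]; apply: cB => //.
  by rewrite groupX.
pose JB := [group of J <*> B].
have abJB : abelian JB by rewrite /JB /= (cent_joinEr _) ?abelianM ?abJ ?abB // centsC.
have sBE1 : B \subset E1 by apply/subsetP=> _ /BP[x Ex ->]; rewrite groupX.
have sJBE : JB \subset E1 by rewrite join_subG sJE1.
have expJB x : x \in JB -> x ^+ p = 1.
  have pc : pow_cond p JB [group of 1].
    have c1 : [~: JB, JB] = 1 by apply/commG1P.
    split; rewrite ?c1 ?comm1G ?sub1G ?norms1 //.
    by move=> u v Ju Jv; rewrite (_ : [~ u, v] = 1) ?expg1n ?group1 //; apply/eqP/commgP; apply: (centsP abJB).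
  have [K eK] := powker odd_p pc.
  suff /subsetP h : JB \subset K by move/h; rewrite eK !inE => /andP[_ /eqP].
  rewrite join_subG gen_subG; apply/andP; split; apply/subsetP=> z Gz; rewrite eK !inE.
    rewrite (subsetP (joing_subl _ _)) ?mem_gen //=.
    have [a [m [Aa Mm ->]]] := GP z Gz; have Ea := autA a Aa.
    rewrite -(AutX Ea) ?groupX ?(subsetP sM2) // expB ?sfB ?(subsetP sM1) //.
    by rewrite (Aut_one Ea).
  by rewrite (subsetP (joing_subr _ _)) //= expB.
(* JB is elementary abelian and contained in E1, so its order is at most p ^ 3, the order of B. *)
have eJB : JB = B :> {set gT}.
  apply/eqP; rewrite eq_sym eqEcard joing_subr cardB.
  have abel : p.-abelem JB by apply/(abelemP pr_p).
  have := rE1 _ sJBE; have := trivg_Phi (pgroupS sJBE pE1); rewrite abel => /eqP->.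
  by rewrite indexg1.
have sJB : J \subset B by rewrite -eJB joing_subl.
have cMJ : M \subset 'C(J).
  by apply/centsP=> m Mm z Jz; apply/commute_sym/cB; [apply: (subsetP sJB) | apply: (subsetP sM1)].
have stJ a : a \in A2 -> stab a J.
  move=> Aa; have Ea := autA a Aa; apply/stab_imset.
  have sGE : G \subset E2.
    apply/subsetP=> z Gz; apply: (subsetP (Phi_sub _)); apply: (subsetP sJP).
    exact: mem_gen.
  rewrite (Aut_imset Ea (subset_trans sJP (Phi_sub _))) morphim_gen //.
  have sG : autm_morphism Ea @* G \subset G.
    apply/subsetP=> _ /morphimP[z _ Gz ->]; have [b [m [Ab Mm ->]]] := GP z Gz.
    rewrite inE; apply/exists_inP; exists (b * a); first exact: groupM.
    by apply/exists_inP; exists m => //; rewrite permM.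
  congr <<_>>; apply/eqP; rewrite eqEcard sG /= card_injm ?injm_autm //.
have inC : invar A2 'C_E2(J).
  move=> a Aa z /setIP[Ez /centP cz]; have Ea := autA a Aa.
  rewrite inE (Aut_stab Ea) //=; apply/centP=> j.
  rewrite -((stab_imset a J).1 (stJ a Aa)) => /imsetP[j' Jj' ->].
  have Ej' : j' \in E2 := subsetP (subset_trans sJP (Phi_sub _)) _ Jj'.
  by rewrite /commute -!(AutM Ea) // cz.
have prM : prime #|E2 : M| by rewrite iM2.
have sMC : M \subset 'C_E2(J) by rewrite subsetI sM2.
have cE2 : E2 \subset 'C(J).
  case: (idx_cases (K := [group of 'C_E2(J)]) sMC (subsetIl _ _) prM) => /= eC.
    by case: ninv; rewrite -eC.
  by rewrite -eC subsetIr.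
have cSJ : S \subset 'C(J).
  rewrite -eE12 mul_subG //; apply/centsP=> x Ex z Jz.
  by apply/commute_sym/cB => //; apply: (subsetP sJB).
have sMH : M \subset axis S E1.
  have nQS : S \subset 'N('Phi(E1)) by rewrite normal_norm // (char_normal_trans (Phi_char E1)).
  have nQE := subset_trans sE1 nQS.
  apply/subsetP=> m Mm; have Em := subsetP sM1 m Mm.
  apply/(cmodP _ nQE nQS); split=> // s Ss.
  have Er : [~ m, s] \in E1.
    by rewrite commgEl groupM ?groupV // memJ_norm // (subsetP (normal_norm nE1)).
  rewrite -kK //; apply/eqP; apply: (mulgI (f m)).
  have -> : f m * [~ m, s] ^+ (p ^ k.+1) = f (m * [~ m, s]) by rewrite /f -kM.
  have -> : m * [~ m, s] = m ^ s by rewrite commgEl mulKVg.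
  rewrite mulg1 /f -conjXg; apply/conjg_fixP/commgP.
  apply/commute_sym; apply: (centsP cSJ) => //; apply: mem_gen.
  rewrite inE; apply/exists_inP; exists 1; first exact: group1.
  by apply/exists_inP; exists m; rewrite ?perm1.
have sQM : 'Phi(E1) \subset M.
  rewrite subsetI Phi_sub; apply: subset_trans (PhiS pS sE1) _.
  exact: Phi_le_max nE2 iE2.
have := Lagrange_index sM1 sQM; have [-> _] := irr1; rewrite iM1.
have := Lagrange_index sMH sQM; rewrite iH1 => e1 /eqP.
rewrite expnS eqn_pmul2l ?prime_gt0 // => /eqP e2.
have : #|M : 'Phi(E1)| <= p by rewrite -e1 leq_pmull // indexg_gt0.
by rewrite e2 (leq_p2 pr_p).
Qed.

End IrrPair.

(** * Coprime automorphisms and stabilisers of chains *)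

Section CoprimeAut.
Variables (gT : finGroupType) (p : nat).
Hypotheses (pr_p : prime p).
Implicit Types (X N : {group gT}) (u : {perm gT}).

(* u permutes the cosets of N, which have order prime to that of u *)
Lemma fixed_in_coset r X N u x : prime r -> r != p -> r.-elt u -> p.-group X -> u \in Aut X ->
  N \subset X -> stab u N -> x \in X -> x^-1 * u x \in N -> exists2 y, y \in x *: N & u y = y.
Proof.
move=> pr_r nrp ru pX Au sNX sN Xx Nx; have sX := subsetP sNX.
have acts : [acts <[u]>, on x *: N | 'P].
  rewrite cycle_subG; apply/astabsP => y; rewrite /= apermE.
  apply/idP/idP => [|/lcosetP[n Nn ->]].
    rewrite !mem_lcoset => h; apply: (stabK sN).
    have Xy : y \in X.
      apply: (stabK (Aut_stab Au)); rewrite -[u y](mulKVg x) groupM //; exact: sX.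
    rewrite (AutM Au) ?groupV // (AutV Au) //.
    have -> : (u x)^-1 * u y = (x^-1 * u x)^-1 * (x^-1 * u y).
      by rewrite invMg invgK -mulgA mulKVg.
    by rewrite groupM // groupV.
  rewrite mem_lcoset (AutM Au) // ?sX // mulgA groupM //.
  exact: sN.
have cardx : #|x *: N| = #|N| by rewrite card_lcoset.
have mod := pgroup_fix_mod ru acts.
have ne : 'Fix_(x *: N | 'P)(<[u]>) != set0.
  apply/eqP=> e0; move: mod; rewrite e0 cards0 cardx mod0n => /eqP.
  rewrite -/(r %| #|N|) (card_pgroup (pgroupS sNX pX)) => d.
  have : r %| p by move: d; rewrite Euclid_dvdX // => /andP[].
  by rewrite dvdn_prime2 // (negPf nrp).
have [y /setIP[xy /afixP fy]] := set0Pn _ ne.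
by exists y => //; exact: fy u (cycle_id u).
Qed.

(** Burnside's argument, parallel to [invol_Phi]: fixed points exist in every coset of the Frattini
    subgroup, so they generate X. *)
Lemma trivial_mod_Phi r X u : prime r -> r != p -> r.-elt u -> p.-group X -> u \in Aut X ->
  {in X, forall x, x^-1 * u x \in 'Phi(X)} -> u = 1.
Proof.
move=> pr_r nrp ru pX Au tu.
have gF : group_set [set x in X | u x == x].
  apply/group_setP; split=> [|x y]; first by rewrite inE group1 (Aut_one Au) eqxx.
  rewrite !inE => /andP[Xx /eqP ex] /andP[Xy /eqP ey].
  by rewrite groupM // (AutM Au) // ex ey eqxx.
suff eX : X \subset Group gF.
  apply/permP=> x; rewrite perm1; case: (boolP (x \in X)) => [/(subsetP eX) | nx].
    by rewrite inE => /andP[_ /eqP].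
  by move: Au; rewrite inE => /andP[/out_perm-> ].
have sF : Group gF \subset X by apply/subsetP=> x; rewrite inE => /andP[].
have : 'Phi(X) <*> Group gF = X.
  apply/eqP; rewrite eqEsubset join_subG Phi_sub sF /=.
  apply/subsetP=> x Xx.
  have [y xy uy] := fixed_in_coset pr_r nrp ru pX Au (Phi_sub X)
    (stab_Phi Au (subxx X) (Aut_stab Au)) Xx (tu x Xx).
  rewrite mem_lcoset in xy.
  have Xy : y \in X by rewrite -[y](mulKVg x) groupM // (subsetP (Phi_sub X)).
  have -> : x = y * (x^-1 * y)^-1 by rewrite invMg invgK mulKVg.
  rewrite groupM ?groupV //; apply: mem_gen; rewrite inE; apply/orP; [right | by left].
  by rewrite inE Xy uy eqxx.
by move/Phi_nongen; rewrite genGid => ->.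
Qed.

(** Powers of u move x by powers of the fixed element n, so the order of n, a power of p, divides
    the order of u. *)
Lemma trivial_mod_fixed X N u : p.-group X -> u \in Aut X -> p^'.-elt u -> N \subset X ->
  {in N, forall n, u n = n} -> {in X, forall x, x^-1 * u x \in N} -> {in X, forall x, u x = x}.
Proof.
move=> pX Au pu sNX uN uX x Xx; set n := x^-1 * u x.
have Nn : n \in N := uX x Xx; have Xn := subsetP sNX n Nn.
have e k : (u ^+ k) x = x * n ^+ k.
  elim: k => [|k IHk]; first by rewrite perm1 mulg1.
  rewrite expgSr permM IHk (AutM Au) ?groupX // (uN (n ^+ k)) ?groupX //.
  by rewrite expgS mulgA (mulKVg x).
have n1 : n = 1.
  apply/eqP; rewrite -order_eq1 -dvdn1.
  have : coprime #[n] #[u] by apply: pnat_coprime (mem_p_elt pX Xn) pu.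
  move=> /eqP <-; rewrite dvdn_gcd dvdnn order_dvdn /=; apply/eqP.
  by apply: (mulgI x); rewrite -e expg_order perm1 mulg1.
by rewrite -[u x](mulKVg x) -/n n1 mulg1.
Qed.

Definition tact (A : {set {perm gT}}) (X Y : {set gT}) :=
  [set g in A | [forall x in X, x^-1 * g x \in Y]].

Lemma tactP (A : {set {perm gT}}) (X Y : {set gT}) (g : {perm gT}) :
  reflect (g \in A /\ {in X, forall x, x^-1 * g x \in Y}) (g \in tact A X Y).
Proof. by rewrite inE; apply: (iffP andP) => -[Ag /forall_inP h]. Qed.

Lemma tact_group_set (E : {group gT}) (A : {group {perm gT}}) (X Y : {group gT}) : A \subset Aut E ->
  X \subset E -> Y \subset X -> invar A Y -> group_set (tact A X Y).
Proof.
move=> sA sXE sYX iY; apply/group_setP; split.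
  by apply/tactP; split=> // x Xx; rewrite perm1 mulVg.
move=> g h /tactP[Ag tg] /tactP[Ah th]; apply/tactP; split; first exact: groupM.
move=> x Xx; have Eh := subsetP sA h Ah; have Ex := subsetP sXE x Xx.
have Yg := tg x Xx; have Eg : x^-1 * g x \in E := subsetP sXE _ (subsetP sYX _ Yg).
rewrite permM -[g x](mulKVg x) (AutM Eh) // mulgA groupM ?th //.
exact: iY.
Qed.

(** Chains of three steps are long enough for sections of order at most p ^ 3; shorter chains are
    obtained by repeating a term. *)
Definition chain_stab (A : {set {perm gT}}) (X0 X1 X2 X3 : {set gT}) :=
  [set g in A | [&& [forall x in X0, x^-1 * g x \in X1], [forall x in X1, x^-1 * g x \in X2]
                  & [forall x in X2, x^-1 * g x \in X3]]].

Lemma chain_stabP (A : {set {perm gT}}) (X0 X1 X2 X3 : {set gT}) (g : {perm gT}) :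
  reflect [/\ g \in A, {in X0, forall x, x^-1 * g x \in X1}, {in X1, forall x, x^-1 * g x \in X2}
             & {in X2, forall x, x^-1 * g x \in X3}] (g \in chain_stab A X0 X1 X2 X3).
Proof.
rewrite inE; apply: (iffP and4P) => -[Ag h0 h1 h2]; split=> //; try exact/forall_inP.
Qed.

Lemma stab_mod (X Y : {group gT}) u : Y \subset X -> {in X, forall x, x^-1 * u x \in Y} -> stab u X.
Proof. by move=> sYX h x Xx; rewrite -[u x](mulKVg x) groupM // (subsetP sYX) ?h. Qed.

Lemma chain_stab_group_set (E : {group gT}) (A : {group {perm gT}}) (X1 X2 X3 : {group gT}) :
  A \subset Aut E -> X1 \subset E -> X2 \subset X1 -> X3 \subset X2 -> invar A X3 ->
  group_set (chain_stab A E X1 X2 X3).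
Proof.
move=> sA s1 s2 s3 i3.
have s2E := subset_trans s2 s1; have s3E := subset_trans s3 s2E.
have step (X Y : {group gT}) (g h : {perm gT}) : X \subset E -> Y \subset X -> h \in A -> stab h Y ->
    {in X, forall x, x^-1 * g x \in Y} -> {in X, forall x, x^-1 * h x \in Y} ->
    {in X, forall x, x^-1 * (g * h) x \in Y}.
  move=> sXE sYX Ah hY tg th x Xx; rewrite permM -[g x](mulKVg x).
  have Eh := subsetP sA h Ah.
  have Yg := tg x Xx; have Eg := subsetP sXE _ (subsetP sYX _ Yg).
  by rewrite (AutM Eh) ?(subsetP sXE x) // mulgA groupM ?th // hY.
apply/group_setP; split.
  by apply/chain_stabP; split=> // x Xx; rewrite perm1 mulVg.
move=> g h /chain_stabP[Ag g0 g1 g2] /chain_stabP[Ah h0 h1 h2]; apply/chain_stabP; split.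
- exact: groupM.
- by apply: step => //; apply: stab_mod h1.
- by apply: step => //; apply: stab_mod h2.
- by apply: step => //; apply: i3.
Qed.

(** An element of prime order r different from p has fixed points in each coset that it stabilises.
    Fixed points found step by step along the chain combine to one in every coset of Phi(E), and
    [trivial_mod_Phi] applies. *)
Lemma chain_stab_pgroup (E : {group gT}) (A D : {group {perm gT}}) (X1 X2 : {group gT}) :
  p.-group E -> A \subset Aut E -> X1 \subset E -> X2 \subset X1 -> 'Phi(E) \subset X2 ->
  D \subset chain_stab A E X1 X2 'Phi(E) -> p.-group D.
Proof.
move=> pE sA s1 s2 s3 sD; apply/pgroupP => r pr_r dr; apply: contraT => nrp0.
have nrp : r != p by move: nrp0; rewrite !inE.
have [u Du ou] := Cauchy pr_r dr.
have /chain_stabP[Au u0 u1 u2] := subsetP sD u Du; have Eu := subsetP sA u Au.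
have ru : r.-elt u by rewrite /p_elt ou pnat_id.
have s2E := subset_trans s2 s1.
have stQ : stab u 'Phi(E) := stab_Phi Eu (subxx E) (Aut_stab Eu).
have fx x (X Y : {group gT}) : X \subset E -> Y \subset X -> stab u Y -> x \in X ->
    {in X, forall x, x^-1 * u x \in Y} -> exists2 y, y \in Y & u (x * y) = x * y.
  move=> sXE sYX uY Xx hX.
  have [z /lcosetP[y Yy ->] uz] := fixed_in_coset pr_r nrp ru pE Eu
    (subset_trans sYX sXE) uY (subsetP sXE x Xx) (hX x Xx).
  by exists y.
suff u1' : u = 1 by move: ou (prime_gt1 pr_r); rewrite u1' order1 => <-.
apply: (trivial_mod_Phi pr_r nrp ru pE Eu) => x Ex.
have [y1 Y1 f1] := fx x E X1 (subxx _) s1 (stab_mod s2 u1) Ex u0.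
have [y2 Y2 f2] := fx y1 X1 X2 s1 s2 (stab_mod s3 u2) Y1 u1.
have [y3 Y3 f3] := fx y2 X2 [group of 'Phi(E)] s2E s3 stQ Y2 u2.
have e1 := subsetP s1 y1 Y1; have e2 := subsetP s2E y2 Y2; have e3 := subsetP (Phi_sub E) y3 Y3.
(* The three factors x * y1, y1 * y2 and y2 * y3 are fixed by u. Their alternating product differs
   from x by [y1^-1, y2] * y3, an element of Phi(E). *)
pose f := x * y1 * (y1 * y2)^-1 * (y2 * y3).
have Qf : x^-1 * f \in 'Phi(E).
  have -> : x^-1 * f = [~ y1^-1, y2] * y3 by rewrite /f commgEl conjgE !invMg !invgK !mulgA mulVg mul1g.
  by rewrite groupM // (subsetP (Phi_der pE)) // mem_commg ?groupV.
have uf : u f = f.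
  by rewrite /f !(AutM Eu) ?groupM ?groupV ?groupM // (AutV Eu) ?groupM // -!(AutM Eu) ?groupM // f1 f2 f3.
have Ef : f \in E by rewrite !groupM ?groupV ?groupM.
have -> : x = f * (x^-1 * f)^-1 by rewrite invMg invgK mulKVg.
have Ev := subsetP (Phi_sub E) _ Qf; have := groupVr Qf.
move: (x^-1 * f) Qf Ev => q Qq Eq Qq'.
by rewrite (AutM Eu) ?groupV // uf invMg -mulgA mulKg groupM ?groupV // stQ.
Qed.

End CoprimeAut.

(** * One normal essential subgroup: S / E has order p *)

Section Single.
Variables (gT : finGroupType) (p : nat) (S E : {group gT}) (A B : {group {perm gT}}).
Hypotheses (pr_p : prime p) (odd_p : odd p) (pS : p.-group S) (rS : rk3 p S).
Hypotheses (nES : E <| S) (sA : A \subset Aut E) (sB : B \subset Aut S).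
Hypothesis cE : 'C_S(E) \subset E.
Implicit Types (X Y N : {group gT}) (a g u : {perm gT}).
Local Notation cj := (conj_aut E).
Let P := [group of cj @* S].
Let I := [group of cj @* E].
Hypothesis sylP : p.-Sylow(A) P.
(** Strong p-embedding of H / I in A / I, expressed by p-elements of A so that no quotient appears.
    Here A stands for Aut_F(E), B for Aut_F(S), P for Aut_S(E) and I for Inn(E); [ext] is the
    extension axiom for automorphisms normalising P. *)
Hypothesis semb : exists H : {group {perm gT}}, [/\ H \proper A, I \subset H,
  exists2 x, x \in H & p.-elt x /\ x \notin I &
  forall g, g \in A -> g \notin H -> forall x, x \in H -> x \in H :^ g -> p.-elt x -> x \in I].
Hypothesis ext : forall a, a \in A -> P :^ a = P -> exists2 b, b \in B & {in E, b =1 a}.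

Let sES := normal_sub nES.
Let nE := normal_norm nES.
Let pE := pgroupS sES pS.
Let autA a : a \in A -> a \in Aut E. Proof. exact: (subsetP sA). Qed.
Let sPA : P \subset A := pHall_sub sylP.
Let pP : p.-group P := pHall_pgroup sylP.
Let cjE s x : s \in S -> x \in E -> cj s x = x ^ s.
Proof. by move=> Ss Ex; rewrite norm_conj_autE // (subsetP nE). Qed.
Let Pcj s : s \in S -> cj s \in P.
Proof. by move=> Ss; apply: mem_morphim => //; apply: (subsetP nE). Qed.
Let PP g : g \in P -> exists2 s, s \in S & g = cj s.
Proof. by case/morphimP=> s _ Ss ->; exists s. Qed.
Let sIP : I \subset P. Proof. exact: morphimS. Qed.
Let nQ : 'Phi(E) <| S. Proof. exact: char_normal_trans (Phi_char E) nES. Qed.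
Let iQ : invar A 'Phi(E).
Proof. by move=> a /autA Aa; apply: stab_Phi Aa (subxx _) (Aut_stab Aa). Qed.
Let iE : invar A E. Proof. by move=> a /autA Aa; apply: Aut_stab. Qed.

Lemma I_normal : I <| A.
Proof.
rewrite /normal (subset_trans sIP sPA) /=; apply/subsetP=> a Aa; rewrite inE.
apply/subsetP=> _ /imsetP[_ /morphimP[e Ne Ee ->] ->]; have Ea := autA Aa.
have -> : cj e ^ a = cj (a e).
  apply/permP=> x; case: (boolP (x \in E)) => [Ex | nx]; last first.
    by rewrite (out_Aut _ nx) ?(out_Aut _ nx) ?groupJ ?Aut_aut.
  have := (stab_imset a E).1 (iE Aa) => eE; move: Ex; rewrite -{1}eE => /imsetP[x' Ex' ->].
  rewrite permJ !norm_conj_autE ?(subsetP (normG E)) // ?(Aut_stab Ea) //.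
  exact: (AutJ Ea).
by apply: mem_morphim; rewrite ?(subsetP (normG E)) // ?(Aut_stab Ea).
Qed.

(** Normalisers grow in p-groups: if X were not in H, an element n of X outside H would normalise X
    :&: H, which would lie in H and in its conjugate by n, hence in I. *)
Lemma semb_pgroup (H X : {group {perm gT}}) :
    (forall g, g \in A -> g \notin H -> forall x, x \in H -> x \in H :^ g -> p.-elt x -> x \in I) ->
  X \subset A -> p.-group X -> ~~ (X :&: H \subset I) -> X \subset H.
Proof.
move=> hH sXA pX nXI; apply/idPn=> nXH; pose Y := [group of X :&: H].
  have ltY : Y \proper X by rewrite properE subsetIl /= subsetI subxx.
  have := nilpotent_proper_norm (pgroup_nil pX) ltY.
  case/properP=> _ [n /setIP[Xn nYn] nYn'].
  have nHn : n \notin H by apply: contra nYn' => Hn; rewrite inE Xn.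
  case/subsetPn: nXI => x Yx; case/negP.
  apply: (hH n (subsetP sXA n Xn) nHn); first by case/setIP: Yx.
    rewrite -(normP nYn) in Yx; apply: subsetP Yx.
    by rewrite conjSg subsetIr.
  by apply: mem_p_elt pX _; case/setIP: Yx.
Qed.

Lemma semb_Sylow : exists H : {group {perm gT}}, [/\ H \proper A, P \subset H,
  ~~ (P \subset I) &
  forall g, g \in A -> g \notin H -> forall x, x \in H -> x \in H :^ g -> p.-elt x -> x \in I].
Proof.
have [H [ltH sIH [x Hx [px nIx]] hH]] := semb; have sHA := proper_sub ltH.
have sxA : <[x]> \subset A by rewrite cycle_subG (subsetP sHA).
have [g Ag sxP] := Sylow_subJ sylP sxA px.
have nI := normal_norm I_normal.
have nPI : ~~ (P \subset I).
  apply: contra nIx => sPI; rewrite -cycle_subG; apply: subset_trans sxP _.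
  by rewrite -(normP (subsetP nI g Ag)) conjSg.
have sPgH : P :^ g \subset H.
  apply: (semb_pgroup hH).
  - by rewrite -(conjGid Ag) conjSg.
  - by rewrite pgroupJ.
  - apply: contra nIx => sI; apply: (subsetP sI).
    by rewrite inE Hx andbT -cycle_subG.
exists [group of H :^ g^-1]; split=> //=.
- by rewrite -(conjGid (groupVr Ag)) properJ.
- by rewrite -(conjSg _ _ g) conjsgKV.
move=> k Ak nHk y Hy Hyk py.
have e : y = (y ^ g) ^ g^-1 by rewrite conjgK.
have nIg : I :^ g^-1 = I by rewrite (normP _) // groupV (subsetP nI).
have nHkg : k ^ g \notin H by apply: contra nHk; rewrite mem_conjgV.
have Hyg : y ^ g \in H by rewrite -mem_conjgV.
have Hykg : y ^ g \in H :^ (k ^ g) by rewrite (conjgE k) !conjsgM memJ_conjg.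
rewrite -nIg e memJ_conjg; apply: (hH (k ^ g)) => //; rewrite ?groupJ ?p_eltJ //.
Qed.

(** O_p(Out_F(E)) is trivial: by Sylow's theorem K lies in P, hence in H, and by normality also in a
    conjugate of H by an element outside H. *)
Lemma normal_p_sub_I (K : {group {perm gT}}) : K <| A -> p.-group K -> K \subset I.
Proof.
move=> nK pK; have [H [ltH sPH _ hH]] := semb_Sylow.
have [g Ag sKP] := Sylow_subJ sylP (normal_sub nK) pK.
have nKA := subsetP (normal_norm nK).
have sKP' : K \subset P by rewrite -(conjSg _ _ g) (normP (nKA g Ag)).
have [_ [k Ak nHk]] := properP ltH.
apply/subsetP=> x Kx; apply: (hH k Ak nHk); last exact: mem_p_elt pK Kx.
  exact: (subsetP (subset_trans sKP' sPH)).
apply: subsetP (_ : K \subset _) x Kx.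
by rewrite -(normP (nKA k Ak)) conjSg (subset_trans sKP').
Qed.

(** The stabiliser of an A-stable chain is a normal p-subgroup of A. *)
Lemma chain_sub_I X1 X2 : X1 \subset E -> X2 \subset X1 -> 'Phi(E) \subset X2 ->
  invar A X1 -> invar A X2 -> chain_stab A E X1 X2 'Phi(E) \subset I.
Proof.
move=> s1 s2 s3 i1 i2.
pose D := Group (chain_stab_group_set sA s1 s2 s3 iQ).
have pD : p.-group D by apply: (chain_stab_pgroup (A := A) (D := D) pr_p pE sA s1 s2 s3).
apply: (normal_p_sub_I (K := D)) pD; apply/andP; split.
  by apply/subsetP=> g /chain_stabP[].
apply/subsetP=> a Aa; rewrite inE; apply/subsetP=> _ /imsetP[g /chain_stabP[Ag g0 g1 g2] ->].
have Ea := autA Aa.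
have st (X Y : {group gT}) : X \subset E -> Y \subset X -> invar A X -> invar A Y ->
    {in X, forall x, x^-1 * g x \in Y} -> {in X, forall x, x^-1 * (g ^ a) x \in Y}.
  move=> sXE sYX iX iY h x Xx; have := (stab_imset a X).1 (iX a Aa) => eX.
  move: Xx; rewrite -eX => /imsetP[x' Xx' ->]; have Ex' := subsetP sXE x' Xx'.
  rewrite permJ -(AutV Ea) // -(AutM Ea) ?groupV // ?iY ?h //.
  exact: Aut_stab (autA Ag) _ Ex'.
have s2E := subset_trans s2 s1.
apply/chain_stabP; split; first exact: groupJ.
- exact: st.
- exact: st.
- exact: st.
Qed.

Lemma tact_sub_I g : g \in A -> {in E, forall x, x^-1 * g x \in 'Phi(E)} -> g \in I.
Proof.
move=> Ag tg; have sQE := Phi_sub E.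
apply: (subsetP (chain_sub_I (X1 := [group of 'Phi(E)]) (X2 := [group of 'Phi(E)]) _ _ _ _ _)) => //.
have Eg := autA Ag.
apply/chain_stabP; split=> // x Qx; rewrite groupM ?groupV //; exact: iQ.
Qed.

Lemma cj_I s : s \in S -> cj s \in I -> s \in E.
Proof.
move=> Ss /morphimP[e Ne Ee es].
have : s * e^-1 \in 'C_S(E).
  apply/setIP; split; first by rewrite groupM ?groupV //; apply: (subsetP sES).
  apply/centP=> x Ex.
  apply: commute_sym; apply/commgP/conjg_fixP; rewrite conjgM.
  by rewrite -(cjE Ss Ex) es norm_conj_autE // conjgK.
by move/(subsetP cE); rewrite groupMr ?groupV.
Qed.

(** S / E is faithful on V: an element trivial on V induces an inner automorphism by [tact_sub_I],
    and E contains its centraliser in S. *)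
Lemma cmod_faithful : cmod S E 'Phi(E) = E.
Proof.
have nS := normal_norm nQ; have nE' := subset_trans sES nS.
apply/eqP; rewrite eqEsubset (sub_cmod sES nS nE') (Phi_der pE) andbT.
apply/subsetP=> s /(cmodP _ nS nE')[Ss cs]; apply: cj_I => //; apply: tact_sub_I.
  by apply: (subsetP sPA); apply: Pcj.
by move=> x Ex; rewrite cjE // -commgEl -invg_comm groupV cs.
Qed.

Lemma S_neq_E : ~~ (S \subset E).
Proof.
have [H [_ _ nPI _]] := semb_Sylow.
by apply: contra nPI => sSE; apply: morphimS.
Qed.

(** Suppose that S / E has order at least p ^ 2. Then V has order p ^ 3, and some z outside E
    centralises a plane Y / Phi(E), with commutator a line spanned by c0. Outside H, every a moves
    c0 off Y, because otherwise z and its conjugate would lie in one p-group. Hence c1 = a c0 has so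
    many S-conjugates that they fill the coset of Y / Phi(E), and one of them lies in a @: Y without
    coming from E, against strong embedding. *)
Lemma index_SE : #|S : E| = p.
Proof.
have nS := normal_norm nQ; have nE' := subset_trans sES nS.
have /p_natP[k ek] : p.-nat #|S : E| by apply: pnat_dvd (dvdn_indexg S E) pS.
case: k ek => [|[|k]] ek.
- by have := S_neq_E; rewrite -indexg_eq1 ek.
- by rewrite ek expn1.
exfalso; have big : p ^ 2 <= #|S : E| by rewrite ek leq_exp2l ?(prime_gt1 pr_p).
have ltQE : 'Phi(E) \proper E.
  apply: Phi_proper; apply: contra S_neq_E => /eqP E1.
  by apply: subset_trans _ cE; rewrite E1 subsetI subxx cents1.
have [Y [sQY ltY nYS iEY]] := pquot_gt pr_p pS nQ nES ltQE.
have sYE := proper_sub ltY; have cEY := pcentral pr_p pS nYS nES sYE iEY.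
have nYE : Y :!=: 'Phi(E).
  apply/eqP=> eY; case/negP: S_neq_E; rewrite -cmod_faithful (sub_cmod (subxx _) nS nE').
  by rewrite commGC; move: cEY; rewrite eY.
have ltQY : 'Phi(E) \proper Y by rewrite properEneq eq_sym nYE.
have [L [sQL ltL nLS iYL]] := pquot_gt pr_p pS nQ nYS ltQY.
have sLY := proper_sub ltL; have cYL := pcentral pr_p pS nLS nYS sLY iYL.
have sLE := subset_trans sLY sYE.
have [w Ew nYw] : exists2 w, w \in E & w \notin Y by apply/subsetPn; case/properP: ltY => _ [u Eu nu]; apply/subsetPn; exists u.
have [y0 Yy nLy] : exists2 w, w \in Y & w \notin L by apply/subsetPn; case/properP: ltL => _ [u Eu nu]; apply/subsetPn; exists u.
have ext1 (X Z : {group gT}) x s : Z \subset X -> prime #|X : Z| -> x \in X -> x \notin Z ->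
    X \subset E -> s \in S -> {in Z, forall z, [~ z, s] \in 'Phi(E)} -> [~ x, s] \in 'Phi(E) ->
    {in X, forall z, [~ z, s] \in 'Phi(E)}.
  move=> sZX prX Xx nZx sXE Ss cZ cx z Xz; have Ns := subsetP nS s Ss.
  have nX := subset_trans sXE nE'.
  have eX : cmod1 X s 'Phi(E) = X.
    apply: (idx_full (N := Z) (x := x)) => //; last by apply/(cmod1P _ nX Ns).
      apply/subsetP=> u Zu; apply/(cmod1P _ nX Ns); split; first exact: (subsetP sZX).
      exact: cZ.
    exact: cmod1_sub.
  by move: Xz; rewrite -{1}eX => /(cmod1P _ nX Ns)[].
have [eL | neL] := eqVneq (L : {set gT}) 'Phi(E).
  have le : #|S : cmod1 S w 'Phi(E)| <= #|Y : 'Phi(E)|.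
    apply: index_cmod1 => //; first exact: (subsetP sES).
    - exact: subset_trans sYE nE'.
    - move=> s Ss; rewrite -invg_comm groupV; apply: (subsetP cEY); exact: mem_commg.
    - by move: cYL; rewrite eL.
  have sCE : cmod1 S w 'Phi(E) \subset E.
    rewrite -{2}cmod_faithful; apply/subsetP=> s /(cmod1P _ nS (subsetP nE' w Ew))[Ss cs].
    apply/(cmodP _ nS nE'); split=> // e Ee; rewrite -invg_comm groupV.
    apply: (ext1 E Y w s) => //; first by rewrite iEY.
      move=> z Yz; rewrite -eL; apply: (subsetP cYL); exact: mem_commg.
    by rewrite -invg_comm groupV.
  have le2 : #|S : E| <= p.
    apply: leq_trans (_ : #|S : cmod1 S w 'Phi(E)| <= _).
      by rewrite dvdn_leq ?indexg_gt0 // indexgS.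
    by move: iYL le; rewrite eL => ->.
  by have := leq_trans big le2; rewrite (leq_p2 pr_p).
have iLQ : #|L : 'Phi(E)| = p.
  apply: (p_index_le pr_p pE sLE sQL) _; last by rewrite eq_sym.
  have := rS sES; rewrite -(Lagrange_index sYE sQY) -(Lagrange_index sLY sQL) iEY iYL.
  by rewrite mulnA mulnn (expnSr p 2) leq_pmul2l ?expn_gt0 ?prime_gt0.
have cLQ := pcentral pr_p pS nQ nLS sQL iLQ.
(* If D were E, then S / E would act faithfully on a plane and have order at most p. *)
pose D := [group of cmod S Y 'Phi(E)].
have nY := subset_trans sYE nE'.
have sED : E \subset D.
  by rewrite (sub_cmod sES nS nY); apply: subset_trans (commgS _ sYE) (Phi_der pE).
have sDS : D \subset S := cmod_sub _ _ _.
have ltED : ~~ (D \subset E).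
  apply/negP=> sDE; move: big; rewrite leqNgt; case/negP.
  apply: leq_ltn_trans (_ : #|S : E| <= p) _; last by rewrite -{1}[p]expn1 ltn_exp2l ?(prime_gt1 pr_p).
  have le : #|S : cmod1 S y0 'Phi(E)| <= #|L : 'Phi(E)|.
    apply: index_cmod1 => //; first exact: (subsetP (subset_trans sYE sES)).
    - exact: subset_trans sLE nE'.
    - move=> s Ss; rewrite -invg_comm groupV; apply: (subsetP cYL); exact: mem_commg.
  apply: leq_trans (_ : #|S : cmod1 S y0 'Phi(E)| <= _); last by rewrite -iLQ.
  rewrite dvdn_leq ?indexg_gt0 // indexgS //; apply: subset_trans sDE.
  apply/subsetP=> s /(cmod1P _ nS (subsetP nY y0 Yy))[Ss cs].
  apply/(cmodP _ nS nY); split=> // e Ye; rewrite -invg_comm groupV.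
  apply: (ext1 Y L y0 s) => //; first by rewrite iYL.
    move=> z Lz; apply: (subsetP cLQ); exact: mem_commg.
  by rewrite -invg_comm groupV.
have [z Dz nEz] := subsetPn ltED; have Sz := subsetP sDS z Dz.
have cz y : y \in Y -> [~ y, z] \in 'Phi(E).
  by move=> Yy'; have /(cmodP _ nS nY)[_ h] := Dz; rewrite -invg_comm groupV h.
pose c0 := [~ w, z].
have Yc0 : c0 \in Y by apply: (subsetP cEY); apply: mem_commg.
have Ec0 := subsetP sYE c0 Yc0.
have nQc0 : c0 \notin 'Phi(E).
  apply/negP=> cQ; case/negP: nEz; rewrite -cmod_faithful; apply/(cmodP _ nS nE'); split=> // e Ee.
  rewrite -invg_comm groupV; apply: (ext1 E Y w z) => //; by rewrite iEY.
pose L' := [group of <[c0]> <*> 'Phi(E)].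
have sQL' : 'Phi(E) \subset L' := joing_subr _ _.
have L'c0 : c0 \in L' by apply: (subsetP (joing_subl _ _)); apply: cycle_id.
have sL'Y : L' \subset Y by rewrite join_subG sQY cycle_subG Yc0.
have sL'E := subset_trans sL'Y sYE.
have comL x : x \in E -> [~ x, z] \in L'.
  have nL' : E \subset 'N(L').
    by rewrite -commg_subl; apply: subset_trans (subset_trans (commSg _ sL'E) (Phi_der pE)) sQL'.
  have zL' : z \in 'N(L').
    rewrite inE; apply/subsetP=> _ /imsetP[l Ll ->].
    by rewrite conjg_mulR groupM // (subsetP sQL') // cz // (subsetP sL'Y).
  have eE : cmod1 E z L' = E.
    apply: (idx_full (N := Y) (x := w)) => //.
    - apply/subsetP=> y Yy'; apply/(cmod1P _ nL' zL'); split; first exact: (subsetP sYE).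
      by rewrite (subsetP sQL') // cz.
    - exact: cmod1_sub.
    - by rewrite iEY.
    - by apply/(cmod1P _ nL' zL').
  by move=> Ex; move: Ex; rewrite -{1}eE => /(cmod1P _ nL' zL')[].
have [H [ltH sPH nPI hH]] := semb_Sylow.
have stQ a : a \in A -> stab a 'Phi(E) := @iQ a.
(* If a c0 is in Y, then [cj z] and its conjugate by a both stabilise the chain E, L1, L2, Phi(E).
   This stabiliser is a p-group meeting H outside I, so it lies in H; the conjugate then lies in H
   and in H :^ a, which forces z into E. *)
have Fa a : a \in A -> a \notin H -> a c0 \notin Y.
  move=> Aa nHa; apply/negP=> Yac; have Ea := autA Aa.
  have eaL' := Aut_imset Ea sL'E.
  pose L2 := Group (Aut_img_group Ea sL'E).
  have sL2E : L2 \subset E by apply: Aut_sub Ea _ sL'E.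
  have sQL2 : 'Phi(E) \subset L2.
    by rewrite -{1}((stab_imset a 'Phi(E)).1 (stQ a Aa)); apply: imsetS.
  have sL2Y : L2 \subset Y.
    rewrite /= eaL' morphimY ?cycle_subG //; last exact: Phi_sub.
    rewrite join_subG morphim_cycle // cycle_subG.
    rewrite -(@Aut_imset _ _ _ Ea [group of 'Phi(E)] (Phi_sub E)) /=.
    by rewrite ((stab_imset a 'Phi(E)).1 (stQ a Aa)) sQY andbT /= Yac.
  pose L1 := [group of L' <*> L2].
  have sL1Y : L1 \subset Y by rewrite join_subG sL'Y.
  have sL1E := subset_trans sL1Y sYE.
  have sL21 : L2 \subset L1 := joing_subr _ _.
  have sL'1 : L' \subset L1 := joing_subl _ _.
  pose X := Group (chain_stab_group_set sA sL1E sL21 sQL2 iQ).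
  have pX : p.-group X by apply: (chain_stab_pgroup (A := A) (D := X) pr_p pE sA sL1E sL21 sQL2).
  have Pz := Pcj Sz; have Az := subsetP sPA _ Pz.
  have ccz y : y \in Y -> y^-1 * cj z y \in 'Phi(E).
    by move=> Yy'; rewrite cjE ?(subsetP sYE) // -commgEl cz.
  have Xz : cj z \in X.
    apply/chain_stabP; split=> // x Ex.
    - by rewrite cjE // -commgEl (subsetP sL'1) // comL.
    - by rewrite (subsetP sQL2) // ccz // (subsetP sL1Y).
    - by rewrite ccz // (subsetP sL2Y).
  have Xza : cj z ^ a \in X.
    have st (X' Y' : {set gT}) x : {in X', forall x, x^-1 * cj z x \in Y'} -> X' \subset E ->
        x \in a @: X' -> x^-1 * (cj z ^ a) x \in a @: Y'.
      move=> h sX /imsetP[x' Xx' ->]; rewrite permJ; have Ex' := subsetP sX x' Xx'.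
      rewrite -(AutV Ea) // -(AutM Ea) ?groupV //; first exact: imset_f (h x' Xx').
      exact: Aut_stab (autA Az) _ Ex'.
    have eaE := (stab_imset a E).1 (iE Aa); have eaQ := (stab_imset a 'Phi(E)).1 (stQ a Aa).
    have cY x : x \in L1 -> x^-1 * (cj z ^ a) x \in L2.
      move=> Lx; apply: (st E) => //; last by rewrite eaE (subsetP sL1E).
      by move=> e Ee; rewrite cjE // -commgEl comL.
    apply/chain_stabP; split=> // [|x Ex|x Lx].
    - by rewrite groupJ.
    - rewrite (subsetP sL21) //; apply: (st E) => //; last by rewrite eaE.
      by move=> e Ee; rewrite cjE // -commgEl comL.
    - suff : x^-1 * (cj z ^ a) x \in a @: 'Phi(E) by rewrite eaQ.
      apply: (st L') => // l Ll; apply: ccz; exact: (subsetP sL'Y).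
  have nXI : ~~ (X :&: H \subset I).
    apply: contra nEz => /subsetP sI; apply: cj_I => //; apply: sI.
    by rewrite inE Xz (subsetP sPH).
  have sXH : X \subset H.
    by apply: semb_pgroup hH _ pX nXI; apply/subsetP=> g /chain_stabP[].
  case/negP: nEz; apply: cj_I => //.
  have [_ nI] := andP I_normal; rewrite -(memJ_norm _ (subsetP nI a Aa)).
  apply: (hH a Aa nHa); first exact: (subsetP sXH).
    by rewrite memJ_conjg (subsetP sPH).
  by rewrite p_eltJ; apply: mem_p_elt pP Pz.
have sHA := proper_sub ltH; have [_ [a Aa nHa]] := properP ltH; have Ea := autA Aa.
pose c1 := a c0; have nYc1 : c1 \notin Y := Fa a Aa nHa.
have Ec1 : c1 \in E by apply: iE.
(* For s outside E the conjugate g of [cj s] by a^-1 is outside H by strong embedding, so [Fa]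
   applies to g itself. *)
have fact s : s \in S -> c1 ^ s \in a @: Y -> s \in E.
  move=> Ss hs; apply/idPn=> nEs; pose g := a * cj s * a^-1.
  have Pc := Pcj Ss; have Ac := subsetP sPA _ Pc.
  have Ag : g \in A by rewrite !groupM ?groupV.
  have nHg : g \notin H.
    apply: contra nEs => Hg; apply: cj_I => //.
    apply: (hH a Aa nHa); first exact: (subsetP sPH).
      by rewrite mem_conjg (_ : _ ^ _ = g) // conjgE invgK mulgA.
    exact: mem_p_elt pP Pc.
  case/negP: (Fa g Ag nHg); rewrite !permM cjE //.
  by case/imsetP: hs => y Yy' ->; rewrite permK.
pose aY := Group (Aut_img_group Ea sYE).
have sC1 : cmod1 S c1 'Phi(E) \subset E.
  apply/subsetP=> s /(cmod1P _ nS (subsetP nE' c1 Ec1))[Ss cs]; apply: fact => //.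
  suff : c1 ^ s \in aY by [].
  rewrite conjg_mulR groupM //; first exact: (imset_f a Yc0).
  rewrite -invg_comm groupV; have : [~ s, c1] \in a @: 'Phi(E) by rewrite ((stab_imset a 'Phi(E)).1 (stQ a Aa)).
  by apply: subsetP; apply: imsetS.
have iYQ : #|Y : 'Phi(E)| = (p ^ 2)%N by rewrite -(Lagrange_index sLY sQL) iYL iLQ.
(* Two planes in a space of dimension 3 share a line. The element c1 * v is then an S-conjugate of
   c1 by [clY], and it lies in a @: Y. *)
have [v /setIP[Yv aYv] nQv] : exists2 v, v \in Y :&: aY & v \notin 'Phi(E).
  apply/subsetPn; apply/negP=> sI.
  have := mul_cardG Y aY; rewrite [#|aY|]card_imset; last exact: perm_inj.
  have cY := Lagrange sQY; have cEY' := Lagrange sYE.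
  have le : #|Y * aY| <= #|E|.
    by apply: subset_leq_card; rewrite mul_subG //; apply: Aut_sub.
  have le2 := subset_leq_card sI.
  move=> e; have : #|Y| * #|Y| <= #|E| * #|'Phi(E)| by rewrite e leq_mul.
  rewrite -cEY' iEY -{2}cY iYQ -mulnA leq_pmul2l ?cardG_gt0 // mulnC leq_pmul2r ?cardG_gt0 //.
  by rewrite leq_p2.
(* The stabiliser of c1 modulo Phi(E) lies in E, so the orbit has at least p ^ 2 elements, the size
   of the coset in which it lies. *)
have clY : coset 'Phi(E) c1 ^: (S / 'Phi(E)) = coset 'Phi(E) c1 *: (Y / 'Phi(E)).
  apply/eqP; rewrite eqEcard; apply/andP; split.
    apply/subsetP=> _ /imsetP[_ /morphimP[s Ns Ss ->] ->].
    have Nc := subsetP nE' c1 Ec1.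
    rewrite mem_lcoset conjg_mulR mulKg -morphR //= mem_quotient //.
    by apply: (subsetP cEY); apply: mem_commg.
  rewrite card_lcoset card_quotient // iYQ -index_cent1.
  apply: leq_trans big _; rewrite /= -morphim_setIpre -/(cmod1 S c1 'Phi(E)).
  have sQC1 : 'Phi(E) \subset cmod1 S c1 'Phi(E).
    apply/subsetP=> q Qq; apply/(cmod1P _ nS (subsetP nE' c1 Ec1)).
    split; first exact: (subsetP (normal_sub nQ)).
    by rewrite (subsetP (Phi_der pE)) // mem_commg // (subsetP (Phi_sub E)).
  rewrite index_quotient_eq ?cmod1_sub //; last by rewrite subIset // sQC1 orbT.
  by rewrite dvdn_leq ?indexg_gt0 // indexgS.
have : coset 'Phi(E) (c1 * v) \in coset 'Phi(E) c1 ^: (S / 'Phi(E)).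
  rewrite clY mem_lcoset morphM ?(subsetP nE') ?(subsetP sYE v) //= mulKg.
  exact: mem_quotient.
case/imsetP=> _ /morphimP[s Ns Ss ->]; have Nc := subsetP nE' c1 Ec1.
have Ev := subsetP sYE v Yv; have Nv := subsetP nE' v Ev.
have Es1 : c1 ^ s \in E by rewrite memJ_norm // (subsetP nE).
have Ncv := groupM Nc Nv; have Ns1 := subsetP nE' _ Es1.
rewrite -morphJ // => e.
have : (c1 * v)^-1 * c1 ^ s \in 'Phi(E).
  by apply: coset_idr; rewrite ?groupM ?groupV // morphM ?groupV // morphV //= e mulVg.
rewrite invMg -mulgA -commgEl => Qvc.
have EE : s \in E.
  apply: fact => //; suff : c1 ^ s \in aY by [].
  rewrite conjg_mulR groupM //; first exact: (imset_f a Yc0).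
  rewrite -(mulKVg v [~ c1, s]) groupM //.
  have : v^-1 * [~ c1, s] \in a @: 'Phi(E) by rewrite ((stab_imset a 'Phi(E)).1 (stQ a Aa)).
  by apply: subsetP; apply: imsetS.
case/negP: nQv; rewrite -groupV -(groupMr _ (_ : [~ c1, s] \in 'Phi(E))) //.
by apply: (subsetP (Phi_der pE)); apply: mem_commg.
Qed.

End Single.

(** * The element -1 as a word in two transvections *)

Section NegWord.
Variables (gT : finGroupType) (p : nat) (E N : {group gT}).
Hypotheses (pr_p : prime p) (nE : E \subset 'N(N)).
Implicit Types (u v : {perm gT}).

Lemma coset_congr u x y : u \in Aut E -> stab u N -> x \in E -> y \in E ->
  coset N x = coset N y -> coset N (u x) = coset N (u y).
Proof.
move=> Au sN Ex Ey e; have nN := subsetP nE.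
have : x^-1 * y \in N.
  by apply: coset_idr; rewrite ?nN ?groupM ?groupV // morphM ?nN ?groupV // morphV ?nN //= e mulVg.
move=> h; rewrite -[y](mulKVg x) (AutM Au) ?groupM ?groupV // morphM ?nN ?(Aut_stab Au) ?groupM ?groupV //=.
by rewrite (coset_id (sN _ h)) mulg1.
Qed.

(* In SL_2(p), with u = (1 1; 0 1) and v = (1 0; -1 1), the matrix (u v u)^2 is -1. *)
Lemma neg_word u v q r j : u \in Aut E -> v \in Aut E -> stab u N -> stab v N ->
  q \in E -> r \in E -> commute (coset N q) (coset N r) -> r ^+ p \in N -> ~~ (p %| j) ->
  coset N (u r) = coset N (r * q) -> coset N (u q) = coset N q ->
  coset N (v r) = coset N r -> coset N (v q) = coset N (q * r ^+ j) ->
  exists2 z, z \in <<[set u; v]>> & coset N (z q) = coset N q^-1 /\ coset N (z r) = coset N r^-1.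
Proof.
move=> Au Av sN uN Eq Er cqr rp npj ur uq vr vq; have nN := subsetP nE.
(* m is chosen with j * m = -1 modulo p: then v ^+ m sends q to q * r^-1, which normalises the lower
   triangular generator. *)
have [m em] : exists m, p %| (j * m).+1.
  have j0 : 0 < j by rewrite lt0n; apply: contraNneq npj => ->.
  have [a b e _] := egcdnP p j0.
  have gpj : gcdn j p = 1%N by apply/eqP; rewrite -/(coprime j p) coprime_sym prime_coprime.
  rewrite gpj in e; exists (a * p.-1)%N.
  have -> : (j * (a * p.-1)).+1 = (p * (b * p.-1 + 1))%N.
    by rewrite mulnA (mulnC j) e mulnDl mul1n -addnS prednK ?prime_gt0 // mulnDr muln1 mulnA (mulnC p).
  exact: dvdn_mulr.
have stE w x : w \in Aut E -> x \in E -> w x \in E by move=> Aw; apply: Aut_stab.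
pose c x := coset N x; have cM x y : x \in E -> y \in E -> c (x * y) = c x * c y.
  by move=> Ex Ey; rewrite /c morphM ?nN.
have cV x : x \in E -> c x^-1 = (c x)^-1 by move=> Ex; rewrite /c morphV ?nN.
have cX x n : x \in E -> c (x ^+ n) = c x ^+ n by move=> Ex; rewrite /c morphX ?nN.
have cong w x y : w \in Aut E -> stab w N -> x \in E -> y \in E -> c x = c y -> c (w x) = c (w y).
  exact: coset_congr.
have vX n : c ((v ^+ n) r) = c r /\ c ((v ^+ n) q) = c q * c r ^+ (j * n).
  elim: n => [|n [IHr IHq]]; first by rewrite !perm1 muln0 mulg1.
  have Avn := groupX n Av.
  rewrite expgSr !permM; split.
    by rewrite (cong v _ r) // ?stE.
  rewrite (cong v _ (q * r ^+ (j * n))) ?stE ?groupM ?groupX ?cM ?cX ?groupX //.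
  rewrite (AutM Av) ?groupX // (AutX Av) // cM ?stE ?groupX ?stE // cX ?stE //.
  by rewrite /c vq vr -/(c _) cM ?groupX // cX // -mulgA -expgD mulnS.
pose v' := v ^+ m; have Av' : v' \in Aut E := groupX m Av.
have [v'r v'q0] := vX m.
have v'q : c (v' q) = c q * (c r)^-1.
  rewrite v'q0; congr (_ * _); apply: (mulIg (c r)).
  rewrite mulVg -expgSr -cX // /c coset_id //.
  by case/dvdnP: em => k ->; rewrite mulnC expgM groupX.
have sN' : stab v' N.
  have : v' \in 'N(N | 'P); last by move/astabsP => h x Nx; have := h x; rewrite /= apermE Nx.
  rewrite groupX //; apply/astabsP => x; rewrite /= apermE.
  apply/idP/idP => [/(stabK uN) | /uN] //.
pose w := u * v' * u; have Aw : w \in Aut E by rewrite !groupM.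
have sw : stab w N by move=> x Nx; rewrite !permM sN // sN' // sN.
have Evr := stE _ _ Av' Er; have Evq := stE _ _ Av' Eq.
have wr : c (w r) = c q.
  rewrite /w !permM (cong u _ q) ?stE //.
  rewrite (cong v' _ (r * q)) ?stE ?groupM //.
  by rewrite (AutM Av') // cM // v'r v'q mulgA -cqr -mulgA mulgV mulg1.
have wq : c (w q) = c r^-1.
  rewrite /w !permM.
  have e1 : c (v' (u q)) = c (q * r^-1).
    by rewrite (cong v' _ q) ?stE // v'q cM ?groupV // cV.
  rewrite (cong u _ (q * r^-1)) ?stE ?groupM ?groupV //.
  rewrite (AutM Au) ?groupV // (AutV Au) // cM ?groupV ?stE // !cV ?stE //.
  by rewrite /c uq ur -/(c q) -/(c (r * q)) cM // invMg mulgA mulgV mul1g.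
exists (w * w).
  by rewrite !groupM ?groupX // mem_gen // !inE eqxx ?orbT.
split; rewrite permM.
  rewrite -[LHS]/(c (w (w q))) (cong w _ r^-1) ?stE ?groupV //.
  by rewrite (AutV Aw) // cV ?stE // wr -cV.
by rewrite -[LHS]/(c (w (w r))) (cong w _ q) ?stE.
Qed.

End NegWord.

(** * One normal essential subgroup: the action on V *)

Section Single.
Variables (gT : finGroupType) (p : nat) (S E : {group gT}) (A B : {group {perm gT}}).
Hypotheses (pr_p : prime p) (odd_p : odd p) (pS : p.-group S) (rS : rk3 p S).
Hypotheses (nES : E <| S) (sA : A \subset Aut E) (sB : B \subset Aut S).
Hypothesis cE : 'C_S(E) \subset E.
Implicit Types (X Y N : {group gT}) (a g u : {perm gT}).
Local Notation cj := (conj_aut E).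
Let P := [group of cj @* S].
Let I := [group of cj @* E].
Hypothesis sylP : p.-Sylow(A) P.
Hypothesis semb : exists H : {group {perm gT}}, [/\ H \proper A, I \subset H,
  exists2 x, x \in H & p.-elt x /\ x \notin I &
  forall g, g \in A -> g \notin H -> forall x, x \in H -> x \in H :^ g -> p.-elt x -> x \in I].
Hypothesis ext : forall a, a \in A -> P :^ a = P -> exists2 b, b \in B & {in E, b =1 a}.

Let sES := normal_sub nES.
Let nE := normal_norm nES.
Let pE := pgroupS sES pS.
Let autA a : a \in A -> a \in Aut E. Proof. exact: (subsetP sA). Qed.
Let sPA : P \subset A := pHall_sub sylP.
Let pP : p.-group P := pHall_pgroup sylP.
Let cjE s x : s \in S -> x \in E -> cj s x = x ^ s.
Proof. by move=> Ss Ex; rewrite norm_conj_autE // (subsetP nE). Qed.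
Let Pcj s : s \in S -> cj s \in P.
Proof. by move=> Ss; apply: mem_morphim => //; apply: (subsetP nE). Qed.
Let PP g : g \in P -> exists2 s, s \in S & g = cj s.
Proof. by case/morphimP=> s _ Ss ->; exists s. Qed.
Let sIP : I \subset P. Proof. exact: morphimS. Qed.
Let nQ : 'Phi(E) <| S. Proof. exact: char_normal_trans (Phi_char E) nES. Qed.
Let iQ : invar A 'Phi(E).
Proof. by move=> a /autA Aa; apply: stab_Phi Aa (subxx _) (Aut_stab Aa). Qed.
Let iE : invar A E. Proof. by move=> a /autA Aa; apply: Aut_stab. Qed.
Let nI := I_normal nES sA sylP.
Let tact_I := tact_sub_I pr_p pS nES sA sylP semb.
Let chain_I := chain_sub_I pr_p pS nES sA sylP semb.
Let cj_I := @cj_I _ _ _ nES cE.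
Let normal_I := normal_p_sub_I nES sA sylP semb.
Let iSE := index_SE pr_p pS rS nES sA cE sylP semb.
Let faithful := cmod_faithful pr_p pS nES sA cE sylP semb.
Let neSE := S_neq_E nES sA sylP semb.

Let nS := normal_norm nQ.
Let nEQ := subset_trans sES nS.
Let dE := Phi_der pE.

Lemma conj_neq : exists2 a, a \in A & P :^ a != P.
Proof.
apply/exists_inP/contraT; rewrite negb_exists_in => /forall_inP h.
have nP : P <| A.
  rewrite /normal sPA; apply/subsetP=> a Aa; rewrite inE; have := h a Aa; rewrite negbK => /eqP->.
  exact: subxx.
have [H [_ _ nPI _]] := semb_Sylow nES sA sylP semb.
by case/negP: nPI; apply: normal_I.
Qed.

Let S_full (K : {group gT}) y : K \subset S -> E \subset K -> y \in K -> y \notin E -> K :=: S.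
Proof. by move=> sKS sEK Ky nEy; apply: (idx_full (N := E) (x := y)); rewrite ?iSE. Qed.

Lemma comm_full N x y : N <| S -> 'Phi(E) \subset N -> x \in E -> y \in S -> y \notin E ->
  [~ x, y] \in N -> {in S, forall s, [~ x, s] \in N}.
Proof.
move=> nNS sQN Ex Sy nEy cxy s Ss; have nN := normal_norm nNS.
have Nx := subsetP nN x (subsetP sES x Ex).
have eS : cmod1 S x N = S.
  apply: (@S_full [group of cmod1 S x N] y) => //; first exact: cmod1_sub.
    apply/subsetP=> e Ee; apply/(cmod1P _ nN Nx); split; first exact: (subsetP sES).
    by rewrite (subsetP sQN) // (subsetP dE) // mem_commg.
  by apply/(cmod1P _ nN Nx); rewrite -invg_comm groupV.
by move: Ss; rewrite -{1}eS => /(cmod1P _ nN Nx)[_ h]; rewrite -invg_comm groupV.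
Qed.

Lemma P_sub (X : {group {perm gT}}) y : y \in S -> y \notin E -> cj y \in X -> I \subset X -> P \subset X.
Proof.
move=> Sy nEy Xy sIX.
have eS : S :&: cj @*^-1 X = S.
  apply: (@S_full [group of S :&: cj @*^-1 X] y) => //; first exact: subsetIl.
    by rewrite subsetI sES /= -sub_morphim_pre ?normG.
  by rewrite inE Sy mem_morphpre // (subsetP nE).
by rewrite /= sub_morphim_pre // -{1}eS subsetIr.
Qed.

Let P_subJ (X : {group {perm gT}}) y a : a \in A -> y \in S -> y \notin E -> cj y ^ a \in X ->
  I \subset X -> P :^ a \subset X.
Proof.
move=> Aa Sy nEy Xy sIX; rewrite sub_conjg.
apply: (@P_sub [group of X :^ a^-1] y) => //=; first by rewrite mem_conjg invgK.
by rewrite -sub_conjg (normP (subsetP (normal_norm nI) a Aa)).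
Qed.

Lemma conj_tact a y X Y : a \in A -> y \in S -> X \subset E -> Y \subset E ->
  {in X, forall x, [~ x, y] \in Y} -> {in a @: X, forall x, x^-1 * (cj y ^ a) x \in a @: Y}.
Proof.
move=> Aa Sy sXE sYE h _ /imsetP[x Xx ->]; have Ex := subsetP sXE x Xx.
have Ea := autA Aa; rewrite permJ -(AutV Ea) // -(AutM Ea) ?groupV //.
  by apply: imset_f; rewrite cjE // -commgEl h.
by rewrite cjE // memJ_norm // (subsetP nE).
Qed.

(** The chain stabiliser is a p-group that contains the Sylow subgroup P, hence equals it; the
    second membership puts P :^ a into it as well. *)
Lemma chain_conj a y X1 X2 : a \in A -> y \in S -> y \notin E ->
  X1 \subset E -> X2 \subset X1 -> 'Phi(E) \subset X2 ->
  {in E, forall x, [~ x, y] \in X1} -> {in X1, forall x, [~ x, y] \in X2} ->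
  {in X2, forall x, [~ x, y] \in 'Phi(E)} ->
  cj y ^ a \in chain_stab A E X1 X2 'Phi(E) -> P :^ a = P.
Proof.
move=> Aa Sy nEy s1 s2 s3 h0 h1 h2 hs'.
pose X := Group (chain_stab_group_set sA s1 s2 s3 iQ).
have s2E := subset_trans s2 s1.
have pX : p.-group X by apply: (chain_stab_pgroup (A := A) (D := X) pr_p pE sA s1 s2 s3).
have Ay := subsetP sPA _ (Pcj Sy).
have Xy : cj y \in X.
  apply/chain_stabP; split=> // x Xx; rewrite cjE -?commgEl ?h0 ?h1 ?h2 //.
    exact: (subsetP s1).
  exact: (subsetP s2E).
have sIX : I \subset X.
  apply/subsetP=> _ /morphimP[e Ne Ee ->]; have Se := subsetP sES e Ee.
  have h x : x \in E -> x^-1 * cj e x \in 'Phi(E).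
    by move=> Ex; rewrite cjE // -commgEl (subsetP dE) // mem_commg.
  apply/chain_stabP; split=> [|x Xx|x Xx|x Xx].
  - exact: subsetP sPA _ (Pcj Se).
  - by rewrite (subsetP s2) // (subsetP s3) // h.
  - by rewrite (subsetP s3) // h // (subsetP s1).
  - by rewrite h // (subsetP s2E).
have sPX : P \subset X := @P_sub X y Sy nEy Xy sIX.
have sPaX : P :^ a \subset X by apply: (@P_subJ X y a).
have sXA : X \subset A by apply/subsetP=> g /chain_stabP[].
have eX : X :=: P by apply: (sub_pHall sylP).
by apply/eqP; rewrite eqEcard cardJg leqnn andbT; move: sPaX; rewrite eX.
Qed.

Let c x := coset 'Phi(E) x.
Let cM x y : x \in E -> y \in E -> c (x * y) = c x * c y.
Proof. by move=> Ex Ey; rewrite /c morphM ?(subsetP nEQ). Qed.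
Let cV x : x \in E -> c x^-1 = (c x)^-1.
Proof. by move=> Ex; rewrite /c morphV ?(subsetP nEQ). Qed.
Let cX x n : x \in E -> c (x ^+ n) = c x ^+ n.
Proof. by move=> Ex; rewrite /c morphX ?(subsetP nEQ). Qed.
Let cC x y : x \in E -> y \in E -> commute (c x) (c y).
Proof.
move=> Ex Ey; apply/commgP; rewrite /c -morphR ?(subsetP nEQ) //; apply/eqP/coset_id.
by apply: (subsetP dE); apply: mem_commg.
Qed.
Let c_eq x y : x \in E -> y \in E -> c x = c y -> x^-1 * y \in 'Phi(E).
Proof.
move=> Ex Ey e; apply: coset_idr; first by rewrite (subsetP nEQ) ?groupM ?groupV.
by rewrite -/(c _) cM ?groupV // cV // e mulVg.
Qed.
Let c_id x : x \in 'Phi(E) -> c x = 1. Proof. exact: coset_id. Qed.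
Let sQE := Phi_sub E.
Let stE a x : a \in A -> x \in E -> a x \in E. Proof. by move=> Aa; apply: iE. Qed.

Lemma comm_mod_I z u : z \in A -> u \in A -> {in E, forall x, c (z (u x)) = c (u (z x))} ->
  u^-1 * u ^ z \in I.
Proof.
move=> Az Au h; apply: tact_I; first by rewrite groupM ?groupV ?groupJ.
move=> x Ex; pose x' := z^-1 (u^-1 x).
have Ex' : x' \in E by apply: stE; rewrite ?groupV //; apply: stE; rewrite ?groupV.
have -> : (u^-1 * u ^ z) x = z (u x') by rewrite conjgE !permM.
have Ezu : z (u x') \in E by apply: stE; last apply: stE.
by apply: c_eq => //; rewrite h // /x' !permKV.
Qed.

(** The commutator of z and u stabilises an A-stable chain, so it is inner by [chain_sub_I], and
    inner automorphisms are trivial on V. *)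
Lemma chain_comm z u X1 X2 : z \in A -> u \in A -> X1 \subset E -> X2 \subset X1 ->
  'Phi(E) \subset X2 -> invar A X1 -> invar A X2 ->
  {in E, forall x, (z (u x))^-1 * u (z x) \in X1} -> {in X1, forall x, (z (u x))^-1 * u (z x) \in X2} ->
  {in X2, forall x, (z (u x))^-1 * u (z x) \in 'Phi(E)} -> {in E, forall x, c (z (u x)) = c (u (z x))}.
Proof.
move=> Az Au s1 s2 s3 i1 i2 h0 h1 h2 x Ex.
have Ezx := stE Az Ex.
have : z^-1 * z ^ u \in chain_stab A E X1 X2 'Phi(E).
  have st (X Y : {set gT}) : invar A X -> {in X, forall x, (z (u x))^-1 * u (z x) \in Y} ->
      {in X, forall x, x^-1 * (z^-1 * z ^ u) x \in Y}.
    move=> iX h v Xv; pose v' := u^-1 (z^-1 v).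
    have Xv' : v' \in X by apply: (iX); rewrite ?groupV //; apply: (iX); rewrite ?groupV.
    have := h v' Xv'; rewrite /v' !permKV => hv.
    by rewrite conjgE !permM.
  by apply/chain_stabP; split; rewrite ?groupM ?groupV ?groupJ //; apply: st.
move=> /(subsetP (chain_I s1 s2 s3 i1 i2)) /morphimP[e Ne Ee h].
have e1 : z ^ u = z * cj e by rewrite -h mulKVg.
have Ee' : e \in S := subsetP sES e Ee.
pose v := u x; have Ev : v \in E := stE Au Ex.
have := permJ z u x; rewrite e1 permM -/v => e2.
have : c (z v) = c (cj e (z v)).
  have Ez := stE Az Ev; rewrite cjE // conjg_mulR.
  have Q1 : [~ z v, e] \in 'Phi(E) by rewrite (subsetP dE) ?mem_commg.
  by rewrite cM ?(subsetP sQE _ Q1) // (c_id Q1) mulg1.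
by rewrite e2.
Qed.

Let out_S : exists2 y, y \in S & y \notin E. Proof. by apply/subsetPn. Qed.

Let axis_y x y : y \in S -> y \notin E -> x \in E -> [~ x, y] \in 'Phi(E) -> x \in axis S E.
Proof.
move=> Sy nEy Ex h; apply/(cmodP _ nEQ nS); split=> //.
exact: (comm_full nQ (subxx _) Ex Sy nEy h).
Qed.
Let cHS : [~: axis S E, S] \subset 'Phi(E). Proof. exact: cmod_comm. Qed.
Let sHE : axis S E \subset E. Proof. exact: cmod_sub. Qed.
Let sQH : 'Phi(E) \subset axis S E.
Proof.
by rewrite (sub_cmod (A := [group of 'Phi(E)]) sQE nEQ nS) commg_subl; exact: nS.
Qed.
Let bet X : 'Phi(E) \subset X -> X \subset axis S E -> X <| S.
Proof.
move=> sQX sXH; rewrite /normal (subset_trans sXH (subset_trans sHE sES)) -commg_subl.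
exact: subset_trans (subset_trans (commSg _ sXH) cHS) sQX.
Qed.
Let nH : axis S E <| S. Proof. exact: (bet (X := [group of axis S E])). Qed.
Let imQ a : a \in A -> a @: 'Phi(E) = 'Phi(E).
Proof. by move=> Aa; apply: (stab_imset a 'Phi(E)).1; apply: iQ. Qed.
Let imE a : a \in A -> a @: E = E.
Proof. by move=> Aa; apply: (stab_imset a E).1; apply: iE. Qed.

(** * Hyperplane axis: construction of C, W, a and t *)

Section TransvectionCase.
Hypothesis iH : #|E : axis S E| = p.
Let H := [group of axis S E].
Let Z := [group of centre S E].
Let sQZ : 'Phi(E) \subset Z := joing_subr _ _.
Let cEH : [~: E, S] \subset H. Proof. exact: (pcentral pr_p pS nH nES sHE iH). Qed.
Let sZH : Z \subset H. Proof. by rewrite join_subG cEH. Qed.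
Let sZE := subset_trans sZH sHE.
Let iZ : #|Z : 'Phi(E)| = p.
Proof.
have [y Sy nEy] := out_S.
have [w Ew nHw] : exists2 w, w \in E & w \notin H.
  by apply/subsetPn; rewrite -indexg_eq1 iH neq_ltn (prime_gt1 pr_p) orbT.
pose q := [~ w, y]; have Hq : q \in H by rewrite (subsetP cEH) // mem_commg.
have nQq : q \notin 'Phi(E) by apply: contra nHw; apply: axis_y.
pose Z0 := [group of <[q]> <*> 'Phi(E)].
have sZ0H : Z0 \subset H by rewrite join_subG cycle_subG Hq sQH.
have nZ0 : Z0 <| S by apply: bet => //; apply: joing_subr.
have Eq := subsetP sHE q Hq.
have iZ0 : #|Z0 : 'Phi(E)| = p.
  by apply: (cycle_join_p pr_p pE (subxx E)) => //; apply: Phi_pow.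
suff -> : Z :=: Z0 by [].
apply/eqP; rewrite eqEsubset !join_subG !joing_subr !andbT cycle_subG /=.
rewrite (mem_gen (_ : q \in _)) ?inE ?mem_commg // andbT.
have nE0 := subset_trans sES (normal_norm nZ0).
have eE : cmod1 E y Z0 = E.
  have Ny := subsetP (normal_norm nZ0) y Sy.
  apply: (idx_full (N := H) (x := w)) => //.
  - apply/subsetP=> h Hh; apply/(cmod1P _ nE0 Ny); split; first exact: (subsetP sHE).
    by apply: (subsetP (joing_subr _ _)); apply: (subsetP cHS); apply: mem_commg.
  - exact: cmod1_sub.
  - by rewrite iH.
  - apply/(cmod1P _ nE0 Ny); split=> //; apply: (subsetP (joing_subl _ _)); exact: cycle_id.
rewrite gen_subG; apply/subsetP=> _ /imset2P[x s Ex Ss ->].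
apply: (comm_full nZ0 (joing_subr _ _) Ex Sy nEy) => //.
by move: Ex; rewrite -{1}eE => /(cmod1P _ nE0 (subsetP (normal_norm nZ0) y Sy))[].
Qed.

(** Otherwise y and its conjugate by a would both stabilise the chain E, Z <*> Za, Za, Phi(E), and
    [chain_conj] would give P :^ a = P. *)
Let Z_move a : a \in A -> P :^ a != P -> ~~ (a @: Z \subset H).
Proof.
move=> Aa nPa; apply: contra nPa => sZaH; apply/eqP; have [y Sy nEy] := out_S.
have Ea := autA Aa; pose Za := Group (Aut_img_group Ea sZE).
have sQZa : 'Phi(E) \subset Za by rewrite -{1}(imQ Aa); apply: imsetS.
have sX : Z <*> Za \subset H by rewrite join_subG sZH.
have sXE := subset_trans sX sHE.
have cZy x : x \in E -> [~ x, y] \in Z by move=> Ex; rewrite mem_gen // inE mem_commg.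
have cHy x : x \in H -> [~ x, y] \in 'Phi(E) by move=> Hx; rewrite (subsetP cHS) // mem_commg.
apply: (chain_conj (X1 := [group of Z <*> Za]) (X2 := Za) Aa Sy nEy) => //=.
- exact: joing_subr.
- by move=> x Ex; apply: (subsetP (joing_subl _ _)); apply: cZy.
- by move=> x Xx; apply: (subsetP sQZa); apply: cHy; apply: (subsetP sX).
- by move=> x Xx; apply: cHy; apply: (subsetP sZaH).
have h1 x : x \in E -> x^-1 * (cj y ^ a) x \in Za.
  by move=> Ex; apply: (conj_tact (X := E)) => //; rewrite imE.
apply/chain_stabP; split=> [|x Ex|x Xx|x Xx].
- by rewrite groupJ // (subsetP sPA) ?Pcj.
- by apply: (subsetP (joing_subr _ _)); apply: h1.
- by apply: h1; apply: (subsetP sXE).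
- have : x^-1 * (cj y ^ a) x \in a @: 'Phi(E); last by rewrite imQ.
  apply: (conj_tact (X := Z)) => // u Zu; apply: cHy; exact: (subsetP sZH).
Qed.

(** C is the intersection of the axes of P and P :^ a, and W is the product of their centres. On W /
    Phi(E) the elements s and s' act in the basis r, q as an upper and a lower elementary matrix,
    and [neg_word] gives z acting as -1 there and trivially on C / Phi(E). As z commutes with s
    modulo I, it normalises P and extends to b in B; t is the power of b that makes it an
    involution. *)
Lemma single_transv a : a \in A -> P :^ a != P -> exists (C W : {group gT}) t a1 g,
  [/\ transv p S E C W t a1, C :=: H :&: a @: H, t \in B, a1 \in P :^ a &
    g \in <<P :|: P :^ a>> /\ {in E, t =1 g}].
Proof.
move=> Aa nPa; have [y Sy nEy] := out_S; have Ea := autA Aa.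
pose s := cj y; pose s' := s ^ a.
have Ps : s \in P := Pcj Sy; have As := subsetP sPA s Ps; have As' : s' \in A by rewrite groupJ.
have Es := autA As; have Es' := autA As'.
have cHy x : x \in H -> [~ x, y] \in 'Phi(E) by move=> Hx; rewrite (subsetP cHS) // mem_commg.
have cZy x : x \in E -> [~ x, y] \in Z by move=> Ex; rewrite mem_gen // inE mem_commg.
pose Ha := Group (Aut_img_group Ea sHE); pose Za := Group (Aut_img_group Ea sZE).
have sHaE : Ha \subset E by apply: Aut_sub Ea _ sHE.
have sZHa : Za \subset Ha by apply: imsetS.
have sZaE := subset_trans sZHa sHaE.
have sQHa : 'Phi(E) \subset Ha by rewrite -{1}(imQ Aa); apply: imsetS.
have sQZa : 'Phi(E) \subset Za by rewrite -{1}(imQ Aa); apply: imsetS.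
have nZaH : ~~ (Za \subset H) := Z_move Aa nPa.
have nZHa : ~~ (Z \subset Ha).
  have := @Z_move a^-1; rewrite groupV => /(_ Aa) h.
  have nP' : P :^ a^-1 != P by apply: contra nPa => /eqP {1}<-; rewrite conjsgKV.
  apply: contra (h nP') => sZHa'; apply/subsetP=> _ /imsetP[x /(subsetP sZHa') /imsetP[u Hu ->] ->].
  by rewrite permK.
have iHa : #|E : Ha| = p.
  have e1 := Lagrange sHE; have e2 := Lagrange sHaE.
  rewrite [#|Ha|]card_imset in e2; last exact: perm_inj.
  by apply/eqP; rewrite -(eqn_pmul2l (cardG_gt0 H)) /= e2 -e1 iH.
have neH : H :!=: Ha by apply: contraNneq nZHa => <-.
pose C := [group of H :&: Ha].
have [_ _ eHHa iC] := max_meet pr_p pE sHE sHaE iH iHa neH.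
have sQC : 'Phi(E) \subset C by rewrite subsetI sQH.
have iZa : #|Za : 'Phi(E)| = p.
  have e1 := Lagrange sQZ; have e2 := Lagrange sQZa.
  rewrite [#|Za|]card_imset in e2; last exact: perm_inj.
  by apply/eqP; rewrite -(eqn_pmul2l (cardG_gt0 'Phi(E))) /= e2 -e1 iZ.
have meetQ (X Y : {group gT}) : #|X : 'Phi(E)| = p -> 'Phi(E) \subset X -> 'Phi(E) \subset Y ->
    ~~ (X \subset Y) -> X :&: Y = 'Phi(E).
  move=> iX sQX sQY nXY; case: (idx_cases (K := [group of X :&: Y]) _ _ (_ : prime #|X : 'Phi(E)|)).
  - by rewrite subsetI sQX.
  - exact: subsetIl.
  - by rewrite iX.
  - by [].
  by move=> e; case/negP: nXY; rewrite -e subsetIr.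
have mZHa : Z :&: Ha = 'Phi(E) by apply: meetQ.
have mZaH : Za :&: H = 'Phi(E) by apply: meetQ.
have mZZa : Z :&: Za = 'Phi(E) by apply: meetQ => //; apply: contra nZHa => /subset_trans->.
have nZS : Z <| S by apply: bet.
pose W := [group of Z <*> Za].
have eW : W :=: Z * Za.
  by apply: norm_joinEr; exact: subset_trans sZaE (subset_trans sES (normal_norm nZS)).
have sWE : W \subset E by rewrite join_subG sZE.
have sZW : Z \subset W := joing_subl _ _; have sZaW : Za \subset W := joing_subr _ _.
have sQW := subset_trans sQZ sZW.
have iW : #|W : 'Phi(E)| = (p ^ 2)%N.
  have := mul_cardG Z Za; rewrite -eW mZZa -(Lagrange sQZ) -(Lagrange sQZa) -(Lagrange sQW) iZ iZa.
  move=> e; apply/eqP; rewrite -(eqn_pmul2l (cardG_gt0 'Phi(E))) -(eqn_pmul2r (cardG_gt0 'Phi(E))).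
  by rewrite -e -mulnn; apply/eqP; ring.
have WH : W :&: H = Z.
  rewrite eW -group_modl // mZaH; apply: mulGSid => //.
have WC0 : W :&: C = 'Phi(E) by rewrite setIA WH mZHa.
have sCE : C \subset E := subset_trans (subsetIl _ _) sHE.
have WC : W * C = E.
  apply/eqP; rewrite eqEcard mul_subG //=.
  have := mul_cardG W C; rewrite WC0 -(Lagrange sQW) iW => e.
  rewrite -(leq_pmul2r (cardG_gt0 'Phi(E))) -e -(Lagrange sHE) iH -(Lagrange (subsetIl H Ha)) iC -mulnn.
  by apply: eq_leq; ring.
have s2 x : x \in E -> x^-1 * s' x \in Za.
  by move=> Ex; apply: (conj_tact (X := E)) => //; rewrite imE.
have s1 x : x \in Ha -> x^-1 * s' x \in 'Phi(E).
  by move=> Hx; rewrite -(imQ Aa); apply: (conj_tact (X := H)).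
have s3 x : x \in E -> x \notin Ha -> x^-1 * s' x \notin 'Phi(E).
  move=> Ex nHx; move: Ex nHx; rewrite -{1}(imE Aa) => /imsetP[x0 Ex0 ->] nHx.
  have nH0 : x0 \notin H by apply: contra nHx => Hx; apply: imset_f.
  apply: contra nH0; rewrite permJ cjE // -(AutV Ea) // -(AutM Ea) ?groupV ?memJ_norm ?(subsetP nE) //.
  rewrite -commgEl => /(stabK (iQ Aa)); exact: axis_y.
have tQ u : u \in A -> stab u 'Phi(E) := @iQ u.
have [r Zr nHr] := subsetPn nZaH; have Er := subsetP sZaE r Zr; have Har := subsetP sZHa r Zr.
pose q := [~ r, y]; have Zq : q \in Z := cZy r Er; have Eq := subsetP sZE q Zq.
have nQq : q \notin 'Phi(E) by apply: contra nHr; apply: axis_y.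
have nHaq : q \notin Ha.
  by apply: contra nQq => Haq; rewrite -mZHa inE Zq.
have cycQ (X : {group gT}) x : #|X : 'Phi(E)| = p -> 'Phi(E) \subset X -> X \subset E -> x \in X ->
    x \notin 'Phi(E) -> X :=: <[x]> <*> 'Phi(E).
  move=> iX sQX sXE Xx nQx; apply/esym; apply: (idx_full (N := [group of 'Phi(E)]) (x := x)) => //.
  - exact: joing_subr.
  - by rewrite join_subG cycle_subG Xx.
  - by rewrite iX.
  - by apply: (subsetP (joing_subl _ _)); apply: cycle_id.
have nQr : r \notin 'Phi(E) by apply: contra nHr; apply: (subsetP sQH).
have eZa := cycQ Za r iZa sQZa sZaE Zr nQr; have eZ := cycQ Z q iZ sQZ sZE Zq nQq.
have [j npj ej] : exists2 j, ~~ (p %| j) & c (s' q) = c (q * r ^+ j).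
  have := s2 q Eq; rewrite eZa norm_joinEl; last by rewrite cycle_subG (subsetP nEQ).
  case/mulsgP=> _ n /cycleP[j ->] Qn e; exists j.
    apply: contra (s3 q Eq nHaq) => /dvdnP[k ek]; rewrite e groupM //.
    by rewrite ek mulnC expgM groupX // Phi_pow.
  have En := subsetP sQE n Qn.
  rewrite -(mulKVg q (s' q)) e mulgA. by rewrite (cM _ En) ?(c_id Qn) ?mulg1 // groupM ?groupX.
have Qa := s1 r Har; have Qb := cHy q (subsetP sZH q Zq).
have [| | |z zG [zq zr]] := @neg_word gT p E [group of 'Phi(E)] pr_p nEQ s s' q r j Es Es'
  (tQ s As) (tQ s' As') Eq Er (cC Eq Er) (Phi_pow pE Er) npj _ _ _ ej.
- by rewrite cjE // conjg_mulR.
- by rewrite cjE // conjg_mulR -[LHS]/(c _) cM ?(subsetP sQE _ Qb) // (c_id Qb) mulg1.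
- by rewrite -(mulKVg r (s' r)) -[LHS]/(c _) cM ?(subsetP sQE _ Qa) // (c_id Qa) mulg1.
have s12A : <<[set s; s']>> \subset A by rewrite gen_subG subUset !sub1set As.
have Az := subsetP s12A z zG; have Ez := autA Az.
have zC x : x \in C -> x^-1 * z x \in 'Phi(E).
  move=> Cx; have : z \in Group (tact_group_set sA sCE sQC iQ).
    apply: subsetP zG; rewrite gen_subG subUset !sub1set; apply/andP; split; apply/tactP; split=> //.
      move=> u /setIP[Hu _]; rewrite cjE ?(subsetP sHE) // -commgEl; exact: cHy.
    by move=> u /setIP[_ Hu]; apply: s1.
  by case/tactP=> _; apply.
have zW x : x \in W -> x * z x \in 'Phi(E).
  have gK : group_set [set x in E | x * z x \in 'Phi(E)].
    apply/group_setP; split=> [|u v]; first by rewrite inE group1 (Aut_one Ez) mulg1 group1.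
    rewrite !inE => /andP[Eu hu] /andP[Ev hv]; rewrite groupM // (AutM Ez) //=.
    have := stE Az Eu; have := stE Az Ev; move=> Ezv Ezu.
    apply: coset_idr; first by rewrite (subsetP nEQ) ?groupM.
    rewrite -[LHS]/(c _) !cM ?groupM // -mulgA (mulgA (c v)) (cC Ev Ezu) -mulgA -cM //.
    rewrite (c_id hv) mulg1 -cM // c_id //.
  have inv1 v : v \in E -> c (z v) = c v^-1 -> v \in Group gK.
    move=> Ex e; rewrite inE Ex /=; apply: coset_idr; first by rewrite (subsetP nEQ) ?groupM ?stE.
    by rewrite -[LHS]/(c _) cM ?stE // e cV // mulgV.
  suff sWK : W \subset Group gK by move/(subsetP sWK); rewrite inE => /andP[].
  rewrite join_subG eZ eZa !join_subG !cycle_subG !inv1 //= ?andbT.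
  have sQK : 'Phi(E) \subset [set x in E | x * z x \in 'Phi(E)].
    apply/subsetP=> u Qu; rewrite inE (subsetP sQE) // groupM //; exact: tQ.
  by rewrite sQK.
have czW x : x \in W -> c (z x) = (c x)^-1.
  move=> Wx; have Ex := subsetP sWE x Wx; apply: (mulgI (c x)).
  by rewrite mulgV -cM ?stE // c_id // zW.
have czC x : x \in C -> c (z x) = c x.
  move=> Cx; have Ex := subsetP sCE x Cx; have Q1 := zC x Cx.
  by rewrite -(mulKVg x (z x)) cM ?(subsetP sQE _ Q1) // (c_id Q1) mulg1.
have csC x : x \in C -> c (s x) = c x.
  move=> Cx; have Ex := subsetP sCE x Cx; have Q1 := cHy x (subsetP (subsetIl _ _) x Cx).
  by rewrite cjE // conjg_mulR cM ?(subsetP sQE _ Q1) // (c_id Q1) mulg1.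
have cong u x x' : u \in A -> x \in E -> x' \in E -> c x = c x' -> c (u x) = c (u x').
  move=> Au Ex Ex'; apply: (coset_congr nEQ) => //; first exact: autA.
  exact: tQ.
have zs : {in E, forall x, c (z (s x)) = c (s (z x))}.
  move=> x; rewrite -{1}WC => /mulsgP[w d Ww Cd ->].
  have [Ew Ed] := (subsetP sWE w Ww, subsetP sCE d Cd).
  rewrite !(AutM Es, AutM Ez) ?stE // !cM ?stE //.
  congr (_ * _); last first.
    transitivity (c d).
      by rewrite -[RHS](czC d Cd); apply: cong; rewrite ?stE ?csC.
    by rewrite -[LHS](csC d Cd); apply: cong; rewrite ?stE ?czC.
  have Wsw : s w \in W.
    by rewrite cjE // conjg_mulR groupM // (subsetP sZW) // cZy.
  rewrite czW //; transitivity (c (s w^-1)); first by rewrite (AutV Es) // cV ?stE.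
  by apply: cong; rewrite ?stE ?groupV // czW // cV.
have PzP : P :^ z = P.
  apply/eqP; rewrite eqEcard cardJg leqnn andbT; apply: (P_subJ (X := P) Az Sy nEy) => //.
  rewrite -(mulKVg s (cj y ^ z)) groupM // (subsetP sIP) //; exact: comm_mod_I.
have [b Bb bz] := ext Az PzP; have Sb := subsetP sB b Bb.
have bS x : x \in S -> b x \in S by apply: Aut_stab.
have bSE x : x \in S -> x^-1 * b x \in E.
  have gK : group_set [set x in S | x^-1 * b x \in E].
    apply/group_setP; split=> [|u v]; first by rewrite inE group1 (Aut_one Sb) mulg1 groupV group1.
    rewrite !inE => /andP[Su hu] /andP[Sv hv]; rewrite groupM // (AutM Sb) //=.
    have -> : (u * v)^-1 * (b u * b v) = (u^-1 * b u) ^ v * (v^-1 * b v).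
      by rewrite invMg conjgE !mulgA mulgK.
    by rewrite groupM // memJ_norm // (subsetP nE).
  suff eS : Group gK :=: S by move=> Sx; move: Sx; rewrite -{1}eS inE => /andP[].
  apply: (@S_full _ y) => //.
  - by apply/subsetP=> u; rewrite inE => /andP[].
  - apply/subsetP=> u Eu; rewrite inE (subsetP sES) //= bz // groupM ?groupV ?stE //.
  rewrite inE Sy /=; apply: cj_I; first by rewrite groupM ?groupV ?bS.
  have nEx v : v \in S -> v \in 'N(E) by apply: subsetP.
  rewrite morphM ?groupV ?nEx ?bS // morphV ?nEx //=.
  have -> : cj (b y) = cj y ^ z; last exact: comm_mod_I.
  apply/permP=> x1; case: (boolP (x1 \in E)) => [Ex | nx]; last first.
    by rewrite (out_Aut _ nx) ?(out_Aut _ nx) ?Aut_aut ?autA ?groupJ.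
  move: Ex; rewrite -{1}(imE Az) => /imsetP[x0 Ex0 ->].
  rewrite permJ !cjE ?bS ?stE // -!bz ?memJ_norm ?nEx // (AutJ Sb) //.
  exact: (subsetP sES).
(* k is the odd part of the order of b: b ^+ k has 2-power order and, k being odd, still acts as -1
   on W / Phi(E). *)
have [k [m [oddk ob]]] : exists k m, odd k /\ (2 ^ m * k)%N = #[b].
  exists (#[b]`_(2^'))%N, (logn 2 #[b]); rewrite -p_part partnC ?order_gt0 //.
  by rewrite odd_2'nat part_pnat.
pose t := b ^+ k; pose g := z ^+ k.
have bXS n x : x \in S -> x^-1 * (b ^+ n) x \in E.
  move=> Sx; elim: n => [|n IHn]; first by rewrite perm1 mulVg group1.
  rewrite expgSr permM; have S1 : (b ^+ n) x \in S by apply: (Aut_stab (groupX n Sb)).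
  by rewrite -(mulKVg ((b ^+ n) x) (b _)) mulgA groupM // bSE.
have bX n x : x \in E -> (b ^+ n) x = (z ^+ n) x /\ (z ^+ n) x \in E.
  move=> Ex; elim: n => [|n [IH1 IH2]]; first by rewrite !perm1.
  by rewrite !expgSr !permM IH1 bz // stE.
have zz x : x \in E -> x^-1 * (z ^+ 2) x \in 'Phi(E).
  move=> Ex; apply: c_eq => //; first by rewrite permM !stE.
  rewrite permM; move: Ex; rewrite -{1}WC => /mulsgP[w d Ww Cd ->].
  have [Ew Ed] := (subsetP sWE w Ww, subsetP sCE d Cd).
  rewrite !(AutM Ez) ?stE // !cM ?stE //; congr (_ * _).
    transitivity (c (z w^-1)).
      by rewrite (AutV Ez) // cV ?stE // czW // invgK.
    by apply: cong; rewrite ?stE ?groupV // czW // cV.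
  by rewrite -[LHS](czC d Cd); apply: cong; rewrite ?stE // czC.
have zzg n : z ^+ 2 ^+ n \in tact A E 'Phi(E).
  apply: (groupX (G := Group (tact_group_set sA (subxx E) sQE iQ))); apply/tactP; split=> //.
  exact: groupX.
have tz2 n : b ^+ n = 1 -> z ^+ n = 1.
  move=> b1; apply/permP=> x; rewrite perm1; case: (boolP (x \in E)) => [Ex | nx].
    by have [<- _] := bX n x Ex; rewrite b1 perm1.
  exact: (out_Aut (groupX n Ez)).
(* The square of z is trivial on V. So t ^+ 2, a 2-element, is trivial on E by coprime action, and
   then on S because it is trivial on S / E. *)
have t2 : t ^+ 2 = 1.
  have bm : b ^+ (k * 2 * 2 ^ m) = 1.
    have -> : (k * 2 * 2 ^ m = 2 ^ m * k * 2)%N by ring.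
    by rewrite ob expgM expg_order expg1n.
  have tb : t ^+ 2 ^+ (2 ^ m) = 1 by rewrite -bm !expgM.
  have g2 : (z ^+ 2) ^+ k = 1.
    have nd : 2 != p by apply: contraTneq odd_p => <-.
    apply: (trivial_mod_Phi (r := 2) pr_p _ nd _ pE) => //.
    - apply: (pnat_dvd (n := 2 ^ m)); last by rewrite pnatX pnat_id.
      rewrite order_dvdn; apply/eqP.
      have e : z ^+ 2 ^+ k ^+ (2 ^ m) = z ^+ (k * 2 * 2 ^ m).
        rewrite -!expgM; congr (_ ^+ _); ring.
      by rewrite e tz2.
    - by rewrite !groupX.
    - by have /tactP[_] := zzg k.
  have t2E x : x \in E -> (t ^+ 2) x = x.
    move=> Ex; have -> : t ^+ 2 = b ^+ (2 * k) by rewrite /t -expgM mulnC.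
    by have [-> _] := bX (2 * k)%N x Ex; rewrite expgM g2 perm1.
  apply/permP=> x; rewrite perm1; case: (boolP (x \in S)) => [Sx | nx]; last first.
    by apply: (out_Aut (groupX 2 (groupX k Sb))).
  apply: (trivial_mod_fixed pS (N := E) (u := t ^+ 2)) => //.
  - by rewrite !groupX.
  - apply: (pnat_dvd (n := 2 ^ m)); first by rewrite order_dvdn tb.
    have nd : 2 != p by apply: contraTneq odd_p => <-.
    by rewrite pnatX pnatE // !inE nd.
  by move=> v Sv; rewrite /t -expgM; apply: bXS.
have gE x : x \in E -> t x = g x by move=> Ex; have [] := bX k x Ex.
have gstE x : x \in E -> g x \in E by move=> Ex; have [] := bX k x Ex.
have gW x : x \in W -> x * g x \in 'Phi(E).
  move=> Wx; have Ex := subsetP sWE x Wx.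
  have -> : g = z * (z ^+ 2) ^+ k./2.
    by rewrite /g -expgM -expgS mul2n -[in LHS](odd_double_half k) oddk.
  rewrite permM -(mulKVg (z x) (_ (z x))) mulgA groupM ?zW //.
  by have /tactP[_] := zzg k./2; apply; apply: stE.
have gC x : x \in C -> x^-1 * g x \in 'Phi(E).
  have /tactP[_] : g \in tact A C 'Phi(E); last by apply.
  by apply: (groupX (G := Group (tact_group_set sA sCE sQC iQ))); apply/tactP.
exists C, W, t, s', g; split=> //; last 2 first.
- by rewrite memJ_conjg.
- split=> //; apply: groupX; apply: subsetP zG; apply: genS.
  by rewrite subUset !sub1set !inE Ps memJ_conjg Ps orbT.
- split=> //.
  + exact: subsetIl.
  + exact: groupX.
  + by move=> x; rewrite -permM -[t * t]/(t ^+ 2) t2 perm1.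
  + by move=> x Ex; rewrite gE ?gstE.
  + by move=> x Wx; rewrite gE ?gW // (subsetP sWE).
  + by move=> x Cx; rewrite gE ?gC // (subsetP sCE).
  + by move=> v Sv; apply: bXS.
  + by move=> x /setIP[_ Hx]; apply: s1.
  + move=> x Wx; rewrite -(mulKVg x (s' x)) groupM // (subsetP sZaW) // s2 // (subsetP sWE) //.
  + move=> x Zx nQx; have Ex := subsetP sZE x Zx.
    have nHax : x \notin Ha by apply: contra nQx => Hax; rewrite -mZHa inE Zx.
    apply: contra (s3 x Ex nHax) => Hs; rewrite -mZaH inE s2 //=.
    by rewrite groupM ?groupV // (subsetP sZH).
- exact: groupX.
Qed.

End TransvectionCase.

(** * Axis not a hyperplane: irreducibility *)

Let fix_meet X : X <| S -> 'Phi(E) \subset X -> X \subset E -> X :!=: 'Phi(E) ->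
  exists2 x, x \in X & x \in axis S E /\ x \notin 'Phi(E).
Proof.
move=> nXS sQX sXE neX; have sXS := normal_sub nXS.
have nX := subset_trans sXE nEQ.
have : (X / 'Phi(E)) :&: 'Z(S / 'Phi(E)) != 1.
  apply: meet_center_nil; rewrite ?quotient_normal ?(pgroup_nil (quotient_pgroup _ pS)) //.
  rewrite -subG1 quotient_sub1 //; apply: contra neX => sXQ.
  by rewrite eqEsubset sXQ.
rewrite -subG1 => /subsetPn[_ /setIP[/morphimP[x Nx Xx ->] /centerP[_ cx]] nx].
exists x => //; split.
  apply/(cmodP _ nEQ nS); split=> [|s Ss]; first exact: (subsetP sXE).
  have Ns := subsetP nS s Ss; apply: coset_idr; first by rewrite groupR.
  by rewrite morphR //; apply/eqP/commgP; apply: cx; apply: mem_quotient.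
by apply: contra nx => Qx; rewrite inE; apply/eqP/coset_id.
Qed.

(** The axis must be a line in a space of dimension 3. A proper invariant X contains this line. On E
    / X or X / Phi(E), whichever is a plane, [neg_word] yields z acting as -1, while z is trivial on
    the other factor. Since z commutes with s on V, the plane and the line separate under s, which
    makes the axis larger than it is. *)
Lemma single_irr : #|E : axis S E| != p -> irr_on p A E /\ #|axis S E : 'Phi(E)| = p.
Proof.
set H := [group of axis S E] => niH; have [y Sy nEy] := out_S.
have cHy x : x \in H -> [~ x, y] \in 'Phi(E) by move=> Hx; rewrite (subsetP cHS) // mem_commg.
have nHE : ~~ (E \subset H).
  apply: contra neSE => sEH; rewrite -faithful (sub_cmod (subxx _) nS nEQ) commGC.
  exact: subset_trans (commSg _ sEH) cHS.
have ppow (X Y : {group gT}) : X \subset E -> Y \subset X -> exists k, #|X : Y| = (p ^ k)%N.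
  move=> sXE sYX; have /p_natP[k ek] : p.-nat #|X : Y|; last by exists k.
  by apply: pnat_dvd (dvdn_indexg X Y) _; apply: pgroupS sXE pE.
have lt1 (X Y : {group gT}) k : ~~ (X \subset Y) -> #|X : Y| = (p ^ k)%N -> 0 < k.
  by rewrite -indexg_eq1; case: k => // h e; rewrite e in h.
have neE : E :!=: 'Phi(E) by apply: contraNneq nHE => ->.
have nHQ : ~~ (H \subset 'Phi(E)).
  have [x Ex [Hx nQx]] := fix_meet nES sQE (subxx _) neE.
  by apply/subsetPn; exists x.
have [iEH iHQ] : #|E : H| = (p ^ 2)%N /\ #|H : 'Phi(E)| = p.
  have [k ek] := ppow E H (subxx _) sHE; have [m em] := ppow H [group of 'Phi(E)] sHE sQH.
  have k0 := lt1 _ _ _ nHE ek; have m0 := lt1 H [group of 'Phi(E)] m nHQ em.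
  have le : k + m <= 3.
    have := rS sES; rewrite -(Lagrange_index sHE sQH) ek em -expnD leq_exp2l //.
    exact: prime_gt1.
  have k2 : 1 < k.
    by rewrite ltn_neqAle k0 andbT; apply: contraNneq niH => k1; rewrite ek -k1 expn1.
  have ek2 : k = 2.
    by apply/eqP; rewrite eqn_leq k2 andbT -ltnS -addn1; apply: leq_trans le; rewrite leq_add2l.
  have em1 : m = 1%N by apply/eqP; rewrite eqn_leq m0 andbT; move: le; rewrite ek2.
  by rewrite ek em ek2 em1 expn1.
have iEQ : #|E : 'Phi(E)| = (p ^ 3)%N by rewrite -(Lagrange_index sHE sQH) iEH iHQ -expnSr.
split=> //; split=> // X sQX sXE iX.
have [eXQ | neXQ] := eqVneq (X : {set gT}) 'Phi(E); first by left.
have [eXE | neXE] := eqVneq (X : {set gT}) E; first by right.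
exfalso; have [a Aa nPa] := conj_neq; have Ea := autA Aa.
have imX g : g \in A -> g @: X = X by move=> Ag; apply: (stab_imset g X).1; apply: iX.
have nXS : X <| S.
  rewrite /normal (subset_trans sXE sES); apply/subsetP=> s Ss; rewrite inE.
  apply/subsetP=> _ /imsetP[x Xx ->]; rewrite -cjE ?(subsetP sXE) //.
  by apply: (iX _ (subsetP sPA _ (Pcj Ss))).
have sHX : H \subset X.
  have [x Xx [Hx nQx]] := fix_meet nXS sQX sXE neXQ.
  have <- : H :&: X = H; last exact: subsetIr.
  apply: (idx_full (N := [group of 'Phi(E)]) (K := [group of H :&: X]) (x := x)) => //.
  - by rewrite subsetI sQH.
  - exact: subsetIl.
  - by rewrite iHQ.
  - by rewrite inE Hx.
pose s := cj y; pose s' := s ^ a.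
have Ps : s \in P := Pcj Sy; have As := subsetP sPA s Ps; have As' : s' \in A by rewrite groupJ.
have Es := autA As; have Es' := autA As'.
have tQ g : g \in A -> stab g 'Phi(E) := @iQ g.
have cong u x x' : u \in A -> x \in E -> x' \in E -> c x = c x' -> c (u x) = c (u x').
  by move=> Au Ex Ex'; apply: (coset_congr nEQ) => //; [exact: autA | exact: tQ].
have s12A : <<[set s; s']>> \subset A by rewrite gen_subG subUset !sub1set As.
have cyc (X1 N : {group gT}) x : #|X1 : N| = p -> N \subset X1 -> x \in X1 -> x \notin N ->
    X1 :=: <[x]> <*> N.
  move=> iX1 sN Xx nNx; apply/esym; apply: (idx_full (N := N) (x := x)) => //.
  - exact: joing_subr.
  - by rewrite join_subG cycle_subG Xx.
  - by rewrite iX1.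
  - by apply: (subsetP (joing_subl _ _)); apply: cycle_id.
(* s' moves q by a nontrivial power of r modulo N *)
have pw (X1 N : {group gT}) q r : #|X1 : N| = p -> N \subset X1 -> X1 \subset E -> 'Phi(E) \subset N ->
    r \in X1 -> r \notin N -> q \in E -> q^-1 * s' q \in X1 -> q^-1 * s' q \notin N ->
    exists2 j, ~~ (p %| j) & coset N (s' q) = coset N (q * r ^+ j).
  move=> iX1 sN s1 sQN Xr nNr Eq Xq nNq.
  have nN : E \subset 'N(N).
    by rewrite -commg_subl; apply: subset_trans (subset_trans (commSg _ (subset_trans sN s1)) dE) sQN.
  have Er := subsetP s1 r Xr.
  move: Xq; rewrite (cyc X1 N r) // norm_joinEl; last by rewrite cycle_subG (subsetP nN).
  case/mulsgP=> _ n /cycleP[j ->] Qn e; exists j.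
    apply: contra nNq => /dvdnP[k ek]; rewrite e groupM //.
    by rewrite ek mulnC expgM groupX // (subsetP sQN) // Phi_pow.
  have En := subsetP (subset_trans sN s1) n Qn.
  rewrite -(mulKVg q (s' q)) e mulgA morphM ?(subsetP nN) ?groupM ?groupX //=.
  by rewrite (coset_id Qn) mulg1.
have ims3 (X1 Y1 : {group gT}) x : X1 \subset E -> Y1 \subset E ->
    {in X1, forall x, [~ x, y] \in Y1} -> x \in a @: X1 -> x^-1 * s' x \in a @: Y1.
  by move=> s1 s2 h; apply: conj_tact.
have ims4 (N : {group gT}) x : N \subset E -> a @: N = N -> x \in E -> x^-1 * s' x \in N ->
    exists2 x0, x0 \in E & x = a x0 /\ [~ x0, y] \in N.
  move=> sNE eN Ex; move: (Ex); rewrite -{1}(imE Aa) => /imsetP[x0 Ex0 ->] hN.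
  exists x0 => //; split=> //; move: hN.
  rewrite permJ cjE // -(AutV Ea) // -(AutM Ea) ?groupV ?memJ_norm ?(subsetP nE) // -commgEl.
  by rewrite -{1}eN => /imsetP[v Nv /perm_inj->].
(* First case: X is the line H. The signs of z are -1 on E / H and 1 on H / Phi(E). *)
have [eXH | neXH] := eqVneq (X : {set gT}) H.
  have iH : invar A H by move=> g Ag x; rewrite /= -eXH; apply: iX.
  have imH g : g \in A -> g @: H = H by move=> Ag; apply: (stab_imset g H).1; apply: iH.
  have nnH := normal_norm nH; have nEH := subset_trans sES nnH.
  have ltHE : H \proper E by rewrite properE sHE.
  have [Y [sHY ltY nYS iEY]] := pquot_gt pr_p pS nH nES ltHE.
  have sYE := proper_sub ltY; have sQY := subset_trans sQH sHY.
  have iYH : #|Y : H| = p.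
    have := Lagrange_index sYE sHY; rewrite iEY iEH -mulnn => /eqP.
    by rewrite eqn_pmul2l ?prime_gt0 // => /eqP.
  have cEY := pcentral pr_p pS nYS nES sYE iEY; have cYH := pcentral pr_p pS nH nYS sHY iYH.
  have cEYy x : x \in E -> [~ x, y] \in Y by move=> Ex; rewrite (subsetP cEY) // mem_commg.
  have cYHy x : x \in Y -> [~ x, y] \in H by move=> Ex; rewrite (subsetP cYH) // mem_commg.
  have nEH' : ~~ ([~: E, S] \subset H).
    apply/negP=> sEH.
    pose f x := c [~ x, y].
    have fM : {in E &, {morph f : x x' / x * x'}}.
      move=> x x' Ex Ex'; rewrite /f commMgJ.
      have E1 z : z \in E -> [~ z, y] \in E by move=> Ez; apply: (subsetP sYE); apply: cEYy.
      have Exy := E1 x Ex; have Exy' := E1 x' Ex'.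
      have Q1 : [~ [~ x, y], x'] \in 'Phi(E) by rewrite (subsetP dE) // mem_commg.
      rewrite (cM (groupJ Exy Ex') Exy') conjg_mulR (cM Exy (subsetP sQE _ Q1)).
      by rewrite (c_id Q1) mulg1.
    have : #|E : H| <= p.
      rewrite (index_ker fM (K := H)).
        rewrite -iHQ -card_quotient ?(subset_trans sHE) //; apply: subset_leq_card.
        apply/subsetP=> _ /imsetP[x Ex ->]; apply: mem_quotient.
        by apply: (subsetP sEH); apply: mem_commg.
      move=> x; apply/idP/andP => [Hx | [Ex /eqP h]].
        by rewrite (subsetP sHE) //; split=> //; apply/eqP/c_id/cHy.
      apply: (axis_y Sy nEy Ex); apply: coset_idr h.
      by rewrite (subsetP nEQ) // (subsetP sYE) // cEYy.
    by rewrite iEH (leq_p2 pr_p).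
  have cnH x : x \in E -> x \notin Y -> [~ x, y] \notin H.
    move=> Ex nYx; apply: contra nEH' => hx.
    have Ny := subsetP nnH y Sy.
    have eE : cmod1 E y H = E.
      apply: (idx_full (N := Y) (x := x)) => //.
      - apply/subsetP=> v Yv; apply/(cmod1P _ nEH Ny); split; first exact: (subsetP sYE).
        exact: cYHy.
      - exact: cmod1_sub.
      - by rewrite iEY.
      - by apply/(cmod1P _ nEH Ny).
    rewrite gen_subG; apply/subsetP=> _ /imset2P[v u Ev Su ->].
    apply: (comm_full nH sQH Ev Sy nEy) => //.
    by move: Ev; rewrite -{1}eE => /(cmod1P _ nEH Ny)[].
  pose Ya := Group (Aut_img_group Ea sYE).
  have sYaE : Ya \subset E by apply: Aut_sub Ea _ sYE.
  have cYa : #|Ya| = #|Y| by apply: card_imset; apply: perm_inj.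
  have sHYa : H \subset Ya by rewrite -(imH a Aa); apply: imsetS.
  have h1 x : x \in E -> x^-1 * s' x \in Ya.
    by move=> Ex; apply: (ims3 E Y) => //; rewrite imE.
  have h2 x : x \in Ya -> x^-1 * s' x \in H.
    by move=> Yx; rewrite -(imH a Aa); apply: (ims3 Y H).
  have h3 x : x \in H -> x^-1 * s' x \in 'Phi(E).
    by move=> Hx; rewrite -(imQ Aa); apply: (ims3 H [group of 'Phi(E)]) => //; rewrite imH.
  have nYa : ~~ (Ya \subset Y).
    apply: contra nPa => sYa; apply/eqP; apply: (chain_conj (X1 := Y) (X2 := H) Aa Sy nEy) => //.
    have eYa : Ya :=: Y by apply/eqP; rewrite eqEcard sYa cYa leqnn.
    apply/chain_stabP; split=> // [x Ex|x Yx]; first by rewrite -eYa h1.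
    by apply: h2; rewrite eYa.
  have iYaH : #|Ya : H| = p.
    have e1 := Lagrange sHY; have e2 := Lagrange sHYa; rewrite cYa -e1 iYH in e2.
    by apply/eqP; rewrite -(eqn_pmul2l (cardG_gt0 H)) e2.
  have [r Yar nYr] := subsetPn nYa; have Er := subsetP sYaE r Yar.
  pose q := [~ r, y]; have Yq : q \in Y := cEYy r Er; have Eq := subsetP sYE q Yq.
  have nHq : q \notin H := cnH r Er nYr.
  have nHr : r \notin H by apply: contra nYr; apply: (subsetP sHY).
  have nYaq : q \notin Ya.
    apply/negP=> Yaq; case/negP: nYa.
    have eY : Y :&: Ya = Y.
      apply: (idx_full (N := H) (K := [group of Y :&: Ya]) (x := q)) => //.
      - by rewrite subsetI sHY.
      - exact: subsetIl.
      - by rewrite iYH.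
      - by rewrite inE Yq.
    suff -> : Ya :=: Y by [].
    by apply/esym/eqP; rewrite eqEcard cYa leqnn andbT -eY subsetIr.
  have nHsq : q^-1 * s' q \notin H.
    apply: contra nYaq => hq; have [x0 Ex0 [-> h]] := ims4 H q sHE (imH a Aa) Eq hq.
    apply: imset_f; apply: contraTT h; exact: cnH.
  have [j npj ej] := pw Ya H q r iYaH sHYa sYaE sQH Yar nHr Eq (h1 q Eq) nHsq.
  have tH g : g \in A -> stab g H := @iH g.
  have cHc x x' : x \in E -> x' \in E -> commute (coset H x) (coset H x').
    move=> Ex Ex'; apply/commgP; rewrite -morphR ?(subsetP nEH) //; apply/eqP/coset_id.
    by apply: (subsetP sQH); apply: (subsetP dE); apply: mem_commg.
  have cHM x x' : x \in E -> x' \in H -> coset H (x * x') = coset H x.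
    move=> Ex Hx'; rewrite morphM ?(subsetP nEH) ?(subsetP sHE x') //=.
    by rewrite (coset_id Hx') mulg1.
  have [|||z zG [zq zr]] := @neg_word gT p E H pr_p nEH s s' q r j Es Es' (tH s As) (tH s' As')
    Eq Er (cHc q r Eq Er) (subsetP sQH _ (Phi_pow pE Er)) npj _ _ _ ej.
  - by rewrite cjE // conjg_mulR.
  - by rewrite cjE // conjg_mulR cHM // cYHy.
  - by rewrite -(mulKVg r (s' r)) cHM // h2.
  have Az := subsetP s12A z zG; have Ez := autA Az.
  have zHQ x : x \in H -> x^-1 * z x \in 'Phi(E).
    move=> Hx; have : z \in Group (tact_group_set sA sHE sQH iQ).
      apply: subsetP zG; rewrite gen_subG subUset !sub1set; apply/andP; split; apply/tactP; split=> //.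
      by move=> u Hu; rewrite cjE ?(subsetP sHE) // -commgEl; exact: cHy.
    by case/tactP=> _; apply.
  have czH x : x \in H -> c (z x) = c x.
    move=> Hx; have Q1 := zHQ x Hx; rewrite -(mulKVg x (z x)) cM ?(subsetP sQE _ Q1) ?(subsetP sHE x) //.
    by rewrite (c_id Q1) mulg1.
  have csH x : x \in H -> c (s x) = c x.
    move=> Hx; have Q1 := cHy x Hx.
    by rewrite cjE ?(subsetP sHE x) // conjg_mulR cM ?(subsetP sQE _ Q1) ?(subsetP sHE x) // (c_id Q1) mulg1.
  have zE x : x \in E -> coset H (z x) = (coset H x)^-1.
    have gK : group_set [set x in E | coset H (z x) == (coset H x)^-1].
      apply/group_setP; split=> [|u v].
        by rewrite inE group1 (Aut_one Ez) morph1 invg1 eqxx.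
      rewrite !inE => /andP[Eu /eqP hu] /andP[Ev /eqP hv]; rewrite groupM // (AutM Ez) //=.
      rewrite !morphM ?(subsetP nEH) ?stE //= hu hv invMg.
      by apply/eqP; rewrite -!morphV ?(subsetP nEH) //=; apply: cHc; rewrite groupV.
    have sKE : Group gK \subset E by apply/subsetP=> u; rewrite inE => /andP[].
    have sHK : H \subset Group gK.
      apply/subsetP=> u Hu; rewrite inE (subsetP sHE) //= (coset_id Hu) invg1.
      by apply/eqP/coset_id; apply: iH.
    have Kq : q \in Group gK by rewrite inE Eq zq morphV ?(subsetP nEH) //=.
    have Kr : r \in Group gK by rewrite inE Er zr morphV ?(subsetP nEH) //=.
    have sYK : Y \subset Group gK.
      by rewrite (cyc Y H q) // join_subG sHK cycle_subG Kq.
    have eK : Group gK = E :> {set gT}.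
      by apply: (idx_full (N := Y) (x := r)) => //; rewrite iEY.
    by move=> Ex; move: Ex; rewrite -{1}eK inE => /andP[_ /eqP].
  have congH u x x' : u \in A -> x \in E -> x' \in E -> coset H x = coset H x' -> coset H (u x) = coset H (u x').
    by move=> Au Ex Ex'; apply: (coset_congr nEH) => //; [exact: autA | exact: tH].
  have zs : {in E, forall x, c (z (s x)) = c (s (z x))}.
    have hQ : {in H, forall x, (z (s x))^-1 * s (z x) \in 'Phi(E)}.
      move=> x Hx; have Ex := subsetP sHE x Hx.
      by apply: c_eq; rewrite ?stE // czH ?csH ?czH // iH.
    apply: (chain_comm (X1 := H) (X2 := H)) => // x Ex; last first.
      by apply: (subsetP sQH); apply: hQ.
    have e1 : coset H (z (s x)) = coset H (s (z x)).
      rewrite zE ?stE // -morphV ?(subsetP nEH) ?stE //= -(AutV Es) //.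
      by apply: congH; rewrite ?stE ?groupV // zE // morphV ?(subsetP nEH).
    apply: coset_idr; first by rewrite (subsetP nEH) ?groupM ?groupV ?stE.
    by rewrite morphM ?groupV ?(subsetP nEH) ?stE // morphV ?(subsetP nEH) ?stE //= e1 mulVg.
  (* s multiplies q by cc, which lies in H. Since z fixes cc and inverts q modulo H, equality of z s
     and s z at q gives cc ^+ 2 = 1 on V, so q would be in the axis. *)
  have Ezq := stE Az Eq; have Hcc := cYHy q Yq; have Ecc := subsetP sHE _ Hcc.
  have Hh : z q * q \in H.
    have Nzq : z q * q \in 'N(H) by apply: (subsetP nEH); rewrite groupM.
    apply: (coset_idr Nzq).
    by rewrite morphM ?(subsetP nEH) //= zE // mulVg.
  have Eh := subsetP sHE _ Hh; pose cc := [~ q, y].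
  have sq : s q = q * cc by rewrite /s cjE // conjg_mulR.
  have e1 : c (z (s q)) = c (z q) * c cc.
    by rewrite sq (AutM Ez) // cM ?stE // (czH cc Hcc).
  have e2 : c (s (z q)) = c (z q) * (c cc)^-1.
    have -> : s (z q) = s (z q * q) * (s q)^-1 by rewrite (AutM Es) // mulgK.
    rewrite cM ?groupV ?stE // (csH _ Hh) sq invMg (cM (groupVr Ecc) (groupVr Eq)) (cV Ecc).
    by rewrite (cM Ezq Eq) -(cV Ecc) (cC (groupVr Ecc) (groupVr Eq)) (cV Eq) mulgA mulgK.
  have := zs q Eq; rewrite e1 e2 => /mulgI e3.
  case/negP: nHq; apply: (axis_y Sy nEy Eq); rewrite -/cc.
  apply: (invol_odd odd_p pS); first exact: (subsetP sES).
  apply: coset_idr; first by rewrite (subsetP nEQ) ?groupX.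
  by rewrite -[LHS]/(c _) cX // expgS expg1 {1}e3 mulVg.
(* Second case: X is a plane. The signs of z are -1 on X / Phi(E) and 1 on E / X. *)
have iXH : #|X : H| = p /\ #|E : X| = p.
  have e := Lagrange_index sXE sHX; rewrite iEH in e.
  have [k ek] := ppow X H sXE sHX; have [m em] := ppow E X (subxx _) sXE.
  have k0 : 0 < k.
    apply: lt1 ek; apply: contra neXH => sXH; by rewrite eqEsubset sXH.
  have m0 : 0 < m.
    apply: lt1 em; apply: contra neXE => sEX; by rewrite eqEsubset sXE.
  move: e; rewrite ek em -expnD => /eqP; rewrite eqn_exp2l ?(prime_gt1 pr_p) //.
  case: k k0 {ek} => [|[|k]] // _; case: m m0 {em} => [|[|m]] // _; rewrite !addSn !addnS //.
have [iXH' iEX] := iXH.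
have nnX := normal_norm nXS; have nEX := subset_trans sES nnX.
have cEX := pcentral pr_p pS nXS nES sXE iEX; have cXH := pcentral pr_p pS nH nXS sHX iXH'.
have cEXy x : x \in E -> [~ x, y] \in X by move=> Ex; rewrite (subsetP cEX) // mem_commg.
have cXHy x : x \in X -> [~ x, y] \in H by move=> Ex; rewrite (subsetP cXH) // mem_commg.
pose Ha := Group (Aut_img_group Ea sHE).
have cHa : #|Ha| = #|H| by apply: card_imset; apply: perm_inj.
have sHaX : Ha \subset X by rewrite -(imX a Aa); apply: imsetS.
have sHaE := subset_trans sHaX sXE.
have sQHa : 'Phi(E) \subset Ha by rewrite -{1}(imQ Aa); apply: imsetS.
have h1 x : x \in E -> x^-1 * s' x \in X.
  by move=> Ex; rewrite -(imX a Aa); apply: (ims3 E X) => //; rewrite imE.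
have h2 x : x \in X -> x^-1 * s' x \in Ha.
  by move=> Xx; apply: (ims3 X H) => //; rewrite imX.
have h3 x : x \in Ha -> x^-1 * s' x \in 'Phi(E).
  by move=> Hx; rewrite -(imQ Aa); apply: (ims3 H [group of 'Phi(E)]).
have nHa : ~~ (Ha \subset H).
  apply: contra nPa => sHa; apply/eqP; apply: (chain_conj (X1 := X) (X2 := H) Aa Sy nEy) => //.
  have eHa : Ha :=: H by apply/eqP; rewrite eqEcard sHa cHa leqnn.
  apply/chain_stabP; split=> // [x Xx|x Hx]; first by rewrite -eHa h2.
  by apply: h3; rewrite eHa.
have iHaQ : #|Ha : 'Phi(E)| = p.
  have e1 := Lagrange sQH; have e2 := Lagrange sQHa; rewrite cHa -e1 iHQ in e2.
  by apply/eqP; rewrite -(eqn_pmul2l (cardG_gt0 'Phi(E))) e2.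
have [r Har nHr] := subsetPn nHa; have Er := subsetP sHaE r Har; have Xr := subsetP sHaX r Har.
pose q := [~ r, y]; have Hq : q \in H := cXHy r Xr; have Eq := subsetP sHE q Hq.
have nQq : q \notin 'Phi(E) by apply: contra nHr; apply: axis_y.
have nQr : r \notin 'Phi(E) by apply: contra nHr; apply: (subsetP sQH).
have nHaq : q \notin Ha.
  apply/negP=> Haq; case/negP: nHa.
  have eY : H :&: Ha = H.
    apply: (idx_full (N := [group of 'Phi(E)]) (K := [group of H :&: Ha]) (x := q)) => //.
    - by rewrite subsetI sQH.
    - exact: subsetIl.
    - by rewrite iHQ.
    - by rewrite inE Hq.
  suff -> : Ha :=: H by [].
  by apply/esym/eqP; rewrite eqEcard cHa leqnn andbT -eY subsetIr.
have nQsq : q^-1 * s' q \notin 'Phi(E).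
  apply: contra nHaq => hq.
  have [x0 Ex0 [-> h]] := ims4 [group of 'Phi(E)] q sQE (imQ Aa) Eq hq.
  by apply: imset_f; apply: axis_y h.
have [j npj ej] := pw Ha [group of 'Phi(E)] q r iHaQ sQHa sHaE (subxx _) Har nQr Eq
  (h2 q (subsetP sHX q Hq)) nQsq.
have csH x : x \in H -> c (s x) = c x.
  move=> Hx; have Q1 := cHy x Hx.
  by rewrite cjE ?(subsetP sHE x) // conjg_mulR cM ?(subsetP sQE _ Q1) ?(subsetP sHE x) // (c_id Q1) mulg1.
have [|||z zG [zq zr]] := @neg_word gT p E [group of 'Phi(E)] pr_p nEQ s s' q r j Es Es'
  (tQ s As) (tQ s' As') Eq Er (cC Eq Er) (Phi_pow pE Er) npj _ _ _ ej.
- by rewrite cjE // conjg_mulR.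
- exact: csH.
- have Q1 := h3 r Har; rewrite -(mulKVg r (s' r)) -[LHS]/(c _) cM ?(subsetP sQE _ Q1) //.
  by rewrite (c_id Q1) mulg1.
have Az := subsetP s12A z zG; have Ez := autA Az.
pose T := Group (tact_group_set sA (subxx E) sXE iX).
have Ts : s \in T by apply/tactP; split=> // x Ex; rewrite cjE // -commgEl cEXy.
have Tz : z \in T.
  apply: subsetP zG; rewrite gen_subG subUset !sub1set Ts; apply/tactP; split=> //.
have zX x : x \in X -> c (z x) = (c x)^-1.
  have gK : group_set [set x in X | c (z x) == (c x)^-1].
    apply/group_setP; split=> [|u v].
      by rewrite inE group1 (Aut_one Ez) /c morph1 invg1 eqxx.
    rewrite !inE => /andP[Xu /eqP hu] /andP[Xv /eqP hv].
    have Eu := subsetP sXE u Xu; have Ev := subsetP sXE v Xv.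
    rewrite groupM // (AutM Ez) //= !cM ?stE // hu hv invMg.
    by apply/eqP; rewrite -!cV //; apply: cC; rewrite groupV.
  have sKX : Group gK \subset X by apply/subsetP=> u; rewrite inE => /andP[].
  have sQK : 'Phi(E) \subset Group gK.
    apply/subsetP=> u Qu; rewrite inE (subsetP sQX) //= (c_id Qu) invg1.
    by apply/eqP/c_id; apply: tQ.
  have Kq : q \in Group gK by rewrite inE (subsetP sHX) //=; apply/eqP; rewrite -cV //; exact: zq.
  have Kr : r \in Group gK by rewrite inE Xr /=; apply/eqP; rewrite -cV //; exact: zr.
  have sHK : H \subset Group gK.
    by rewrite (cyc H [group of 'Phi(E)] q) // join_subG sQK cycle_subG Kq.
  have eK : Group gK = X :> {set gT}.
    by apply: (idx_full (N := H) (x := r)) => //; rewrite iXH'.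
  by move=> Xx; move: Xx; rewrite -{1}eK inE => /andP[_ /eqP].
have sX x : x \in X -> s x \in X by apply: (iX).
have zs : {in E, forall x, c (z (s x)) = c (s (z x))}.
  apply: (chain_comm (X1 := X) (X2 := X)) => // x Ex.
  - have /tactP[_ g1] := groupM Ts Tz; have /tactP[_ g2] := groupM Tz Ts.
    have := groupM (groupVr (g1 x Ex)) (g2 x Ex).
    by rewrite !permM invMg invgK -mulgA mulKVg.
  - by rewrite groupM ?groupV //; do 2?[apply: (iX)].
  have Ex' := subsetP sXE x Ex.
  apply: c_eq; rewrite ?stE // zX ?sX // -cV ?stE // -(AutV Es) //.
  by apply/esym/cong; rewrite ?stE ?groupV // zX // cV.
have [e Ee nXe] : exists2 e, e \in E & e \notin X.
  by apply/subsetPn; apply: contra neXE => sEX; rewrite eqEsubset sXE.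
pose cc := [~ e, y]; have Xcc : cc \in X := cEXy e Ee; have Ecc := subsetP sXE _ Xcc.
pose x := e^-1 * z e; have Xx : x \in X by have /tactP[_] := Tz; apply.
have Ex := subsetP sXE x Xx.
have se : s e = e * cc by rewrite /s cjE // conjg_mulR.
have ze : z e = e * x by rewrite mulKVg.
have sx : c (s x) = c x * c cc ^- 2.
  have Esx := stE As Ex.
  have e1 : c (z (s e)) = c e * (c x * (c cc)^-1).
    by rewrite se (AutM Ez) // (cM (stE Az Ee) (stE Az Ecc)) (zX _ Xcc) ze (cM Ee Ex) mulgA.
  have e2 : c (s (z e)) = c e * (c cc * c (s x)).
    by rewrite ze (AutM Es) // (cM (stE As Ee) Esx) se (cM Ee Ecc) mulgA.
  have := zs e Ee; rewrite e1 e2 => /mulgI h.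
  apply: (mulgI (c cc)); rewrite -h mulgA (cC Ecc Ex) -mulgA; congr (_ * _).
  by rewrite expgS expg1 invMg mulgA mulgV mul1g.
(* k is the inverse of 2 modulo p. As s multiplies x by cc ^- 2 on V, correcting e by x ^+ k cancels
   its commutator cc with y and gives a point of the axis outside X. *)
pose k := p.+1./2; have k2 : (k * 2 = p.+1)%N.
  by have := odd_double_half p.+1; rewrite /= odd_p add0n -muln2.
pose e' := e * x ^+ k; have Ee' : e' \in E by rewrite groupM ?groupX.
case/negP: nXe; rewrite -(mulgK (x ^+ k) e) groupM ?groupV ?groupX //.
apply: (subsetP sHX); apply: (axis_y Sy nEy Ee').
have -> : [~ e', y] = e'^-1 * s e' by rewrite cjE // commgEl.
apply: c_eq => //; first exact: stE.
rewrite (AutM Es) ?groupX // (AutX Es) // !cM ?groupX ?stE // !cX ?stE // sx se cM // -mulgA.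
congr (_ * _); rewrite expgMn; last first.
  by rewrite -cX // -cV ?groupX //; apply: cC; rewrite ?groupV ?groupX.
have com : commute (c cc) (c x ^+ k) by rewrite -cX //; apply: cC; rewrite ?groupX.
rewrite mulgA com -mulgA -[LHS]mulg1; congr (_ * _).
rewrite -expgVn -expgM mulnC k2 expgS mulgA mulgV mul1g -cV // -cX ?groupV //.
by apply/esym/c_id; rewrite Phi_pow ?groupV.
Qed.

End Single.

Lemma three_mod (gT : finGroupType) (G H K N : {group gT}) :
  G \subset 'N(N) -> H \subset 'N(N) -> K \subset 'N(N) ->
  [~: G, H, K] \subset N -> [~: H, K, G] \subset N -> [~: K, G, H] \subset N.
Proof.
move=> nG nH nK.
have e (A B C : {group gT}) : A \subset 'N(N) -> B \subset 'N(N) -> C \subset 'N(N) ->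
    ([~: A, B, C] \subset N) = ([~: A / N, B / N, C / N] == 1).
  move=> nA nB nC; have nAB : [~: A, B] \subset 'N(N) by apply: comm_subG.
  have nABC : [~: A, B, C] \subset 'N(N) by apply: comm_subG.
  have eR : [~: A, B, C] / N = [~: A / N, B / N, C / N] by rewrite !quotientR.
  by rewrite -eR -subG1 quotient_sub1.
rewrite !e // => /eqP h1 /eqP h2; apply/eqP; exact: three_subgroup h1 h2.
Qed.

(** * Comparing the data of two transvection subgroups *)

Section TwoChar.
Variables (gT : finGroupType) (p : nat) (S : {group gT}).
Hypotheses (pr_p : prime p) (odd_p : odd p) (pS : p.-group S) (rS : rk3 p S).
Implicit Types (X Y V N E C W D K M : {group gT}) (t a : {perm gT}).

(** E = W * C, and an a-stable subgroup that contains the centre contains W by [tr_Wfull]. *)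
Lemma tr_all E C W t a K : transv p S E C W t a -> K \subset E -> C \subset K -> stab a K ->
  centre S E \subset K -> K :=: E.
Proof.
move=> tr sKE sCK aK sZK.
have [q Zq nQq] := subsetPn (tr_Zneq pr_p tr).
have sQK := subset_trans (tr_QC tr) sCK.
have e : W :&: K = W.
  apply: (tr_Wfull pr_p pS tr (K := [group of W :&: K]) (q := q)) => //=.
  - exact: subsetIl.
  - by apply: stabI => //; apply: tr_aW tr.
  - by rewrite subsetI sQK (subset_trans (joing_subr _ _) (tr_ZW tr)).
  - by rewrite inE (subsetP sZK) ?(subsetP (tr_ZW tr)).
apply/eqP; rewrite eqEsubset sKE -{1}(tr_WC tr) mul_subG // -e subsetIr //.
Qed.

(** S is abelian modulo the centre of E2, since E2 has index p and S centralises it there; so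
    [E1, S] lies in that centre. *)
Lemma tr_centre_sub E1 C1 W1 t1 a1 E2 C2 W2 t2 a2 :
  transv p S E1 C1 W1 t1 a1 -> transv p S E2 C2 W2 t2 a2 -> 'Phi(E1) = 'Phi(E2) ->
  centre S E1 \subset centre S E2.
Proof.
move=> tr1 tr2 eT; have nZ := tr_nZ pr_p pS tr2.
have cZ : [~: S, S] \subset centre S E2.
  apply: (der_ext (H := E2)).
  - exact: normal_sub (tr_nE tr2).
  - exact: normal_norm nZ.
  - by rewrite (tr_iE tr2).
  - exact: joing_subl.
rewrite join_subG eT joing_subr andbT; apply: subset_trans cZ.
by apply: commSg; apply: normal_sub (tr_nE tr1).
Qed.

(* t1 t2 is unipotent on axis / Phi, where B acts as a group of order prime to p. *)
Lemma tr_CC E1 C1 W1 t1 a1 E2 C2 W2 t2 a2 (B : {group {perm gT}}) :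
  transv p S E1 C1 W1 t1 a1 -> transv p S E2 C2 W2 t2 a2 -> axis S E1 = axis S E2 ->
  'Phi(E1) = 'Phi(E2) -> centre S E1 = centre S E2 -> B \subset Aut S -> t1 \in B -> t2 \in B ->
  {in B, forall b : {perm gT}, p.-elt b -> {in axis S E1, forall m : gT, m^-1 * b m \in 'Phi(E1)}} ->
  C1 :=: C2.
Proof.
move=> tr1 tr2 eM eT eZ sB B1 B2 pB.
set M := axis S E1 in eM pB; set T := 'Phi(E1) in eT pB; set Z := centre S E1 in eZ.
have nT : T <| S := tr_nQ tr1; have nTS := normal_norm nT; have nN := subsetP nTS.
have sMS : M \subset S := normal_sub (tr_nH tr1); have sZM : Z \subset M := tr_ZH pr_p pS tr1.
have sTZ : T \subset Z := joing_subr _ _; have sZS := subset_trans sZM sMS.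
have sTS := normal_sub nT.
have A1 := subsetP sB _ B1; have A2 := subsetP sB _ B2.
pose c x := coset T x.
have cM x y : x \in S -> y \in S -> c (x * y) = c x * c y by move=> Sx Sy; rewrite /c morphM ?nN.
have cV x : x \in S -> c x^-1 = (c x)^-1 by move=> Sx; rewrite /c morphV ?nN.
have cX x n : x \in S -> c (x ^+ n) = c x ^+ n by move=> Sx; rewrite /c morphX ?nN.
have cid x : x \in T -> c x = 1 by apply: coset_id.
have idc x : x \in S -> c x = 1 -> x \in T by move=> Sx; apply: coset_idr; apply: nN.
have ceq x y : x \in S -> y \in S -> x^-1 * y \in T -> c y = c x.
  by move=> Sx Sy /cid; rewrite cM ?groupV // cV // => h; apply: (mulgI (c x)^-1); rewrite h mulVg.
have stS t x : t \in Aut S -> x \in S -> t x \in S by move=> At; apply: Aut_stab.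
have tT t E C W a : transv p S E C W t a -> 'Phi(E) = T -> stab t T.
  move=> tr <-; exact: stab_Phi (tr_tS tr) (normal_sub (tr_nE tr)) (tr_tE tr).
have tT1 := tT _ _ _ _ _ tr1 (erefl _); have tT2 := tT _ _ _ _ _ tr2 (esym eT).
have cong t x y : t \in Aut S -> stab t T -> x \in S -> y \in S -> c x = c y -> c (t x) = c (t y).
  by move=> At st Sx Sy; apply: (coset_congr nTS).
have tZ t E C W a x : transv p S E C W t a -> 'Phi(E) = T -> centre S E = Z -> x \in Z ->
    c (t x) = (c x)^-1.
  move=> tr eQ eZ' Zx; have Sx := subsetP sZS x Zx; apply: (mulgI (c x)).
  rewrite mulgV -cM ?stS ?(tr_tS tr) // cid // -eQ; apply: (tr_tW tr).
  by apply: (subsetP (tr_ZW tr)); rewrite eZ'.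
have tZ1 x := tZ _ _ _ _ _ x tr1 (erefl _) (erefl _).
have tZ2 x := tZ _ _ _ _ _ x tr2 (esym eT) (esym eZ).
have tC t E C W a x : transv p S E C W t a -> 'Phi(E) = T -> x \in C -> c (t x) = c x.
  move=> tr eQ Cx; have Sx : x \in S by apply: (subsetP (normal_sub (tr_nC tr))).
  by apply: ceq; rewrite ?stS ?(tr_tS tr) // -eQ; apply: (tr_tC tr).
have nZ : Z <| S := tr_nZ pr_p pS tr1.
have tMZ t E C W a x : transv p S E C W t a -> 'Phi(E) = T -> centre S E = Z -> axis S E = M ->
    x \in M -> x^-1 * t x \in Z.
  move=> tr eQ eZ' eM'; rewrite -eM' -(tr_ZC pr_p pS tr) => /mulsgP[z d Zz Cd ->].
  rewrite eZ' in Zz; have Sz := subsetP sZS z Zz; have At := tr_tS tr.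
  have Sd : d \in S by apply: (subsetP (normal_sub (tr_nC tr))).
  have Ztz : t z \in Z.
    have : z * t z \in Z by apply: (subsetP sTZ); rewrite -eQ; apply: (tr_tW tr); apply: (subsetP (tr_ZW tr)); rewrite eZ'.
    by rewrite groupMl.
  have -> : (z * d)^-1 * t (z * d) = (z^-1 * t z) ^ d * (d^-1 * t d).
    by rewrite (AutM At) // invMg conjgE !mulgA mulgK.
  rewrite groupM //; last by apply: (subsetP sTZ); rewrite -eQ; apply: (tr_tC tr).
  by rewrite memJ_norm ?(subsetP (normal_norm nZ)) // groupM ?groupV.
pose b := t1 * t2; have Bb : b \in B by rewrite groupM.
have Ab := subsetP sB b Bb; have bT : stab b T by move=> x Tx; rewrite permM tT2 // tT1.
have bZ x : x \in Z -> c (b x) = c x.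
  move=> Zx; have Sx := subsetP sZS x Zx; rewrite permM.
  transitivity (c (t2 x^-1)); first by apply: cong; rewrite ?stS ?groupV // tZ1 // cV.
  by rewrite (AutV A2) // cV ?stS // tZ2 // invgK.
have bM x : x \in M -> x^-1 * b x \in Z.
  move=> Mx; have h1 := tMZ _ _ _ _ _ x tr1 (erefl _) (erefl _) (erefl _) Mx.
  have Mt : t1 x \in M by rewrite -(mulKVg x (t1 x)) groupM // (subsetP sZM).
  have h2 := tMZ _ _ _ _ _ _ tr2 (esym eT) (esym eZ) (esym eM) Mt.
  by rewrite permM -(mulKVg (t1 x) (t2 _)) mulgA groupM.
have bn n x : x \in M -> c ((b ^+ n) x) = c x * c (x^-1 * b x) ^+ n.
  move=> Mx; have Sx := subsetP sMS x Mx; have Zf := bM x Mx; set f := _ * b x in Zf *.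
  have Sf := subsetP sZS f Zf; have ef : b x = x * f by rewrite mulKVg.
  elim: n => [|n IHn]; first by rewrite perm1 mulg1.
  rewrite expgSr permM (cong b _ (x * f ^+ n)) ?stS ?groupM ?groupX //; last by rewrite IHn cM ?groupX ?cX.
  rewrite (AutM Ab) ?groupX // (AutX Ab) // cM ?groupX ?stS // cX ?stS // (bZ f Zf) ef cM //.
  by rewrite -mulgA -expgS.
(* k is the p'-part of the order of b, so b ^+ k is a p-element and acts trivially on M / T by [pB].
   By [bn] it displaces x by the k-th power of the displacement under b, and k is prime to p. *)
have [k npk pe] : exists2 k, ~~ (p %| k) & p.-elt (b ^+ k).
  exists (#[b]`_(p^'))%N; first by rewrite -p'natE // part_pnat.
  rewrite /p_elt orderXdiv ?dvdn_part // -{1}(partnC p (order_gt0 b)) mulnK ?part_gt0 //.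
  exact: part_pnat.
have bM1 x : x \in M -> c (b x) = c x.
  move=> Mx; have Sx := subsetP sMS x Mx; have Zf := bM x Mx.
  have Sf := subsetP sZS _ Zf; have e1 := bn 1%N x Mx; rewrite expg1 in e1.
  suff Tf : x^-1 * b x \in T by rewrite e1 (cid _ Tf) mulg1.
  apply: (expg_coprime pr_p (k := k)) => //.
    by apply: (Phi_pow (tr_pE pS tr1)); apply: (subsetP (tr_HE S E1)); apply: (subsetP sZM).
  apply: idc; first exact: groupX.
  have := pB _ (groupX k Bb) pe x Mx; move/(ceq _ _ Sx (stS _ _ (groupX k Ab) Sx)); rewrite bn // -cX //.
  by move/eqP; rewrite -[X in _ == X]mulg1 (inj_eq (mulgI _)) => /eqP.
(* On M, t1 and t2 now agree modulo T. A point of C1 is therefore fixed by t2 modulo T, and its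
   component in the centre, which t2 inverts, must be trivial. *)
have sC12 : C1 \subset C2.
  apply/subsetP=> x Cx; have Mx : x \in M := subsetP (tr_CH tr1) x Cx; have Sx := subsetP sMS x Mx.
  have e2 : c (t2 x) = c x.
    rewrite -[RHS](bM1 x Mx) permM; apply: cong; rewrite ?stS //.
    by rewrite (tC _ _ _ _ _ x tr1).
  move: (Mx); rewrite eM -(tr_ZC pr_p pS tr2) => /mulsgP[z d Zz Cd ex]; rewrite -eZ in Zz.
  have Sz := subsetP sZS z Zz; have Sd : d \in S by apply: (subsetP (normal_sub (tr_nC tr2))).
  have Tz : z \in T.
    apply: (invol_odd odd_p pS) => //; apply: idc; first exact: groupX.
    move: e2; rewrite ex (AutM A2) // !cM ?stS // tZ2 // (tC _ _ _ _ _ d tr2) //.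
    by move/mulIg => h; transitivity ((c z)^-1 * c z); [rewrite h | rewrite mulVg].
  by rewrite ex groupM // (subsetP (tr_QC tr2)) // -eT.
apply/eqP; rewrite eqEcard sC12 -(leq_pmul2r (prime_gt0 pr_p)) -{1}(tr_iC tr2) -(tr_iC tr1).
by rewrite (Lagrange (tr_CH tr2)) (Lagrange (tr_CH tr1)) /= -eM leqnn.
Qed.

Lemma tr_gen E C W t a K w z : transv p S E C W t a -> K \subset E -> C \subset K ->
  z \in centre S E -> z \notin 'Phi(E) -> z \in K -> w \in E -> w \notin axis S E -> w \in K -> K :=: E.
Proof.
move=> tr sKE sCK Zz nQz Kz Ew nw Kw.
have nCz : z \notin C.
  apply: contra nQz => Cz; rewrite -(tr_WIC tr) inE Cz andbT.
  by apply: (subsetP (tr_ZW tr)).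
have sMK : axis S E \subset K.
  have <- : K :&: axis S E = axis S E; last exact: subsetIl.
  apply: (idx_full (N := C) (K := [group of K :&: axis S E]) (x := z)) => //.
  - by rewrite subsetI sCK (tr_CH tr).
  - exact: subsetIr.
  - by rewrite (tr_iC tr).
  - by rewrite inE Kz (subsetP (tr_ZH pr_p pS tr)).
apply: (idx_full (N := [group of axis S E]) (x := w)) => //.
by rewrite (tr_iH tr).
Qed.

Lemma tr_iCQle E C W t a : transv p S E C W t a -> #|C : 'Phi(E)| <= p.
Proof.
move=> tr; have := rS (normal_sub (tr_nE tr)).
rewrite -(Lagrange_index (tr_HE S E) (tr_QH tr)) -(Lagrange_index (tr_CH tr) (tr_QC tr)).
by rewrite (tr_iH tr) (tr_iC tr) !expnS muln1 !leq_pmul2l ?prime_gt0.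
Qed.

End TwoChar.

(** * A full flag in C / Phi(C) *)

Section TwoChar.
Variables (gT : finGroupType) (p : nat) (S : {group gT}).
Hypotheses (pr_p : prime p) (odd_p : odd p) (pS : p.-group S) (rS : rk3 p S).
Implicit Types (X Y V N E C W D K M : {group gT}) (t a : {perm gT}).

(** Assume that both alternatives fail. Then [E, E] lies in V1: otherwise it spans V2 over V1, V2 is
    a-stable, and its centraliser in E modulo Phi(C) contains C and the centre, hence is E. Next,
    p-th powers of E lie in V1 by the same device. So Phi(E) lies in V1, which has index p ^ 2 in C,
    while C / Phi(E) has order at most p. *)
Lemma line_contra E C W t a V1 V2 : transv p S E C W t a ->
  V1 <| S -> V2 <| S -> 'Phi(C) \subset V1 -> V1 \subset V2 -> V2 \subset C ->
  #|C : V2| = p -> #|V2 : V1| = p -> V1 :=: [~: C, E] <*> 'Phi(C) ->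
  V2 :=: cmod C (centre S E) 'Phi(C) -> [~: V1, S] \subset 'Phi(C) -> [~: V2, S] \subset V1 ->
  [~: V2, E] \subset 'Phi(C) \/ [~: C, S] \subset V1.
Proof.
move=> tr nV1 nV2 sN1 s12 s2C iC2 i21 eV1 eV2 cV1 cV2.
case: (boolP ([~: V2, E] \subset 'Phi(C))) => [|n2]; first by left.
case: (boolP ([~: C, S] \subset V1)) => [|nC]; first by right.
exfalso; set N := [group of 'Phi(C)].
have nES := tr_nE tr; have sES := normal_sub nES; have pE := tr_pE pS tr; have Aa := tr_aE tr.
have nCS := tr_nC tr; have sCS := normal_sub nCS; have pC := pgroupS sCS pS.
have sCE := tr_CE tr; have s1C := subset_trans s12 s2C; have s2E := subset_trans s2C sCE.
have nN : N <| S by apply: char_normal_trans (Phi_char C) nCS.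
have nNS := normal_norm nN; have nNE := subset_trans sES nNS.
have aC : stab a C := tr_aCC tr.
have aN : stab a N := stab_Phi Aa sCE aC.
have aE := Aut_stab Aa.
have aV1 : stab a V1.
  rewrite eV1; apply: (stab_join (X := [group of [~: C, E]]) (Y := N) Aa) => //.
  - by apply: subset_trans (commSg _ sCE) _; rewrite commg_subl normG.
  - exact: subset_trans (Phi_sub C) sCE.
  - by apply: (stab_comm Aa).
have cCE1 : [~: C, E] \subset V1 by rewrite eV1 joing_subl.
have n1S := normal_norm nV1; have n1E := subset_trans sES n1S.
have dC := Phi_der pC.
have [z Zz nQz] := subsetPn (tr_Zneq pr_p tr).
have sZE : centre S E \subset E := subset_trans (tr_ZH pr_p pS tr) (tr_HE S E).
have Ez := subsetP sZE z Zz; have sQC := tr_QC tr.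
have nW := subset_trans (tr_WE tr) n1E.
have dE1 : [~: E, E] \subset V1.
  apply/idPn=> ndE; pose X := [group of [~: E, E] <*> V1].
  have sXC : X \subset C.
    by rewrite join_subG s1C (subset_trans (Phi_der pE) sQC).
  have nX : X <| S.
    have nEE : [~: E, E] <| S by apply: char_normal_trans (der_char 1 E) nES.
    exact: normalY.
  have aX : stab a X.
    have sEE : [~: E, E] \subset E := subset_trans (Phi_der pE) (Phi_sub E).
    apply: (stab_join (X := [group of [~: E, E]]) Aa) => //; first exact: subset_trans s1C sCE.
    by apply: (stab_comm Aa).
  have ltV1X : ~~ (X \subset V1) by apply: contra ndE; apply: subset_trans (joing_subl _ _).
  have [w [y [Ww nw Sy ny]]] := tr_ex pr_p tr; have Ew := subsetP (tr_WE tr) w Ww.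
  have sV1X : V1 \subset X := joing_subr _ _.
  pose u := [~ w, z]; have Cu : u \in C.
    by apply: (subsetP sQC); apply: (subsetP (Phi_der pE)); apply: mem_commg.
  pose Y := [group of <[u]> <*> V1].
  have sYC : Y \subset C by rewrite join_subG cycle_subG Cu.
  have sV1Y : V1 \subset Y := joing_subr _ _.
  have nYE : E \subset 'N(Y).
    rewrite -commg_subl; apply: subset_trans (commSg _ sYC) _; exact: subset_trans cCE1 _.
  have cCY x v : x \in E -> v \in C -> [~ x, v] \in Y.
    by move=> Ex Cv; rewrite -invg_comm groupV (subsetP sV1Y) // (subsetP cCE1) // mem_commg.
  have full1 g : g \in E -> [~ w, g] \in Y -> [~ z, g] \in Y -> {in E, forall x, [~ x, g] \in Y}.
    move=> Eg h1 h2 x Ex; have Ng := subsetP nYE g Eg.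
    have eE : cmod1 E g Y = E.
      apply: (tr_gen pr_p pS tr (K := [group of cmod1 E g Y]) (w := w) (z := z)) => //.
      - exact: cmod1_sub.
      - apply/subsetP=> v Cv; apply/(cmod1P _ nYE Ng); split; first exact: (subsetP sCE).
        by rewrite -invg_comm groupV cCY.
      - by apply/(cmod1P _ nYE Ng).
      - by apply/(cmod1P _ nYE Ng).
    by move: Ex; rewrite -{1}eE => /(cmod1P _ nYE Ng)[].
  have Yu : u \in Y by apply: (subsetP (joing_subl _ _)); apply: cycle_id.
  have hw : {in E, forall x, [~ x, w] \in Y}.
    by apply: full1 => //; rewrite ?commgg ?group1 // -invg_comm groupV.
  have hz : {in E, forall x, [~ x, z] \in Y} by apply: full1; rewrite ?commgg ?group1.
  have dEY : [~: E, E] \subset Y.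
    rewrite gen_subG; apply/subsetP=> _ /imset2P[x x' Ex Ex' ->].
    by apply: full1 => //; rewrite -invg_comm groupV ?hw ?hz.
  have iX : #|X : V1| = p.
    apply: (p_index_le pr_p pE) => //.
    - exact: subset_trans sXC sCE.
    - apply: leq_trans (index_cycle_join pr_p (_ : u \in 'N(V1)) _).
      + by rewrite dvdn_leq ?indexg_gt0 // indexSg // join_subG dEY.
      + by apply: (subsetP n1E); apply: (subsetP sCE).
      + by apply: (subsetP sN1); apply: Phi_pow.
    - by apply: contraNneq ltV1X => e; rewrite -e subxx.
  have cXS : [~: X, S] \subset V1 := pcentral pr_p pS nV1 nX (joing_subr _ _) iX.
  (* S centralises both X and V2 modulo V1. If X were not in V2, the two would generate C, giving
     the second alternative. *)
  have sX2 : X \subset V2.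
    apply/idPn=> nX2; case/negP: nC.
    rewrite -(sub_cmod (subxx C) (subset_trans sCS n1S) n1S).
    have s2c : V2 \subset cmod C S V1 by rewrite (sub_cmod s2C (subset_trans sCS n1S) n1S).
    have sXc : X \subset cmod C S V1 by rewrite (sub_cmod sXC (subset_trans sCS n1S) n1S).
    have [x Xx nx] := subsetPn nX2.
    suff -> : cmod C S V1 = C by [].
    apply: (idx_full (N := V2) (x := x)) => //; rewrite ?iC2 ?cmod_sub //.
    exact: (subsetP sXc).
  have eX : X :=: V2.
    have [x Xx nx] := subsetPn ltV1X.
    by apply: (idx_full (N := V1) (x := x)) => //; rewrite i21.
  have aV2 : stab a V2 by move=> x; rewrite -eX; apply: aX.
  case/negP: n2; rewrite commGC -(sub_cmod (subxx E) nNE (subset_trans s2E nNE)).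
  suff -> : cmod E V2 N = E by [].
  apply: (tr_all pr_p pS tr (K := [group of cmod E V2 N])); first exact: cmod_sub.
  - rewrite (sub_cmod sCE nNE (subset_trans s2E nNE)); exact: subset_trans (commgS _ s2C) dC.
  - apply: (stab_cmod Aa) => //; first exact: subset_trans s2E nNE.
    exact: subset_trans (Phi_sub C) sCE.
  - rewrite (sub_cmod (A := [group of centre S E]) sZE nNE (subset_trans s2E nNE)) commGC.
    by rewrite eV2; apply: cmod_comm; [exact: subset_trans sCS nNS | exact: subset_trans sZE nNE].
have pc : pow_cond p E V1.
  split=> // [|x x' Ex Ex'].
    by apply: subset_trans (commSg _ dE1) _; rewrite commg_subl.
  apply: (subsetP sN1); apply: Phi_pow => //; apply: (subsetP s1C).
  by apply: (subsetP dE1); apply: mem_commg.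
have [K eK] := powker odd_p pc.
have sKE : K \subset E by apply/subsetP=> x; rewrite eK => /andP[].
(* x ^+ p commutes with the centre modulo Phi(C), so it is in V2. Also [x ^+ p, e] is the p-th power
   of [x, e] modulo Phi(C), hence trivial there. If x ^+ p were outside V1, it would span V2 over
   V1, and E would centralise V2. *)
have ZV1 x : x \in centre S E -> x ^+ p \in V1.
  move=> Zx; have Ex := subsetP sZE x Zx.
  case: (boolP (x \in 'Phi(E))) => [Qx | nQx].
    by apply: (subsetP sN1); apply: Phi_pow => //; apply: (subsetP sQC).
  set xp := x ^+ p; have Qxp : xp \in 'Phi(E) := Phi_pow pE Ex.
  have Cxp := subsetP sQC _ Qxp; have Exp := subsetP sCE _ Cxp.
  have nNZ := subset_trans sZE nNE; have Nxp := subsetP nNE _ Exp.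
  have eZ : cmod1 (centre S E) xp N = centre S E.
    apply: (idx_full (N := [group of 'Phi(E)]) (x := x)) => //.
    - apply/subsetP=> v Qv; apply/(cmod1P _ nNZ Nxp); split; first by apply: (subsetP (joing_subr _ _)).
      by apply: (subsetP dC); rewrite mem_commg // (subsetP sQC).
    - exact: cmod1_sub.
    - by rewrite (tr_iZ pr_p pS tr).
    - apply/(cmod1P _ nNZ Nxp); split=> //.
      by rewrite (eqP (_ : [~ x, xp] == 1)) ?group1 //; apply/commgP/commuteX.
  have V2x : xp \in V2.
    rewrite eV2; apply/(cmodP _ (subset_trans sCS nNS) nNZ); split=> // v Zv.
    rewrite -invg_comm groupV.
    have : v \in cmod1 (centre S E) xp N by rewrite eZ.
    by case/(cmod1P _ nNZ Nxp).
  have cE e : e \in E -> [~ xp, e] \in N.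
    move=> Ee; have Ne := subsetP nNE e Ee; have Nx := subsetP nNE x Ex.
    pose v := [~ x, e]; have V1v : v \in V1 by apply: (subsetP dE1); apply: mem_commg.
    have Ev := subsetP s1C v V1v; have Nv := subsetP nNE v (subsetP sCE v Ev).
    apply: coset_idr; first by rewrite groupR.
    have cxv : commute (coset N x) (coset N v).
      apply/commute_sym/commgP; rewrite -morphR //; apply/eqP/coset_id.
      by apply: (subsetP cV1); rewrite mem_commg // (subsetP sES).
    have e1 : coset N (xp ^ e) = coset N xp.
      have -> : xp ^ e = (x * v) ^+ p by rewrite conjXg conjg_mulR.
      have cXN g : g \in 'N(N) -> coset N (g ^+ p) = coset N g ^+ p by move=> Ng; rewrite morphX.
      have cMN : coset N (x * v) = coset N x * coset N v by rewrite morphM.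
      have -> : coset N ((x * v) ^+ p) = (coset N x * coset N v) ^+ p.
        by rewrite -cMN; apply: cXN; rewrite groupM.
      have vp : coset N v ^+ p = 1 by rewrite -(cXN v Nv); apply: coset_id; apply: Phi_pow.
      by rewrite expgMn // vp mulg1 -(cXN x Nx).
    by rewrite commgEl morphM ?groupV ?groupJ // [X in _ * X]e1 morphV //= mulVg.
  apply/idPn=> nV1x; case/negP: n2; rewrite -(sub_cmod (subxx V2) (subset_trans s2E nNE) nNE).
  suff -> : cmod V2 E N = V2 by [].
  apply: (idx_full (N := V1) (x := xp)) => //.
  - rewrite (sub_cmod s12 (subset_trans s2E nNE) nNE); exact: subset_trans (commgS _ sES) cV1.
  - exact: cmod_sub.
  - by rewrite i21.
  - by apply/(cmodP _ (subset_trans s2E nNE) nNE).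
have eKE : K :=: E.
  apply: (tr_all pr_p pS tr) => //.
  - apply/subsetP=> x Cx; rewrite eK inE (subsetP sCE) //=.
    by apply: (subsetP sN1); apply: Phi_pow.
  - move=> x; rewrite !eK !inE => /andP[Ex V1x]; rewrite (aE x Ex) /= -(AutX Aa) //.
    exact: aV1.
  - by apply/subsetP=> x Zx; rewrite eK inE (subsetP sZE) //= ZV1.
have sQ1 : 'Phi(E) \subset V1.
  apply: (Phi_sub_crit pr_p pE n1E dE1) => x; rewrite -{1}eKE eK inE => /andP[_ h]; exact: h.
have := tr_iCQle pr_p rS tr; have := Lagrange_index s2C s12; rewrite iC2 i21 => e.
rewrite leqNgt; case/negP; apply: leq_trans (_ : #|C : V1| <= _).
  by rewrite -e -{1}[p]muln1 ltn_pmul2l ?prime_gt0 ?prime_gt1.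
by rewrite dvdn_leq ?indexg_gt0 // indexgS.
Qed.

End TwoChar.

(** * Signs of an involution on sections *)

Section Signs.
Variables (gT : finGroupType) (p : nat) (S : {group gT}) (t : {perm gT}).
Hypotheses (pr_p : prime p) (odd_p : odd p) (pS : p.-group S).
Hypotheses (At : t \in Aut S) (tt : forall x, t (t x) = x).
Implicit Types (X Y V N K : {group gT}).

(** [true] stands for the sign -1, so that signs multiply by exclusive or. *)
Definition sgn (b : bool) (x : gT) := if b then x^-1 else x.
Definition acts_by b (X Y : {set gT}) := {in X, forall x, (sgn b x)^-1 * t x \in Y}.

Lemma acts_by_sign X Y : X \subset S -> Y \subset X -> X \subset 'N(Y) -> #|X : Y| = p ->
  stab t X -> stab t Y -> exists b, acts_by b X Y.
Proof.
move=> sXS sYX nYX iXY tX tY; have sX := subsetP sXS.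
have dX : [~: X, X] \subset Y.
  by apply: (der_ext sYX nYX); rewrite ?iXY // commg_subl.
case: (boolP [forall x in X, x * t x \in Y]) => [/forall_inP h | ].
  by exists true => x Xx; rewrite /sgn invgK h.
rewrite negb_forall_in => /exists_inP[x0 Xx0 nv]; exists false.
have gF : group_set [set x in X | x^-1 * t x \in Y].
  apply/group_setP; split=> [|x y]; first by rewrite inE group1 (Aut_one At) mulg1 groupV group1.
  rewrite !inE => /andP[Xx hx] /andP[Xy hy]; rewrite groupM // (AutM At) ?sX //=.
  have -> : (x * y)^-1 * (t x * t y) = (x^-1 * t x) ^ y * (y^-1 * t y).
    by rewrite invMg conjgE !mulgA mulgK.
  by rewrite groupM // memJ_norm // (subsetP nYX).
have tt' x : t (t x) = x by apply: tt.
suff eX : Group gF :=: X by move=> x; rewrite -{1}eX inE => /andP[].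
have sFX : Group gF \subset X by apply/subsetP=> x; rewrite inE => /andP[].
have cX x y : x \in X -> y \in X -> [~ x, y] \in Y by move=> Xx Xy; rewrite (subsetP dX) // mem_commg.
have Xtx0 := tX x0 Xx0.
have Xv : x0 * t x0 \in X by rewrite groupM.
have Fv : x0 * t x0 \in Group gF.
  rewrite inE Xv /= (AutM At) ?sX // tt'.
  have -> : (x0 * t x0)^-1 * (t x0 * x0) = [~ t x0, x0] by rewrite invMg commgEl conjgE !mulgA.
  exact: cX.
have sYF : Y \subset Group gF.
  by apply/subsetP=> y Yy; rewrite inE (subsetP sYX) //= groupM ?groupV ?tY.
by apply: (idx_full sYF sFX _ Fv nv); rewrite iXY.
Qed.

Section PairSign.
Variables (G X Y V N K : {group gT}) (x s : gT) (b d : bool).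
Hypotheses (nN : N <| S) (sXS : X \subset S) (sYS : Y \subset S) (sVS : V \subset S) (sKS : K \subset S).
Hypotheses (sGS : G \subset S) (cX : [~: X, G] \subset V) (cY : [~: Y, S] \subset N).
Hypotheses (cV : [~: V, S] \subset N) (cK : [~: X, K] \subset N).
Hypotheses (Xx : x \in X) (Yx : (sgn b x)^-1 * t x \in Y).
Hypotheses (Gs : s \in G) (Gts : t s \in G) (Ks : (sgn d s)^-1 * t s \in K).
Let c g := coset N g.

(** V is central modulo N, so inverses pass out of the commutator, and the hypotheses on Y and K
    remove the error terms. *)
Lemma pair_sign_comm : c (t [~ x, s]) = if b (+) d then (c [~ x, s])^-1 else c [~ x, s].
Proof.
have nS := normal_norm nN; have nSN := subsetP nS.
have sX := subsetP sXS; have sY := subsetP sYS; have sV := subsetP sVS; have sK := subsetP sKS.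
have sG := subsetP sGS.
have cM g h : g \in S -> h \in S -> c (g * h) = c g * c h by move=> Sg Sh; rewrite /c morphM ?nSN.
have cid g : g \in N -> c g = 1 by apply: coset_id.
have sN := subsetP (normal_sub nN).
have Vc g h : g \in X -> h \in G -> [~ g, h] \in V.
  by move=> Xg Sh; apply: (subsetP cX); apply: mem_commg.
have cJ v g : v \in V -> g \in S -> c (v ^ g) = c v.
  move=> Vv Sg; have Nv : [~ v, g] \in N by apply: (subsetP cV); apply: mem_commg.
  by rewrite conjg_mulR (cM _ _ (sV _ Vv) (sN _ Nv)) (cid _ Nv) mulg1.
have Sx := sX x Xx; have Ss := sG s Gs; have Sts := sG _ Gts.
have Xb : sgn b x \in X by case: (b); rewrite /sgn ?groupV.
have Sb := sX _ Xb; have Gd : sgn d s \in G by case: (d); rewrite /sgn ?groupV.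
have Sd := sG _ Gd.
have e1 : t x = sgn b x * ((sgn b x)^-1 * t x) by rewrite mulKVg.
have e2 : t s = sgn d s * ((sgn d s)^-1 * t s) by rewrite mulKVg.
have Yv := Yx; set v := _ * t x in e1 Yv; have Kk := Ks; set k := _ * t s in e2 Kk.
have Sv := sY v Yv; have Sk := sK k Kk.
have s1 : c [~ t x, t s] = c [~ sgn b x, t s].
  have Nv : [~ v, t s] \in N by apply: (subsetP cY); apply: mem_commg.
  by rewrite e1 commMgJ cM ?groupJ ?groupR // cJ ?Vc // (cid _ Nv) mulg1.
have s2 : c [~ sgn b x, t s] = c [~ sgn b x, sgn d s].
  have Nk : [~ sgn b x, k] \in N by apply: (subsetP cK); apply: mem_commg.
  by rewrite e2 commgMJ cM ?groupJ ?groupR // cJ ?Vc // (cid _ Nk) mul1g.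
have s3 g : g \in X -> c [~ g^-1, s] = (c [~ g, s])^-1.
  move=> Xg; have Sg := sX g Xg.
  apply: (mulgI (c [~ g, s])); rewrite mulgV -{1}(cJ [~ g, s] g^-1) ?Vc ?groupV //.
  by rewrite -cM ?groupJ ?groupR ?groupV // -commMgJ mulgV comm1g cid.
have s4 g : g \in X -> c [~ g, s^-1] = (c [~ g, s])^-1.
  move=> Xg; have Sg := sX g Xg.
  apply: (mulIg (c [~ g, s])); rewrite mulVg -(cJ [~ g, s] s^-1) ?Vc ?groupV //.
  by rewrite -cM ?groupJ ?groupR ?groupV // -commgMJ mulgV commg1 cid.
rewrite (AutR At) // s1 s2 /sgn; case: (b); case: (d) => //=.
- by rewrite s4 ?groupV // s3 // invgK.
- exact: s3.
- exact: s4.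
Qed.

End PairSign.

(** If the signs disagreed, [x, s] would equal its own inverse modulo N, and in odd order it would
    lie in N. *)
Lemma pair_sign X Y V N K x s b d e : N <| S -> X \subset S -> Y \subset S -> V \subset S -> K \subset S ->
  [~: X, S] \subset V -> [~: Y, S] \subset N -> [~: V, S] \subset N -> [~: X, K] \subset N ->
  acts_by b X Y -> acts_by e V N -> x \in X -> s \in S -> (sgn d s)^-1 * t s \in K ->
  [~ x, s] \notin N -> e = b (+) d.
Proof.
move=> nN sXS sYS sVS sKS cX cY cV cK aX aV Xx Ss Ks nu.
have nSN := subsetP (normal_norm nN); pose u := [~ x, s].
have Sts : t s \in S by apply: (Aut_stab At).
have h := pair_sign_comm nN sXS sYS sVS sKS (subxx S) cX cY cV cK Xx (aX x Xx) Ss Sts Ks.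
have Vu : u \in V by apply: (subsetP cX); apply: mem_commg.
have Su := subsetP sVS u Vu; rewrite -/u in h nu.
pose c g := coset N g.
have cI g : g \in S -> c g^-1 = (c g)^-1 by move=> Sg; rewrite /c morphV ?nSN.
have s6 : c (t u) = (if e then (c u)^-1 else c u).
  have Nu := aV u Vu; have Seu : sgn e u \in S by case: (e); rewrite /sgn ?groupV.
  have Stu : t u \in S by apply: (Aut_stab At).
  have : c (sgn e u) = c (t u).
    apply: (mulgI (c (sgn e u))^-1); rewrite mulVg -cI // /c -morphM ?groupV ?nSN //=.
    exact/esym/coset_id.
  by move=> <-; rewrite /sgn; case: (e) => //; rewrite cI.
apply/eqP/idPn => ned; case/negP: nu; apply: (invol_odd odd_p pS) => //.
apply: coset_idr; first by rewrite nSN ?groupX.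
have h2 : c u = (c u)^-1.
  by move: h s6; rewrite /c => -> ; move: ned; case: (b (+) d); case: (e).
by rewrite morphX ?nSN //= expgS expg1 {1}[coset _ _]h2 mulVg.
Qed.

End Signs.

(** * S centralises C modulo Phi(C) *)

Section StepU.
Variables (gT : finGroupType) (p : nat) (S : {group gT}).
Hypotheses (pr_p : prime p) (odd_p : odd p) (pS : p.-group S) (rS : rk3 p S).
Implicit Types (X Y V N E C W D K M : {group gT}) (t a : {perm gT}).

(** t is trivial on S / E1, hence on E2 / (E1 :&: E2), and every coset there contains a fixed
    point. *)
Lemma pair_fixed E1 C W t a E2 : transv p S E1 C W t a -> E2 <| S -> #|S : E2| = p -> E1 :!=: E2 ->
  stab t E2 -> exists y, [/\ y \in E2, y \notin E1 & t y = y].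
Proof.
move=> tr nE2 iE2 ne st; have [nE1 iE1] := (tr_nE tr, tr_iE tr).
have /subsetPn[y0 Ey0 ny0] : ~~ (E2 \subset E1).
  apply: contra ne => s21; rewrite eq_sym eqEcard s21 -(leq_pmul2r (prime_gt0 pr_p)) -{1}iE1 -iE2.
  by rewrite !Lagrange ?normal_sub //= leqnn.
have sE2 := normal_sub nE2; have Sy0 := subsetP sE2 y0 Ey0.
have My : y0^-1 * t y0 \in [group of E1 :&: E2].
  by rewrite inE (tr_tSE tr) //= groupM ?groupV ?st.
have [y yM ty] := invol_fixed odd_p pS (tr_tS tr) (tr_tt tr) (subset_trans (subsetIr E1 E2) sE2) Sy0 My.
move: yM; rewrite mem_lcoset => /setIP[y1 y2].
exists y; split=> //; first by rewrite -(mulKVg y0 y) groupM.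
by apply: contra ny0 => Ey; rewrite -groupV -(mulgK y y0^-1) groupM ?groupV.
Qed.

(** If the claim fails, the centre Z does not centralise C modulo Phi(C), and C / Phi(C) carries a
    flag Phi(C), F1, F2, C with F1 = [C, Z] Phi(C) and F2 the centraliser of Z. Outside the axis
    there are w in E1, inverted by t1 modulo Phi(E1), and y in E2, fixed by t1. At each of the two
    commutator steps of the flag the signs allow only one of w and y to act nontrivially, and each
    distribution is contradictory. *)
Lemma tr_U E1 W1 t1 a1 E2 W2 t2 a2 C : transv p S E1 C W1 t1 a1 -> transv p S E2 C W2 t2 a2 ->
  E1 :!=: E2 -> E1 :&: E2 = axis S E1 -> axis S E1 = axis S E2 -> centre S E1 = centre S E2 ->
  'Phi(E2) = 'Phi(E1) -> stab t1 E2 -> [~: C, S] \subset 'Phi(C).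
Proof.
move=> tr1 tr2 ne eM eax eZ eT st; apply/idPn=> nCS.
have [nE1 nE2] := (tr_nE tr1, tr_nE tr2); have [sE1 sE2] := (normal_sub nE1, normal_sub nE2).
have [At tt] := (tr_tS tr1, tr_tt tr1).
have nC := tr_nC tr1; have sCS := normal_sub nC; have pC := pgroupS sCS pS.
have sC1 := tr_CE tr1; have sC2 := tr_CE tr2.
pose N := [group of 'Phi(C)]; have nN : N <| S by apply: char_normal_trans (Phi_char C) nC.
have nNS := normal_norm nN; have dC : [~: C, C] \subset N := Phi_der pC.
have nNC := subset_trans sCS nNS.
pose Z := [group of centre S E1]; pose T := [group of 'Phi(E1)].
have sZE1 : Z \subset E1 := subset_trans (tr_ZH pr_p pS tr1) (tr_HE S E1).
have sZE2 : Z \subset E2 by rewrite /= eZ; apply: subset_trans (tr_ZH pr_p pS tr2) (tr_HE S E2).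
have sZS := subset_trans sZE1 sE1; have sTC : T \subset C := tr_QC tr1.
have sTS := subset_trans sTC sCS; have nNZ := subset_trans sZS nNS.
have [_ _ eS _] := max_meet pr_p pS sE1 sE2 (tr_iE tr1) (tr_iE tr2) ne.
have irr E W t a : transv p S E C W t a -> centre S E = Z -> [~: C, Z] \subset N -> [~: C, E] \subset N.
  move=> tr e c; have sCE := tr_CE tr; have nNE := subset_trans (normal_sub (tr_nE tr)) nNS.
  have Aa := tr_aE tr; have sNE := subset_trans (Phi_sub C) sCE.
  rewrite commGC -(sub_cmod (subxx E) nNE nNC).
  suff -> : cmod E C N = E by [].
  apply: (tr_all pr_p pS tr (K := [group of cmod E C N])); first exact: cmod_sub.
  - by rewrite (sub_cmod sCE nNE nNC).
  - apply: (stab_cmod Aa) => //; first exact: Aut_stab.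
      exact: tr_aCC tr.
    exact: stab_Phi Aa sCE (tr_aCC tr).
  - rewrite e (sub_cmod _ nNE nNC) ?(commGC Z) // -e.
    exact: subset_trans (tr_ZH pr_p pS tr) (tr_HE S E).
have ncZ : ~~ ([~: C, Z] \subset N).
  apply: contra nCS => c; apply: (comm_mulr (esym eS) nNS nNC).
    exact: irr tr1 _ c.
  exact: irr tr2 (esym eZ) c.
have zc (D X : {group gT}) : D \subset S -> Z \subset D <*> T -> [~: D, C] \subset X -> N \subset X ->
    X <| S -> [~: C, Z] \subset X.
  move=> sDS sZD c sNX nX; have nXS := normal_norm nX.
  rewrite commGC -(sub_cmod sZS nXS (subset_trans sCS nXS)).
  apply: subset_trans sZD _; rewrite join_subG !(sub_cmod _ nXS (subset_trans sCS nXS)) // c /=.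
  exact: subset_trans (commSg _ sTC) (subset_trans dC sNX).
have ltNC : N \proper C.
  apply: Phi_proper; apply: contraNneq nCS => ->; by rewrite comm1G sub1G.
have [F2 [sN2 lt2 n2 i2]] := pquot_gt pr_p pS nN nC ltNC; have s2C := proper_sub lt2.
have c2 := pcentral pr_p pS n2 nC s2C i2.
have lt12 : N \proper F2.
  rewrite properEneq sN2 andbT; apply: contraNneq nCS => e; by move: c2; rewrite -e.
have [F1 [sN1 lt1 n1 i1]] := pquot_gt pr_p pS nN n2 lt12; have s12 := proper_sub lt1.
have c1 := pcentral pr_p pS n1 n2 s12 i1.
have s1C := subset_trans s12 s2C.
have cF1 : [~: F1, S] \subset N.
  case: (eqVneq (F1 : {set gT}) N) => [-> | ne1]; first by rewrite commg_subl.
  apply: (pcentral pr_p pS nN n1 sN1).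
  apply: (p_index_le pr_p pS (subset_trans s1C sCS) sN1); last by rewrite eq_sym.
  have := rS sCS; rewrite -(Lagrange_index s2C sN2) -(Lagrange_index s12 sN1) i1 i2.
  by rewrite !expnS muln1 !leq_pmul2l ?prime_gt0.
have sF2S := subset_trans s2C sCS; have sF1S := subset_trans s1C sCS.
have sZSS : Z \subset [~: S, S] <*> T.
  rewrite join_subG joing_subr andbT; apply: subset_trans (joing_subl _ _); exact: commSg.
have sSS : [~: S, S] \subset S by rewrite commg_subl normG.
have nS1 := normal_norm n1; have nS2 := normal_norm n2.
have k1 : [~: C, Z] \subset F1.
  apply: (zc [group of [~: S, S]]) => //=.
  have h : [~: C, S, S] \subset F1 := subset_trans (commSg _ c2) c1.
  by apply: (three_mod (G := S) (H := C) (K := S)) => //; rewrite ?(commGC S C) // (subset_trans sCS).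
have k2 : [~: F2, Z] \subset N.
  have h : [~: F2, S, S] \subset N := subset_trans (commSg _ c1) cF1.
  have h2 : [~: [~: S, S], F2] \subset N.
    by apply: (three_mod (G := S) (H := F2) (K := S)) => //; rewrite ?(commGC S F2) // (subset_trans sF2S).
  rewrite commGC -(sub_cmod sZS nNS (subset_trans sF2S nNS)).
  apply: subset_trans sZSS _; rewrite join_subG !(sub_cmod _ nNS (subset_trans sF2S nNS)) // h2 /=.
  exact: subset_trans (commgSS sTC s2C) dC.
have eF1 : F1 :=: [~: C, Z] <*> N.
  have ne1 : N :!=: F1.
    by apply: contraNneq ncZ => e; move: k1; rewrite -e.
  have i1N : #|F1 : N| = p.
    apply: (p_index_le pr_p pS sF1S sN1) => //.
    have := rS sCS; rewrite -(Lagrange_index s2C sN2) -(Lagrange_index s12 sN1) i1 i2.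
    by rewrite !expnS muln1 !leq_pmul2l ?prime_gt0.
  have [x Cx nx] := subsetPn ncZ.
  apply/esym; apply: (idx_full (N := N) (K := [group of [~: C, Z] <*> N]) (x := x)) => //.
  - exact: joing_subr.
  - by rewrite join_subG k1.
  - by rewrite i1N.
  - exact: (subsetP (joing_subl _ _)).
have s2c : F2 \subset cmod C Z N by rewrite (sub_cmod s2C nNC nNZ).
have eF2 : F2 :=: cmod C Z N.
  case: (idx_cases (K := [group of cmod C Z N]) s2c (cmod_sub C Z N) _); first by rewrite i2.
    by move=> /= ->.
  by move=> /= e; case/negP: ncZ; rewrite -(sub_cmod (subxx C) nNC nNZ) e.
have tT : stab t1 T := stab_Phi At sE1 (tr_tE tr1).
have tC : stab t1 C.
  move=> x Cx; rewrite -(mulKVg x (t1 x)) groupM // (subsetP sTC) //; exact: (tr_tC tr1).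
have tN : stab t1 N := stab_Phi At sCS tC.
have sES : [~: E1, S] \subset S by apply: subset_trans (commSg _ sE1) sSS.
have tZ : stab t1 Z.
  apply: (stab_join (X := [group of [~: E1, S]]) At) => //.
  apply: (stab_comm At) => //; [exact: tr_tE tr1 | exact: Aut_stab].
have sNS := normal_sub nN.
have tF1 : stab t1 F1.
  rewrite eF1; apply: (stab_join (X := [group of [~: C, Z]]) (Y := N) At) => //.
    by apply: subset_trans k1 sF1S.
  by apply: (stab_comm At).
have tF2 : stab t1 F2 by rewrite eF2; apply: (stab_cmod At).
have [b3 a3] := acts_by_sign pr_p At tt sCS s2C (subset_trans sCS nS2) i2 tC tF2.
have [b2 a2'] := acts_by_sign pr_p At tt sF2S s12 (subset_trans sF2S nS1) i1 tF2 tF1.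
have [b1 a1'] : exists b, acts_by t1 b F1 N.
  case: (eqVneq (F1 : {set gT}) N) => [e | ne1].
    by exists false => x; rewrite e => Nx; rewrite groupM ?groupV ?tN.
  apply: (acts_by_sign pr_p At tt sF1S sN1 (subset_trans sF1S nNS)) => //.
  apply: (p_index_le pr_p pS sF1S sN1); last by rewrite eq_sym.
  have := rS sCS; rewrite -(Lagrange_index s2C sN2) -(Lagrange_index s12 sN1) i1 i2.
  by rewrite !expnS muln1 !leq_pmul2l ?prime_gt0.
have [w [_ [Ww nw _ _]]] := tr_ex pr_p tr1; have E1w := subsetP (tr_WE tr1) w Ww.
have Sw := subsetP sE1 w E1w.
have [y [E2y nE1y ty]] := pair_fixed tr1 nE2 (tr_iE tr2) ne st; have Sy := subsetP sE2 y E2y.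
have nMy : y \notin axis S E2 by rewrite -eax -eM inE (negPf nE1y).
have cCT : [~: C, T] \subset N := subset_trans (commgS _ sTC) dC.
have Kw : (sgn true w)^-1 * t1 w \in T by rewrite /sgn invgK; apply: (tr_tW tr1).
have Ky : (sgn false y)^-1 * t1 y \in T by rewrite /sgn ty mulVg.
have ps2 x s d : x \in F2 -> s \in S -> (sgn d s)^-1 * t1 s \in T -> [~ x, s] \notin N -> b1 = b2 (+) d.
  apply: (pair_sign odd_p pS At nN sF2S sF1S sF1S sTS) => //.
  exact: subset_trans (commSg _ s2C) cCT.
have ps3 x s d : x \in C -> s \in S -> (sgn d s)^-1 * t1 s \in T -> [~ x, s] \notin F1 -> b2 = b3 (+) d.
  apply: (pair_sign odd_p pS At n1 sCS sF2S sF2S sTS) => //.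
  exact: subset_trans cCT sN1.
have dich (X Y : {group gT}) s : {in X, forall x, [~ x, s] \in Y} \/ exists2 x, x \in X & [~ x, s] \notin Y.
  case: (boolP [forall x in X, [~ x, s] \in Y]) => [/forall_inP | ]; first by left.
  by rewrite negb_forall_in => /exists_inP; right.
(* The sign on F1 / N would be both equal and opposite to the sign on F2 / F1 if w and y acted
   nontrivially together. *)
have r2 : {in F2, forall x, [~ x, w] \in N} \/ {in F2, forall x, [~ x, y] \in N}.
  case: (dich F2 N w) => [|[x Fx nx]]; first by left.
  case: (dich F2 N y) => [|[x' Fx' nx']]; first by right.
  have := ps2 x w true Fx Sw Kw nx; rewrite (ps2 x' y false Fx' Sy Ky nx').
  by case: (b2).
have r3 : {in C, forall x, [~ x, w] \in F1} \/ {in C, forall x, [~ x, y] \in F1}.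
  case: (dich C F1 w) => [|[x Fx nx]]; first by left.
  case: (dich C F1 y) => [|[x' Fx' nx']]; first by right.
  have := ps3 x w true Fx Sw Kw nx; rewrite (ps3 x' y false Fx' Sy Ky nx').
  by case: (b3).
have [z Zz nTz] := subsetPn (tr_Zneq pr_p tr1).
(* commutation with E1 or E2 is checked on generators *)
have gE E W t a X Y g : transv p S E C W t a -> centre S E = Z -> 'Phi(E) = T -> X \subset S ->
    Y <| S -> [~: X, C] \subset Y -> [~: X, Z] \subset Y -> g \in E -> g \notin axis S E ->
    {in X, forall x, [~ x, g] \in Y} -> [~: X, E] \subset Y.
  move=> tr e eQ sXS nY h1 h2 Eg ng h3; have nYS := normal_norm nY.
  have sES' := normal_sub (tr_nE tr); have nYE := subset_trans sES' nYS; have nYX := subset_trans sXS nYS.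
  rewrite commGC -(sub_cmod (subxx E) nYE nYX).
  have sZE : Z \subset E by rewrite -e; apply: subset_trans (tr_ZH pr_p pS tr) (tr_HE S E).
  suff -> : cmod E X Y = E by [].
  apply: (tr_gen pr_p pS tr (K := [group of cmod E X Y]) (w := g) (z := z)) => //.
  - exact: cmod_sub.
  - by rewrite (sub_cmod (tr_CE tr) nYE nYX) commGC.
  - by rewrite e.
  - by rewrite eQ.
  - by apply: subsetP Zz; rewrite (sub_cmod sZE nYE nYX) commGC.
  - apply/(cmodP _ nYE nYX); split=> // x Xx; rewrite -invg_comm groupV; exact: h3.
have F2C : [~: F2, C] \subset N := subset_trans (commSg _ s2C) dC.
have CCF1 : [~: C, C] \subset F1 := subset_trans dC sN1.
have AB : [~: C, S, S] \subset N -> False.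
  move=> h; case/negP: ncZ; apply: (zc [group of [~: S, S]]) => //=.
  by apply: (three_mod (G := S) (H := C) (K := S)) => //; rewrite ?(commGC S C).
have A2 : [~: F2, S] \subset N -> False by move=> h; apply: AB; apply: subset_trans (commSg _ c2) h.
have A1 : [~: C, S] \subset F1 -> False by move=> h; apply: AB; apply: subset_trans (commSg _ h) cF1.
have lineE E W t a : transv p S E C W t a -> centre S E = Z -> [~: C, E] \subset F1 ->
    ~~ ([~: F2, E] \subset N) -> False.
  move=> tr e h1 h2; have sZE : Z \subset E by rewrite -e; apply: subset_trans (tr_ZH pr_p pS tr) (tr_HE S E).
  have eV1 : F1 :=: [~: C, E] <*> 'Phi(C).
    apply/eqP; rewrite eqEsubset !join_subG h1 sN1 andbT {1}eF1 join_subG joing_subr andbT.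
    by rewrite andbT; apply: subset_trans (commgS _ sZE) _; exact: joing_subl.
  have eV2 : F2 :=: cmod C (centre S E) 'Phi(C) by rewrite e.
  case: (line_contra pr_p odd_p pS rS tr n1 n2 sN1 s12 s2C i2 i1 eV1 eV2 cF1 c1) => //.
  by move=> h; case/negP: h2.
have same E W t a : transv p S E C W t a -> centre S E = Z -> 'Phi(E) = T ->
    [~: C, E] \subset F1 -> [~: F2, E] \subset N -> False.
  move=> tr e eQ h1 h2; have sES' := normal_sub (tr_nE tr); case/negP: ncZ.
  apply: (zc [group of [~: E, S]]) => //=.
  - by apply: subset_trans (commSg _ sES') sSS.
  - by rewrite -eQ -e.
  apply: (three_mod (G := S) (H := C) (K := E)) => //; first exact: subset_trans sES' nNS.
    by rewrite (commGC S C); apply: subset_trans (commSg _ c2) h2.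
  apply: subset_trans (commSg _ h1) cF1.
have mulE X Y : X \subset S -> Y <| S -> [~: X, E1] \subset Y -> [~: X, E2] \subset Y -> [~: X, S] \subset Y.
  by move=> sXS nY; apply: (comm_mulr (esym eS) (normal_norm nY)); apply: subset_trans sXS (normal_norm nY).
(* If the same element is trivial at both steps, its E acts so weakly that the three subgroups lemma
   gives [C, Z] inside Phi(C). If the trivial elements differ, [line_contra] applies to the subgroup
   acting trivially at the upper step. *)
case: r2 => r2; case: r3 => r3.
- apply: (same _ _ _ _ tr1) => //.
    exact: (gE _ _ _ _ C F1 w tr1).
  exact: (gE _ _ _ _ F2 N w tr1).
- apply: (lineE _ _ _ _ tr2) => //.
    exact: (gE _ _ _ _ C F1 y tr2).
  apply/negP=> h; apply: A2; apply: mulE => //.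
  exact: (gE _ _ _ _ F2 N w tr1).
- apply: (lineE _ _ _ _ tr1) => //.
    exact: (gE _ _ _ _ C F1 w tr1).
  apply/negP=> h; apply: A2; apply: mulE => //.
  exact: (gE _ _ _ _ F2 N y tr2).
- apply: (same _ _ _ _ tr2) => //.
    exact: (gE _ _ _ _ C F1 y tr2).
  exact: (gE _ _ _ _ F2 N y tr2).
Qed.

End StepU.

(** * The common axis is central in S *)

Section Central.
Variables (gT : finGroupType) (p : nat) (S : {group gT}).
Hypotheses (pr_p : prime p) (odd_p : odd p) (pS : p.-group S) (rS : rk3 p S).
Implicit Types (X Y V N E C W D K M : {group gT}) (t a : {perm gT}).

(** For x in E, x ^+ p is in Phi(E), hence in C, and S centralises it modulo Phi(C). Comparing x ^+
    p with its conjugate by s shows that [x, s] ^+ p is in N1. So the kernel of the power map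
    contains C and the centre, and [tr_all] finishes. *)
Lemma tr_Phi_der E C W t a : transv p S E C W t a -> [~: C, S] \subset 'Phi(C) ->
  'Phi(E) = [~: E, E] <*> 'Phi(C).
Proof.
move=> tr cCS; have nES := tr_nE tr; have sES := normal_sub nES; have pE := tr_pE pS tr.
have Aa := tr_aE tr; have nC := tr_nC tr; have sCS := normal_sub nC; have pC := pgroupS sCS pS.
have sCE := tr_CE tr; have sQC := tr_QC tr.
pose N1 := [group of [~: E, E] <*> 'Phi(C)].
have sN1E : N1 \subset E.
  by rewrite join_subG (subset_trans (Phi_der pE) (Phi_sub E)) (subset_trans (Phi_sub C) sCE).
have sNN1 : 'Phi(C) \subset N1 := joing_subr _ _.
have dE1 : [~: E, E] \subset N1 := joing_subl _ _.
have nN1 : E \subset 'N(N1).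
  by rewrite -commg_subl; apply: subset_trans (commSg _ sN1E) dE1.
have aN1 : stab a N1.
  apply: (stab_join (X := [group of [~: E, E]]) (Y := [group of 'Phi(C)]) Aa) => //.
  - exact: subset_trans (Phi_der pE) (Phi_sub E).
  - exact: subset_trans (Phi_sub C) sCE.
  - by apply: (stab_comm Aa) => //; apply: Aut_stab.
  - exact: stab_Phi Aa sCE (tr_aCC tr).
have pc : pow_cond p E N1.
  split=> // [|x x' Ex Ex']; first by apply: subset_trans (commSg _ dE1) _; rewrite commg_subl.
  by rewrite groupX // (subsetP dE1) // mem_commg.
have [K eK] := powker odd_p pc.
have sKE : K \subset E by apply/subsetP=> x; rewrite eK => /andP[].
have sCK : C \subset K.
  apply/subsetP=> x Cx; rewrite eK inE (subsetP sCE) //=.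
  by apply: (subsetP sNN1); apply: Phi_pow.
have eKE : K :=: E.
  apply: (tr_all pr_p pS tr) => //.
    move=> x; rewrite !eK !inE => /andP[Ex N1x]; rewrite (Aut_stab Aa Ex) /= -(AutX Aa) //.
    exact: aN1.
  rewrite join_subG (subset_trans sQC sCK) andbT gen_subG.
  apply/subsetP=> _ /imset2P[x s Ex Ss ->].
  have Exs : [~ x, s] \in E.
    by rewrite commgEl groupM ?groupV // memJ_norm // (subsetP (normal_norm nES)).
  rewrite eK inE Exs /=; have nN := subsetP nN1.
  apply: coset_idr; first by rewrite nN ?groupX.
  have := pow_mod odd_p pc Ex Exs; rewrite -conjg_mulR -conjXg conjg_mulR.
  have N1x : [~ x ^+ p, s] \in N1.
    apply: (subsetP sNN1); apply: (subsetP cCS); rewrite mem_commg //.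
    by apply: (subsetP sQC); apply: Phi_pow.
  rewrite morphM ?nN ?groupX ?(subsetP sN1E _ N1x) //= (coset_id N1x) mulg1.
  by move/eqP; rewrite -{1}[X in X == _]mulg1 (inj_eq (mulgI _)) eq_sym => /eqP.
apply/eqP; rewrite eqEsubset join_subG (Phi_der pE) (PhiS pE sCE) !andbT.
apply: (Phi_sub_crit pr_p pE nN1 dE1) => x; rewrite -{1}eKE eK inE => /andP[_ h]; exact: h.
Qed.

(** t inverts W modulo Phi(E), so it fixes commutators of W modulo Phi(C), and by [tr_Phi_der] these
    generate Phi(E) over Phi(C) up to commutators with C. So t is trivial on both layers of C /
    Phi(C), and [invol_Phi] concludes. *)
Lemma tr_fixC E C W t a : transv p S E C W t a -> [~: C, S] \subset 'Phi(C) ->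
  {in C, forall x, t x = x}.
Proof.
move=> tr cCS; have nES := tr_nE tr; have sES := normal_sub nES; have pE := tr_pE pS tr.
have nC := tr_nC tr; have sCS := normal_sub nC; have pC := pgroupS sCS pS.
have sCE := tr_CE tr; have sQC := tr_QC tr; have [At tt] := (tr_tS tr, tr_tt tr).
have eQ := tr_Phi_der tr cCS; have sWE := tr_WE tr.
pose N := [group of 'Phi(C)]; have nN : N <| S by apply: char_normal_trans (Phi_char C) nC.
have nNS := subsetP (normal_norm nN); have sNS := normal_sub nN.
have nQ := tr_nQ tr; have sQS := normal_sub nQ.
have tQ : stab t 'Phi(E) := stab_Phi At sES (tr_tE tr).
have tC : stab t C.
  move=> x Cx; rewrite -(mulKVg x (t x)) groupM // (subsetP sQC) //; exact: (tr_tC tr).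
have tN : stab t N := stab_Phi At sCS tC.
have gD : group_set [set x in 'Phi(E) | x^-1 * t x \in N].
  apply/group_setP; split=> [|x y]; first by rewrite inE group1 (Aut_one At) mulg1 groupV group1.
  rewrite !inE => /andP[Qx hx] /andP[Qy hy].
  have [Sx Sy] := (subsetP sQS x Qx, subsetP sQS y Qy); rewrite groupM // (AutM At) //=.
  have -> : (x * y)^-1 * (t x * t y) = (x^-1 * t x) ^ y * (y^-1 * t y).
    by rewrite invMg conjgE !mulgA mulgK.
  by rewrite groupM // memJ_norm // nNS.
have sND : N \subset Group gD.
  apply/subsetP=> x Nx; rewrite inE groupM ?groupV ?tN // andbT.
  exact: subsetP (PhiS pE sCE) x Nx.
have cQS : [~: 'Phi(E), S] \subset N := subset_trans (commSg _ sQC) cCS.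
have sDQ : Group gD \subset 'Phi(E) by apply/subsetP=> x; rewrite inE => /andP[].
have nED : E \subset 'N(Group gD).
  rewrite -commg_subl; apply: subset_trans (subset_trans (commSg _ sDQ) (commgS _ sES)) _.
  exact: subset_trans cQS sND.
have sWS := subset_trans sWE sES.
have dW : [~: W, W] \subset Group gD.
  rewrite gen_subG; apply/subsetP=> _ /imset2P[x y Wx Wy ->].
  have [Ex Ey] := (subsetP sWE x Wx, subsetP sWE y Wy).
  have Qxy : [~ x, y] \in 'Phi(E) by rewrite (subsetP (Phi_der pE)) // mem_commg.
  have Sxy := subsetP sQS _ Qxy.
  have h := pair_sign_comm At (G := E) (X := E) (Y := C) (V := [group of 'Phi(E)]) (K := C)
    (b := true) (d := true) nN sES sCS sQS sCS sES (Phi_der pE) cCS cQS _ Ex _ Ey _ _.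
  rewrite inE Qxy /=; have St : t [~ x, y] \in S by apply: (Aut_stab At).
  apply: coset_idr; first by rewrite nNS ?groupM ?groupV.
  rewrite morphM ?groupV ?nNS // morphV ?nNS //= h ?mulVg //.
  - by rewrite commGC; apply: subset_trans (commgS _ sES) cCS.
  - by rewrite /sgn invgK (subsetP sQC) // (tr_tW tr).
  - exact: tr_tE tr y Ey.
  - by rewrite /sgn invgK (subsetP sQC) // (tr_tW tr).
have cSC : [~: S, C] \subset N by rewrite commGC.
have dE : [~: E, E] \subset Group gD.
  apply: (comm_mul (esym (tr_WC tr)) nED dW); apply: subset_trans sND.
    exact: subset_trans (commSg _ sWS) cSC.
  exact: Phi_der pC.
have tQN x : x \in 'Phi(E) -> x^-1 * t x \in N.
  have sQD : 'Phi(E) \subset Group gD.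
    by apply: subset_trans (_ : [~: E, E] <*> 'Phi(C) \subset _); [rewrite -eQ | rewrite join_subG dE].
  by move/(subsetP sQD); rewrite inE => /andP[].
apply: (invol_Phi odd_p pS At tt sCS) => x Cx; have Sx := subsetP sCS x Cx.
have [x' xx' tx'] := invol_fixed odd_p pS At tt sQS Sx (tr_tC tr Cx).
rewrite mem_lcoset in xx'; set q := x^-1 * x' in xx'.
have Sq := subsetP sQS q xx'.
have ex : x = x' * q^-1 by rewrite invMg invgK mulKVg.
have Sx' : x' \in S by rewrite -(mulKVg x x') groupM.
have -> : x^-1 * t x = ((q^-1 * t q) ^ q^-1)^-1.
  rewrite {2}ex (AutM At) ?groupV // (AutV At) // tx' {1}ex invMg invgK -mulgA mulKg.
  by rewrite conjgE invgK !mulgA mulgV mul1g invMg invgK.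
by rewrite groupV memJ_norm ?nNS ?groupV //; apply: tQN.
Qed.

(** [y, z] is in C, hence fixed by t1. But t1 fixes y and inverts z up to an element of Phi(E1), so
    it also inverts [y, z] modulo N. *)
Lemma pair_comm E1 C W1 t1 a1 N y : transv p S E1 C W1 t1 a1 -> {in C, forall x, t1 x = x} ->
  y \in S -> t1 y = y -> N <| S -> [~: C, S] \subset N -> {in centre S E1, forall z, [~ y, z] \in N}.
Proof.
move=> tr fC Sy ty nN cCN z Zz; have [At tt] := (tr_tS tr, tr_tt tr).
have nNS := subsetP (normal_norm nN); have sQC := tr_QC tr.
have Mz := subsetP (tr_ZH pr_p pS tr) z Zz.
have Sz := subsetP (normal_sub (tr_nH tr)) z Mz.
have Qy v : v \in axis S E1 -> [~ y, v] \in 'Phi(E1).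
  by move=> Mv; rewrite -invg_comm groupV (subsetP (tr_HS tr)) // mem_commg.
have Cu := subsetP sQC _ (Qy z Mz).
have sCS := normal_sub (tr_nC tr).
pose q := z * t1 z; have Qq : q \in 'Phi(E1) by apply: (tr_tW tr); apply: (subsetP (tr_ZW tr)).
have Cq := subsetP sQC q Qq; have Sq := subsetP sCS q Cq.
have tz : t1 z = z^-1 * q by rewrite mulKg.
have e : [~ y, z] = [~ y, q] * [~ y, z^-1] ^ q.
  by rewrite -{1}(fC _ Cu) (AutR At) // ty tz commgMJ.
apply: (invol_odd odd_p pS); first by rewrite groupR.
pose c g := coset N g.
have cM g h : g \in S -> h \in S -> c (g * h) = c g * c h by move=> Sg Sh; rewrite /c morphM ?nNS.
have cJ v g : v \in 'Phi(E1) -> g \in S -> c (v ^ g) = c v.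
  move=> Qv Sg; have Sv := subsetP sCS v (subsetP sQC v Qv).
  have Nv : [~ v, g] \in N by apply: (subsetP cCN); rewrite mem_commg // (subsetP sQC).
  by rewrite conjg_mulR cM ?groupR // [c [~ v, g]]coset_id // mulg1.
have Nyq : [~ y, q] \in N by rewrite -invg_comm groupV (subsetP cCN) // mem_commg.
have Qzi : [~ y, z^-1] \in 'Phi(E1) by rewrite Qy // groupV.
have h1 : c [~ y, z] = c [~ y, z^-1].
  by rewrite {1}e cM ?groupJ ?groupR ?groupV // [c [~ y, q]]coset_id // mul1g cJ.
apply: coset_idr; first by rewrite nNS ?groupX ?groupR.
rewrite -[LHS]/(c _) expgS expg1 cM ?groupR // {1}h1.
rewrite -[X in _ * X](cJ _ z^-1) ?Qy ?groupV // -cM ?groupJ ?groupR ?groupV //.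
by rewrite -commgMJ mulgV commg1 [c 1]coset_id.
Qed.

Lemma abel_Phi C : p.-group C -> #|C : 'Phi(C)| <= p -> [~: C, C] = 1.
Proof.
move=> pC le; case: (boolP (C \subset 'Phi(C))) => [sC | /subsetPn[x Cx nx]].
  case: (eqVneq (C : {set gT}) 1) => [-> | ne]; first by rewrite comm1G.
  by have := Phi_proper ne; rewrite properE sC andbF.
have e : <[x]> <*> 'Phi(C) = C.
  apply: (idx_full (N := [group of 'Phi(C)]) (K := [group of <[x]> <*> 'Phi(C)]) (x := x)) => //.
  - exact: joing_subr.
  - by rewrite join_subG cycle_subG Cx Phi_sub.
  - rewrite (p_index_le pr_p pC (subxx C) (Phi_sub C) le) //.
    by apply: contraNneq nx => ->.
  - by apply: (subsetP (joing_subl _ _)); apply: cycle_id.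
rewrite joingC in e; have := Phi_nongen e; rewrite genGid => <-.
exact/commG1P/cycle_abelian.
Qed.

(** The fixed points y and w centralise the axis modulo Phi(C), so E2 is abelian there and Phi(E1)
    lies in Phi(C). Then C / Phi(C) has order at most p and C is abelian. As t1 and t2 fix C
    pointwise, C is even central in S, and the same argument with 1 in place of Phi(C) proves the
    claim. *)
Lemma two_char E1 W1 t1 a1 E2 W2 t2 a2 C : transv p S E1 C W1 t1 a1 -> transv p S E2 C W2 t2 a2 ->
  E1 :!=: E2 -> E1 :&: E2 = axis S E1 -> axis S E1 = axis S E2 -> centre S E1 = centre S E2 ->
  'Phi(E2) = 'Phi(E1) -> stab t1 E2 -> stab t2 E1 -> axis S E1 \subset 'C(S).
Proof.
move=> tr1 tr2 ne eM eax eZ eT st1 st2.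
have [nE1 nE2] := (tr_nE tr1, tr_nE tr2); have [sE1 sE2] := (normal_sub nE1, normal_sub nE2).
have cCS : [~: C, S] \subset 'Phi(C) := tr_U pr_p odd_p pS rS tr1 tr2 ne eM eax eZ eT st1.
have f1 := tr_fixC tr1 cCS; have f2 := tr_fixC tr2 cCS.
have nC := tr_nC tr1; have sCS := normal_sub nC; have pC := pgroupS sCS pS.
pose N := [group of 'Phi(C)]; have nN : N <| S by apply: char_normal_trans (Phi_char C) nC.
have nNS := normal_norm nN.
have [y [E2y nE1y ty]] := pair_fixed pr_p odd_p pS tr1 nE2 (tr_iE tr2) ne st1.
have ne' : E2 :!=: E1 by rewrite eq_sym.
have [w [E1w nE2w tw]] := pair_fixed pr_p odd_p pS tr2 nE1 (tr_iE tr1) ne' st2.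
have [Sy Sw] := (subsetP sE2 y E2y, subsetP sE1 w E1w).
pose M := [group of axis S E1]; pose Z := [group of centre S E1]; pose T := [group of 'Phi(E1)].
have sTC : T \subset C := tr_QC tr1; have sMS : M \subset S := normal_sub (tr_nH tr1).
have sZM : Z \subset M := tr_ZH pr_p pS tr1; have sZS := subset_trans sZM sMS.
have sTZ : T \subset Z := joing_subr _ _.
have nMy : y \notin M by rewrite /= -eM inE (negPf nE1y).
have nMw : w \notin M by rewrite /= -eM inE (negPf nE2w) andbF.
have MM (X : {group gT}) : X <| S -> [~: C, S] \subset X -> [~: M, M] \subset X.
  move=> nX c; have nXS := normal_norm nX; have nXM := subset_trans sMS nXS.
  apply: (comm_mul (A := Z) (B := C) (esym (tr_ZC pr_p pS tr1)) nXM).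
  - apply: (der_ext sTZ (subset_trans sZM nXM)); first by rewrite (tr_iZ pr_p pS tr1).
    exact: subset_trans (commgSS sTC sZS) c.
  - by rewrite commGC; apply: subset_trans (commgS _ sZS) c.
  - exact: subset_trans (commgS _ sCS) c.
have cyM (X : {group gT}) g : X <| S -> [~: C, S] \subset X -> g \in S ->
    {in Z, forall z, [~ g, z] \in X} -> {in M, forall m, [~ g, m] \in X}.
  move=> nX c Sg h m Mm.
  have /mulsgP[z d Zz Cd ->] : m \in Z * C by rewrite (tr_ZC pr_p pS tr1).
  rewrite commgMJ groupM //; last by rewrite memJ_norm ?h // (subsetP (normal_norm nX)) // (subsetP sCS).
  by rewrite -invg_comm groupV (subsetP c) // mem_commg.
have hyN (X : {group gT}) : X <| S -> [~: C, S] \subset X -> {in M, forall m, [~ y, m] \in X}.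
  by move=> nX c; apply: cyM => //; exact: (pair_comm tr1 f1 Sy ty nX c).
have hwN (X : {group gT}) : X <| S -> [~: C, S] \subset X -> {in M, forall m, [~ w, m] \in X}.
  move=> nX c; apply: cyM => // z Zz; have Zz' : z \in centre S E2 by rewrite -eZ.
  exact: (pair_comm tr2 f2 Sw tw nX c).
have sME2 : M \subset E2 by rewrite /= -eM subsetIr.
have sME1 : M \subset E1 by rewrite /= -eM subsetIl.
have full (X E : {group gT}) g : X <| S -> [~: C, S] \subset X -> E \subset S -> M \subset E ->
    #|E : M| = p -> g \in E -> g \notin M -> {in M, forall m, [~ g, m] \in X} -> [~: M, E] \subset X.
  move=> nX c sES sME iE Eg ng h; have nXE := subset_trans sES (normal_norm nX).
  have nXM := subset_trans sME nXE.
  rewrite commGC -(sub_cmod (subxx E) nXE nXM).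
  suff -> : cmod E M X = E by [].
  apply: (idx_full (N := M) (x := g)) => //.
  - by rewrite (sub_cmod sME nXE nXM) MM.
  - exact: cmod_sub.
  - by rewrite iE.
  - by apply/(cmodP _ nXE nXM).
have i1 : #|E1 : M| = p := tr_iH tr1.
have i2 : #|E2 : M| = p by rewrite /= eax; apply: tr_iH tr2.
have d2 : [~: E2, E2] \subset N.
  have c := full N E2 y nN cCS sE2 sME2 i2 E2y nMy (hyN N nN cCS).
  by apply: (der_ext sME2 (subset_trans sE2 nNS)); rewrite ?i2.
have eTN : 'Phi(E1) \subset N by rewrite -eT (tr_Phi_der tr2 cCS) join_subG d2 /=.
have abC : [~: C, C] = 1.
  apply: abel_Phi => //; apply: leq_trans (tr_iCQle pr_p rS tr1).
  by rewrite dvdn_leq ?indexg_gt0 // indexgS.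
(* For v in W, x ^ v lies in C and is fixed by t, while t sends v to v^-1 up to an element of
   Phi(E). So x ^ v = x ^ v^-1, the square of v centralises x, and so does v. *)
have cWC E W t a : transv p S E C W t a -> 'Phi(E) = T -> {in C, forall x, t x = x} -> E \subset 'C(C).
  move=> tr eQ fC; have sWE := tr_WE tr; have sES := normal_sub (tr_nE tr).
  have [At tt] := (tr_tS tr, tr_tt tr); have cCC : C \subset 'C(C) by apply/commG1P.
  rewrite -(tr_WC tr) mul_subG //; apply/subsetP=> v Wv; apply/centP=> x Cx.
  have Sv := subsetP sES v (subsetP sWE v Wv); have Sx := subsetP sCS x Cx.
  have : v \in 'C_S[x]; last by case/setIP=> _ /cent1P.
  apply: (invol_odd odd_p pS (N := [group of 'C_S[x]]) Sv).
  have Cxv g : g \in S -> x ^ g \in C by move=> Sg; rewrite memJ_norm // (subsetP (normal_norm nC)).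
  have Qv := tr_tW tr Wv; rewrite eQ in Qv; set q := v * t v in Qv.
  have tv : t v = v^-1 * q by rewrite mulKg.
  have h : x ^ v = x ^ v^-1.
    rewrite -{1}(fC _ (Cxv v Sv)) (AutJ At) // (fC x Cx) tv conjgM; apply/conjg_fixP/commgP.
    by apply/(centP (subsetP cCC _ (Cxv _ (groupVr Sv)))); apply: (subsetP sTC).
  rewrite inE groupX //=; apply/cent1P/commute_sym/commgP/conjg_fixP.
  by rewrite expgS expg1 conjgM h conjgKV.
have c1 : [~: C, S] \subset [1 gT]%G.
  have [_ _ eS _] := max_meet pr_p pS sE1 sE2 (tr_iE tr1) (tr_iE tr2) ne.
  have cC : S \subset 'C(C).
    by rewrite -eS mul_subG ?(cWC _ _ _ _ tr1) // (cWC _ _ _ _ tr2).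
  by apply/trivgP/commG1P; rewrite centsC.
have n1 : [1 gT]%G <| S by apply: normal1.
have cE1 := full [1 gT]%G E1 w n1 c1 sE1 sME1 i1 E1w nMw (hwN _ n1 c1).
have cE2 := full [1 gT]%G E2 y n1 c1 sE2 sME2 i2 E2y nMy (hyN _ n1 c1).
have [_ _ eS _] := max_meet pr_p pS sE1 sE2 (tr_iE tr1) (tr_iE tr2) ne.
rewrite centsC -eS mul_subG // centsC; apply/commG1P/trivgP; [exact: cE1 | exact: cE2].
Qed.

End Central.

(** * Morphisms of a fusion system as permutations *)

Lemma perm_extend (T : finType) (f : T -> T) (A : {set T}) : {in A &, injective f} ->
  exists u : {perm T}, {in A, u =1 f}.
Proof.
move=> injf; pose B := f @: A; have cAB : #|~: A| = #|~: B|.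
  by apply/eqP; rewrite -(eqn_add2l #|A|) cardsC -(card_in_imset injf) cardsC.
pose g x := if x \in A then f x else nth x (enum (~: B)) (index x (enum (~: A))).
have gB x : x \notin A -> g x \in ~: B.
  move=> nx; rewrite /g (negPf nx) -mem_enum mem_nth // -cardE -cAB cardE index_mem mem_enum inE.
  exact: nx.
have ing x : x \in A -> g x \in B by move=> Ax; rewrite /g Ax; apply: imset_f.
have injg : injective g.
  move=> x y e; case: (boolP (x \in A)) => Ax; case: (boolP (y \in A)) => Ay.
  - by apply: injf => //; move: e; rewrite /g Ax Ay.
  - by have := gB y Ay; rewrite inE -e ing.
  - by have := gB x Ax; rewrite inE e ing.
  have lt z : z \notin A -> index z (enum (~: A)) < size (enum (~: B)).
    by move=> nz; rewrite -cardE -cAB cardE index_mem mem_enum inE.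
  move: e; rewrite /g (negPf Ax) (negPf Ay) (set_nth_default y) ?lt // => /eqP.
  rewrite nth_uniq ?enum_uniq ?lt // => /eqP e.
  have mx z : z \notin A -> z \in enum (~: A) by move=> nz; rewrite mem_enum inE.
  by rewrite -(nth_index x (mx x Ax)) e nth_index ?mx.
by exists (perm injg) => x Ax; rewrite permE /g Ax.
Qed.

Section Alperin.
Variables (gT : finGroupType) (S : {group gT}) (F : fusion_rel gT) (p : nat).
Hypotheses (pr_p : prime p) (pS : p.-group S) (sat : saturated S F p).
Implicit Types (P Q R X : {group gT}) (u v a : {perm gT}).

Let fsF : fusion_system S F. Proof. by case: sat. Qed.

(* permutations standing for the morphisms that they extend *)
Definition fhom (P Q : {set gT}) (u : {perm gT}) := F P Q (finfun u).

Lemma fhom_of (P : {set gT}) Q f : F P Q f -> exists2 u, fhom P Q u & {in P, u =1 f}.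
Proof.
move=> h; have [_ [_ injf _]] := fs_hom fsF h; have [u eu] := perm_extend injf.
by exists u => //; apply: (fs_ext fsF h) => x Px; rewrite ffunE eu.
Qed.

Lemma fhom_ext (P Q : {set gT}) u v : fhom P Q u -> {in P, u =1 v} -> fhom P Q v.
Proof. by move=> h e; apply: (fs_ext fsF h) => x Px; rewrite !ffunE e. Qed.

Lemma fhom_comp (P Q R : {set gT}) u v : fhom P Q u -> fhom Q R v -> fhom P R (u * v).
Proof.
move=> h1 h2; apply: (fs_ext fsF (fs_comp fsF h1 h2)) => x Px.
by rewrite !ffunE permM.
Qed.

Lemma fhom_codom (P Q : {set gT}) R u : fhom P Q u -> u @: P \subset R -> R \subset S -> fhom P R u.
Proof.
move=> h s1 s2; apply: (fs_codom fsF h) => //.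
by rewrite (eq_in_imset (g := u)) // => x _; rewrite ffunE.
Qed.

Lemma fhomP (P Q : {set gT}) u : fhom P Q u ->
  [/\ P \subset S, Q \subset S, {in P &, {morph u : x y / x * y}} & u @: P \subset Q].
Proof.
move=> h; have [[_ _ sP sQ] [m _ i]] := fs_hom fsF h; split=> //.
  by move=> x y Px Py; have := m x y Px Py; rewrite !ffunE.
by move: i; rewrite (eq_in_imset (g := u)) // => x _; rewrite ffunE.
Qed.

Lemma fhom_img (P Q : {set gT}) u : fhom P Q u -> group_set (u @: P).
Proof.
move=> h; have [[gP _ _ _] _] := fs_hom fsF h; have [_ _ m _] := fhomP h.
have -> : u @: P = Morphism (D := Group gP) m @* (Group gP) by rewrite morphimEdom.
exact: groupP.
Qed.

Lemma fhom_inv (P Q : {set gT}) u : fhom P Q u -> fhom (u @: P) P u^-1.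
Proof.
move=> h; have [g [hg e]] := fs_inv fsF h.
have ei : finfun u @: P = u @: P by apply: eq_in_imset => x _; rewrite ffunE.
rewrite ei in hg; apply: (fs_ext fsF hg) => _ /imsetP[x Px ->].
by have := e x Px; rewrite !ffunE permK.
Qed.

Lemma fhom_res P Q u : fhom P S u -> Q \subset P -> fhom Q S u.
Proof.
move=> h sQP; have [sPS _ _ _] := fhomP h; have sQS := subset_trans sQP sPS.
have h1 : F Q P (conj_map 1).
  by apply: (fs_conj fsF); rewrite ?conjsg1.
apply: (fs_ext fsF (fs_comp fsF h1 h)) => x Qx.
by rewrite !ffunE conjg1.
Qed.

Lemma fhom1 P : P \subset S -> fhom P S 1.
Proof.
move=> sPS; have h1 : F P S (conj_map 1) by apply: (fs_conj fsF); rewrite ?conjsg1.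
by apply: (fs_ext fsF h1) => x Qx; rewrite !ffunE conjg1 perm1.
Qed.

Lemma autFP P a : reflect (a \in Aut P /\ fhom P P a) (a \in autF F P).
Proof.
have e : pval a = finfun a :> {ffun gT -> gT} by apply/ffunP=> x; rewrite ffunE -pvalE.
by rewrite /fhom -e; apply: setIdP.
Qed.

Lemma autF_group_set P : P \subset S -> group_set (autF F P).
Proof.
move=> sPS; apply/group_setP; split=> [|a b /autFP[Aa ha] /autFP[Ab hb]].
  apply/autFP; split; first exact: group1.
  by apply: (fhom_codom (fhom1 sPS)) => //; apply/subsetP=> _ /imsetP[x Px ->]; rewrite perm1.
by apply/autFP; split; [exact: groupM | exact: fhom_comp ha hb].
Qed.

(** Members of [autF] fix every point outside P, so the values of u there are replaced by the
    identity. *)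
Lemma autF_of P u : fhom P P u -> exists2 a, a \in autF F P & {in P, a =1 u}.
Proof.
move=> h; have [sP _ m i] := fhomP h.
have inj : injective (fun x => if x \in P then u x else x).
  have sP' x : x \in P -> u x \in P by move=> Px; apply: (subsetP i); apply: imset_f.
  have eP : u @: P = P by apply/eqP; rewrite eqEcard i (card_imset _ (@perm_inj _ u)) leqnn.
  move=> x y /=; case: ifP => Px; case: ifP => Py //.
  - by move/perm_inj.
  - by move=> e; move: Py; rewrite -e sP'.
  - by move=> e; move: Px; rewrite e sP'.
exists (perm inj) => [|x Px]; last by rewrite permE Px.
have e : {in P, perm inj =1 u} by move=> x Px; rewrite permE Px.
apply/autFP; split; last by apply: (fhom_ext h) => x Px; rewrite e.
rewrite inE; apply/andP; split.
  apply/subsetP=> x; rewrite inE permE; case: ifP => // _; by rewrite eqxx.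
by apply/morphicP=> x y Px Py; rewrite !e ?groupM // m.
Qed.

Lemma autS_conj P : P \subset S -> autS S P = conj_aut P @* 'N_S(P).
Proof.
move=> sPS; apply/setP=> a; apply/idP/idP.
  rewrite inE => /andP[Aa /exists_inP[s Ns /forall_inP h]]; apply/morphimP; exists s => //.
    by case/setIP: Ns.
  apply/permP=> x; case: (boolP (x \in P)) => Px.
    by rewrite (eqP (h x Px)) norm_conj_autE //; case/setIP: Ns.
  by rewrite (out_Aut Aa) // (out_Aut _ Px) // Aut_aut.
case/morphimP=> s Ns Ss ->; rewrite inE Aut_aut /=; apply/exists_inP; exists s => //.
by apply/forall_inP=> x Px; rewrite norm_conj_autE.
Qed.

Lemma innA_conj P : innA P = conj_aut P @* P.
Proof.
apply/setP=> a; apply/idP/idP.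
  rewrite inE => /andP[Aa /exists_inP[s Ns /forall_inP h]].
  have Ns' := subsetP (normG P) s Ns; apply/morphimP; exists s => //.
  apply/permP=> x; case: (boolP (x \in P)) => Px.
    by rewrite (eqP (h x Px)) norm_conj_autE.
  by rewrite (out_Aut Aa) // (out_Aut _ Px) // Aut_aut.
case/morphimP=> s Ns Ss ->; rewrite inE Aut_aut /=; apply/exists_inP; exists s => //.
by apply/forall_inP=> x Px; rewrite norm_conj_autE.
Qed.

End Alperin.

(** * Strong p-embedding by elements *)

Section StronglyEmbedded.
Variables (aT : finGroupType) (p : nat) (A I : {group aT}).
Hypotheses (pr_p : prime p) (nIA : I <| A).

(** The condition on A / I pulled back to A. It avoids the type [coset_of], which depends on I, and
    can therefore be conjugated freely. *)
Definition semb_elt (H : {group aT}) := [/\ H \proper A, I \subset H,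
  exists2 x, x \in H & p.-elt x /\ x \notin I &
  forall g, g \in A -> g \notin H -> forall x, x \in H -> x \in H :^ g -> p.-elt x -> x \in I].

Let nI := normal_norm nIA.

(** The p-part of any preimage is again a preimage. *)
Lemma lift_p (H : {group aT}) (h : coset_of I) : H \subset A -> h \in H / I -> p.-elt h ->
  exists2 x, x \in H & p.-elt x /\ coset I x = h.
Proof.
move=> sHA /morphimP[x Nx Hx ->] ph; exists x.`_p; first by rewrite groupX.
split; first exact: p_elt_constt.
by rewrite morph_constt // constt_p_elt.
Qed.

Lemma semb_elim (K : {group coset_of I}) : strongly_p_embedded p (A / I) K ->
  exists H, semb_elt H.
Proof.
move=> [ltK pK hK]; pose H := [group of A :&: coset I @*^-1 K].
have sKA := proper_sub ltK.
have sIH : I \subset H by rewrite subsetI (normal_sub nIA) -{1}(ker_coset I) kerE morphpreS // sub1G.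
have mH x : x \in A -> (x \in H) = (coset I x \in K).
  move=> Ax; rewrite inE Ax /=; apply/morphpreP/idP => [[]// | h]; split=> //.
  exact: (subsetP nI).
have eK : H / I = K.
  apply/setP=> k; apply/idP/idP => [/morphimP[x Nx Hx ->] | Kk].
    by rewrite -mH //; case/setIP: Hx.
  have /morphimP[x Nx Ax ek] := subsetP sKA k Kk.
  by rewrite ek mem_quotient // mH // -ek.
exists H; split=> //.
- rewrite properE subsetIl; apply/negP=> sAH; have [_ [x Ax nx]] := properP ltK.
  by case/negP: nx; apply: subsetP Ax; rewrite -eK quotientS.
- have [h Kh oh] := Cauchy pr_p pK.
  have ph : p.-elt h by rewrite /p_elt oh pnat_id.
  rewrite -eK in Kh; have [x Hx [px ex]] := lift_p (subsetIl _ _) Kh ph.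
  exists x => //; split=> //; apply/negP=> Ix; move: (prime_gt1 pr_p).
  by rewrite -oh -ex coset_id // order1.
move=> g Ag nHg x Hx Hgx px.
have Ax : x \in A by case/setIP: Hx.
have Nx := subsetP nI x Ax; have Ng := subsetP nI g Ag.
have := hK (coset I g); rewrite inE -mH // nHg mem_quotient // => /(_ isT) np.
apply: coset_idr => //; apply/eqP; rewrite -order_eq1; apply/eqP.
have px' : p.-elt (coset I x) by apply: morph_p_elt.
have Kx : coset I x \in K :&: K :^ coset I g.
  rewrite inE -mH // Hx /= -eK -quotientJ //; exact: mem_quotient.
have := order_dvdG Kx; case/p_natP: px' => -[|n] -> // d.
by case/negP: np; apply: dvdn_trans d; rewrite expnS dvdn_mulr.
Qed.

Lemma semb_intro (H : {group aT}) : semb_elt H -> strongly_p_embedded p (A / I) (H / I).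
Proof.
move=> [ltH sIH [x Hx [px nIx]] hH]; have sHA := proper_sub ltH; have [_ [a Aa nHa]] := properP ltH.
have inH y : y \in A -> coset I y \in H / I -> y \in H.
  move=> Ay /morphimP[h Nh Hh e]; have Ny := subsetP nI y Ay.
  have : h^-1 * y \in I.
    by apply: coset_idr; rewrite ?groupM ?groupV // morphM ?groupV // morphV //= e mulVg.
  by move/(subsetP sIH); rewrite groupMl ?groupV.
split.
- rewrite properE quotientS //=; apply/negP=> s; case/negP: nHa; apply: inH => //.
  by apply: (subsetP s); apply: mem_quotient.
- have Nx := subsetP nI x (subsetP sHA x Hx).
  have : coset I x != 1 by apply: contra nIx => /eqP e; apply: coset_idr.
  have px' : p.-elt (coset I x) by apply: morph_p_elt.
  have := order_dvdG (mem_quotient I Hx); rewrite -order_eq1.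
  case/p_natP: px' => -[|n] -> // d _; apply: dvdn_trans d; by rewrite expnS dvdn_mulr.
move=> _ /setDP[/morphimP[g Ng Ag ->] nHg]; apply/negP=> pd.
have nHg' : g \notin H by apply: contra nHg => Hg; apply: mem_quotient.
have [h /setIP[h1 h2] oh] := Cauchy pr_p pd.
have ph : p.-elt h by rewrite /p_elt oh pnat_id.
have [y Hy [py ey]] := lift_p sHA h1 ph.
have Ay := subsetP sHA y Hy.
have Hgy : y \in H :^ g.
  rewrite mem_conjg; apply: inH; first by rewrite groupJ ?groupV.
  move: h2; rewrite -ey mem_conjg -morphV // -morphJ ?groupV // ; exact: subsetP nI y Ay.
have := hH g Ag nHg' y Hy Hgy py => Iy.
by move: (prime_gt1 pr_p); rewrite -oh -ey coset_id // order1.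
Qed.

End StronglyEmbedded.

(** * Alperin's argument for subgroups normal in F *)

Section NormalInFusion.
Variables (gT : finGroupType) (S : {group gT}) (F : fusion_rel gT) (p : nat).
Hypotheses (pr_p : prime p) (pS : p.-group S) (sat : saturated S F p).
Implicit Types (P Q R : {set gT}) (u v a w : {perm gT}).

Let fsF : fusion_system S F. Proof. by case: sat. Qed.
Local Notation hom := (fhom F).

Lemma autS_sub (P : {group gT}) : P \subset S -> autS S P \subset autF F P.
Proof.
move=> sPS; apply/subsetP=> a Sa; apply/(autFP F).
have := Sa; rewrite inE => /andP[Aa /exists_inP[s Ns /forall_inP h]]; split=> //.
have [Ss Ns'] := setIP Ns.
have : F P P (conj_map s) by apply: (fs_conj fsF); rewrite ?(normP Ns').
by move/(fs_ext fsF); apply=> x Px; rewrite !ffunE (eqP (h x Px)).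
Qed.

Lemma autF_conj (P Q : {group gT}) u a : hom P Q u -> Q :=: u @: P -> a \in autF F P ->
  a ^ u \in autF F Q.
Proof.
move=> hu eQ /(autFP F)[Aa ha]; have [sP sQ mu iu] := fhomP sat hu.
have hu' : hom Q P u^-1 by rewrite eQ; apply: fhom_inv sat _ _ _ hu.
have h : hom Q Q (a ^ u).
  by rewrite conjgE; apply: (fhom_comp sat hu'); apply: (fhom_comp sat ha).
apply/(autFP F); split=> //; rewrite inE; apply/andP; split.
  apply/subsetP=> y; rewrite inE; apply: contraR => ny.
  have nP : u^-1 y \notin P.
    by apply: contra ny => Py; rewrite eQ -[y](permKV u); apply: imset_f.
  by rewrite conjgE !permM (out_Aut Aa nP) permKV.
by have [_ _ m _] := fhomP sat h; apply/morphicP.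
Qed.

Lemma conj_aut_conj (P Q : {group gT}) u g h : hom P Q u -> Q :=: u @: P ->
  g \in 'N(P) -> h \in 'N(Q) -> conj_aut P g ^ u = conj_aut Q h -> {in P, forall x, u (x ^ g) = u x ^ h}.
Proof.
move=> hu eQ Ng Nh e x Px; have Qx : u x \in Q by rewrite eQ imset_f.
by rewrite -(norm_conj_autE Nh Qx) -e permJ norm_conj_autE.
Qed.

(** By Sylow's theorem in Aut_F(Q), some automorphism of Q moves the image of Aut_S(P) into
    Aut_S(Q). After this correction the extension domain is all of N_S(P). *)
Lemma extend_norm (P Q : {group gT}) u0 : hom P S u0 -> Q :=: u0 @: P -> fully_normalized S F Q ->
  exists2 u, hom P S u & Q :=: u @: P /\ exists2 v, hom 'N_S(P) S v & {in P, v =1 u}.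
Proof.
move=> hu0 eQ fnQ; have [sPS _ _ iu0] := fhomP sat hu0.
have sQS : Q \subset S by rewrite eQ.
have [_ [sat2 sat3]] := sat; have [fcQ sylQ] := sat2 Q sQS fnQ.
have hPQ : hom P Q u0 by apply: (fhom_codom sat hu0) => //; rewrite eQ.
pose A := Group (autF_group_set sat sQS); pose R := [group of conj_aut P @* 'N_S(P)].
have eR : autS S P = R := autS_conj sPS.
pose T := [group of conj_aut Q @* 'N_S(Q)]; have eT : autS S Q = T := autS_conj sQS.
have pR : p.-group R by apply: morphim_pgroup; apply: pgroupS pS; apply: subsetIl.
rewrite eT in sylQ.
have sRA : R :^ u0 \subset A.
  apply/subsetP=> _ /imsetP[a Ra ->]; apply: (autF_conj hPQ eQ).
  by apply: (subsetP (autS_sub sPS)); rewrite eR.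
have pRu : p.-group (R :^ u0) by rewrite pgroupJ.
have [al Aal sR] := Sylow_subJ (G := A) (P := T) (Q := (R :^ u0)%G) sylQ sRA pRu.
have /(autFP F)[Aal1 hal] := Aal.
have /(autFP F)[_ hal'] : al^-1 \in autF F Q := groupVr Aal.
pose u := u0 * al^-1; have hu : hom P Q u := fhom_comp sat hPQ hal'.
have eQu : Q :=: u @: P.
  have -> : u @: P = al^-1 @: (u0 @: P).
    by rewrite -imset_comp; apply: eq_in_imset => x _; rewrite /= permM.
  by rewrite -eQ; apply/esym; apply: (stab_imset _ _).1; apply: Aut_stab; rewrite groupV.
have huS : hom P S u by apply: (fhom_codom sat hu) => //; rewrite -eQu.
exists u => //; split=> //.
have eu : finfun u @: P = Q.
  by rewrite eQu; apply: eq_in_imset => x _; rewrite ffunE.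
have sRT : R :^ u \subset T.
  by rewrite /u conjsgM -(conjsgK al T) conjSg.
have [fb [hfb efb]] : exists fb : {ffun gT -> gT}, F (Nphi S P (finfun u)) S fb /\ {in P, fb =1 finfun u}.
  by apply: sat3 => //; rewrite eu.
have eN : Nphi S P (finfun u) = 'N_S(P).
  apply/setP=> g; rewrite inE; apply/andP/idP => [[]// | Ng]; split=> //.
  have [Sg Ng'] := setIP Ng.
  have Rg : conj_aut P g \in R by apply: mem_morphim.
  have : conj_aut P g ^ u \in T by apply: (subsetP sRT); rewrite memJ_conjg.
  case/morphimP=> h Nh TSh eh; apply/exists_inP; exists h; first by rewrite eu.
  apply/forall_inP=> x Px; rewrite !ffunE; apply/eqP.
  exact: (conj_aut_conj hu eQu Ng' Nh eh).
rewrite eN in hfb; have [v hv ev] := fhom_of sat hfb; exists v => // x Px.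
by rewrite ev ?efb ?ffunE // inE (subsetP sPS) // (subsetP (normG P)).
Qed.

Variable X : {group gT}.
Hypotheses (sXS : X \subset S) (invS : {in autF F S, forall b : {perm gT}, b @: X = X}).
Hypothesis invE : forall E : {group gT}, essential S F p E ->
  X \subset E /\ {in autF F E, forall a : {perm gT}, a @: X = X}.

(** The required extension exists for this morphism. Quantifying over permutations makes it a
    boolean, so that the good automorphisms form a finite set. *)
Definition good P u :=
  [exists v, [&& hom (P <*> X) S v, [forall x in P, v x == u x] & v @: X == X]].

Lemma goodP P u : reflect (exists v, [/\ hom (P <*> X) S v, {in P, v =1 u} & v @: X = X]) (good P u).
Proof.
apply: (iffP existsP) => -[v].
  by case/and3P=> h /forall_inP e /eqP i; exists v; split=> // x Px; apply/eqP/e.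
by case=> h e i; exists v; rewrite h i eqxx andbT; apply/forall_inP=> x Px; rewrite e.
Qed.

Lemma good_normal : X <| S.
Proof.
rewrite /normal sXS; apply/subsetP=> s Ss; rewrite inE.
have As : conj_aut S s \in autF F S.
  apply: (subsetP (autS_sub (subxx S))); rewrite (autS_conj (subxx S)).
  have NSs := subsetP (normG S) s Ss; by apply: mem_morphim; rewrite ?in_setI ?Ss.
rewrite -{2}(invS As); apply/subsetP=> _ /imsetP[x Xx ->].
by apply/imsetP; exists x => //; rewrite norm_conj_autE ?(subsetP (normG S)) // (subsetP sXS).
Qed.

Lemma join_mul (P : {group gT}) : P \subset S -> P <*> X = P * X.
Proof. by move=> sPS; apply: norm_joinEl; apply: subset_trans sPS (normal_norm good_normal). Qed.

Lemma good_img (P : {group gT}) u v (Q : {group gT}) : P \subset S -> Q :=: u @: P -> Q \subset S ->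
  hom (P <*> X) S v -> {in P, v =1 u} -> v @: X = X -> v @: (P <*> X) = Q <*> X.
Proof.
move=> sPS eQ sQS hv ev eX; have [_ _ m _] := fhomP sat hv.
have memP x : x \in P -> x \in P <*> X by apply: (subsetP (joing_subl _ _)).
have memX x : x \in X -> x \in P <*> X by apply: (subsetP (joing_subr _ _)).
rewrite -> (join_mul sPS) at 1; rewrite (join_mul sQS); apply/setP=> y; apply/imsetP/mulsgP => [[z] | [a b Qa Xb ->]].
  case/mulsgP=> x c Px Xc -> ->; exists (u x) (v c).
  - by rewrite eQ imset_f.
  - by rewrite -eX imset_f.
  by rewrite m ?(memP x) ?(memX c) // (ev x).
move: Qa Xb; rewrite eQ -{1}eX => /imsetP[x Px ->] /imsetP[c Xc ->].
exists (x * c); first exact: mem_mulg.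
by rewrite m ?(memP x) ?(memX c) // (ev x).
Qed.

Lemma good_res (P P' : {group gT}) u u' : P \subset P' -> good P' u' -> {in P, u' =1 u} -> good P u.
Proof.
move=> sPP /goodP[v [h e i]] e'; apply/goodP; exists v; split=> //.
  have sJ : (P <*> X)%G \subset (P' <*> X)%G by rewrite join_subG joing_subr (subset_trans sPP (joing_subl _ _)).
  exact: (fhom_res sat h sJ).
by move=> x Px; rewrite e ?e' // (subsetP sPP).
Qed.

Lemma good_comp (P Q : {group gT}) u w : hom P S u -> Q :=: u @: P -> good P u -> good Q w -> good P (u * w).
Proof.
move=> hu eQ /goodP[v1 [h1 e1 i1]] /goodP[v2 [h2 e2 i2]].
have [sPS _ _ iu] := fhomP sat hu; have sQS : Q \subset S by rewrite eQ.
have eI := good_img sPS eQ sQS h1 e1 i1.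
apply/goodP; exists (v1 * v2); split.
- apply: (fhom_comp sat) h2; apply: (fhom_codom sat h1 (R := (Q <*> X)%G)); first by rewrite eI.
  by rewrite join_subG sQS.
- by move=> x Px; rewrite !permM e1 // e2 // eQ imset_f.
have -> : (v1 * v2) @: X = v2 @: (v1 @: X).
  by rewrite -imset_comp; apply: eq_in_imset => x _; rewrite /= permM.
by rewrite i1.
Qed.

Lemma good_inv (P Q : {group gT}) u : hom P S u -> Q :=: u @: P -> good P u -> good Q u^-1.
Proof.
move=> hu eQ /goodP[v [h e i]]; have [sPS _ _ iu] := fhomP sat hu; have sQS : Q \subset S by rewrite eQ.
have eI := good_img sPS eQ sQS h e i; have h' := fhom_inv sat h.
have [sJS _ _ _] := fhomP sat h.
apply/goodP; exists v^-1; split.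
- rewrite -eI; apply: (fhom_codom sat h') => //; apply: subset_trans sJS.
  by have [_ _ _] := fhomP sat h'.
- by move=> y; rewrite eQ => /imsetP[x Px ->]; rewrite permK -(e x Px) permK.
rewrite -{1}i -imset_comp -[RHS]imset_id; apply: eq_in_imset => x _; by rewrite /= permK.
Qed.

Lemma fixed_img (Q : {group gT}) a : a \in autF F Q -> a @: Q = Q.
Proof. by move=> /(autFP F)[Aa _]; apply: (stab_imset _ _).1; apply: Aut_stab. Qed.

Lemma good_norm (Q : {group gT}) s : Q \subset S -> s \in 'N_S(Q) -> good Q (conj_aut Q s).
Proof.
move=> sQS Ns; have [Ss NQ] := setIP Ns; have nX := subsetP (normal_norm good_normal) s Ss.
have sJ : Q <*> X \subset S by rewrite join_subG sQS.
have h : F (Q <*> X)%G S (conj_map s).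
  by apply: (fs_conj fsF) => //; rewrite -(conjGid Ss) conjSg.
have [v hv ev] := fhom_of sat h; apply/goodP; exists v; split=> //.
  by move=> x Qx; rewrite ev ?ffunE ?norm_conj_autE // (subsetP (joing_subl _ _)).
rewrite -[RHS](normP nX); apply: eq_in_imset => x Xx.
by rewrite ev ?ffunE // (subsetP (joing_subr _ _)).
Qed.

Section FullyNormalized.
Variables (Q : {group gT}).
Hypotheses (sQS : Q \subset S) (fnQ : fully_normalized S F Q) (ltQ : Q \proper 'N_S(Q)).
Hypothesis goodQ : forall (R : {group gT}) w, #|Q| < #|R| -> hom R S w -> good R w.

Let A := Group (autF_group_set sat sQS).
Let I := [group of conj_aut Q @* Q].
Let T := [group of conj_aut Q @* 'N_S(Q)].

(** Saturation extends a to a subgroup strictly larger than Q, where [goodQ] already applies. *)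
Lemma good_Nphi a s : a \in A -> s \in Nphi S Q (finfun a) -> s \notin Q -> good Q a.
Proof.
move=> Aa Ns nQs; have [_ [sat2 sat3]] := sat; have [fcQ _] := sat2 Q sQS fnQ.
have eQa := fixed_img Aa; have /(autFP F)[_ ha] := Aa.
have ha' : F Q S (finfun a) by apply: (fhom_codom sat ha); rewrite ?eQa.
have eu : finfun a @: Q = Q by rewrite -[RHS]eQa; apply: eq_in_imset => x _; rewrite ffunE.
have [fb [hfb efb]] : exists fb : {ffun gT -> gT}, F (Nphi S Q (finfun a)) S fb /\ {in Q, fb =1 finfun a}.
  by apply: sat3 => //; rewrite eu.
have [[gN _ _ _] _] := fs_hom fsF hfb; have [v hv ev] := fhom_of sat hfb.
have sQN : Q \subset Group gN.
  apply/subsetP=> x Qx; rewrite inE; have Nx := subsetP (normG Q) x Qx.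
  rewrite inE (subsetP sQS) // Nx andTb; have [_ _ m _] := fhomP sat ha.
  have Qax : a x \in Q by rewrite -eQa imset_f.
  apply/exists_inP; exists (a x); first by rewrite eu inE (subsetP sQS) // (subsetP (normG Q)).
  apply/forall_inP=> y Qy; rewrite !ffunE; apply/eqP.
  have mV : a x^-1 = (a x)^-1.
    apply: (mulIg (a x)); rewrite -m ?groupV // !mulVg.
    by have := m 1 1 (group1 _) (group1 _); rewrite mulg1 => /(congr1 (mulg (a 1)^-1)); rewrite mulKg mulVg.
  by rewrite /conjg !m ?groupM ?groupV // mV.
have gd : good (Group gN) v.
  apply: goodQ => //; apply: proper_card; rewrite properE sQN.
  by apply/subsetPn; exists s.
by apply: (good_res sQN gd) => x Qx; rewrite ev ?efb ?ffunE // (subsetP sQN).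
Qed.

Lemma good_set_group : group_set [set a in A | good Q a].
Proof.
apply/group_setP; split=> [|a b].
  apply/setIdP; split; first exact: (group1 A).
  apply/goodP; exists 1; split=> //.
    by apply: (fhom1 sat); rewrite join_subG sQS.
  by rewrite -[RHS]imset_id; apply: eq_in_imset => x _; rewrite perm1.
move=> /setIdP[Aa ga] /setIdP[Ab gb]; apply/setIdP; split; first exact: (groupM (G := A)).
have /(autFP F)[_ ha] := Aa; have ha' : hom Q S a by apply: (fhom_codom sat ha); rewrite ?fixed_img.
by apply: (good_comp ha' _ ga gb); rewrite fixed_img.
Qed.

(** The good automorphisms form a subgroup H that contains Aut_S(Q). If it is proper, it is strongly
    p-embedded modulo Inn(Q), since an automorphism carrying a p-element outside Inn(Q) between
    conjugates in Aut_S(Q) extends to a larger subgroup. Then Q is essential, and [invE] makes every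
    automorphism good after all. *)
Lemma good_fully_normalized a : a \in A -> good Q a.
Proof.
move=> Aa; apply: contraT => nga; pose H := Group good_set_group.
have inH x : x \in H = (x \in A) && good Q x by apply/setIdP/andP.
have [_ [sat2 sat3]] := sat; have [fcQ sylQ] := sat2 Q sQS fnQ.
have eT : autS S Q = T := autS_conj sQS.
rewrite eT in sylQ.
have nIA : I <| A.
  rewrite /normal; apply/andP; split.
    by apply: subset_trans (morphimS _ _) (pHall_sub sylQ); rewrite subsetI sQS normG.
  apply/subsetP=> b Ab; rewrite inE; apply/subsetP=> _ /imsetP[_ /morphimP[x Nx Qx ->] ->].
  have /(autFP F)[_ hb] := Ab.
  have Qbx : b x \in Q by rewrite -(fixed_img Ab) imset_f.
  suff -> : conj_aut Q x ^ b = conj_aut Q (b x) by apply: mem_morphim; rewrite // (subsetP (normG Q)).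
  have /(autFP F)[Ab' _] := Ab; have conjA z : conj_aut Q z \in Aut Q by apply: Aut_aut.
  apply: (eq_Aut (A := Q)); rewrite ?groupJ //.
  move=> y Qy; rewrite norm_conj_autE ?(subsetP (normG Q)) // conjgE !permM.
  have Qy' : b^-1 y \in Q by rewrite -(fixed_img (groupVr Ab : b^-1 \in A)) imset_f.
  rewrite norm_conj_autE //; have [_ _ m _] := fhomP sat hb.
  have mV : b x^-1 = (b x)^-1.
    apply: (mulIg (b x)); rewrite -m ?groupV // !mulVg.
    by have := m 1 1 (group1 _) (group1 _); rewrite mulg1 => /(congr1 (mulg (b 1)^-1)); rewrite mulKg mulVg.
  by rewrite /conjg !m ?groupM ?groupV // mV permKV.
have sTH : T \subset H.
  apply/subsetP=> z Tz; rewrite inH (subsetP (pHall_sub sylQ)) // andTb.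
  by case/morphimP: Tz => s Ns NSs ->; apply: good_norm.
have sHA : H \subset A by apply/subsetP=> x; rewrite inH => /andP[].
have sylH : p.-Sylow(H) T := pHall_subl sTH sHA sylQ.
have sCQ : 'C_S(Q) \subset Q.
  apply: contraR nga => /subsetPn[s /setIP[Ss Cs] nQs]; apply: (good_Nphi Aa _ nQs).
  rewrite inE inE Ss (subsetP (cent_sub Q)) // andTb; apply/exists_inP; exists 1; first exact: group1.
  by apply/forall_inP=> x Qx; rewrite !ffunE conjg1 /conjg -(centP Cs x Qx) mulKg.
have lem b z : b \in A -> z \in T -> z ^ b \in T -> z \notin I -> good Q b.
  move=> Ab /morphimP[s NQs NSs ->] /morphimP[h NQh NSh eh] nI.
  have Ss : s \in S by case/setIP: NSs.
  apply: (@good_Nphi b s Ab); last first.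
    by apply: contra nI => Qs; apply: mem_morphim.
  have eu : finfun b @: Q = Q by rewrite -[RHS](fixed_img Ab); apply: eq_in_imset => x _; rewrite ffunE.
  rewrite inE NSs andTb; apply/exists_inP; exists h; first by rewrite eu.
  apply/forall_inP=> x Qx; rewrite !ffunE; apply/eqP.
  have /(autFP F)[_ hb] := Ab.
  by apply: (conj_aut_conj hb _ NQs NQh eh Qx); rewrite fixed_img.
have semb : semb_elt p A I H.
  split.
  - by rewrite properE sHA; apply/subsetPn; exists a => //; rewrite inH negb_and nga orbT.
  - by apply: subset_trans sTH; apply: morphimS; rewrite subsetI sQS normG.
  - have [_ [s Ns nQs]] := properP ltQ; have [Ss NQs] := setIP Ns.
    have Ts : conj_aut Q s \in T by apply: mem_morphim.
    exists (conj_aut Q s); first exact: (subsetP sTH).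
    split; first exact: mem_p_elt (pHall_pgroup sylQ) Ts.
    apply: contra nQs => /morphimP[q Nq Qq e]; have NQq := subsetP (normG Q) q Qq.
    have Ssq : s * q^-1 \in S by rewrite groupM // groupV (subsetP sQS).
    rewrite -(mulgKV q s) groupM //; apply: (subsetP sCQ); rewrite inE Ssq andTb.
    apply/centP=> x Qx; apply: commute_sym; apply/commgP/conjg_fixP.
    by rewrite conjgM -(norm_conj_autE NQs Qx) e norm_conj_autE // conjgK.
  move=> g Ag nHg x Hx xJ px; apply: contraR nHg => nIx.
  have nI := subsetP (normal_norm nIA).
  have pT1 y : y \in H -> p.-elt y -> exists2 h, h \in H & y ^ h \in T.
    move=> Hy py; have sy : <[y]> \subset H by rewrite cycle_subG.
    have [h Hh sh] := Sylow_subJ sylH sy py; exists h^-1; first by rewrite groupV.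
    by rewrite -mem_conjgV invgK; apply: (subsetP sh); apply: cycle_id.
  have [h Hh Th] := pT1 x Hx px.
  case/imsetP: xJ => y Hy ey; have py : p.-elt y by move: px; rewrite ey p_eltJ.
  have [k Hk Tk] := pT1 y Hy py.
  have Ah := subsetP sHA h Hh; have Ak := subsetP sHA k Hk.
  have Hb : k^-1 * g * h \in H.
    rewrite inH !groupM ?groupV // andTb; apply: (lem _ (y ^ k)) => //.
    - by rewrite !groupM ?groupV.
    - by rewrite !conjgM conjgK -ey.
    have Ay : y \in A := subsetP sHA y Hy.
    by rewrite memJ_norm ?nI //; apply: contra nIx => Iy; rewrite ey memJ_norm ?nI.
  by move: Hb; rewrite groupMr // groupMl ?groupV.
have ess : essential S F p Q.
  split=> //.
  - move=> f hf; have [[_ _ _ _] [m inj _]] := fs_hom fsF hf.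
    have sZ : f @: 'Z(Q) \subset 'C_S(f @: Q).
      apply/subsetP=> _ /imsetP[z /setIP[Qz Cz] ->]; have [v hv ev] := fhom_of sat hf.
      have [_ _ _ iv] := fhomP sat hv; rewrite inE -ev // (subsetP iv) ?imset_f // andTb.
      apply/centP=> _ /imsetP[x Qx ->]; rewrite ev // /commute -!m //.
      by rewrite (centP Cz).
    have eZ : 'C_S(Q) = 'Z(Q).
      apply/eqP; rewrite eqEsubset; apply/andP; split; last exact: setSI.
      by rewrite /center subsetI sCQ subsetIr.
    have : f @: 'Z(Q) == 'C_S(f @: Q).
      rewrite eqEcard sZ andTb card_in_imset; last first.
        by move=> x y /setIP[Qx _] /setIP[Qy _]; apply: inj.
      by rewrite -eZ; apply: fcQ.
    by move/eqP <-; apply: imsetS; apply: subsetIl.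
  by rewrite innA_conj; exists (H / I)%G; exact: (semb_intro pr_p nIA semb).
have [sXQ iX] := invE ess; have /(autFP F)[_ ha] := Aa.
case/negP: nga; apply/goodP; exists a; split=> //; last exact: iX.
by rewrite (joing_idPl sXQ); apply: (fhom_codom sat ha); rewrite ?fixed_img.
Qed.

End FullyNormalized.

(** Induction on the index of P: a morphism is a composite of restrictions from larger subgroups and
    of one automorphism of a fully normalised conjugate. *)
Lemma good_all n (P : {group gT}) u : #|S| - #|P| < n -> hom P S u -> good P u.
Proof.
elim: n P u => [|n IH] P u // lt hu; have [sPS _ _ iu] := fhomP sat hu.
case: (eqVneq (P : {set gT}) S) => [eP | neP].
  rewrite eP in hu; have [a Fa ea] := autF_of sat hu; have /(autFP F)[_ ha] := Fa.
  apply/goodP; exists a; split; last exact: invS.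
    by rewrite eP (joing_idPl sXS).
  by move=> x; rewrite eP => Sx; rewrite ea.
have big (R : {group gT}) w : #|P| < #|R| -> hom R S w -> good R w.
  move=> ltR hw; apply: IH => //; have [sRS _ _ _] := fhomP sat hw.
  move: lt; rewrite ltnS; apply: leq_trans; apply: ltn_sub2l => //; apply: leq_trans ltR _; exact: subset_leq_card.
have grow (P' : {group gT}) : P' \subset S -> #|P'| = #|P| -> P' \proper 'N_S(P').
  move=> sP' e; apply: nilpotent_proper_norm (pgroup_nil pS) _.
  rewrite properEcard sP' e; rewrite ltn_neqAle subset_leq_card // andbT.
  by apply: contra neP => /eqP ec; rewrite eqEcard sPS ec leqnn.
case: (@arg_maxnP _ u (fun w => hom P S w) (fun w => #|'N_S(w @: P)|) hu) => u0 hu0 mx.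
pose Q := Group (fhom_img sat hu0); have [_ _ _ iu0] := fhomP sat hu0.
have sQS : Q \subset S by [].
have cQ : #|Q| = #|P| by apply: card_imset perm_inj.
have hPQ : hom P Q u0 by apply: (fhom_codom sat hu0 (R := Q)).
have fnQ : fully_normalized S F Q.
  move=> f hf; have [w hw ew] := fhom_of sat hf.
  rewrite -(eq_in_imset ew); have := mx (u0 * w) (fhom_comp sat hPQ hw); congr (_ <= _).
  rewrite -[in RHS]imset_comp; congr #|'N_S(_)|; apply: eq_in_imset => x _; by rewrite /= permM.
have toQ (P' : {group gT}) w : #|P'| = #|P| -> hom P' S w -> Q :=: w @: P' ->
    exists2 w', hom P' S w' & Q :=: w' @: P' /\ good P' w'.
  move=> cP' hw eQ; have [w' hw' [eQ' [v hv ev]]] := extend_norm hw eQ fnQ.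
  have [sP' _ _ _] := fhomP sat hw.
  exists w' => //; split=> //; apply: (good_res (P' := 'N_S(P')%G) _ _ ev).
    by rewrite subsetI sP' normG.
  by apply: big => //; rewrite -cP'; apply: proper_card; apply: grow.
have [uP huP [eQP gP]] := toQ P u0 erefl hu0 erefl.
pose P1 := Group (fhom_img sat hu); have cP1 : #|P1| = #|P| by apply: card_imset perm_inj.
have hV : hom P1 P u^-1 := fhom_inv sat hu.
have h1 : hom P1 S (u^-1 * u0) := fhom_comp sat hV hu0.
have e1 : Q :=: (u^-1 * u0) @: P1.
  by rewrite /= -imset_comp; apply: eq_in_imset => x _; rewrite /= permM permK.
have [u1 hu1 [eQ1 g1]] := toQ P1 _ cP1 h1 e1.
pose w := uP^-1 * (u * u1).
have hQP : hom Q P uP^-1 by rewrite eQP; apply: (fhom_inv sat huP).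
have hP1 : hom P P1 u by apply: (fhom_codom sat hu (R := P1)).
have h1Q : hom P1 Q u1 by apply: (fhom_codom sat hu1); rewrite -?eQ1.
have hw : hom Q Q w := fhom_comp sat hQP (fhom_comp sat hP1 h1Q).
have [a Fa ea] := autF_of sat hw.
have ga : good Q a.
  apply: (good_fully_normalized (sQS := sQS)) => //; first exact: grow.
  by move=> R v; rewrite cQ; apply: big.
have gw : good Q w := good_res (subxx Q) ga ea.
have gPw : good P (uP * w) := good_comp huP eQP gP gw.
(* uP and u1 carry P and its image to Q and extend to the normalisers; w is the automorphism of Q
   left over. *)
have eu : u = uP * w * u1^-1 by rewrite /w !mulgA mulgV mul1g mulgK.
have hPw : hom P Q (uP * w).
  by rewrite /w mulgA mulgV mul1g; apply: (fhom_comp sat hP1 h1Q).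
have eQw : Q :=: (uP * w) @: P.
  rewrite /w mulgA mulgV mul1g eQ1 /= -imset_comp.
  by apply: eq_in_imset => x _; rewrite /= permM.
have hPS : hom P S (uP * w) by apply: (fhom_codom sat hPw); rewrite -?eQw.
rewrite eu; apply: (good_comp hPS eQw gPw); exact: (good_inv hu1 eQ1 g1).
Qed.

Lemma normal_in_fusion_of_essential : normal_in_fusion S F X.
Proof.
split=> // P R f hf; have [[gP gR sPS sRS] _] := fs_hom fsF hf.
have {}hf : F (Group gP) (Group gR) f := hf.
have [u hu eu] := fhom_of sat hf; have [_ _ _ iu] := fhomP sat hu.
have huS : hom P S u by apply: (fhom_codom sat hu (R := S)) => //; apply: subset_trans iu sRS.
have /goodP[v [hv ev iX]] := @good_all _ (Group gP) u (ltnSn _) huS.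
have eI := @good_img (Group gP) u v (Group (fhom_img sat huS)) sPS erefl (subset_trans iu sRS) hv ev iX.
exists (finfun v); split.
- rewrite -(@join_mul (Group gP)) // -(@join_mul (Group gR)) //.
  apply: (fhom_codom sat hv (R := (Group gR <*> X)%G)); last by rewrite join_subG sRS.
  by rewrite eI /= genS // setSU.
- by move=> x Px; rewrite ffunE ev ?eu.
by rewrite -[RHS]iX; apply: eq_in_imset => x _; rewrite ffunE.
Qed.

End NormalInFusion.

(** * A presentation of the Sylow p-subgroup of Sp_4(p) *)

Section Quad.
Variable p : nat.
Hypothesis pr_p : prime p.

(** y acts on the elementary abelian group generated by e0, e1, e2 as one Jordan block of size 3. *)
Definition quad_rel (rT : finGroupType) (y e0 e1 e2 : rT) :=
  [/\ [/\ y ^+ p = 1, e0 ^+ p = 1, e1 ^+ p = 1 & e2 ^+ p = 1],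
      [/\ commute e0 e1, commute e0 e2 & commute e1 e2] &
      [/\ e0 ^ y = e0 * e1, e1 ^ y = e1 * e2 & e2 ^ y = e2]].

Lemma card_join_le (rT : finGroupType) (G : {group rT}) (x : rT) m :
  x \in 'N(G) -> x ^+ p = 1 -> #|G| <= m -> #|G <*> <[x]>| <= m * p.
Proof.
move=> nGx xp le; rewrite norm_joinEr ?cycle_subG //.
have := mul_cardG G <[x]> => e; apply: leq_trans (_ : #|G| * #|<[x]>| <= _).
  by rewrite e leq_pmulr.
apply: leq_mul => //; rewrite -orderE; apply: dvdn_leq (prime_gt0 pr_p) _.
by rewrite order_dvdn xp.
Qed.

Lemma card_join_ge (rT : finGroupType) (G : {group rT}) (x : rT) m :
  x \in 'N(G) -> x ^+ p = 1 -> x \notin G -> m <= #|G| -> m * p <= #|G <*> <[x]>|.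
Proof.
move=> nGx xp nx le; rewrite norm_joinEr ?cycle_subG //.
have ox : #[x] = p.
  have : #[x] %| p by rewrite order_dvdn xp.
  case/((primeP pr_p).2)/orP=> /eqP // o1; case/negP: nx.
  by move/eqP: o1; rewrite order_eq1 => /eqP->; apply: group1.
have ti : G :&: <[x]> = 1.
  by rewrite setIC; apply: prime_TIg; rewrite -?orderE ?ox // cycle_subG.
by rewrite TI_cardMg // -orderE ox leq_mul2r le orbT.
Qed.

Section Rel.
Variables (rT : finGroupType) (y e0 e1 e2 : rT).
Hypothesis rel : quad_rel y e0 e1 e2.
Let G2 := [group of 1 <*> <[e2]>].
Let G1 := [group of G2 <*> <[e1]>].
Let G0 := [group of G1 <*> <[e0]>].
Let GG := [group of G0 <*> <[y]>].

Let com2 x : commute x e2 -> x \in 'C(G2).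
Proof.
by move=> c; rewrite /= joing1G cent_cycle; apply/cent1P/commute_sym.
Qed.
Let com1 x : commute x e2 -> commute x e1 -> x \in 'C(G1).
Proof.
move=> c2 c1; rewrite /= centY inE com2 //= cent_cycle; exact/cent1P/commute_sym.
Qed.
Let N1 : e2 \in 'N([1 rT]). Proof. by rewrite norm1 inE. Qed.
Let N2 : e1 \in 'N(G2).
Proof. by have [_ [_ _ c12] _] := rel; apply: (subsetP (cent_sub _)); apply: com2. Qed.
Let N3 : e0 \in 'N(G1).
Proof. by have [_ [c01 c02 _] _] := rel; apply: (subsetP (cent_sub _)); apply: com1. Qed.
Let m2 : e2 \in G2. Proof. by apply: (subsetP (joing_subr _ _)); apply: cycle_id. Qed.
Let m1 : e1 \in G1. Proof. by apply: (subsetP (joing_subr _ _)); apply: cycle_id. Qed.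
Let m0 : e0 \in G0. Proof. by apply: (subsetP (joing_subr _ _)); apply: cycle_id. Qed.
Let s21 : G2 \subset G1 := joing_subl _ _.
Let s10 : G1 \subset G0 := joing_subl _ _.
Let N4 : y \in 'N(G0).
Proof.
have [_ _ [y0 y1 y2]] := rel; rewrite inE /= !conjYg conjs1g -!cycleJ y0 y1 y2.
have k2 : e2 \in G0 := subsetP s10 _ (subsetP s21 _ m2); have k1 : e1 \in G0 := subsetP s10 _ m1.
rewrite !join_subG !cycle_subG sub1G /=.
by apply/andP; split; [apply/andP; split; [exact: k2 | exact: (groupM k1 k2)] | exact: (groupM m0 k1)].
Qed.

Lemma quad_gen : <<[set y; e0; e1; e2]>> = GG.
Proof.
apply/eqP; rewrite eqEsubset gen_subG; apply/andP; split.
  have s0G : G0 \subset GG := joing_subl _ _.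
  apply/subsetP=> x; rewrite !inE => /orP[/orP[/orP[]|]|] /eqP->.
  - by apply: (subsetP (joing_subr _ _)); apply: cycle_id.
  - exact: (subsetP s0G).
  - by apply: (subsetP s0G); apply: (subsetP s10).
  - by apply: (subsetP s0G); apply: (subsetP s10); apply: (subsetP s21).
rewrite !join_subG !cycle_subG sub1G /=.
by rewrite !mem_gen // !inE eqxx ?orbT.
Qed.

Lemma quad_card_le : #|<<[set y; e0; e1; e2]>>| <= p ^ 4.
Proof.
have [[yp p0 p1 p2] _ _] := rel; rewrite quad_gen !expnSr.
apply: (@card_join_le _ G0 y) => //; apply: (@card_join_le _ G1 e0) => //.
apply: (@card_join_le _ G2 e1) => //; apply: (@card_join_le _ [1 rT]%G e2) => //.
by rewrite cards1.
Qed.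

(** No collapse occurs once e2 is nontrivial: y centralises [G2] but not e1, it sends [G1] into
    itself with commutators in [G2] but not e0, and it does not commute with e0. *)
Lemma quad_card : e2 != 1 -> #|<<[set y; e0; e1; e2]>>| = (p ^ 4)%N.
Proof.
have [[yp p0 p1 p2] [c01 c02 c12] [y0 y1 y2]] := rel.
move=> ne2; apply/eqP; rewrite eqn_leq quad_card_le quad_gen !expnSr /=.
have cy x : x \in G2 -> x ^ y = x.
  rewrite /= joing1G => /cycleP[i ->]; by rewrite conjXg y2.
have ney x z : x ^ y = x * z -> z != 1 -> x ^ y != x.
  by move=> -> nz; rewrite -{2}[x]mulg1 (inj_eq (mulgI x)).
have n1 : e1 \notin G2 by apply: contra (ney _ _ y1 ne2) => /cy ->.
have ne1 : e1 != 1 by apply: contraNneq n1 => ->.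
have cy1 x : x \in G1 -> x^-1 * x ^ y \in G2.
  move=> G1x; have : x \in G2 <*> <[e1]> by [].
  rewrite norm_joinEr ?cycle_subG // => /mulsgP[u _ Gu /cycleP[i ->] ->].
  rewrite conjMg conjXg y1 (cy u Gu) (expgMn _ c12) invMg -mulgA mulKg mulKg groupX //.
have n0 : e0 \notin G1.
  by apply: contra n1 => /cy1; rewrite y0 mulKg.
have ny : y \notin G0.
  apply/negP=> Gy; have : y \in 'C[e0].
    move: Gy; apply: subsetP; rewrite !join_subG sub1G /= !cycle_subG.
    by rewrite !(sameP cent1P eqP) -/(commute _ _) /commute c01 c02 !eqxx.
  move/cent1P=> c; case/negP: ne1; move: y0; rewrite conjgE -c mulKg => /eqP.
  by rewrite -{1}[e0]mulg1 (inj_eq (mulgI _)) eq_sym.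
apply: (@card_join_ge _ G0 y) => //; apply: (@card_join_ge _ G1 e0) => //.
apply: (@card_join_ge _ G2 e1) => //; apply: (@card_join_ge _ [1 rT]%G e2) => //.
  by rewrite inE.
by rewrite cards1.
Qed.

End Rel.

(* Both groups are isomorphic to the subgroup of G x H generated by the pairs of generators. *)
Lemma quad_isog (gT rT : finGroupType) (y e0 e1 e2 : gT) (y' e0' e1' e2' : rT) :
  quad_rel y e0 e1 e2 -> e2 != 1 -> quad_rel y' e0' e1' e2' -> e2' != 1 ->
  <<[set y; e0; e1; e2]>> \isog <<[set y'; e0'; e1'; e2']>>.
Proof.
move=> r1 n1 r2 n2.
pose D := <<[set (y, y'); (e0, e0'); (e1, e1'); (e2, e2')]>>.
have rD : quad_rel (y, y') (e0, e0') (e1, e1') (e2, e2').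
  have pX (u : gT) (v : rT) n : (u, v) ^+ n = (u ^+ n, v ^+ n).
    by elim: n => // n IHn; rewrite !expgS IHn.
  have [[a1 a2 a3 a4] [b1 b2 b3] [c1 c2 c3]] := r1; have [[a1' a2' a3' a4'] [b1' b2' b3'] [c1' c2' c3']] := r2.
  split; split; rewrite ?pX ?a1 ?a2 ?a3 ?a4 ?a1' ?a2' ?a3' ?a4' //.
  - by congr (_, _).
  - by congr (_, _).
  - by congr (_, _).
  - by congr (_, _); [move: c1 | move: c1']; rewrite conjgE.
  - by congr (_, _); [move: c2 | move: c2']; rewrite conjgE.
  - by congr (_, _); [move: c3 | move: c3']; rewrite conjgE.
have leD : #|D| <= p ^ 4 := quad_card_le rD.
have iso (sT : finGroupType) (f : {morphism [set: gT * rT] >-> sT}) (A : {set sT}) :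
    f @* D = <<A>> -> #|<<A>>| = (p ^ 4)%N -> D \isog <<A>>.
  move=> e c; have sD : D \subset [set: gT * rT] by rewrite subsetT.
  have cD : #|f @* D| = #|D|.
    apply/eqP; rewrite eqn_leq leq_morphim /= e c.
    exact: leD.
  have inj : 'injm (restrm sD f).
    by rewrite -card_im_injm morphim_restrm setIid cD.
  rewrite -e -[f @* D](_ : restrm sD f @* D = _); last by rewrite morphim_restrm setIid.
  exact: sub_isog.
have i1 : D \isog <<[set y; e0; e1; e2]>>.
  apply: (iso _ (fst_morphism gT rT)); last exact: quad_card.
  by rewrite morphim_gen ?subsetT // !morphimU ?morphim_set1 ?inE.
have i2 : D \isog <<[set y'; e0'; e1'; e2']>>.
  apply: (iso _ (snd_morphism gT rT)); last exact: quad_card.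
  by rewrite morphim_gen ?subsetT // !morphimU ?morphim_set1 ?inE.
by rewrite isog_sym in i1; apply: isog_trans i1 i2.
Qed.

End Quad.

(** Stated for an arbitrary map, so that it serves both for orbit maps and for x |-> [x, y]. *)
Lemma card_fiber (gT : finGroupType) (T : finType) (R K : {group gT}) (f : gT -> T) :
  (forall g h, g \in R -> h \in R -> f g = f h -> g * h^-1 \in K) -> #|R| <= #|f @: R| * #|K|.
Proof.
move=> h; pose r y := odflt 1 [pick g in R | f g == y].
have rP g : g \in R -> r (f g) \in R /\ f (r (f g)) = f g.
  move=> Rg; rewrite /r; case: pickP => [x /andP[Rx /eqP] // | no].
  by have := no g; rewrite /= Rg eqxx.
pose F g := (f g, g * (r (f g))^-1).
have inj : {in R &, injective F}.
  by move=> g g' Rg Rg' [e1 e2]; move: e2; rewrite e1 => /mulIg.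
rewrite -(card_in_imset inj) -cardsX; apply: subset_leq_card.
apply/subsetP=> _ /imsetP[g Rg ->]; rewrite inE /= imset_f //=.
by have [Rr er] := rP g Rg; apply: h.
Qed.

(** * Explicit symplectic matrices *)

Section FourByFour.
Import GRing.Theory.
Variable R : comNzRingType.
Local Open Scope ring_scope.
Implicit Types (f g : nat -> nat -> R) (a b c : R).

(** Indices in [nat] let every entry of a product reduce by computation, after which [ring] decides
    it. *)
Definition mxf f : 'M[R]_4 := \matrix_(i, j) f i j.
Let mulf f g i j := f i 0%N * g 0%N j + f i 1%N * g 1%N j + f i 2 * g 2 j + f i 3 * g 3 j.

Let mxf_mul f g : mxf f *m mxf g = mxf (mulf f g).
Proof.
by apply/matrixP=> i j; rewrite !mxE !big_ord_recl big_ord0 !mxE /= addr0 !addrA.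
Qed.
Let mxf_tr f : (mxf f)^T = mxf (fun i j => f j i).
Proof. by apply/matrixP=> i j; rewrite !mxE. Qed.
Let mxf_add f g : mxf f + mxf g = mxf (fun i j => f i j + g i j).
Proof. by apply/matrixP=> i j; rewrite !mxE. Qed.
Let mxf1 : 1%:M = mxf (fun i j => if i == j then 1 else 0).
Proof. by apply/matrixP=> i j; rewrite !mxE -(inj_eq val_inj) /=; case: eqP. Qed.
Let mxf0 : 0 = mxf (fun i j => 0).
Proof. by apply/matrixP=> i j; rewrite !mxE. Qed.

Let mxf_eq f g :
  (forall i j, (i < 4)%N -> (j < 4)%N -> f i j = g i j) -> mxf f = mxf g.
Proof. by move=> h; apply/matrixP=> i j; rewrite !mxE h. Qed.

Definition symp_mx := mxf (fun i j => if i + 2 == j then 1 else if j + 2 == i then -1 else 0).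
(** 1 + [ymx] is a unipotent element of the Levi factor GL_2 of the Siegel parabolic; 1 +
    [emx a b c], with a symmetric block, runs through its unipotent radical. *)
Definition ymx := mxf (fun i j => nth 0 (nth [::]
  [:: [:: 0; -1; 0; 0]; [:: 0; 0; 0; 0]; [:: 0; 0; 0; 0]; [:: 0; 0; 1; 0]] i) j).
Definition emx a b c := mxf (fun i j => nth 0 (nth [::]
  [:: [:: 0; 0; a; b]; [:: 0; 0; b; c]; [:: 0; 0; 0; 0]; [:: 0; 0; 0; 0]] i) j).

Ltac mx4_tac := rewrite /symp_mx /ymx /emx ?mxf1 ?mxf0 ?mxf_add ?mxf_tr ?mxf_mul; apply: mxf_eq => //;
  case=> [|[|[|[|?]]]] //; case=> [|[|[|[|?]]]] // _ _; rewrite /mulf /=; ring.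

Lemma ymx_sp : (1%:M + ymx) *m symp_mx *m (1%:M + ymx)^T = symp_mx.
Proof. by mx4_tac. Qed.
Lemma emx_sp a b c : (1%:M + emx a b c) *m symp_mx *m (1%:M + emx a b c)^T = symp_mx.
Proof. by mx4_tac. Qed.
Lemma ymx_sqr : ymx *m ymx = 0. Proof. by mx4_tac. Qed.
Lemma emx_mul a b c a' b' c' : emx a b c *m emx a' b' c' = 0. Proof. by mx4_tac. Qed.
Lemma emx0 : emx 0 0 0 = 0. Proof. by mx4_tac. Qed.
Lemma emx_conj a b c :
  (1%:M + emx a b c) *m (1%:M + ymx) =
  (1%:M + ymx) *m (1%:M + emx a b c) *m (1%:M + emx (b + b + c) c 0).
Proof. by mx4_tac. Qed.

End FourByFour.

(** * Sylow p-subgroups of Sp_4(p) have order p ^ 4 *)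

Section SpBound.
Import GRing.Theory.
Variable p : nat.
Hypotheses (pr_p : prime p) (odd_p : odd p).
Local Notation F := 'F_p.
Local Notation J := (sympJ p).
Local Open Scope ring_scope.

Let charF : p \in [pchar F]. Proof. exact: pchar_Fp. Qed.
Let cardF : #|F| = p. Proof. exact: card_Fp. Qed.

Lemma sympJ_sqr : J *m J = - 1%:M.
Proof.
apply/matrixP=> i j; rewrite !mxE !big_ord_recl big_ord0 !mxE.
by case: i => [[|[|[|[|i]]]] Hi] //; case: j => [[|[|[|[|j]]]] Hj] //=; rewrite ?(mulr0, mul0r, mulr1, mul1r, addr0, add0r, mulrN1, oppr0) //=.
Qed.

Lemma sympJ_tr : J^T = - J.
Proof.
apply/matrixP=> i j; rewrite !mxE.
by case: i => [[|[|[|[|i]]]] Hi] //; case: j => [[|[|[|[|j]]]] Hj] //=; rewrite ?oppr0 ?opprK.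
Qed.

Definition spB (x w : 'rV[F]_4) : F := (x *m J *m w^T) 0 0.

Let BE x w : x *m J *m w^T = (spB x w)%:M. Proof. exact: mx11_scalar. Qed.

Lemma spBDr x w w' : spB x (w + w') = spB x w + spB x w'.
Proof. by rewrite /spB linearD mulmxDr mxE. Qed.

Lemma spBZr a x w : spB x (a *: w) = a * spB x w.
Proof. by rewrite /spB linearZ -scalemxAr mxE. Qed.

Lemma spBN x w : spB w x = - spB x w.
Proof.
have : (x *m J *m w^T)^T = (spB x w)%:M by rewrite BE tr_scalar_mx.
rewrite !trmx_mul trmxK sympJ_tr mulNmx mulmxN mulmxA BE => e.
have : (- spB w x)%:M = (spB x w)%:M :> 'M_1 by rewrite -e raddfN.
by move/(congr1 (fun M : 'M_1 => M 0 0)); rewrite !mxE eqxx !mulr1n => <-; rewrite opprK.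
Qed.
Lemma spBxx x : spB x x = 0.
Proof.
have h : spB x x *+ 2 = 0 by rewrite mulr2n {2}spBN subrr.
apply/eqP; move/eqP: h; rewrite -mulr_natr mulf_eq0 => /orP[] //.
rewrite -(dvdn_pcharf charF) dvdn_prime2 // => /eqP e2.
by have : odd 2 by rewrite -[X in odd X]e2.
Qed.
Lemma spB_nondeg v : v != 0 -> exists x, spB v x = 1.
Proof.
move=> nz; have nzJ : v *m J != 0.
  apply: contraNneq nz => e; have : v *m J *m J = 0 by rewrite e mul0mx.
  by rewrite -mulmxA sympJ_sqr mulmxN mulmx1 => /eqP; rewrite oppr_eq0.
have [i nzi] : exists i, (v *m J) 0 i != 0 by apply/rV0Pn.
exists (((v *m J) 0 i)^-1 *: delta_mx 0 i); rewrite spBZr /spB trmx_delta -colE.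
by rewrite (_ : col i (v *m J) 0 0 = (v *m J) 0 i) ?mulVf // mxE.
Qed.

Lemma Sp4_inv g x w : g \in Sp4 p -> spB (x *m GLval g) (w *m GLval g) = spB x w.
Proof.
by rewrite inE => /eqP e; rewrite /spB trmx_mul -[in RHS]e !mulmxA.
Qed.

Lemma card_hyper v : v != 0 -> #|[set x | spB v x == 0]| = (p ^ 3)%N.
Proof.
move=> nz; pose A : 'cV[F]_4 := J^T *m v^T.
have eA x : (spB v x == 0) = (x <= kermx A)%MS.
  have -> : (x <= kermx A)%MS = (x *m A == 0) by apply/sub_kermxP/eqP.
  have : (v *m J *m x^T)^T = x *m A by rewrite !trmx_mul trmxK mulmxA.
  rewrite BE tr_scalar_mx => <-; apply/eqP/eqP => [-> | ]; first by rewrite raddf0.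
  by move/(congr1 (fun M : 'M_1 => M 0 0)); rewrite !mxE eqxx mulr1n.
have -> : [set x | spB v x == 0] = rowg (kermx A) by apply/setP=> x; rewrite !inE eA.
rewrite card_rowg cardF mxrank_ker; congr (p ^ _)%N.
have -> : \rank A = 1%N; last by [].
apply/eqP; rewrite eqn_leq rank_leq_col lt0n mxrank_eq0.
have [x ex] := spB_nondeg nz; apply/eqP=> A0.
have : (v *m J *m x^T)^T = x *m A by rewrite !trmx_mul trmxK mulmxA.
rewrite BE A0 mulmx0 tr_scalar_mx ex => /(congr1 (fun M : 'M_1 => M 0 0)).
by rewrite !mxE eqxx mulr1n => /eqP; rewrite oner_eq0.
Qed.

Let rG := GLrepr F 3.

Definition fixv (R : {set {'GL_4[F]}}) (x : 'rV[F]_4) := [set g in R | x *m GLval g == x].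
Lemma fixv_group_set (R : {group {'GL_4[F]}}) x : group_set (fixv R x).
Proof.
apply/group_setP; split=> [|g h]; first by rewrite inE group1 /= mulmx1 eqxx.
rewrite !inE => /andP[Rg /eqP hg] /andP[Rh /eqP hh]; rewrite groupM // andTb.
by rewrite GL_MxE mulmxA hg hh eqxx.
Qed.
Canonical fixv_group R x := Group (fixv_group_set R x).

Lemma fixv_step (R : {group {'GL_4[F]}}) (x : 'rV[F]_4) (D : {set 'rV[F]_4}) m :
  (forall g, g \in R -> x *m GLval g - x \in D) -> (#|D| <= m)%N -> (#|R| <= m * #|fixv R x|)%N.
Proof.
move=> hD le; apply: leq_trans (@card_fiber _ _ R [group of fixv R x] (fun g => x *m GLval g) _) _.
  move=> g h Rg Rh e; rewrite inE groupM ?groupV // andTb GL_MxE mulmxA e -mulmxA -(GL_MxE h h^-1) mulgV.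
  by rewrite GL_1E mulmx1 eqxx.
rewrite leq_mul2r; apply/orP; right; apply: leq_trans le.
rewrite -(card_imset _ (@addIr _ (- x))); apply: subset_leq_card.
by apply/subsetP=> _ /imsetP[_ /imsetP[g Rg ->] ->]; apply: hD.
Qed.

(** Orbit counting. R fixes some v; if w pairs to 1 with v, the R-orbit of w lies in w plus the
    orthogonal of v, so it has at most p ^ 3 points. The stabiliser of w fixes some u orthogonal to
    v and w; if x pairs to 1 with u, then x moves only by multiples of u, which gives a factor p.
    The stabiliser of v, w, u and x, a basis, is trivial. *)
Lemma Sp4_pgroup_le (R : {group {'GL_4[F]}}) : R \subset Sp4 p -> p.-group R -> (#|R| <= p ^ 4)%N.
Proof.
move=> sR pR; have inv g x w := @Sp4_inv g x w.
have [v nzv fv] : exists2 v : 'rV[F]_4, v != 0 & forall g, g \in R -> v *m GLval g = v.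
  have := rfix_pgroup_pchar charF rG isT pR (subsetT R).
  move/rowV0Pn=> [v vf nz]; exists v => // g Rg; by move/rfix_mxP: vf; apply.
have [w ew] := spB_nondeg nzv.
pose R1 := [group of fixv R w].
have sR1 : R1 \subset R by apply/subsetP=> g; rewrite inE => /andP[].
have fw g : g \in R1 -> w *m GLval g = w by rewrite inE => /andP[_ /eqP].
have le1 : (#|R| <= p ^ 3 * #|R1|)%N.
  apply: (fixv_step (D := [set x | spB v x == 0])); last by rewrite card_hyper.
  move=> g Rg; rewrite inE -scaleN1r spBDr spBZr mulN1r.
  by rewrite -{1}(fv g Rg) inv ?(subsetP sR) // subrr.
pose A : 'M[F]_(4, 1 + 1) := row_mx (J^T *m v^T) (J^T *m w^T).
have sp0 u x : (x *m (J^T *m u^T) == 0 :> 'M_1) = (spB u x == 0).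
  have : (u *m J *m x^T)^T = x *m (J^T *m u^T) by rewrite !trmx_mul trmxK mulmxA.
  rewrite BE tr_scalar_mx => <-; apply/eqP/eqP => [ | -> ]; last by rewrite raddf0.
  by move/(congr1 (fun M : 'M_1 => M 0 0)); rewrite !mxE eqxx mulr1n.
have eU x : (x <= kermx A)%MS = (spB v x == 0) && (spB w x == 0).
  have -> : (x <= kermx A)%MS = (x *m A == 0) by apply/sub_kermxP/eqP.
  by rewrite mul_mx_row row_mx_eq0 !sp0.
have Umod : mxmodule (subg_repr rG (subsetT R1)) (kermx A).
  apply/mxmoduleP=> g R1g; apply/row_subP=> i; rewrite row_mul eU.
  have := row_sub i (kermx A); rewrite eU => /andP[/eqP h1 /eqP h2].
  have Rg := subsetP sR1 g R1g; have Sg := subsetP sR g Rg.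
  by rewrite -{1}(fv g Rg) -{1}(fw g R1g) /= !inv // h1 h2 !eqxx.
have rkU : (0 < \rank (kermx A))%N.
  by rewrite mxrank_ker subn_gt0; apply: leq_ltn_trans (rank_leq_col A) _.
have [u nzu [Uu fu]] : exists2 u : 'rV[F]_4, u != 0 & (u <= kermx A)%MS /\ forall g, g \in R1 -> u *m GLval g = u.
  have := rfix_pgroup_pchar charF (submod_repr Umod) rkU (pgroupS sR1 pR) (subxx R1).
  move/rowV0Pn=> [r rf nz]; exists (val_submod r); first by rewrite val_submod_eq0.
  split=> [|g R1g]; first exact: val_submodP.
  have e : r *m submod_repr Umod g = r by move/rfix_mxP: rf; apply.
  by have := val_submodJ Umod r R1g; rewrite e => /esym.
have := Uu; rewrite eU => /andP[/eqP vu /eqP wu].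
have [x ex] := spB_nondeg nzu.
have wv : spB w v = -1 by rewrite spBN ew.
have uv : spB u v = 0 by rewrite spBN vu oppr0.
have uw : spB u w = 0 by rewrite spBN wu oppr0.
pose M : 'M[F]_(1 + 1 + (1 + 1), 4) := col_mx (col_mx v w) (col_mx u x).
have eM (c : 'rV[F]_(1 + 1 + (1 + 1))) : exists a b d e, c *m M = a *: v + b *: w + (d *: u + e *: x) /\
   ((a = 0 /\ b = 0) /\ (d = 0 /\ e = 0) -> c = 0).
  rewrite -[c]hsubmxK -[lsubmx c]hsubmxK -[rsubmx c]hsubmxK.
  set a := lsubmx (lsubmx c); set b := rsubmx (lsubmx c); set d := lsubmx (rsubmx c); set e := rsubmx (rsubmx c).
  exists (a 0 0), (b 0 0), (d 0 0), (e 0 0); split.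
    by rewrite /M !mul_row_col [a]mx11_scalar [b]mx11_scalar [d]mx11_scalar [e]mx11_scalar !mul_scalar_mx !mxE eqxx !mulr1n.
  case=> [[a0 b0] [d0 e0]]; rewrite [a]mx11_scalar [b]mx11_scalar [d]mx11_scalar [e]mx11_scalar a0 b0 d0 e0.
  by rewrite !raddf0 !row_mx0.
have solve a b d e : let z := a *: v + b *: w + (d *: u + e *: x) in
    spB v z = 0 -> spB w z = 0 -> spB u z = 0 -> z = d *: u /\ (a = 0 /\ (b = 0 /\ e = 0)).
  move=> z; rewrite /z !spBDr !spBZr ew vu wu uv uw ex wv !spBxx !mulr0 !add0r !addr0 !mulr1 => h1 h2 h3.
  have e0 : e = 0 by move: h3.
  have b0 : b = 0 by move: h1; rewrite e0 mul0r addr0.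
  have a0 : a = 0 by move: h2; rewrite e0 mul0r addr0 mulrN1 => /eqP; rewrite oppr_eq0 => /eqP.
  by rewrite a0 b0 e0 !scale0r !add0r addr0.
have uM : row_free M.
  apply: inj_row_free => c; have [a [b [d [e [ec hc]]]]] := eM c; rewrite ec => z0.
  have [] := solve a b d e; rewrite z0; try by rewrite /spB linear0 mulmx0 mxE.
  move=> /esym/eqP; rewrite scaler_eq0 (negPf nzu) orbF => /eqP d0 [a0 [b0 e0]].
  exact: hc.
have R2 : fixv R1 x = 1%g.
  apply/trivgP/subsetP=> g; rewrite inE => /andP[R1g /eqP fx]; rewrite inE.
  have eMg : M *m GLval g = M.
    by rewrite /M !mul_col_mx fu // fx fw // fv // (subsetP sR1).
  have uM' : (M : 'M_4) \in unitmx by rewrite -row_free_unit.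
  apply/eqP/val_inj; have := mulKmx uM' (GLval g); rewrite eMg mulVmx //.
have le2 : (#|R1| <= p * #|fixv R1 x|)%N.
  apply: (fixv_step (D := [set c *: u | c : F])); last by apply: leq_trans (leq_imset_card _ _) _; rewrite cardF.
  move=> g R1g; have Rg := subsetP sR1 g R1g; have Sg := subsetP sR g Rg.
  pose z := x *m GLval g - x.
  have z0 y : y *m GLval g = y -> spB y z = 0.
    by move=> fy; rewrite /z -scaleN1r spBDr spBZr mulN1r -{1}fy inv // subrr.
  have /submxP[c ec] : (z <= M)%MS by apply: submx_full; rewrite /row_full; move: uM; rewrite /row_free.
  have [a [b [d [e [ecM _]]]]] := eM c; rewrite ecM in ec.
  have [] := solve a b d e; rewrite -?ec; try by apply: z0; rewrite ?fv ?fw ?fu.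
  by rewrite -/z; move=> ez _; apply/imsetP; exists d; rewrite // /z -ez ec.
rewrite R2 cards1 muln1 in le2; apply: leq_trans le1 _.
by rewrite (expnSr p 3) leq_mul2l le2 orbT.
Qed.

Lemma sp_lift (M : 'M[F]_4) : M *m J *m M^T = J -> exists2 g : {'GL_4[F]}, g \in Sp4 p & GLval g = M.
Proof.
move=> h; have u : M \in unitmx.
  have : M *m (J *m M^T *m (- J)) = 1%:M by rewrite mulmxA mulmxA h mulmxN sympJ_sqr opprK.
  by case/mulmx1_unit.
by exists (FinRing.unit 'M[F]_4 u : {'GL_4[F]}); rewrite // inE; apply/eqP.
Qed.

Lemma sp_pow (N : 'M[F]_4) (g : {'GL_4[F]}) : N *m N = 0 -> GLval g = 1%:M + N -> (g ^+ p = 1)%g.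
Proof.
move=> NN eg.
have h n : GLval (g ^+ n)%g = 1%:M + n%:R *: N.
  elim: n => [|n IHn]; first by rewrite expg0 GL_1E scale0r addr0.
  rewrite expgSr GL_MxE IHn eg mulmxDr mulmx1 mulmxDl mul1mx -scalemxAl NN scaler0 addr0.
  by rewrite -addrA -natr1 scalerDl scale1r.
by apply: val_inj; rewrite [LHS]h (pcharf0 charF) scale0r addr0.
Qed.

Local Notation ymx := (ymx F).
Local Notation emx := (@emx F).

Lemma Sp4_quad : exists y e0 e1 e2 : {'GL_4[F]},
  [/\ quad_rel p y e0 e1 e2, (e2 != 1)%g & [set y; e0; e1; e2] \subset Sp4 p].
Proof.
have [y Sy ey] := sp_lift (ymx_sp F).
(* The parameters (0, 0, 1), (1, 1, 0), (2, 0, 0) are successive commutators with y under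
   [emx_conj]. The last one is nonzero because p is odd. *)
have [e0 S0 ee0] := sp_lift (@emx_sp F 0 0 1).
have [e1 S1 ee1] := sp_lift (@emx_sp F 1 1 0).
have [e2 S2 ee2] := sp_lift (@emx_sp F 2%:R 0 0).
have com a b c a' b' c' (g h : {'GL_4[F]}) : GLval g = 1%:M + emx a b c -> GLval h = 1%:M + emx a' b' c' -> commute g h.
  move=> eg eh; apply: val_inj; rewrite [LHS]GL_MxE [RHS]GL_MxE eg eh.
  by rewrite !mulmxDl !mulmxDr !mul1mx !mulmx1 !emx_mul !addr0 addrAC.
have cj (g h : {'GL_4[F]}) : GLval g *m GLval y = GLval y *m GLval g *m GLval h -> (g ^ y = g * h)%g.
  move=> e; rewrite conjgE; apply: (mulgI y); rewrite mulKVg mulgA; apply: val_inj.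
  by rewrite [LHS]GL_MxE [RHS]GL_MxE GL_MxE.
exists y, e0, e1, e2; split.
- split; split.
  + exact: sp_pow (ymx_sqr F) ey.
  + exact: sp_pow (emx_mul _ _ _ _ _ _) ee0.
  + exact: sp_pow (emx_mul _ _ _ _ _ _) ee1.
  + exact: sp_pow (emx_mul _ _ _ _ _ _) ee2.
  + exact: com ee0 ee1.
  + exact: com ee0 ee2.
  + exact: com ee1 ee2.
  + by apply: cj; rewrite ey ee0 ee1 emx_conj !add0r.
  + by apply: cj; rewrite ey ee1 ee2 emx_conj !addr0.
  rewrite -[RHS]mulg1; apply: cj; rewrite ey ee2 GL_1E emx_conj !addr0.
  by rewrite emx0 addr0.
- apply/eqP=> e; move: ee2; rewrite e GL_1E => /eqP; rewrite -subr_eq0 opprD addrA subrr sub0r oppr_eq0.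
  move/eqP/(congr1 (fun M : 'M[F]_4 => M 0 (inord 2))); rewrite !mxE inordK //= => /eqP.
  rewrite -(dvdn_pcharf charF) dvdn_prime2 // => /eqP e2'.
  by have : odd 2 by rewrite -[X in odd X]e2'.
by rewrite !subUset !sub1set Sy S0 S1 S2.
Qed.

Lemma Sp4_group_set : group_set (Sp4 p).
Proof.
apply/group_setP; split=> [|g h]; first by rewrite inE GL_1E mul1mx trmx1 mulmx1.
rewrite !inE => /eqP eg /eqP eh; apply/eqP.
by rewrite GL_MxE trmx_mul !mulmxA -(mulmxA (GLval g)) -(mulmxA (GLval g)) eh.
Qed.

Lemma Sp4_Sylow_quad (gT : finGroupType) (y e0 e1 e2 : gT) :
  quad_rel p y e0 e1 e2 -> (e2 != 1)%g ->
  exists P : {group {'GL_4[F]}}, (p.-Sylow(Sp4 p) P)%g /\ (<<[set y; e0; e1; e2]>> \isog P)%g.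
Proof.
move=> r n2; have [y' [e0' [e1' [e2' [r' n2' sS]]]]] := Sp4_quad.
exists [group of <<[set y'; e0'; e1'; e2']>>]%g; split; last exact: (quad_isog pr_p).
have sG : (<<[set y'; e0'; e1'; e2']>> \subset Group Sp4_group_set)%g by rewrite gen_subG.
have cP := quad_card pr_p r' n2'.
have pP : (p.-group <<[set y'; e0'; e1'; e2']>>)%g by rewrite /pgroup cP pnatX pnat_id.
have [Q sylQ sQ] := Sylow_superset sG pP.
have eP : (<<[set y'; e0'; e1'; e2']>>)%g = Q.
  apply/eqP; rewrite eqEcard sQ cP.
  by apply: Sp4_pgroup_le; [exact: pHall_sub sylQ | exact: pHall_pgroup sylQ].
by have := sylQ; rewrite -eP.
Qed.

End SpBound.

(** With fixed points of order p only, y acts on A as a single Jordan block. A cyclic vector e0 and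
    its commutators with y give the relations of [quad_rel], and orders agree. *)
Lemma Sp4_criterion (p : nat) (gT : finGroupType) (S A : {group gT}) y :
  prime p -> odd p -> p.-group S -> A <| S -> p.-abelem A -> #|A| = (p ^ 3)%N -> #|S : A| = p ->
  y \in S -> y ^+ p = 1 -> #|'C_A[y]| = p ->
  exists P : {group {'GL_4['F_p]}}, (p.-Sylow(Sp4 p) P)%g /\ (S \isog P)%g.
Proof.
move=> pr_p odd_p pS nAS abA cA iA Sy yp cC.
have sAS := normal_sub nAS; have nAy := subsetP (normal_norm nAS) y Sy.
have p1 := prime_gt1 pr_p; have p0 := prime_gt0 pr_p.
have [cAA eA] := abelemP pr_p abA.
pose d a := [~ a, y].
have dA a : a \in A -> d a \in A by move=> Aa; rewrite /d commgEl groupM ?groupV ?memJ_norm.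
have step (X : {group gT}) k : X <| S -> #|X| = (p ^ k.+1)%N ->
    exists Y : {group gT}, [/\ Y <| S, #|Y| = (p ^ k)%N & {in X, forall x, d x \in Y}].
  move=> nX cX; have ltX : [1 gT]%G \proper X.
    by rewrite proper1G -cardG_gt1 cX -(exp1n k.+1) ltn_exp2r.
  have [Y [_ ltY nY iY]] := pquot_gt pr_p pS (normal1 S) nX ltX; have sY := proper_sub ltY.
  exists Y; split=> //.
    by apply/eqP; rewrite -(eqn_pmul2r p0) -{1}iY Lagrange // cX expnSr.
  move=> x Xx; apply: (subsetP (pcentral pr_p pS nY nX sY iY)); exact: mem_commg.
have [F2 [n2 c2 d2]] := step A 2 nAS cA.
have [F1 [n1 c1 d1]] := step F2 1%N n2 c2.
have [F0 [_ c0 d0]] := step F1 0%N n1 c1.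
have F01 : F0 :=: 1 by apply/eqP; rewrite trivg_card1 c0.
(* If d vanished on its own image, image and kernel of d would both have order at most p, too small
   for A. *)
have [e0 Ae0 nd] : exists2 a, a \in A & d (d a) != 1.
  apply/exists_inP; apply: contraT; rewrite negb_exists => /forallP h.
  have sd : d @: A \subset 'C_A[y].
    apply/subsetP=> _ /imsetP[a Aa ->]; rewrite inE dA //; apply/cent1P/commute_sym.
    by have := h a; rewrite Aa negbK => /commgP.
  have := @card_fiber _ _ A [group of 'C_A[y]] d _; rewrite cA /= cC => le.
  have : (p ^ 3 <= p * p)%N.
    apply: leq_trans (le _) _; last by rewrite leq_mul2r -cC subset_leq_card ?orbT.
    move=> a b Aa Ab; rewrite /d !commgEl => e; rewrite inE groupM ?groupV // andTb.
    have fx : (a * b^-1) ^ y = a * b^-1.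
      rewrite conjMg conjVg; have -> : a ^ y = a * b^-1 * b ^ y by rewrite -mulgA -e mulKVg.
      by rewrite mulgK.
    by apply/cent1P/commgP/conjg_fixP.
  by rewrite mulnn leq_exp2l.
pose e1 := d e0; pose e2 := d e1.
have A1 : e1 \in A := dA _ Ae0; have A2 : e2 \in A := dA _ A1.
have de2 : d e2 = 1 by apply/eqP; rewrite -in_set1 -[[set 1]]F01; apply: d0; apply: d1; apply: d2.
have r : quad_rel p y e0 e1 e2.
  split; first by split=> //; apply: eA.
    by split; apply: (centsP cAA).
  have cj x : x ^ y = x * d x by apply: conjg_mulR.
  by split; rewrite cj // -/(d e2) de2 mulg1.
have -> : S :=: <<[set y; e0; e1; e2]>>; last exact: Sp4_Sylow_quad.
apply/eqP; rewrite eq_sym eqEcard gen_subG !subUset !sub1set Sy !(subsetP sAS) //=.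
by rewrite (quad_card pr_p r nd) -(Lagrange sAS) cA iA -expnSr.
Qed.

(** What the local analysis uses of a normal essential subgroup, detached from F: A is Aut_F(E) and
    B is Aut_F(S). *)
Record single (p : nat) (gT : finGroupType) (S : {group gT}) (B A : {group {perm gT}}) (E : {group gT}) : Prop := Single {
  sg_n : E <| S;
  sg_A : A \subset Aut E;
  sg_c : 'C_S(E) \subset E;
  sg_syl : p.-Sylow(A) [group of conj_aut E @* S];
  sg_semb : exists H, semb_elt p A [group of conj_aut E @* E] H;
  sg_ext : forall a, a \in A -> [group of conj_aut E @* S] :^ a = [group of conj_aut E @* S] ->
    exists2 b, b \in B & {in E, b =1 a} }.

(** * Pairs of normal essential subgroups *)

Section SinglePair.
Variables (p : nat) (gT : finGroupType) (S : {group gT}) (B : {group {perm gT}}).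
Hypotheses (pr_p : prime p) (odd_p : odd p) (pS : p.-group S) (rS : rk3 p S) (sB : B \subset Aut S).
Implicit Types (A : {group {perm gT}}) (E C W : {group gT}) (t a : {perm gT}).
Local Notation single := (single p S B).

Lemma sg_iS A E : single A E -> #|S : E| = p.
Proof. by case=> n sA c syl se _; apply: (index_SE pr_p pS rS n sA c syl se). Qed.

Lemma sg_axis A E x y : single A E -> y \in S -> y \notin E -> x \in E -> [~ x, y] \in 'Phi(E) ->
  x \in axis S E.
Proof.
move=> sg Sy nEy Ex h; have [n sA c syl se _] := sg.
have nQ : 'Phi(E) <| S := char_normal_trans (Phi_char E) n.
have nS := normal_norm nQ.
apply/(cmodP _ (subset_trans (normal_sub n) nS) nS); split=> //.
exact: (comm_full pr_p pS rS n sA c syl se nQ (subxx _) Ex Sy nEy h).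
Qed.

Lemma sg_transv A E a : single A E -> #|E : axis S E| = p -> a \in A ->
  [group of conj_aut E @* S] :^ a != [group of conj_aut E @* S] ->
  exists C W t a1, [/\ transv p S E C W t a1, C :=: axis S E :&: a @: axis S E, t \in B & a1 \in A].
Proof.
move=> [n sA c syl se ext] iH Aa nP.
have [C [W [t [a1 [g [tr eC Bt Pa1 _]]]]]] :=
  single_transv pr_p odd_p pS rS n sA sB c syl se ext iH Aa nP.
exists C, W, t, a1; split=> //; apply: (subsetP _ _ Pa1).
by rewrite -(conjGid Aa) conjSg; apply: pHall_sub syl.
Qed.

Lemma sg_some_transv A E : single A E -> #|E : axis S E| = p ->
  exists C W t a1 a, [/\ transv p S E C W t a1, C :=: axis S E :&: a @: axis S E, t \in B &
    [/\ a1 \in A, a \in A & [group of conj_aut E @* S] :^ a != [group of conj_aut E @* S]]].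
Proof.
move=> sg iH; have [n sA c syl se _] := sg.
have [a Aa nP] := conj_neq n sA syl se.
have [C [W [t [a1 [tr eC Bt Aa1]]]]] := sg_transv sg iH Aa nP.
by exists C, W, t, a1, a.
Qed.

Lemma comm_div (g h y : gT) : [~ g * h^-1, y] = ([~ g, y] * [~ h, y]^-1) ^ h^-1.
Proof. by rewrite /commg /conjg !invMg !invgK !mulgA !mulgK. Qed.

(** The map x |-> [x, y] has the axis as kernel modulo Phi(E1), so the centre has order at least p ^
    2 over Phi(E1). The centre lies in Phi(S), which therefore has index at most p in E1 and fills
    the intersection. *)
Lemma irr_frat A1 E1 E2 : single A1 E1 -> E2 <| S -> #|S : E2| = p -> E1 :!=: E2 ->
  #|E1 : 'Phi(E1)| = (p ^ 3)%N -> #|axis S E1 : 'Phi(E1)| = p -> 'Phi(S) = E1 :&: E2.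
Proof.
move=> sg n2 i2 ne iQ iHQ; have [n1 sA c syl se _] := sg; have i1 := sg_iS sg.
have p0 := prime_gt0 pr_p; have p1 := prime_gt1 pr_p.
have s1 := normal_sub n1; have s2 := normal_sub n2.
have [_ _ _ iM] := max_meet pr_p pS s1 s2 i1 i2 ne.
have sub (E : {group gT}) : E \subset S -> #|S : E| = p -> 'Phi(S) \subset E.
  by move=> sE i; apply: Phi_sub_max; apply: p_index_maximal; rewrite ?i.
have sPM : 'Phi(S) \subset E1 :&: E2 by rewrite subsetI !sub.
have nQ : 'Phi(E1) <| S := char_normal_trans (Phi_char E1) n1.
have nQS := normal_norm nQ; have nQE := subset_trans s1 nQS.
have sZE : centre S E1 \subset E1.
  by rewrite join_subG Phi_sub andbT commg_subl; apply: normal_norm n1.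
have sZP : centre S E1 \subset 'Phi(S).
  rewrite join_subG (PhiS pS s1) andbT.
  exact: subset_trans (commSg S s1) (Phi_der pS).
have sQH : 'Phi(E1) \subset axis S E1.
  rewrite (sub_cmod (A := [group of 'Phi(E1)]) (Phi_sub E1) nQE nQS) commg_subl.
  exact: nQS.
have [y Sy nEy] : exists2 y, y \in S & y \notin E1.
  apply/subsetPn; apply: contraL p1 => sSE; rewrite -leqNgt -i1 leq_eqVlt; apply/orP; left.
  by rewrite indexg_eq1.
pose f x := coset 'Phi(E1) [~ x, y].
have fin x : x \in E1 -> [~ x, y] \in centre S E1.
  by move=> Ex; apply: (subsetP (joing_subl _ _)); apply: mem_commg.
have nZ := subset_trans sZE nQE.
have le : #|E1| <= #|f @: E1| * #|[group of axis S E1]|.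
  apply: card_fiber => g h Eg Eh e.
  apply: (sg_axis sg Sy nEy); first by rewrite groupM ?groupV.
  have Ng := subsetP nZ _ (fin g Eg); have Nh := subsetP nZ _ (fin h Eh).
  rewrite comm_div memJ_norm ?groupV ?(subsetP nQE) //.
  apply: coset_idr; first by rewrite groupM ?groupV.
  rewrite morphM ?groupV // morphV //; apply/eqP; rewrite -eq_mulgV1; exact/eqP.
have le2 : #|f @: E1| <= #|centre S E1 : 'Phi(E1)|.
  rewrite -(card_quotient nZ); apply: subset_leq_card; apply/subsetP=> _ /imsetP[x Ex ->].
  by apply: mem_quotient; apply: fin.
have sQZ : 'Phi(E1) \subset centre S E1 by apply: joing_subr.
have le3 : p ^ 2 <= #|centre S E1 : 'Phi(E1)|.
  have := leq_trans le (leq_mul le2 (leqnn _)).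
  rewrite -(Lagrange (Phi_sub E1)) -(Lagrange (G := [group of axis S E1]) (H := [group of 'Phi(E1)]) sQH) /=.
  rewrite iQ iHQ mulnCA leq_pmul2l ?cardG_gt0 // expnSr leq_pmul2r //.
have iEZ : #|E1 : centre S E1| <= p.
  have := Lagrange_index (G := E1) (H := [group of centre S E1]) (K := [group of 'Phi(E1)]) sZE sQZ.
  rewrite /= iQ => e; rewrite -(leq_pmul2r (m := p ^ 2)) ?expn_gt0 ?p0 //.
  by rewrite -expnS -e leq_mul2l le3 orbT.
have iEP : #|E1 : 'Phi(S)| <= p.
  have sPE := subset_trans sPM (subsetIl _ _).
  have := Lagrange_index (G := E1) (H := [group of 'Phi(S)]) (K := [group of centre S E1]) sPE sZP.
  by move=> e; apply: leq_trans iEZ; rewrite -e leq_pmulr.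
have := Lagrange_index (G := E1) (H := [group of E1 :&: E2]) (K := [group of 'Phi(S)]) (subsetIl _ _) sPM.
rewrite /= iM => e; rewrite -e in iEP; apply/eqP; rewrite eqEsubset sPM andTb.
by rewrite -indexg_eq1 eqn_leq indexg_gt0 andbT -(leq_pmul2l p0) muln1.
Qed.

(** [irr_pair_Phi1] makes E1 elementary abelian of order p ^ 3. It remains to find an element of
    order p outside E1, which is taken from E2. *)
Lemma sp4_irr A1 E1 A2 E2 : single A1 E1 -> single A2 E2 -> E1 :!=: E2 -> #|E1 : axis S E1| != p ->
  exists P : {group {'GL_4['F_p]}}, p.-Sylow(Sp4 p) P /\ S \isog P.
Proof.
move=> sg1 sg2 ne nH; have [n1 sA1 c1 syl1 se1 _] := sg1; have [n2 sA2 c2 syl2 se2 _] := sg2.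
have i1 := sg_iS sg1; have i2 := sg_iS sg2; have p0 := prime_gt0 pr_p; have p1 := prime_gt1 pr_p.
have s1 := normal_sub n1; have s2 := normal_sub n2.
have [irr1 iHQ1] := single_irr pr_p odd_p pS rS n1 sA1 c1 syl1 se1 nH.
have PhiM := irr_frat sg1 n2 i2 ne (proj1 irr1) iHQ1.
have [_ _ _ iM1] := max_meet pr_p pS s1 s2 i1 i2 ne.
have ne' : E2 :!=: E1 by rewrite eq_sym.
have [_ _ _ iM2] := max_meet pr_p pS s2 s1 i2 i1 ne'; rewrite setIC in iM2.
(* If E2 is of transvection type, the intersection is its axis by [tr_frat], and a1 moves the centre
   out of it; otherwise irreducibility on E2 excludes invariance. *)
have ninv : ~ invar A2 (E1 :&: E2).
  move=> inv; case: (eqVneq #|E2 : axis S E2| p) => [iH2 | nH2].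
    have [C [W [t [a1 [a [tr _ _ [Aa1 _ _]]]]]]] := sg_some_transv sg2 iH2.
    have eM := tr_frat (M := [group of E1 :&: E2]) pr_p odd_p pS tr PhiM iM2.
    have [q Zq nq] := subsetPn (tr_Zneq pr_p tr).
    have := tr_aZ tr Zq nq; rewrite -eM /= (inv _ Aa1) // eM.
    exact: (subsetP (tr_ZH pr_p pS tr)).
  have [irr2 _] := single_irr pr_p odd_p pS rS n2 sA2 c2 syl2 se2 nH2.
  have sPM : 'Phi(E2) \subset E1 :&: E2 by rewrite -PhiM; apply: (PhiS pS).
  have [e | e] := (proj2 irr2) [group of E1 :&: E2] sPM (subsetIr _ _) inv.
    have := proj1 irr2; rewrite -e iM2 => /esym/eqP; rewrite -{2}(expn1 p) eqn_exp2l //.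
  by move: iM2; rewrite e indexgg => e1; move: p1; rewrite -e1.
have Phi1 := irr_pair_Phi1 pr_p odd_p pS rS n1 i1 n2 i2 ne sA1 sA2 irr1 iHQ1 ninv.
have pE1 := pgroupS s1 pS; have pE2 := pgroupS s2 pS.
have abE1 : p.-abelem E1 by rewrite -trivg_Phi // Phi1.
have cE1 : #|E1| = (p ^ 3)%N by have := proj1 irr1; rewrite Phi1 indexg1.
have cM : #|E1 :&: E2| = (p ^ 2)%N.
  by apply/eqP; rewrite -(eqn_pmul2r p0) -{1}iM1 Lagrange ?subsetIl // cE1 -expnSr.
have cE2 : #|E2| = (p ^ 3)%N by rewrite -(Lagrange (subsetIr E1 E2)) cM iM2 -expnSr.
have [ab1 ex1] := abelemP pr_p abE1.
have nM2 : E1 :&: E2 <| E2.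
  by rewrite /normal subsetIr normsI ?normG // (subset_trans s2 (normal_norm n1)).
have d2 : [~: E2, E2] \subset E1 :&: E2.
  by apply: subset_trans (pcentral pr_p pE2 nM2 (normal_refl E2) (subsetIr _ _) iM2) _.
have pc : pow_cond p E2 [1 gT].
  split; first by rewrite norms1.
    have : nil_class E2 <= 2.
      by apply: leq_trans (nil_class_pgroup pE2) _; rewrite cE2 pfactorK.
    rewrite nil_class2 derg1 => h; apply/trivgP/commG1P; apply: subset_trans h _.
    exact: subsetIr.
  move=> x z Ex Ez; rewrite inE; apply/eqP/ex1.
  by have /setIP[] := subsetP d2 _ (mem_commg Ex Ez).
have [K eK] := powker odd_p pc.
have sK : K \subset E2 by apply/subsetP=> x; rewrite eK => /andP[].
(* The elements of E1 :&: E2 have order dividing p, and so do their A2-images. If all such elements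
   of E2 were in E1, the intersection would be A2-stable. *)
have [y Ey [yp nEy]] : exists2 y, y \in E2 & y ^+ p = 1 /\ y \notin E1.
  have [sKM | /subsetPn[y Ky nM]] := boolP (K \subset E1); last first.
    by move: Ky; rewrite eK => /andP[Ey]; rewrite inE => /eqP yp; exists y.
  case: ninv => a Aa x /setIP[Ex1 Ex2]; have Aa' := subsetP sA2 a Aa.
  have Eax : a x \in E2 := Aut_stab Aa' Ex2.
  rewrite inE Eax andbT; apply: (subsetP sKM); rewrite eK /= inE Eax inE.
  by rewrite -(AutX Aa') // ex1 // (Aut_one Aa') eqxx.
have Sy := subsetP s2 y Ey.
apply: (Sp4_criterion pr_p odd_p pS n1 abE1 cE1 i1 Sy yp).
rewrite -iHQ1 Phi1 indexg1; apply: eq_card => x; apply/setIP/idP => [[Ex /cent1P cx] | Hx].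
  apply: (sg_axis sg1 Sy nEy Ex); rewrite Phi1 inE; apply/commgP; first by [].
have nQS : S \subset 'N('Phi(E1)) by rewrite Phi1 norms1.
move: Hx => /(cmodP _ (subset_trans s1 nQS) nQS)[Ex h]; split=> //.
have : [~ x, y] \in 'Phi(E1) := h y Sy.
by rewrite Phi1 inE => /commgP c; apply/cent1P.
Qed.

Hypothesis innB : {in B, forall b : {perm gT}, p.-elt b -> exists2 s, s \in S & {in S, forall x, b x = x ^ s}}.

(** E1 = E2 is allowed: C depends neither on the essential subgroup nor on the choices made in
    constructing t. *)
Lemma transv_common E1 C1 W1 t1 a1 E2 C2 W2 t2 a2 :
  transv p S E1 C1 W1 t1 a1 -> transv p S E2 C2 W2 t2 a2 -> t1 \in B -> t2 \in B ->
  [/\ 'Phi(E2) = 'Phi(E1), axis S E2 = axis S E1, centre S E2 = centre S E1 & C2 = C1].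
Proof.
move=> tr1 tr2 B1 B2.
have [eP eH] : 'Phi(E1) = 'Phi(E2) /\ axis S E1 = axis S E2.
  case: (eqVneq (E1 : {set gT}) E2) => [-> // | ne].
  by have [<- -> ->] := tr_pair pr_p odd_p pS rS tr1 tr2 ne.
have eZ : centre S E1 = centre S E2.
  apply/eqP; rewrite eqEsubset (tr_centre_sub pr_p pS tr1 tr2 eP).
  by rewrite (tr_centre_sub pr_p pS tr2 tr1 (esym eP)).
split=> //; apply/esym/group_inj; apply: (tr_CC pr_p odd_p pS tr1 tr2 eH eP eZ sB B1 B2).
move=> b Bb pb m Hm; have [s Ss eb] := innB Bb pb.
have Em := subsetP (tr_HE S E1) m Hm.
rewrite eb ?(subsetP (normal_sub (tr_nE tr1))) // -commgEl.
by apply: (subsetP (tr_HS tr1)); apply: mem_commg.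
Qed.

Lemma two_stable_central A1 E1 A2 E2 : single A1 E1 -> single A2 E2 -> E1 :!=: E2 ->
  #|E1 : axis S E1| = p -> #|E2 : axis S E2| = p ->
  {in B, forall b, stab b E1} -> {in B, forall b, stab b E2} -> axis S E1 \subset 'C(S).
Proof.
move=> sg1 sg2 ne iH1 iH2 st1 st2.
have [C1 [W1 [t1 [a1 [b1 [tr1 _ B1 _]]]]]] := sg_some_transv sg1 iH1.
have [C2 [W2 [t2 [a2 [b2 [tr2 _ B2 _]]]]]] := sg_some_transv sg2 iH2.
have [eP eH eZ eC] := transv_common tr1 tr2 B1 B2.
have [eM _ _] := tr_pair pr_p odd_p pS rS tr1 tr2 ne.
rewrite eC in tr2.
by apply: (two_char pr_p odd_p pS rS tr1 tr2 ne eM) => //; [exact: st2 | exact: st1].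
Qed.

(** Here C = 1 and S has order p ^ 3. An x outside E and a y in E outside the axis generate S by
    [tr_gen]; proper subgroups have order at most p ^ 2. *)
Lemma small_rank A E : single A E -> #|E : axis S E| = p -> #|axis S E| = p -> 'Phi(E) = 1 ->
  forall H : {group gT}, H \subset S -> rank_le H 2.
Proof.
move=> sg iH cH P1 H sHS; have p0 := prime_gt0 pr_p; have p1 := prime_gt1 pr_p.
have nE := sg_n sg; have sES := normal_sub nE; have iE := sg_iS sg.
have cE : #|E| = (p ^ 2)%N.
  by rewrite -(Lagrange (G := E) (H := [group of axis S E]) (cmod_sub _ _ _)) /= cH iH mulnn.
have cS : #|S| = (p ^ 3)%N by rewrite -(Lagrange sES) cE iE -expnSr.
have gen2 (x y : gT) (G : {group gT}) : <<[set x; y]>> = G -> rank_le G 2.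
  by move=> e; exists [set x; y]; split=> //; rewrite cards2; case: (_ != _).
have pH := pgroupS sHS pS.
have [C [W [t [a1 [a [tr eC _ _]]]]]] := sg_some_transv sg iH.
have C1 : C :=: 1.
  have := Lagrange (G := [group of axis S E]) (H := C) (tr_CH tr).
  rewrite /= (tr_iC tr) cH => /eqP; rewrite -{2}(mul1n p) eqn_pmul2r // => /eqP.
  exact: card1_trivg.
case: (eqVneq (H : {set gT}) S) => [-> | neHS].
  have [y Ey ny] : exists2 y, y \in E & y \notin axis S E.
    apply/subsetPn; apply: contraL p1 => sEH; rewrite -leqNgt -iH leq_eqVlt; apply/orP; left.
    by rewrite (indexg_eq1 E [group of axis S E]).
  have [x Sx nx] : exists2 x, x \in S & x \notin E.
    apply/subsetPn; apply: contraL p1 => sSE; rewrite -leqNgt -iE leq_eqVlt; apply/orP; left.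
    by rewrite indexg_eq1.
  apply: (@gen2 x y); pose K := [group of <<[set x; y]>>].
  have Kx : x \in K by rewrite mem_gen // !inE eqxx.
  have Ky : y \in K by rewrite mem_gen // !inE eqxx orbT.
  have sKS : K \subset S by rewrite gen_subG subUset !sub1set Sx (subsetP sES).
  have eKE : [group of K :&: E] :=: E.
    apply: (tr_gen (w := y) (z := [~ y, x]) pr_p pS tr) => //.
    - exact: subsetIr.
    - by rewrite C1 sub1G.
    - by apply: (subsetP (joing_subl _ _)); apply: mem_commg.
    - by apply: contra ny => h; apply: (sg_axis sg Sx nx Ey h).
    - rewrite inE groupR //= commgEl groupM ?groupV // memJ_norm //.
      exact: (subsetP (normal_norm nE)).
    by rewrite inE Ky.
  have sEK : E \subset K by rewrite -eKE subsetIl.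
  by apply: (idx_full sEK sKS _ Kx nx); rewrite iE.
have leH : #|H| <= p ^ 2.
  have ltH : #|H| < p ^ 3 by rewrite -cS; apply: proper_card; rewrite properEneq neHS.
  have [n en] := p_natP pH; move: ltH; rewrite en ltn_exp2l // => ltn; rewrite leq_exp2l //.
have [-> | /trivgPn[x Hx nx]] := eqVneq (H : {set gT}) 1.
  by apply: (@gen2 1 1 [1 gT]%G); rewrite setUid; apply: genGid.
have px : p <= #[x].
  have [n en] := p_natP (mem_p_elt pH Hx); rewrite en -{1}(expn1 p) leq_exp2l // lt0n.
  by apply: contra nx => /eqP n0; rewrite -order_eq1 en n0.
case: (eqVneq <[x]> (H : {set gT})) => [e | nexH].
  by apply: (@gen2 x x); rewrite setUid.
have [y Hy ny] : exists2 y, y \in H & y \notin <[x]>.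
  apply/subsetPn; apply: contra nexH => s; by rewrite eqEsubset cycle_subG Hx.
apply: (@gen2 x y); pose K := [group of <<[set x; y]>>].
have sKH : K \subset H by rewrite gen_subG subUset !sub1set Hx.
have [n en] := p_natP (pgroupS sKH pH).
apply/eqP; rewrite eqEcard sKH; apply: leq_trans leH _.
have : #[x] < #|K|.
  apply: proper_card; rewrite properE cycle_subG mem_gen ?inE ?eqxx //; apply/subsetPn.
  by exists y => //; rewrite mem_gen // !inE eqxx orbT.
move/(leq_ltn_trans px); rewrite en -{1}(expn1 p) ltn_exp2l // => n1.
by rewrite leq_exp2l.
Qed.

End SinglePair.

Lemma semb_eltJ (aT : finGroupType) (p : nat) (A I H : {group aT}) (b : aT) :
  semb_elt p A I H -> semb_elt p (A :^ b)%G (I :^ b)%G (H :^ b)%G.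
Proof.
case=> ltH sIH [x Hx [px nIx]] h; split.
- by rewrite /= properE !conjSg -properE.
- by rewrite /= conjSg.
- by exists (x ^ b); rewrite /= ?memJ_conjg // p_eltJ.
move=> g /= Ag nHg y Hy Hyg py; rewrite !mem_conjg in Ag nHg Hy Hyg *.
apply: (h _ Ag nHg) => //; last by rewrite p_eltJ.
by rewrite mem_conjg -conjVg -conjJg.
Qed.

(** * Essential subgroups of the fusion system *)

Section Assembly.
Variables (gT : finGroupType) (S : {group gT}) (F : fusion_rel gT) (p : nat).
Hypotheses (pr_p : prime p) (odd_p : odd p) (pS : p.-group S) (rS : rk3 p S) (sat : saturated S F p).
Implicit Types (E X : {group gT}) (a b t u : {perm gT}).
Local Notation hom := (fhom F).
Local Notation ess := (essential S F p).

Definition autF_gr E (sES : E \subset S) := Group (autF_group_set sat sES).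
Let B := autF_gr (subxx S).

Let autB b : b \in B -> b \in Aut S. Proof. by case/(autFP F). Qed.
Let sB : B \subset Aut S. Proof. by apply/subsetP=> b; apply: autB. Qed.
Let homB b : b \in B -> hom S S b. Proof. by case/(autFP F). Qed.

Section Image.
Variables (E E' : {group gT}) (b : {perm gT}).
Hypotheses (Bb : b \in B) (nE : E <| S) (eE : E' :=: b @: E).
Let Ab := autB Bb.
Let sES := normal_sub nE.

Lemma img_normal : E' <| S.
Proof.
rewrite /normal eE (Aut_sub Ab sES) andTb; apply/subsetP=> s' Ss'; rewrite inE.
have : s' \in b @: S by rewrite ((stab_imset _ _).1 (Aut_stab Ab)).
case/imsetP=> s Ss ->; apply/subsetP=> _ /imsetP[_ /imsetP[z Ez ->] ->].
have Sz := subsetP sES z Ez; have <- : b (z ^ s) = b z ^ b s by apply: (AutJ Ab).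
by rewrite imset_f // memJ_norm // (subsetP (normal_norm nE)).
Qed.

Lemma conj_autJ s : s \in S -> conj_aut E s ^ b = conj_aut E' (b s).
Proof.
move=> Ss; have Ns := subsetP (normal_norm nE) s Ss.
have Ns' := subsetP (normal_norm img_normal) _ (Aut_stab Ab Ss).
apply/permP=> x; rewrite conjgE !permM; have [E'x | nx] := boolP (x \in E').
  move: (E'x); rewrite {1}eE => /imsetP[z Ez ex]; rewrite ex permK.
  have Sz := subsetP sES z Ez; rewrite !norm_conj_autE -?ex // ex.
  by apply: (AutJ Ab).
have nz : b^-1 x \notin E.
  by apply: contra nx => Ez; rewrite eE -[x](permKV b) imset_f.
have A1 : conj_aut E s \in Aut E by apply: Aut_aut.
have A2 : conj_aut E' (b s) \in Aut E' by apply: Aut_aut.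
by rewrite (out_Aut A1 nz) permKV (out_Aut A2 nx).
Qed.

Lemma conj_aut_imJ (X X' : {group gT}) : X \subset S -> X' :=: b @: X ->
  (conj_aut E @* X) :^ b = conj_aut E' @* X'.
Proof.
move=> sXS eX; have sX'S : X' \subset S by rewrite eX (Aut_sub Ab sXS).
apply/setP=> y; apply/imsetP/morphimP => [[_ /morphimP[s Ns Xs ->] ->] | [s' Ns' Xs' ->]].
  have Ss := subsetP sXS s Xs; exists (b s).
  - exact: (subsetP (normal_norm img_normal) _ (Aut_stab Ab Ss)).
  - by rewrite eX imset_f.
  exact: conj_autJ.
move: Xs'; rewrite eX => /imsetP[s Xs ->]; have Ss := subsetP sXS s Xs.
exists (conj_aut E s); last by rewrite conj_autJ.
by apply: mem_morphim => //; apply: (subsetP (normal_norm nE)).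
Qed.

Lemma hom_img : hom E E' b /\ hom E' E b^-1.
Proof.
have h : hom E E' b.
  apply: (fhom_codom sat (fhom_res sat (homB Bb) sES)); first by rewrite eE.
  exact: normal_sub img_normal.
by split=> //; rewrite eE; apply: (fhom_inv sat h).
Qed.

Lemma autF_img : autF F E' = (autF F E) :^ b.
Proof.
have [h h'] := hom_img.
apply/setP=> a; rewrite mem_conjg; apply/idP/idP => Fa.
  apply: (autF_conj sat h' _ Fa).
  by rewrite eE -imset_comp -[LHS]imset_id; apply: eq_in_imset => x _; rewrite /= permK.
by rewrite -(conjgKV b a); apply: (autF_conj sat h eE).
Qed.

(** The quotient types for E and E' differ, so strong embedding is transported as [semb_elt] and
    translated back. *)
Lemma ess_img : ess E -> ess E'.
Proof.
case=> _ c2 c3 [K sK]; have nE' := img_normal; have sE' := normal_sub nE'.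
have [h h'] := hom_img.
have tr f : F E' S f -> exists2 g, F E S g & g @: E = f @: E'.
  move=> hf; have [w hw ew] := fhom_of sat hf.
  exists (finfun (b * w)); first exact: (fhom_comp sat h hw).
  rewrite eE -imset_comp; apply: eq_in_imset => x Ex; rewrite ffunE permM /= ew //.
  by rewrite eE imset_f.
split=> //.
- by move=> f /tr[g hg <-]; apply: c2.
- move=> f _; rewrite (setIidPl (normal_norm nE')); exact: subset_leq_card (subsetIl _ _).
pose A := autF_gr sES; pose I := [group of conj_aut E @* E].
have nIA : I <| A.
  rewrite /normal; apply/andP; split.
    apply: subset_trans (autS_sub sat sES); rewrite autS_conj // (setIidPl (normal_norm nE)).
    exact: morphimS.
  apply/subsetP=> a Aa; rewrite inE; apply/subsetP=> _ /imsetP[_ /morphimP[x Nx Ex ->] ->].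
  have /(autFP F)[Aa' _] := Aa.
  have Eax : a x \in E := Aut_stab Aa' Ex.
  suff -> : conj_aut E x ^ a = conj_aut E (a x) by apply: mem_morphim; rewrite // (subsetP (normG E)).
  apply: (eq_Aut (A := E)); rewrite ?groupJ //; try by apply: Aut_aut.
  move=> y Ey; have Ey' : a^-1 y \in E by apply: (Aut_stab _ Ey); rewrite groupV.
  by rewrite conjgE !permM !norm_conj_autE ?(subsetP (normG E)) // (AutJ Aa') // permKV.
have [H sH] : exists H, semb_elt p A I H.
  by move: K sK; rewrite innA_conj => K; apply: (semb_elim pr_p nIA).
have sJ := semb_eltJ b sH.
have eI : innA E' = (I :^ b)%G by rewrite innA_conj /= (conj_aut_imJ sES eE).
have nJ : (I :^ b)%G <| (A :^ b)%G by rewrite /= normalJ.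
rewrite eI autF_img; exists ((H :^ b) / (I :^ b))%G; exact: (semb_intro pr_p nJ sJ).
Qed.

End Image.

Lemma ess_cent E : ess E -> 'C_S(E) \subset E.
Proof.
case=> sES c2 _ _; have := c2 (finfun (1 : {perm gT})) (fhom1 sat sES).
suff -> : finfun (1 : {perm gT}) @: E = E by [].
by rewrite -[RHS]imset_id; apply: eq_in_imset => x _; rewrite ffunE perm1.
Qed.

Lemma ess_single E (sES : E \subset S) : ess E -> E <| S -> single p S B (autF_gr sES) E.
Proof.
move=> eE nE; have [_ c2 c3 [K sK]] := eE; have [_ [sat2 sat3]] := sat.
have [fcE sylE] := sat2 E sES c3.
pose A := autF_gr sES; pose P := [group of conj_aut E @* S].
have eP : autS S E = P by rewrite autS_conj // (setIidPl (normal_norm nE)).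
rewrite eP in sylE.
have sA : A \subset Aut E by apply/subsetP=> a /(autFP F)[].
have nI := I_normal nE sA sylE.
split=> //.
- exact: ess_cent.
- by move: K sK; rewrite innA_conj => K; apply: (semb_elim pr_p nI).
move=> a Aa ePa; have /(autFP F)[Aa' ha] := Aa.
have eaE : a @: E = E by apply: (stab_imset _ _).1; apply: Aut_stab.
have ha' : F E S (finfun a) by apply: (fhom_codom sat ha); rewrite ?eaE.
have eu : finfun a @: E = E by rewrite -[RHS]eaE; apply: eq_in_imset => x _; rewrite ffunE.
have [fb [hfb efb]] : exists fb : {ffun gT -> gT}, F (Nphi S E (finfun a)) S fb /\ {in E, fb =1 finfun a}.
  by apply: sat3 => //; rewrite eu.
have eN : Nphi S E (finfun a) = S.
  apply/setP=> g; rewrite inE (setIidPl (normal_norm nE)).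
  apply/andP/idP => [[]// | Sg]; split=> //.
  have Ng := subsetP (normal_norm nE) g Sg.
  have : conj_aut E g ^ a \in P by rewrite -[gval P]ePa memJ_conjg mem_morphim.
  case/morphimP=> h Nh Sh eh; apply/exists_inP; exists h; first by rewrite eu inE Sh.
  apply/forall_inP=> x Ex; rewrite !ffunE; apply/eqP.
  by apply: (conj_aut_conj ha _ Ng Nh eh Ex); rewrite eaE.
rewrite eN in hfb; have [v hv ev] := fhom_of sat hfb.
have [b Bb eb] := autF_of sat hv; exists b => // x Ex.
by rewrite eb ?ev ?efb ?ffunE // (subsetP sES).
Qed.

(** Inn(S) is a normal Sylow p-subgroup of Aut_F(S), so it contains every p-element. *)
Lemma autF_p_inner : {in B, forall b : {perm gT}, p.-elt b -> exists2 s, s \in S & {in S, forall x, b x = x ^ s}}.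
Proof.
move=> b Bb pb; have [_ [sat2 _]] := sat.
have fnS : fully_normalized S F S.
  by move=> f _; rewrite (setIidPl (normG S)) subset_leq_card ?subsetIl.
have [_ syl] := sat2 S (subxx S) fnS.
have eT : autS S S = [group of conj_aut S @* S] by rewrite autS_conj // (setIidPl (normG S)).
rewrite eT in syl.
have nT : [group of conj_aut S @* S] <| B.
  rewrite /normal (pHall_sub syl); apply/subsetP=> c Bc; rewrite inE /=.
  have eS : S :=: c @: S by rewrite ((stab_imset _ _).1 (Aut_stab (autB Bc))).
  by rewrite (conj_aut_imJ Bc (normal_refl S) eS (subxx S) eS).
have {}syl : p.-Sylow(B) [group of conj_aut S @* S] := syl.
have : b \in [group of conj_aut S @* S] by rewrite (mem_normal_Hall syl nT).
by case/morphimP=> s Ns Ss ->; exists s => // x Sx; rewrite norm_conj_autE.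
Qed.

Lemma char_normal E : E \subset S -> F_characteristic F E S -> E <| S.
Proof.
move=> sES ch; rewrite /normal sES; apply/subsetP=> s Ss; rewrite inE.
have NSs := subsetP (normG S) s Ss.
have As : conj_aut S s \in autF F S.
  apply: (subsetP (autS_sub sat (subxx S))); rewrite (autS_conj (subxx S)).
  by apply: mem_morphim; rewrite ?in_setI ?Ss.
rewrite -{2}(ch _ As); apply/subsetP=> _ /imsetP[x Ex ->].
by apply/imsetP; exists x => //; rewrite norm_conj_autE // (subsetP sES).
Qed.

Hypothesis nSp4 : ~ exists P : {group {'GL_4['F_p]}}, p.-Sylow(Sp4 p) P /\ S \isog P.

Lemma ess_axis E1 E2 : ess E1 -> ess E2 -> E1 <| S -> E2 <| S -> E1 :!=: E2 -> #|E1 : axis S E1| = p.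
Proof.
move=> e1 e2 n1 n2 ne; case: (eqVneq #|E1 : axis S E1| p) => // nH; case: nSp4.
exact: (sp4_irr pr_p odd_p pS rS sB (ess_single (normal_sub n1) e1 n1) (ess_single (normal_sub n2) e2 n2) ne nH).
Qed.

(** The common axis M is central in S, so every essential E contains it, being self-centralising. As
    S / M has order p ^ 2, it is abelian, and every subgroup above M is normal. *)
Lemma char_unique E1 E2 : ess E1 -> ess E2 -> F_characteristic F E1 S -> F_characteristic F E2 S ->
  E1 :!=: E2 -> forall E, ess E -> E <| S.
Proof.
move=> e1 e2 ch1 ch2 ne E eE; have [s1 _ _ _] := e1; have [s2 _ _ _] := e2; have [sE _ _ _] := eE.
have n1 := char_normal s1 ch1; have n2 := char_normal s2 ch2.
have iH1 := ess_axis e1 e2 n1 n2 ne.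
have iH2 : #|E2 : axis S E2| = p by apply: (ess_axis e2 e1 n2 n1); rewrite eq_sym.
have sg1 := ess_single s1 e1 n1; have sg2 := ess_single s2 e2 n2.
have st (X : {group gT}) : F_characteristic F X S -> {in B, forall b : {perm gT}, stab b X}.
  by move=> ch b Bb; apply/stab_imset; apply: ch.
have cM := two_stable_central pr_p odd_p pS rS sB autF_p_inner sg1 sg2 ne iH1 iH2 (st _ ch1) (st _ ch2).
pose M := [group of axis S E1]; have sME : M \subset E1 := cmod_sub _ _ _.
have sMS : M \subset S := subset_trans sME s1.
have iM : #|S : M| = (p ^ 2)%N.
  by rewrite -(Lagrange_index s1 sME) (sg_iS pr_p pS rS sg1) /= iH1 mulnn.
have nMS : S \subset 'N(M) by rewrite cents_norm // centsC.
have sMsE : M \subset E.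
  apply: subset_trans (ess_cent eE); rewrite subsetI sMS; exact: subset_trans cM (centS sE).
apply: (sub_der1_normal _ sE); apply: subset_trans (der1_min nMS _) sMsE.
apply: (card_p2group_abelian pr_p); by rewrite card_quotient.
Qed.

(** * The case where all essential subgroups are normal *)

Section AllNormal.
Hypotheses (op1 : Op_trivial S F) (nrk : ~ forall H : {group gT}, H \subset S -> rank_le H 2).
Hypothesis alln : forall E, ess E -> E <| S.

Let S_neq1 : S :!=: 1.
Proof.
apply/eqP=> S1; apply: nrk => H; rewrite S1 => /trivgP ->; exists set0.
by rewrite gen0 cards0.
Qed.

Let img_gr E b (nE : E <| S) (Bb : b \in B) := Group (Aut_img_group (autB Bb) (normal_sub nE)).

Let ess_b E b (eE : ess E) (Bb : b \in B) : ess (img_gr (alln eE) Bb).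
Proof. exact: (ess_img Bb (alln eE) _ eE). Qed.

(** A unique essential subgroup would be normal in F, and without any S would be. Triviality of
    O_p(F) excludes both, as a trivial E cannot contain its centraliser S. *)
Lemma two_essentials : exists E1 E2 : {group gT}, [/\ ess E1, ess E2 & E1 :!=: E2].
Proof.
apply: NNPP => no; have uniq E E' : ess E -> ess E' -> E = E'.
  move=> e e'; apply/group_inj/eqP; apply: contraT => ne; case: no; by exists E, E'.
case: (classic (exists E, ess E)) => [[E eE] | none].
  have [sES _ _ _] := eE.
  have nf : normal_in_fusion S F E.
    apply: (normal_in_fusion_of_essential pr_p pS sat sES) => [b Bb | E' eE'].
      by have := uniq _ _ (ess_b eE Bb) eE => /(congr1 (@gval gT)).
    rewrite (uniq E' E) //; split=> // a /(autFP F)[Aa _].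
    by apply: (stab_imset _ _).1; apply: Aut_stab.
  have := ess_cent eE; rewrite (op1 nf) cent1T setIT => /trivgP S1.
  by move: S_neq1; rewrite S1 eqxx.
have nf : normal_in_fusion S F S.
  apply: (normal_in_fusion_of_essential pr_p pS sat (subxx S)) => [b Bb | E' eE'].
    by apply: (stab_imset _ _).1; apply: Aut_stab; apply: autB.
  by case: none; exists E'.
by move: S_neq1; rewrite (op1 nf) eqxx.
Qed.

Lemma all_normal_false : False.
Proof.
have [E1 [E2 [e1 e2 ne]]] := two_essentials.
have iH E : ess E -> #|E : axis S E| = p.
  move=> eE; case: (eqVneq (E : {set gT}) E1) => [eq | neq]; last exact: (ess_axis eE e1 (alln eE) (alln e1)).
  by apply: (ess_axis eE e2 (alln eE) (alln e2)); rewrite eq.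
have sg E (eE : ess E) := ess_single (normal_sub (alln eE)) eE (alln eE).
have [C1 [W1 [t1 [a1 [a0 [tr1 eC1 B1 [_ Aa0 nP0]]]]]]] := sg_some_transv pr_p odd_p pS rS sB (sg _ e1) (iH _ e1).
have com E C W t a : transv p S E C W t a -> t \in B ->
    [/\ 'Phi(E) = 'Phi(E1), axis S E = axis S E1, centre S E = centre S E1 & C = C1].
  by move=> tr Bt; apply: (transv_common pr_p odd_p pS rS sB autF_p_inner tr1 tr B1 Bt).
have phiE E : ess E -> 'Phi(E) = 'Phi(E1) /\ axis S E = axis S E1.
  move=> eE; have [C [W [t [a [b [tr _ Bt _]]]]]] := sg_some_transv pr_p odd_p pS rS sB (sg _ eE) (iH _ eE).
  by have [-> -> _ _] := com _ _ _ _ _ tr Bt.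
have meet E E' : ess E -> ess E' -> E :!=: E' -> E :&: E' = axis S E1.
  move=> eE eE' neE.
  have [C [W [t [a [b [tr _ Bt _]]]]]] := sg_some_transv pr_p odd_p pS rS sB (sg _ eE) (iH _ eE).
  have [C' [W' [t' [a' [b' [tr' _ Bt' _]]]]]] := sg_some_transv pr_p odd_p pS rS sB (sg _ eE') (iH _ eE').
  have [-> _ _] := tr_pair pr_p odd_p pS rS tr tr' neE; exact: (proj2 (phiE _ eE)).
have sQS : 'Phi(E1) \subset S := subset_trans (Phi_sub E1) (normal_sub (alln e1)).
have nfT : normal_in_fusion S F [group of 'Phi(E1)].
  apply: (normal_in_fusion_of_essential (X := [group of 'Phi(E1)]) pr_p pS sat sQS) => [b Bb | E eE] /=.
    rewrite (Aut_Phi (autB Bb) (normal_sub (alln e1))).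
    exact: (proj1 (phiE _ (ess_b e1 Bb))).
  rewrite -(proj1 (phiE _ eE)); split; first exact: Phi_sub.
  by move=> a /(autFP F)[Aa _]; apply: (stab_imset _ _).1; apply: (stab_Phi Aa (subxx _)); apply: Aut_stab.
have T1 : 'Phi(E1) = 1 := op1 nfT.
pose H := axis S E1.
(* The same C1 arises as an intersection of two axes from every essential E and every a that moves
   Aut_S(E). This is the source of its invariance. *)
have capC E (eE : ess E) a : a \in autF F E -> [group of conj_aut E @* S] :^ a != [group of conj_aut E @* S] ->
    C1 :=: H :&: a @: H.
  move=> Aa nP; have [C [W [t [a2 [tr eC Bt _]]]]] := sg_transv pr_p odd_p pS rS sB (sg _ eE) (iH _ eE) Aa nP.
  have [_ eH _ eCC] := com _ _ _ _ _ tr Bt.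
  by rewrite -eCC eC eH.
have sCH : C1 \subset H := tr_CH tr1.
have sCE E : ess E -> C1 \subset E.
  by move=> eE; apply: subset_trans sCH _; rewrite /H -(proj2 (phiE _ eE)); apply: cmod_sub.
have invS : {in autF F S, forall b : {perm gT}, b @: C1 = C1}.
  move=> b Bb; pose E' := img_gr (alln e1) Bb; have eE' : ess E' := ess_b e1 Bb.
  have bH : b @: H = H.
    rewrite /H -{1}(meet _ _ e1 e2 ne) imsetI; last by move=> x y _ _; apply: perm_inj.
    apply: (meet _ _ eE' (ess_b e2 Bb)) => /=.
    by apply: contra ne => /eqP/(imset_inj (@perm_inj _ b)) ->.
  have Aa' : a0 ^ b \in autF F E' by rewrite (autF_img Bb (alln e1) (E' := E')) // memJ_conjg.
  have eP : conj_aut E' @* S = (conj_aut E1 @* S) :^ b.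
    apply/esym; apply: (conj_aut_imJ Bb (alln e1)) => //.
    by apply/esym; apply: (stab_imset _ _).1; apply: Aut_stab; apply: autB.
  have nP' : [group of conj_aut E' @* S] :^ (a0 ^ b) != [group of conj_aut E' @* S].
    apply: contra nP0; rewrite /= eP -conjsgM conjgE mulKVg conjsgM.
    by rewrite (inj_eq (@conjsg_inj _ b)).
  rewrite [RHS](capC _ eE' _ Aa' nP') {1}eC1 imsetI; last by move=> x y _ _; apply: perm_inj.
  rewrite -/H bH -{4}bH -!imset_comp; congr (_ :&: _).
  by apply: eq_in_imset => x _; rewrite /= conjgE !permM permK.
have sCS : C1 \subset S := subset_trans (sCE _ e1) (normal_sub (alln e1)).
have nfC : normal_in_fusion S F C1.
  apply: (normal_in_fusion_of_essential pr_p pS sat sCS) => // E eE.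
  split; first exact: sCE.
  move=> a Aa; pose P := [group of conj_aut E @* S].
  (* If a normalises P, it extends to Aut_F(S). Otherwise C1 is both H :&: a^-1 @: H and a @: H :&:
     H, and a maps the first onto the second. *)
  case: (eqVneq (P :^ a) P) => [ePa | nPa].
    have [b Bb eb] := sg_ext (sg _ eE) Aa ePa.
    rewrite -[RHS](invS b Bb); apply: eq_in_imset => x Cx; rewrite eb //.
    exact: (subsetP (sCE _ eE)).
  have Aa' : a^-1 \in autF F E by apply: (groupVr (G := autF_gr (normal_sub (alln eE)))).
  have nPa' : P :^ a^-1 != P.
    by apply: contra nPa => /eqP e; rewrite -{1}e conjsgKV.
  rewrite [RHS](capC _ eE _ Aa nPa) {1}(capC _ eE _ Aa' nPa') imsetI; last by move=> x y _ _; apply: perm_inj.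
  rewrite -imset_comp setIC; congr (_ :&: _).
  by rewrite -[RHS]imset_id; apply: eq_in_imset => x _; rewrite /= permKV.
have C11 : C1 :=: 1 := op1 nfC.
have cH : #|axis S E1| = p by have := tr_iC tr1; rewrite C11 indexg1.
exact: (nrk (small_rank pr_p odd_p pS rS sB (sg _ e1) (iH _ e1) cH T1)).
Qed.

End AllNormal.
End Assembly.

Theorem theoremB (p : nat) (gT : finGroupType) (S : {group gT})
  (F : fusion_rel gT) :
  prime p -> odd p -> (p.-group S)%g -> sectional_rank S 3 ->
  saturated S F p -> Op_trivial S F ->
  (exists P : {group {'GL_4['F_p]}}, (p.-Sylow(Sp4 p) P)%g /\ (S \isog P)%g) \/
  ((exists E : {group gT}, essential S F p E /\ ~~ (E <| S)%g) /\
   (forall E1 E2 : {group gT},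
      essential S F p E1 -> essential S F p E2 ->
      F_characteristic F E1 S -> F_characteristic F E2 S -> E1 = E2)).
Proof.
move=> pr_p odd_p pS [sec1 sec2] sat op1.
have rS : rk3 p S by move=> H sH; apply: (rank_le_index pr_p (pgroupS sH pS) (sec1 H sH)).
(* Minimality of the sectional rank at 2 would give 3 <= 2, which computes to false. *)
have nrk : ~ forall H : {group gT}, H \subset S -> rank_le H 2 by move/sec2.
case: (classic (exists P : {group {'GL_4['F_p]}}, p.-Sylow(Sp4 p) P /\ S \isog P)) => [sp | nsp]; [by left | right].
have contra := all_normal_false pr_p odd_p pS rS sat nsp op1 nrk.
split.
  apply: NNPP => no; apply: contra => E eE; apply: contraT => nE.
  by case: no; exists E.
move=> E1 E2 e1 e2 ch1 ch2; apply/group_inj/eqP; apply: contraT => ne; exfalso; apply: contra.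
exact: (char_unique pr_p odd_p pS rS sat nsp e1 e2 ch1 ch2 ne).
Qed.
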